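(* Let $N^n$ be a complete Riemannian manifold with a pole $o$, let $S^m$ be a non-compact, connected, complete Riemannian submanifold properly immersed in $N^n$, and let $M_w^m$ be a $w$-model with warping function $w$ and center $o_w$. Suppose that $\{N^n,S^m,M_w^m\}$ is a comparison constellation with lower tangency on the interval $[0,\infty)$, that is: the $o$-radial sectional curvatures of $N$ satisfy $$K_{o,N}(\sigma_x)\ \ge\ -\frac{w''(r)}{w(r)}\qquad\text{for all } x \text{ with } r=r(x)\in[0,\infty),$$ and there are smooth radial functions $g(r),\lambda(r),h(r)$ on $[0,\infty)$ such that $$\mathcal{T}(x)\ge g(r(x)),\qquad \mathcal{B}(x)\ge\lambda(r(x)),\qquad \mathcal{C}(x)\ge h(r(x))$$ for all $x\in S$ with $r(x)\in[0,\infty)$. Assume further that $h$ and $\lambda$ are balanced with respect to $w$ by the inequality $$\mathcal{M}_p(r):=(m+p-2)\,\eta_w(r)-m\,h(r)-(p-2)\,\lambda(r)\ \ge\ 0\qquad\text{for all } r>0.$$ Let $\rho>0$ and let $\Lambda_{g,p}(r)$ denote the function $$\Lambda_{g,p}(r)=w(r)\exp\left(-\int_\rho^r\frac{\mathcal{M}_p(t)}{(p-1)\,g^2(t)}\,dt\right).$$ Suppose finally that $p\ge2$ and that $$\int_\rho^\infty\Lambda_{g,p}(t)\,dt=\infty.$$ Then $S^m$ is $p$-parabolic.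
   Context: A pole of $N$ is a point $o\in N$ such that $\exp_o:T_oN\to N$ is a diffeomorphism. Write $r(x)=\operatorname{dist}_N(o,x)$, and also $r$ for its restriction to $S$. $\nabla^N r$ is the gradient in $N$, and $\nabla^S r$ is the gradient on $S$ of the restriction, i.e. the component of $\nabla^N r$ tangent to $S$. An $o$-radial sectional curvature $K_{o,N}(\sigma_x)$ of $N$ at $x\ne o$ is the sectional curvature of a two-plane $\sigma_x\subset T_xN$ containing the tangent vector to a minimal geodesic from $o$ to $x$. A $w$-model $M_w^m$ is the smooth warped product with base $[0,\Lambda)$ ($0<\Lambda\le\infty$; here $\Lambda=\infty$), fiber the unit sphere $\mathbb{S}^{m-1}$ with its standard metric, and warping function $w:[0,\Lambda)\to[0,\infty)$ with $w(0)=0$, $w'(0)=1$ and $w(r)>0$ for all $r>0$. Its center $o_w$ is the point over $0$. Put $\eta_w(r)=w'(r)/w(r)$. Let $\alpha$ be the second fundamental form of $S$ in $N$ and $H_S=\frac1m\operatorname{trace}\alpha$ the mean curvature vector. The $o$-radial tangency is $\mathcal{T}(x)=\Vert\nabla^S r(x)\Vert$; the $o$-radial mean convexity is $\mathcal{C}(x)=-\langle\nabla^N r(x),H_S(x)\rangle$; the $o$-radial component of the second fundamental form is $\mathcal{B}(x)=-\langle\nabla^N r(x),\alpha_x(U_r,U_r)\rangle$, where $U_r=\nabla^S r(x)/\Vert\nabla^S r(x)\Vert$, taken to be $0$ if $\nabla^S r(x)=0$. For a compact set $D$ in a Riemannian manifold $M$, $\operatorname{Cap}_p(D,M)=\inf_u\int_M\Vert\nabla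 u\Vert^p\,d\mu$, the infimum being over all real-valued $u\in C_0^\infty(M)$ (smooth with compact support) with $u\ge1$ in $D$. $M$ is $p$-parabolic if and only if there is a compact set $D\subseteq M$ such that $\operatorname{Cap}_p(D,M)=0$.
   Formalization: The formal theorem assumes g > 0 on [ρ,∞): otherwise it fails, e.g. g = −100, S = N = hyperbolic space, w = sinh, h = λ = 0. In p-parabolicity the compact set D must have nonempty interior, since D = ∅ always has zero capacity. *)

(* Defs.v *)
(* Smooth and Riemannian manifolds in local coordinates, on top of
   MathComp-Analysis.  Coordinate vectors are row vectors, so that
   d F (v) = v *m 'J F y, and a tangent vector at a point x of a manifold is
   the row of its coordinates in the preferred chart [chart_at x]. *)
From HB Require Import structures.
From mathcomp Require Import all_boot all_order all_algebra.
From mathcomp Require Import all_classical all_reals all_analysis.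

Set Implicit Arguments.
Unset Strict Implicit.
Unset Printing Implicit Defensive.

Import Order.TTheory GRing.Theory Num.Theory numFieldNormedType.Exports.
Local Open Scope ring_scope.
Local Open Scope classical_set_scope.

(* For open U and finite-dimensional V, [Ck k U f] says that f is of class C^k
   on U: all iterated directional derivatives of order <= k exist and are
   continuous. *)
Fixpoint Ck (R : realType) (V W : normedModType R) (k : nat) (U : set V)
    (f : V -> W) : Prop :=
  (forall x, U x -> {for x, continuous f}) /\
  match k with
  | 0 => True
  | k'.+1 => forall v : V, (forall x, U x -> derivable f x v) /\
                           Ck k' U (fun x => 'D_v f x)
  end.

Definition smooth_on (R : realType) (V W : normedModType R) (U : set V)
    (f : V -> W) : Prop := forall k, Ck k U f.

Record chart (R : realType) (n : nat) (T : topologicalType) := Chart {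
  cdom : set T;
  cimg : set 'rV[R]_n;
  cmap : T -> 'rV[R]_n;
  cinv : 'rV[R]_n -> T;
  cdom_open : open cdom;
  cimg_open : open cimg;
  cmap_img : forall x, cdom x -> cimg (cmap x);
  cinv_dom : forall y, cimg y -> cdom (cinv y);
  cmapK : forall x, cdom x -> cinv (cmap x) = x;
  cinvK : forall y, cimg y -> cmap (cinv y) = y;
  cmap_cont : forall x, cdom x -> {for x, continuous cmap};
  cinv_cont : forall y, cimg y -> {for y, continuous cinv}
}.

(* Having a countable atlas is equivalent to second countability; repeated
   charts and charts with empty domain are allowed. *)
Record manifold (R : realType) (n : nat) := Manifold {
  carrier :> topologicalType;
  carrier_hausdorff : hausdorff_space carrier;
  atlas : nat -> chart R n carrier;
  atlas_cover : forall x, exists k, cdom (atlas k) x;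
  atlas_smooth : forall j k,
    smooth_on (cimg (atlas j) `&` cinv (atlas j) @^-1` cdom (atlas k))
              (cmap (atlas k) \o cinv (atlas j))
}.

Lemma chart_at_subproof (R : realType) (n : nat) (M : manifold R n) (x : M) :
  exists k, `[< cdom (atlas M k) x >].
Proof. by have [k xk] := atlas_cover x; exists k; apply/asboolP. Qed.

(* the least index of a chart around x *)
Definition chart_at (R : realType) (n : nat) (M : manifold R n) (x : M) : nat :=
  ex_minn (chart_at_subproof x).

Definition smooth_into (R : realType) (V : normedModType R) (n : nat)
    (M : manifold R n) (U : set V) (f : V -> M) : Prop :=
  (forall x, U x -> {for x, continuous f}) /\
  forall k, smooth_on (U `&` f @^-1` cdom (atlas M k)) (cmap (atlas M k) \o f).

Definition smooth_from (R : realType) (W : normedModType R) (n : nat)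
    (M : manifold R n) (u : M -> W) : Prop :=
  forall k, smooth_on (cimg (atlas M k)) (u \o cinv (atlas M k)).

Definition smooth_map (R : realType) (m n : nat) (S : manifold R m)
    (N : manifold R n) (f : S -> N) : Prop :=
  forall k, smooth_into (cimg (atlas S k)) (f \o cinv (atlas S k)).

Definition dot (R : realType) (n : nat) (G : 'M[R]_n) (u v : 'rV[R]_n) : R :=
  (u *m G *m v^T) 0 0.

Record riemannian (R : realType) (n : nat) := Riemannian {
  rman :> manifold R n;
  (* [metric k y] is the Gram matrix of the coordinate frame of chart k at y *)
  metric : nat -> 'rV[R]_n -> 'M[R]_n;
  metric_smooth : forall k, smooth_on (cimg (atlas rman k)) (metric k);
  metric_sym : forall k y, cimg (atlas rman k) y -> (metric k y)^T = metric k y;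
  metric_pos : forall k y, cimg (atlas rman k) y ->
    forall v, v != 0 -> 0 < dot (metric k y) v v;
  metric_change : forall j k y, cimg (atlas rman j) y ->
    cdom (atlas rman k) (cinv (atlas rman j) y) ->
    let phi := cmap (atlas rman k) \o cinv (atlas rman j) in
    metric j y = 'J phi y *m metric k (phi y) *m ('J phi y)^T
}.

Section LocalGeometry.
Variables (R : realType) (n : nat).
Implicit Types (G : 'rV[R]_n -> 'M[R]_n) (y u v : 'rV[R]_n) (i j k l : 'I_n).

Definition pd i (f : 'rV[R]_n -> R) y : R := 'D_(delta_mx 0 i) f y.

(* Christoffel symbol Gamma^k_{ij} of the Levi-Civita connection *)
Definition christoffel G k i j y : R :=
  \sum_l 2^-1 * invmx (G y) k l *
    (pd i (fun z => G z j l) y + pd j (fun z => G z i l) y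
     - pd l (fun z => G z i j) y).

Definition christoffel_form G y u v : 'rV[R]_n :=
  \row_(k < n) (\sum_(i < n) \sum_(j < n) christoffel G k i j y * u 0 i * v 0 j).

(* l-th component of R(d_i, d_j) d_k, where
   R(X, Y) Z = nabla_X nabla_Y Z - nabla_Y nabla_X Z - nabla_[X, Y] Z *)
Definition riemann G i j k l y : R :=
  pd i (christoffel G l j k) y - pd j (christoffel G l i k) y
  + \sum_s (christoffel G s j k y * christoffel G l i s y
            - christoffel G s i k y * christoffel G l j s y).

Definition riemann_op G y u v (w : 'rV[R]_n) : 'rV[R]_n :=
  \row_(l < n) (\sum_(i < n) \sum_(j < n) \sum_(k < n)
    riemann G i j k l y * u 0 i * v 0 j * w 0 k).

Definition sectional G y u v : R :=
  dot (G y) (riemann_op G y u v v) u /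
  (dot (G y) u u * dot (G y) v v - dot (G y) u v ^+ 2).

End LocalGeometry.

Section RiemannianManifold.
Variables (R : realType) (n : nat) (M : riemannian R n).

Definition coord (x : M) : 'rV[R]_n := cmap (atlas M (chart_at x)) x.

Definition gram (x : M) : 'M[R]_n := metric M (chart_at x) (coord x).

Definition tnorm (x : M) (v : 'rV[R]_n) : R := Num.sqrt (dot (gram x) v v).

Definition sectional_curvature (x : M) (u v : 'rV[R]_n) : R :=
  sectional (metric M (chart_at x)) (coord x) u v.

Definition grad (f : M -> R) (x : M) : 'rV[R]_n :=
  (\row_(i < n) pd i (f \o cinv (atlas M (chart_at x))) (coord x)) *m invmx (gram x).

Definition smooth_curve (c : R -> M) : Prop := smooth_into setT c.

Definition velocity (c : R -> M) (t : R) : 'rV[R]_n :=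
  derive1 (cmap (atlas M (chart_at (c t))) \o c) t.

Definition curve_length (c : R -> M) : R :=
  \int[lebesgue_measure]_(t in `[0, 1]) tnorm (c t) (velocity c t).

(* x and y are joined by a piecewise smooth curve of length l *)
Inductive joined : M -> M -> R -> Prop :=
| joined_arc c : smooth_curve c -> joined (c 0) (c 1) (curve_length c)
| joined_cat x y z l l' : joined x y l -> joined y z l' -> joined x z (l + l').

(* Only meaningful when x and y are in the same component. *)
Definition dist (x y : M) : R := inf [set l | joined x y l].

Definition complete_manifold : Prop :=
  forall a : nat -> M,
    (forall e, 0 < e -> exists n0 : nat, forall i j : nat,
       (n0 <= i)%N -> (n0 <= j)%N -> dist (a i) (a j) < e) ->
    exists x : M, a @ \oo --> x.

Definition geodesic (c : R -> M) : Prop :=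
  smooth_curve c /\
  forall k t, cdom (atlas M k) (c t) ->
    let x := cmap (atlas M k) \o c in
    derive1n 2 x t + christoffel_form (metric M k) (x t) (derive1 x t) (derive1 x t) = 0.

(* restricted to [0, 1], c is a minimal geodesic from x to y *)
Definition minimal_geodesic (x y : M) (c : R -> M) : Prop :=
  [/\ geodesic c, c 0 = x, c 1 = y & curve_length c = dist x y].

(* expo is the exponential map at o, defined on all of T_o M = 'rV_n *)
Definition is_exp (o : M) (expo : 'rV[R]_n -> M) : Prop :=
  forall v, exists c : R -> M,
    [/\ geodesic c, c 0 = o, velocity c 0 = v & expo v = c 1].

Definition pole (o : M) : Prop :=
  exists expo : 'rV[R]_n -> M,
    [/\ is_exp o expo, smooth_into setT expo &
        exists2 loga : M -> 'rV[R]_n, smooth_from loga &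
          cancel expo loga /\ cancel loga expo].

End RiemannianManifold.

(* Lebesgue integral over R^n of a nonnegative Borel function, by Tonelli *)
Fixpoint lebesgue_int (R : realType) (n : nat) : ('rV[R]_n -> \bar R) -> \bar R :=
  match n with
  | 0 => fun f => f 0
  | n'.+1 => fun f =>
      (\int[lebesgue_measure]_x
         lebesgue_int (fun v : 'rV[R]_n' =>
           f (row_mx (x%:M : 'rV[R]_1) v : 'rV[R]_n'.+1)))%E
  end.

Section Capacity.
Variables (R : realType) (n : nat) (M : riemannian R n).

(* Integral of a nonnegative Borel function against the Riemannian measure.
   M is the disjoint union over k of the Borel sets {x | chart_at x = k}, on
   which the measure has density sqrt (det metric) in chart k. *)
Definition volume_int (f : M -> R) : \bar R :=
  (\sum_(k <oo) lebesgue_int (fun y : 'rV[R]_n =>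
     if `[< cimg (atlas M k) y /\ chart_at (cinv (atlas M k) y) = k >]
     then (f (cinv (atlas M k) y) * Num.sqrt (\det (metric M k y)))%:E
     else 0))%E.

Definition test_function (u : M -> R) : Prop :=
  smooth_from u /\ compact (closure [set x | u x != 0]).

Definition capacity (p : R) (D : set M) : \bar R :=
  ereal_inf [set volume_int (fun x => tnorm x (grad u x) `^ p) |
             u in [set u | test_function u /\ forall x, D x -> 1 <= u x]].

(* The compact set is required to have nonempty interior: the empty set (and,
   for p <= n, a single point) has zero capacity in every manifold. *)
Definition p_parabolic (p : R) : Prop :=
  exists D : set M, [/\ compact D, D° !=set0 & capacity p D = 0%E].

End Capacity.

Section Submanifold.
Variables (R : realType) (m n : nat) (S : riemannian R m) (N : riemannian R n).
Variable X : S -> N.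

(* S carries the metric induced by X.  Since that metric is positive definite,
   the differential of X is injective. *)
Definition isometric_immersion : Prop :=
  smooth_map X /\
  forall j k y, cimg (atlas S j) y -> cdom (atlas N k) (X (cinv (atlas S j) y)) ->
    let F := cmap (atlas N k) \o X \o cinv (atlas S j) in
    metric S j y = 'J F y *m metric N k (F y) *m ('J F y)^T.

Definition proper_map : Prop := forall K : set N, compact K -> compact (X @^-1` K).

(* X in the preferred charts around x and X x *)
Definition local_map (x : S) : 'rV[R]_m -> 'rV[R]_n :=
  cmap (atlas N (chart_at (X x))) \o X \o cinv (atlas S (chart_at x)).

Definition tangent_map (x : S) : 'M[R]_(m, n) := 'J (local_map x) (coord x).

Definition normal_part (x : S) (z : 'rV[R]_n) : 'rV[R]_n :=
  z - z *m gram (X x) *m (tangent_map x)^T *m invmx (gram x) *m tangent_map x.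

(* alpha(u, v): normal part of the N-covariant derivative along u of
   dX(v), v being extended with constant coordinates *)
Definition second_form (x : S) (u v : 'rV[R]_m) : 'rV[R]_n :=
  normal_part x
    ('D_u (fun y => 'D_v (local_map x) y) (coord x)
     + christoffel_form (metric N (chart_at (X x))) (coord (X x))
         (u *m tangent_map x) (v *m tangent_map x)).

Definition mean_curvature (x : S) : 'rV[R]_n :=
  m%:R^-1 *: \sum_(i < m) \sum_(j < m)
    invmx (gram x) i j *: second_form x (delta_mx 0 i) (delta_mx 0 j).

Variable o : N.

Definition grad_ambient (x : S) : 'rV[R]_n := grad (dist o) (X x).

Definition grad_restr (x : S) : 'rV[R]_m := grad (dist o \o X) x.

Definition tangency (x : S) : R := tnorm x (grad_restr x).

Definition mean_convexity (x : S) : R :=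
  - dot (gram (X x)) (grad_ambient x) (mean_curvature x).

(* the zero vector where [grad_restr x] vanishes *)
Definition radial_unit (x : S) : 'rV[R]_m := (tangency x)^-1 *: grad_restr x.

Definition radial_second_form (x : S) : R :=
  - dot (gram (X x)) (grad_ambient x)
        (second_form x (radial_unit x) (radial_unit x)).

End Submanifold.

(* Smooth functions on [0, +oo[ are represented by smooth functions on R, of
   which only the values on [0, +oo[ matter; every function smooth up to the
   boundary point 0 has such an extension. *)
Definition warping (R : realType) (w : R -> R) : Prop :=
  [/\ smooth_on setT w, w 0 = 0, derive1 w 0 = 1 & forall r, 0 < r -> 0 < w r].

Definition eta (R : realType) (w : R -> R) (r : R) : R := derive1 w r / w r.

(* The radial curvature bound: every two-plane at x <> o containing the
   tangent vector of a minimal geodesic from o to x is spanned by that vector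
   and a vector v independent of it. *)
Definition radial_curvature_ge (R : realType) (n : nat) (N : riemannian R n)
    (o : N) (b : R -> R) : Prop :=
  forall x : N, x <> o -> forall c, minimal_geodesic o x c ->
  forall v, row_free (col_mx (velocity c 1) v) ->
    b (dist o x) <= sectional_curvature x (velocity c 1) v.

(* {N, S, M_w} is a comparison constellation with lower tangency on [0, +oo[;
   the model M_w enters through its dimension m and its warping function w.
   The radial quantities are only defined off o, where r is smooth. *)
Definition constellation (R : realType) (m n : nat) (S : riemannian R m)
    (N : riemannian R n) (X : S -> N) (o : N) (w g lam h : R -> R) : Prop :=
  [/\ radial_curvature_ge o (fun r => - (derive1n 2 w r / w r)),
      [/\ smooth_on setT g, smooth_on setT lam & smooth_on setT h] &
      forall x : S, X x <> o ->
        [/\ g (dist o (X x)) <= tangency X o x,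
            lam (dist o (X x)) <= radial_second_form X o x &
            h (dist o (X x)) <= mean_convexity X o x]].

Definition balance (R : realType) (m : nat) (p : R) (w lam h : R -> R) (r : R) : R :=
  (m%:R + p - 2) * eta w r - m%:R * h r - (p - 2) * lam r.

Definition Lambda (R : realType) (m : nat) (p rho : R) (w g lam h : R -> R)
    (r : R) : R :=
  w r * expR (- \int[lebesgue_measure]_(t in `[rho, r])
                   (balance m p w lam h t / ((p - 1) * g t ^+ 2))).

(* Main.v *)
(* Let r be the distance to the pole, restricted to S. In normal coordinates the Gauss lemma and the radial curvature bound give the Hessian comparison Hess r <= eta_w(r) (g - dr dr) in N. Restricting to S, with the bounds on the second fundamental form and T >= g, one obtains for A = Lambda^(p-1) that the field A(r) |grad r|^(p-2) grad r has nonpositive divergence on {r > rho}; the function Lambda is chosen so that this holds. If W' = Lambda, this says that W(r) is p-superharmonic. Integrating against the test function s(W(r)) (1 - s(W(r)/L)), where s is a smooth step from 0 to 1, shows that the flux at the level W(r) ~ L is at most the flux at the level W(r) ~ 1. Since the latter does not depend on L, the cutoff functions u = 1 - s(W(r)/L) have p-energy O(1/L). They equal 1 on a fixed ball for large L, and are compactly supported because W is unbounded (the integral of Lambda diverges) and the immersion is proper. Hence the p-capacity of that ball is 0. *)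

(* For a lower curvature bound the length of a Jacobi field is the wrong quantity: the
   Cauchy-Schwarz term in its second derivative spoils the inequality needed for an upper Hessian
   bound. The proof measures instead a covector that is constant in normal coordinates along a ray;
   there the same term has the favourable sign, and a Sturm argument against [w] concludes. The
   exponent in [Lambda] is dictated by the supersolution condition. With A = Lambda^(p-1) one has A'
   = (p-1) A (eta_w - M_p / ((p-1) g^2)), and the bound on the p-Laplacian leaves A M_p (1 - T^2 /
   g^2), which is at most 0 because M_p >= 0 and T >= g > 0. The power p-1 also ties energy to flux:
   |grad u|^p is at most a slope O(1/L) times the flux density of 1 - u. The remaining obstacle is
   integration on S: the volume is a sum over charts cut along pieces that are not open, so
   independence of charts, additivity and finiteness come before any global divergence theorem. The
   change of variables is proved as one inequality by Gaussian mollification and used in both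
   directions. *)
From HB Require Import structures.
From mathcomp Require Import all_boot all_order all_algebra.
From mathcomp Require Import perm.
From mathcomp Require Import all_classical all_reals all_analysis.
From mathcomp Require Import measurable_realfun.
From mathcomp Require Import ring lra.
Require Import Defs.
Set Implicit Arguments.
Unset Strict Implicit.
Unset Printing Implicit Defensive.
Import Order.TTheory GRing.Theory Num.Theory numFieldNormedType.Exports.
Local Open Scope ring_scope.
Local Open Scope classical_set_scope.

(** * Differential calculus in coordinates *)

Section DirectionalDerivatives.
Variable R : realType.
Implicit Types V W Z : normedModType R.

Lemma diff_approx V W (f : V -> W) (L : {linear V -> W}) x : continuous L ->
  (forall e, 0 < e -> \forall h \near 0, `|f (h + x) - f x - L h| <= e * `|h|) ->
  differentiable f x /\ 'd f x = L :> (V -> W).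
Proof.
move=> cL fL.
have H : f \o shift x = cst (f x) + L +o_ 0 id.
  apply: eqaddoE; apply/eqaddoP => e e0 /=.
  near=> h; rewrite /= !fctE /= opprD addrA.
  by near: h; apply: fL.
have dL : 'd f x = L :> (V -> W) by apply: diff_unique.
split=> //; apply/diff_locallyP; split; first by rewrite dL.
by rewrite dL.
Unshelve. all: by end_near. Qed.

Lemma derive_lineE V W (f : V -> W) (x v : V) (t : R) :
  'D_1 (fun s : R => f (s *: v + x)) t = 'D_v f (t *: v + x).
Proof.
rewrite /derive.
suff -> : (fun h : R => h^-1 *: (((fun s : R => f (s *: v + x)) \o shift t) (h *: 1) - f (t *: v + x))) =
  (fun h : R => h^-1 *: ((f \o shift (t *: v + x)) (h *: v) - f (t *: v + x))) by [].
by apply/funext => h /=; rewrite -[h *: 1]/(h * 1) mulr1 scalerDl addrA.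
Qed.

(** Only the curve [h |-> f (h *: v + x)] enters, so directional derivability of the inner map
    suffices; differentiability is asked of the outer map alone. *)
Lemma is_derive_comp V Z W (f : V -> Z) (g : Z -> W) x v :
  derivable f x v -> differentiable g (f x) ->
  is_derive x v (g \o f) ('D_('D_v f x) g (f x)).
Proof.
move=> df dg.
pose k (h : R) := f (h *: v + x).
have k0 : k 0 = f x by rewrite /k scale0r add0r.
have dk : differentiable k 0 by apply/derivable1_diffP; move/derivable1P : df.
have Dk : 'D_1 k 0 = 'D_v f x.
  by rewrite derive_lineE scale0r add0r.
have dgk : differentiable (g \o k) 0 by apply: differentiable_comp; rewrite ?k0.
have Dgk : 'D_v (g \o f) x = 'D_1 (g \o k) 0.
  by rewrite (derive_lineE (g \o f)) scale0r add0r.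
split; first by apply/derivable1P; apply/derivable1_diffP.
rewrite Dgk deriveE // diff_comp ?k0 //= -Dk deriveE // deriveE ?k0 //.
Qed.

Lemma derivable_lineP V W (f : V -> W) (x v : V) (t : R) :
  derivable f (t *: v + x) v <-> derivable (fun s : R => f (s *: v + x)) t 1.
Proof.
rewrite /derivable.
suff -> : (fun h : R => h^-1 *: ((f \o shift (t *: v + x)) (h *: v) - f (t *: v + x))) =
 (fun h : R => h^-1 *: (((fun s : R => f (s *: v + x)) \o shift t) (h *: 1) - f (t *: v + x))) by [].
by apply/funext => h /=; rewrite -[h *: 1]/(h * 1) mulr1 scalerDl addrA.
Qed.

Lemma MVT_line V (f : V -> R) (x v : V) :
  (forall t : R, 0 <= t <= 1 -> derivable f (t *: v + x) v) ->
  exists2 t : R, 0 <= t <= 1 & f (v + x) - f x = 'D_v f (t *: v + x).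
Proof.
move=> df.
have d1 (t : R) : 0 <= t <= 1 -> derivable (fun s : R => f (s *: v + x)) t 1.
  by move=> /df /derivable_lineP.
have [|||t t01 E] := @MVT_segment R (fun s : R => f (s *: v + x)) (fun t => 'D_v f (t *: v + x)) 0 1.
- exact: ler01.
- move=> t; rewrite in_itv /= => /andP[t0 t1]; have t01 : 0 <= t <= 1 by rewrite !ltW.
  by rewrite -derive_lineE; apply: derivableP; apply: d1.
- by apply: derivable_within_continuous => t; rewrite in_itv; exact: d1.
by exists t => //; move: E; rewrite scale1r scale0r add0r subr0 mulr1.
Qed.

Lemma deriveZv V W (f : V -> W) (x v : V) (c : R) :
  derivable f x v -> is_derive x (c *: v) f (c *: 'D_v f x).
Proof.
move=> df.
have dk : derivable (fun s : R => f (s *: v + x)) 0 1 by move/derivable1P : df.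
have := @is_derive_comp _ _ _ (fun s : R => c * s) (fun s : R => f (s *: v + x)) 0 1.
rewrite /= mulr0 => H.
have dc : derivable (fun s : R => c * s) 0 1.
  by apply: derivableM; [exact: derivable_cst|exact: derivable_id].
have Dc : 'D_1 (fun s : R => c * s) 0 = c.
  rewrite deriveMl ?derive_id /=; last exact: derivable_id.
  by rewrite /GRing.scale /= mulr1.
have dd : differentiable (fun s : R => f (s *: v + x)) 0 by apply/derivable1_diffP.
have {}H := H dc dd.
rewrite Dc in H.
have E : (fun s : R => f (s *: v + x)) \o (fun s => c * s) = fun s => f (s *: (c *: v) + x).
  by apply/funext => s /=; rewrite scalerA (mulrC s).
have Dcc : 'D_c (fun s : R => f (s *: v + x)) 0 = c *: 'D_v f x.
  rewrite deriveE // -[in LHS](mulr1 c) -/(c *: (1 : R)) linearZ /= -deriveE //.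
  by rewrite derive_lineE scale0r add0r.
have [d1 E1] := H; split.
  by apply/derivable1P; rewrite -E.
rewrite -Dcc -E1 E derive_lineE scale0r add0r //.
Qed.

End DirectionalDerivatives.

(** * Continuous directional derivatives imply differentiability *)

Section ContinuousPartials.
Variable R : realType.
Implicit Types V W : normedModType R.

Lemma cvg_sumr W (T I : Type) (F : set_system T) (r : seq I) (P : pred I)
  (f : I -> T -> W) (a : I -> W) : Filter F ->
  (forall i, P i -> f i x @[x --> F] --> a i) ->
  \sum_(i <- r | P i) f i x @[x --> F] --> \sum_(i <- r | P i) a i.
Proof.
move=> FF fa; elim: r => [|i r IH].
  rewrite big_nil; under eq_cvg do rewrite big_nil; exact: cvg_cst.
rewrite big_cons; under eq_cvg do rewrite big_cons.
by case: ifPn => // Pi; apply: cvgD IH; exact: fa.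
Qed.

(** The increment along [h *: (u + v)] is made in two moves, first along [h *: u], then along
    [h *: v]. The mean value theorem turns the second move into ['D_v f] at a nearby point, and
    continuity of ['D_v f] at [x] brings it back to [x]. *)
Lemma is_derive_addv V (U : set V) (f : V -> R) (x u v : V) : open U -> U x ->
  (forall y, U y -> derivable f y v) -> {for x, continuous ('D_v f)} ->
  derivable f x u -> is_derive x (u + v) f ('D_u f x + 'D_v f x).
Proof.
move=> oU Ux dv cv du.
suff H : h^-1 *: ((f \o shift x) (h *: (u + v)) - f x) @[h --> 0^'] --> 'D_u f x + 'D_v f x.
  by split; [apply/cvg_ex; exists ('D_u f x + 'D_v f x)|exact/cvg_lim].
have Hu : h^-1 *: ((f \o shift x) (h *: u) - f x) @[h --> 0^'] --> 'D_u f x by exact: du.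
have -> : (fun h : R => h^-1 *: ((f \o shift x) (h *: (u + v)) - f x)) =
   (fun h => h^-1 *: ((f \o shift x) (h *: u) - f x)) +
   (fun h => h^-1 *: (f (h *: v + (h *: u + x)) - f (h *: u + x))).
  apply/funext => h; rewrite !fctE /= -scalerDr; congr (_ *: _).
  by rewrite scalerDr (addrC (h *: u)) -addrA [RHS]addrC subrKA.
apply: (cvgD Hu); apply/cvgrPdist_le => e e0.
have /nbhs_ballP[r /= r0 rU] : nbhs x U by exact: open_nbhs_nbhs.
move/cvgrPdist_le : cv => /(_ e e0) /nbhs_ballP[s /= s0 sP].
pose d := Num.min r s; have d0 : 0 < d by rewrite lt_min r0.
have nuv : 0 < `|u| + `|v| + 1 by rewrite ltr_wpDl // addr_ge0.
near=> h.
have h0 : h != 0 by near: h; exact: nbhs_dnbhs_neq.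
have hd : `|h| < d / (`|u| + `|v| + 1).
  near: h; apply: dnbhs0_lt; exact: divr_gt0.
have inb (t : R) : 0 <= t <= 1 -> ball x d (t *: (h *: v) + (h *: u + x)).
  move=> /andP[t0 t1]; rewrite -ball_normE /= addrA opprD addrCA subrr addr0 normrN.
  apply: le_lt_trans (ler_normD _ _) _; rewrite !normrZ (ger0_norm t0).
  move: hd; rewrite ltr_pdivlMr // => hd; apply: le_lt_trans hd.
  have : t * (`|h| * `|v|) <= `|h| * `|v| by rewrite ler_piMl // mulr_ge0.
  have := normr_ge0 h; lra.
have inU (t : R) : 0 <= t <= 1 -> U (t *: (h *: v) + (h *: u + x)).
  move=> /inb H; apply: rU; apply: le_ball H; by rewrite ge_min lexx.
have dhv (y : V) : U y -> is_derive y (h *: v) f (h *: 'D_v f y).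
  by move=> Uy; apply: deriveZv; apply: dv.
have [t t01 ->] := @MVT_line _ _ f (h *: u + x) (h *: v) (fun t t01 => @ex_derive _ _ _ _ _ _ _ (dhv _ (inU t t01))).
rewrite (@derive_val _ _ _ _ _ _ _ (dhv _ (inU t t01))) [h^-1 *: _]scalerA mulVf // scale1r.
apply: sP; apply: le_ball (inb t t01); by rewrite ge_min lexx orbT.
Unshelve. all: by end_near. Qed.

Lemma derive_rV n (U : set 'rV[R]_n) (f : 'rV[R]_n -> R) : open U ->
  (forall v x, U x -> derivable f x v) ->
  (forall v x, U x -> {for x, continuous ('D_v f)}) ->
  forall x v, U x -> 'D_v f x = \sum_i v 0 i * 'D_(delta_mx 0 i) f x.
Proof.
move=> oU df cf x v Ux.
rewrite {1}[v]matrix_sum_delta big_ord1.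
have : is_derive x (\sum_i v 0 i *: delta_mx 0 i) f (\sum_i v 0 i * 'D_(delta_mx 0 i) f x); last by case.
elim/big_ind2 : _ => [|a b c d Hb Hd|i _].
- exact: is_derive0.
- have [db <-] := Hb; have [dd <-] := Hd.
  by apply: (is_derive_addv oU Ux); [move=> y Uy; exact: df|exact: cf|exact: db].
- exact/deriveZv/df.
Qed.

(** With [c] the row of partial derivatives, this is the candidate for the differential. *)
Definition rowdot n (c v : 'rV[R]_n) : R := \sum_i v 0 i * c 0 i.

Lemma rowdot_is_linear n (c : 'rV[R]_n) : linear (rowdot c).
Proof.
move=> a u v; rewrite /rowdot scaler_sumr -big_split /=; apply: eq_bigr => i _.
by rewrite !mxE mulrDl /GRing.scale /= mulrA.
Qed.

HB.instance Definition _ n (c : 'rV[R]_n) :=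
  GRing.isLinear.Build R 'rV[R]_n R _ (rowdot c) (rowdot_is_linear c).

Lemma le_mx_norm m n (A : 'M[R]_(m, n)) i j : `|A i j| <= `|A|.
Proof.
by rewrite [leRHS]/Num.Def.normr /= mx_normrE; apply: (le_bigmax _ (fun i => `|A i.1 i.2|) (i, j)).
Qed.

Lemma mx_norm_le m n (A : 'M[R]_(m, n)) e : 0 <= e -> (forall i j, `|A i j| <= e) -> `|A| <= e.
Proof.
by move=> e0 H; rewrite [leLHS]/Num.Def.normr /= mx_normrE bigmax_le // => -[i j] _; exact: H.
Qed.

Lemma rowdot_continuous n (c : 'rV[R]_n) : continuous (rowdot c).
Proof.
move=> x; rewrite /rowdot; apply: (@cvg_sumr _ 'rV[R]_n _ (nbhs x)) => i _; apply: cvgMl.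
exact: coord_continuous.
Qed.

(** [Ck] speaks of directional derivatives only, while the chain rule needs a differential. By the
    mean value theorem the increment along [h] is ['D_h f] at a point of the segment, and continuity
    of the partials compares it with [rowdot c h]. *)
Lemma C1_differentiable n (U : set 'rV[R]_n) (f : 'rV[R]_n -> R) : open U ->
  (forall v x, U x -> derivable f x v) ->
  (forall v x, U x -> {for x, continuous ('D_v f)}) ->
  forall x, U x -> differentiable f x.
Proof.
move=> oU df cf x Ux.
have Df := derive_rV oU df cf.
pose c := \row_i 'D_(delta_mx 0 i) f x.
apply: (proj1 (@diff_approx _ _ _ f (rowdot c) x _ _)); first exact: rowdot_continuous.
move=> e e0.
(* Each of the [n] coordinates contributes at most this much; the successor keeps the denominator
   nonzero in dimension 0. *)
have en0 : 0 < e / n.+1%:R by rewrite divr_gt0.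
have /nbhs_ballP[r /= r0 rU] : nbhs x U by exact: open_nbhs_nbhs.
have : \forall y \near x, forall i : 'I_n, `|'D_(delta_mx 0 i) f x - 'D_(delta_mx 0 i) f y| <= e / n.+1%:R.
  have H (i : 'I_n) : \forall y \near x, `|'D_(delta_mx 0 i) f x - 'D_(delta_mx 0 i) f y| <= e / n.+1%:R.
    by have /cvgrPdist_le := cf (delta_mx 0 i) x Ux; apply.
  exact: (@filter_forall _ _ _ (nbhs x) _ H).
move=> /nbhs_ballP[s /= s0 sP].
pose d := Num.min r s; have d0 : 0 < d by rewrite lt_min r0.
apply/nbhs_ballP; exists d => //= h; rewrite -ball_normE /= sub0r normrN => hd.
have inb (t : R) : 0 <= t <= 1 -> ball x d (t *: h + x).
  move=> /andP[t0 t1]; rewrite -ball_normE /= opprD addrCA subrr addr0 normrN.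
  by rewrite normrZ (ger0_norm t0) (le_lt_trans _ hd) // ler_piMl.
have inU (t : R) : 0 <= t <= 1 -> U (t *: h + x).
  by move=> /inb H; apply: rU; apply: le_ball H; rewrite ge_min lexx.
have [t t01 ->] := @MVT_line _ _ f x h (fun t t01 => df _ _ (inU t t01)).
rewrite (Df _ _ (inU t t01)) /= /rowdot -sumrB.
apply: le_trans (ler_norm_sum _ _ _) _.
apply: (@le_trans _ _ (\sum_(i < n) `|h| * (e / n.+1%:R))).
  apply: ler_sum => i _; rewrite -mulrBr normrM ler_pM ?le_mx_norm //.
  rewrite mxE distrC; apply: sP.
  by apply: le_ball (inb t t01); rewrite ge_min lexx orbT.
rewrite sumr_const card_ord -(mulr_natr (_ * _)) -mulrA mulrC; apply: ler_wpM2r => //.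
by rewrite mulrAC ler_pdivrMr // ler_pM2l // ler_nat.
Qed.

End ContinuousPartials.

(** * Closure properties of the classes [Ck] *)

Section CkTheory.
Variable R : realType.
Implicit Types V W : normedModType R.

Lemma Ck_cont V W k (U : set V) (f : V -> W) x : Ck k U f -> U x -> {for x, continuous f}.
Proof. by case: k => [|k] [+ _]; apply. Qed.

Lemma Ck_derivable V W k (U : set V) (f : V -> W) v x : Ck k.+1 U f -> U x -> derivable f x v.
Proof. by case=> _ /(_ v) [+ _]; apply. Qed.

Arguments Ck_derivable {V W k U f} v {x}.

Lemma Ck_derive V W k (U : set V) (f : V -> W) v : Ck k.+1 U f -> Ck k U ('D_v f).
Proof. by case=> _ /(_ v) []. Qed.

Arguments Ck_derive {V W k U f} v.

Lemma CkW V W k (U : set V) (f : V -> W) : Ck k.+1 U f -> Ck k U f.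
Proof.
elim: k f => [|k IH] f [cf df]; first by split.
by split=> // v; have [dv Dv] := df v; split=> //; exact: IH.
Qed.

Lemma sub_Ck V W k (U U' : set V) (f : V -> W) : U' `<=` U -> Ck k U f -> Ck k U' f.
Proof.
move=> U'U; elim: k f => [|k IH] f [cf df].
  by split=> // x /U'U; exact: cf.
split=> [x /U'U|v]; first exact: cf.
by have [dv Dv] := df v; split=> [x /U'U|]; [exact: dv|exact: IH].
Qed.

Lemma near_open V (U : set V) (P : V -> Prop) x : open U -> U x ->
  (forall y, U y -> P y) -> \forall y \near x, P y.
Proof. by move=> oU Ux UP; apply: filterS UP _; exact: open_nbhs_nbhs. Qed.

Lemma near_eq_cont (T T' : topologicalType) (f g : T -> T') x : (\forall y \near x, f y = g y) ->
  {for x, continuous f} -> {for x, continuous g}.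
Proof.
move=> fg; rewrite /prop_for /continuous_at -(nbhs_singleton fg); apply: cvg_trans.
by apply: near_eq_cvg; apply: filterS fg.
Qed.

(** Openness matters: derivatives at a point of [U] only see [f] on a neighbourhood, which then lies
    in [U]. *)
Lemma eq_Ck V W k (U : set V) (f g : V -> W) : open U -> (forall x, U x -> f x = g x) ->
  Ck k U f -> Ck k U g.
Proof.
move=> oU; elim: k f g => [|k IH] f g fg [cf df].
  split=> // x Ux; apply: near_eq_cont (cf x Ux).
  exact: (near_open oU Ux fg).
split=> [x Ux|v].
  by apply: near_eq_cont (cf x Ux); exact: (near_open oU Ux fg).
have [dv Dv] := df v; split=> [x Ux|].
  by apply: near_eq_derivable (dv x Ux); exact: (near_open oU Ux fg).
apply: IH Dv => x Ux; apply: near_eq_derive; exact: (near_open oU Ux fg).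
Qed.

(** Every clause of [Ck] is a statement about single points, so the witnesses [U'] may vary with the
    point. *)
Lemma Ck_local V W k (U : set V) (f : V -> W) :
  (forall x, U x -> exists2 U', U' x & Ck k U' f) -> Ck k U f.
Proof.
elim: k f => [|k IH] f H.
  by split=> // x /H [U' U'x [cf _]]; exact: cf.
split=> [x /H [U' U'x [cf _]]|v]; first exact: cf.
split=> [x /H [U' U'x [_ /(_ v) [dv _]]]|]; first exact: dv.
by apply: IH => x /H [U' U'x [_ /(_ v) [_ Dv]]]; exists U'.
Qed.

Lemma Ck_cst V W k (U : set V) (c : W) : Ck k U (fun=> c).
Proof.
elim: k c => [|k IH] c; first by split=> // x _; exact: cst_continuous.
split=> [x _|v]; first exact: cst_continuous.
split=> [x _|]; first exact: derivable_cst.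
have -> : 'D_v (fun=> c) = fun=> (0 : W) by apply/funext => x; exact: (derive_cst c x v).
exact: IH.
Qed.

Lemma Ck_cont_linear V W k (U : set V) (L : {linear V -> W}) : continuous L -> Ck k U L.
Proof.
move=> cL.
have dL x v : is_derive x v L (L v).
  split; first exact/diff_derivable/linear_differentiable.
  by rewrite deriveE ?diff_lin //; exact: linear_differentiable.
case: k => [|k]; first by split=> // x _; exact: cL.
split=> [x _|v]; first exact: cL.
split=> [x _|]; first by have [] := dL x v.
have -> : 'D_v L = fun=> L v by apply/funext => x; have [] := dL x v.
exact: Ck_cst.
Qed.

Lemma Ck_id V k (U : set V) : Ck k U (fun x : V => x).
Proof. by apply: (@Ck_cont_linear V V k U idfun) => x; exact: cvg_id. Qed.

Lemma CkD V W k (U : set V) (f g : V -> W) : open U -> Ck k U f -> Ck k U g ->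
  Ck k U (fun x => f x + g x).
Proof.
move=> oU; elim: k f g => [|k IH] f g [cf df] [cg dg].
  by split=> // x Ux; apply: cvgD; [exact: cf|exact: cg].
split=> [x Ux|v]; first by apply: cvgD; [exact: cf|exact: cg].
have [dfv Dfv] := df v; have [dgv Dgv] := dg v; split=> [x Ux|].
  by apply: derivableD; [exact: dfv|exact: dgv].
apply: (eq_Ck oU _ (IH _ _ Dfv Dgv)) => x Ux.
by rewrite (deriveD (dfv x Ux) (dgv x Ux)).
Qed.

Lemma Ck_sum V W k (U : set V) (I : Type) (r : seq I) (P : pred I) (f : I -> V -> W) :
  open U -> (forall i, P i -> Ck k U (f i)) -> Ck k U (fun x => \sum_(i <- r | P i) f i x).
Proof.
move=> oU H; elim: r => [|i r IH].
  by apply: (eq_Ck oU _ (Ck_cst k U (0 : W))) => x _; rewrite big_nil.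
have [Pi|nPi] := boolP (P i).
  by apply: (eq_Ck oU _ (CkD oU (H i Pi) IH)) => x _; rewrite big_cons Pi.
by apply: (eq_Ck oU _ IH) => x _; rewrite big_cons (negbTE nPi).
Qed.

Lemma CkM V k (U : set V) (f g : V -> R) : open U -> Ck k U f -> Ck k U g ->
  Ck k U (fun x => f x * g x).
Proof.
move=> oU; elim: k f g => [|k IH] f g Cf Cg; have [cf df] := Cf; have [cg dg] := Cg.
  by split=> // x Ux; apply: cvgM; [exact: cf|exact: cg].
split=> [x Ux|v]; first by apply: cvgM; [exact: cf|exact: cg].
have [dfv Dfv] := df v; have [dgv Dgv] := dg v; split=> [x Ux|].
  by apply: derivableM; [exact: dfv|exact: dgv].
apply: (eq_Ck oU _ (CkD oU (IH _ _ (CkW Cf) Dgv) (IH _ _ (CkW Cg) Dfv))) => x Ux.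
by rewrite (deriveM (dfv x Ux) (dgv x Ux)).
Qed.

Lemma CkZ V k (U : set V) (c : R) (f : V -> R) : open U -> Ck k U f -> Ck k U (fun x => c * f x).
Proof. by move=> oU; apply: CkM => //; exact: Ck_cst. Qed.

Lemma CkN V k (U : set V) (f : V -> R) : open U -> Ck k U f -> Ck k U (fun x => - f x).
Proof.
by move=> oU Cf; apply: (eq_Ck oU _ (CkZ (-1) oU Cf)) => x _; rewrite mulN1r.
Qed.

Lemma CkB V k (U : set V) (f g : V -> R) : open U -> Ck k U f -> Ck k U g ->
  Ck k U (fun x => f x - g x).
Proof. by move=> oU Cf Cg; apply: CkD => //; exact: CkN. Qed.

Lemma Ck_prod V k (U : set V) (I : Type) (r : seq I) (P : pred I) (f : I -> V -> R) :
  open U -> (forall i, P i -> Ck k U (f i)) -> Ck k U (fun x => \prod_(i <- r | P i) f i x).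
Proof.
move=> oU H; elim: r => [|i r IH].
  by apply: (eq_Ck oU _ (Ck_cst k U (1 : R))) => x _; rewrite big_nil.
have [Pi|nPi] := boolP (P i).
  by apply: (eq_Ck oU _ (CkM oU (H i Pi) IH)) => x _; rewrite big_cons Pi.
by apply: (eq_Ck oU _ IH) => x _; rewrite big_cons (negbTE nPi).
Qed.

Lemma CkV V k (U : set V) (f : V -> R) : open U -> (forall x, U x -> f x != 0) -> Ck k U f ->
  Ck k U (fun x => (f x)^-1).
Proof.
move=> oU f0; elim: k => [|k IH] Cf; have [cf df] := Cf.
  by split=> // x Ux; apply: cvgV; [exact: f0|exact: cf].
split=> [x Ux|v]; first by apply: cvgV; [exact: f0|exact: cf].
have [dfv Dfv] := df v; split=> [x Ux|].
  by apply: derivableV; [exact: f0|exact: dfv].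
have Ci := IH (CkW Cf).
apply: (eq_Ck oU _ (CkM oU (CkN oU (CkM oU Ci Ci)) Dfv)) => x Ux.
rewrite (deriveV (f0 x Ux) (dfv x Ux)) /GRing.scale /=; congr (- _ * _).
by rewrite -invfM expr2.
Qed.

Lemma cont_mxP (T : topologicalType) a b (f : T -> 'M[R]_(a, b)) x :
  (forall i j, {for x, continuous (fun y => f y i j)}) -> {for x, continuous f}.
Proof.
move=> H; apply/cvgrPdist_le => e e0.
have : \forall t \near x, forall i j, `|f x i j - f t i j| <= e.
  apply: filter_forall => i; apply: filter_forall => j.
  by have /cvgrPdist_le /(_ e e0) := H i j.
apply: filterS => t Ht; apply: mx_norm_le; first exact: ltW.
by move=> i j; rewrite !mxE; exact: Ht.
Qed.

Lemma cont_coord (T : topologicalType) a b (f : T -> 'M[R]_(a, b)) x i j :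
  {for x, continuous f} -> {for x, continuous (fun y => f y i j)}.
Proof.
move=> cf; apply: (@continuous_comp _ _ _ f (fun A : 'M[R]_(a, b) => A i j)) => //.
exact: coord_continuous.
Qed.

Lemma Ck_mxP V a b k (U : set V) (f : V -> 'M[R]_(a, b)) : open U ->
  Ck k U f <-> forall i j, Ck k U (fun x => f x i j).
Proof.
move=> oU; split.
  elim: k f => [|k IH] f [cf df] i j.
    by split=> // x Ux; exact/cont_coord/cf.
  split=> [x Ux|v]; first exact/cont_coord/cf.
  have [dfv Dfv] := df v; split=> [x Ux|].
    by have /derivable_mxP := dfv x Ux; apply.
  apply: (eq_Ck oU _ (IH _ Dfv i j)) => x Ux.
  by rewrite derive_mx ?mxE //; exact: dfv.
elim: k f => [|k IH] f H.
  by split=> // x Ux; apply: cont_mxP => i j; have [+ _] := H i j; apply.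
split=> [x Ux|v]; first by apply: cont_mxP => i j; have [+ _] := H i j; apply.
have dfv x : U x -> derivable f x v.
  by move=> Ux; apply/derivable_mxP => i j; have := Ck_derivable v (H i j) Ux; exact.
split=> //; apply: IH => i j.
apply: (eq_Ck oU _ (Ck_derive v (H i j))) => x Ux.
by rewrite derive_mx ?mxE //; exact: dfv.
Qed.

Lemma Ck1_differentiable n k (U : set 'rV[R]_n) (f : 'rV[R]_n -> R) x : open U ->
  Ck k.+1 U f -> U x -> differentiable f x.
Proof.
move=> oU Cf Ux; apply: (C1_differentiable oU _ _ Ux) => v y Uy.
  exact: (Ck_derivable _ Cf Uy).
exact: (Ck_cont (Ck_derive v Cf) Uy).
Qed.

Lemma differentiable_mxP V a b (f : V -> 'M[R]_(a, b)) x :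
  (forall i j, differentiable (fun y => f y i j) x) -> differentiable f x.
Proof.
move=> H.
have -> : f = \sum_(i < a) \sum_(j < b) (fun y => f y i j *: delta_mx i j).
  apply/funext => y; rewrite {1}[f y]matrix_sum_delta fct_sumE.
  by apply: eq_bigr => i _; rewrite fct_sumE.
apply: differentiable_sum => i; apply: differentiable_sum => j.
exact: differentiableZl.
Qed.

Lemma Ck1_differentiable_mx n a b k (U : set 'rV[R]_n) (f : 'rV[R]_n -> 'M[R]_(a, b)) x :
  open U -> Ck k.+1 U f -> U x -> differentiable f x.
Proof.
move=> oU /(Ck_mxP _ _ oU) Cf Ux; apply: differentiable_mxP => i j.
exact: (Ck1_differentiable oU (Cf i j)).
Qed.

Lemma derive_delta n (f : 'rV[R]_n -> R) x v : differentiable f x ->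
  'D_v f x = \sum_i v 0 i * 'D_(delta_mx 0 i) f x.
Proof.
move=> df; rewrite deriveE // {1}[v]matrix_sum_delta big_ord1 linear_sum.
by apply: eq_bigr => i _; rewrite linearZ deriveE.
Qed.

(** The derivative of the composite is taken along the moving vector ['D_v f x]. Expanding it in the
    coordinate basis leaves derivatives of [g] along constant vectors, to which the induction
    hypothesis applies. *)
Lemma Ck_comp V n k (U : set V) (U' : set 'rV[R]_n) (f : V -> 'rV[R]_n) (g : 'rV[R]_n -> R) :
  open U -> open U' -> (forall x, U x -> U' (f x)) -> Ck k U f -> Ck k U' g ->
  Ck k U (g \o f).
Proof.
move=> oU oU' fU; elim: k g => [|k IH] g Cf Cg.
  split=> // x Ux; apply: continuous_comp; first exact: (Ck_cont Cf).
  exact/(Ck_cont Cg)/fU.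
have dfg v x (Ux : U x) := is_derive_comp (Ck_derivable v Cf Ux) (Ck1_differentiable oU' Cg (fU x Ux)).
split=> [x Ux|v].
  apply: continuous_comp; first exact: (Ck_cont Cf).
  exact/(Ck_cont Cg)/fU.
split=> [x Ux|]; first by have [] := dfg v x Ux.
have H : Ck k U (fun x => \sum_i 'D_v f x 0 i * ('D_(delta_mx 0 i) g \o f) x).
  apply: Ck_sum => // i _; apply: CkM => //.
    by have /Ck_mxP := Ck_derive v Cf; apply.
  by apply: IH; [exact: CkW|exact: Ck_derive].
apply: (eq_Ck oU _ H) => x Ux; have [_ ->] := dfg v x Ux.
by rewrite (derive_delta _ (Ck1_differentiable oU' Cg (fU x Ux))).
Qed.

Lemma Ck_comp_mx V n a b k (U : set V) (U' : set 'rV[R]_n) (f : V -> 'rV[R]_n)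
  (g : 'rV[R]_n -> 'M[R]_(a, b)) :
  open U -> open U' -> (forall x, U x -> U' (f x)) -> Ck k U f -> Ck k U' g ->
  Ck k U (g \o f).
Proof.
move=> oU oU' fU Cf /(Ck_mxP _ _ oU') Cg; apply/Ck_mxP => // i j.
exact: (Ck_comp oU oU' fU Cf (Cg i j)).
Qed.

(** The variant for outer functions on [R] itself, where the moving direction is a scalar factor and
    no basis is involved. *)
Lemma Ck_comp1 V k (U : set V) (U' : set R) (f : V -> R) (g : R -> R) :
  open U -> (forall x, U x -> U' (f x)) -> Ck k U f -> Ck k U' g ->
  Ck k U (g \o f).
Proof.
move=> oU fU; elim: k g => [|k IH] g Cf Cg.
  split=> // x Ux; apply: continuous_comp; first exact: (Ck_cont Cf).
  exact/(Ck_cont Cg)/fU.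
have dg x (Ux : U x) : differentiable g (f x).
  by apply/derivable1_diffP/(Ck_derivable _ Cg)/fU.
have dfg v x (Ux : U x) := is_derive_comp (Ck_derivable v Cf Ux) (dg x Ux).
split=> [x Ux|v].
  apply: continuous_comp; first exact: (Ck_cont Cf).
  exact/(Ck_cont Cg)/fU.
split=> [x Ux|]; first by have [] := dfg v x Ux.
have H : Ck k U (fun x => 'D_v f x * ('D_1 g \o f) x).
  apply: CkM => //; first exact: Ck_derive.
  by apply: IH; [exact: CkW|exact: Ck_derive].
apply: (eq_Ck oU _ H) => x Ux; have [_ ->] := dfg v x Ux.
rewrite [RHS]deriveE; last exact: dg.
by rewrite -[in RHS](mulr1 ('D_v f x)) -/('D_v f x *: (1 : R)) linearZ /= -deriveE //; exact: dg.
Qed.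

Lemma Ck_coord n k (U : set 'rV[R]_n) i : Ck k U (fun x : 'rV[R]_n => x 0 i).
Proof. by apply: (sub_Ck (subsetT U)); have /Ck_mxP := @Ck_id 'rV[R]_n k setT; apply; exact: openT. Qed.

Lemma jacE n p (f : 'rV[R]_n -> 'rV[R]_p) x v : differentiable f x -> v *m 'J f x = 'D_v f x.
Proof. by move=> df; rewrite /jacobian mul_rV_lin1 deriveE. Qed.

Lemma Ck_jacobian n p k (U : set 'rV[R]_n) (f : 'rV[R]_n -> 'rV[R]_p) : open U ->
  Ck k.+1 U f -> Ck k U (jacobian f).
Proof.
move=> oU Cf; apply/Ck_mxP => // i j.
have /(Ck_mxP _ _ oU) H := Ck_derive (delta_mx 0 i) Cf.
apply: (eq_Ck oU _ (H 0 j)) => x Ux.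
rewrite -jacE; last exact: (Ck1_differentiable_mx oU Cf).
by rewrite -rowE mxE.
Qed.

Lemma Ck_mulmx V a b c k (U : set V) (f : V -> 'M[R]_(a, b)) (g : V -> 'M[R]_(b, c)) :
  open U -> Ck k U f -> Ck k U g -> Ck k U (fun x => f x *m g x).
Proof.
move=> oU /(Ck_mxP _ _ oU) Cf /(Ck_mxP _ _ oU) Cg; apply/Ck_mxP => // i j.
have H : Ck k U (fun x => \sum_l f x i l * g x l j).
  by apply: Ck_sum => // l _; apply: CkM.
by apply: (eq_Ck oU _ H) => x _; rewrite mxE.
Qed.

Lemma Ck_trmx V a b k (U : set V) (f : V -> 'M[R]_(a, b)) :
  open U -> Ck k U f -> Ck k U (fun x => (f x)^T).
Proof.
move=> oU /(Ck_mxP _ _ oU) Cf; apply/Ck_mxP => // i j.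
by apply: (eq_Ck oU _ (Cf j i)) => x _; rewrite mxE.
Qed.

Lemma Ck_det V n k (U : set V) (f : V -> 'M[R]_n) : open U -> Ck k U f ->
  Ck k U (fun x => \det (f x)).
Proof.
move=> oU /(Ck_mxP _ _ oU) Cf.
apply: Ck_sum => // s _; apply: CkM => //; first exact: Ck_cst.
by apply: Ck_prod => // i _; exact: Cf.
Qed.

Lemma Ck_invmx V n k (U : set V) (f : V -> 'M[R]_n) : open U ->
  (forall x, U x -> f x \in unitmx) -> Ck k U f -> Ck k U (fun x => invmx (f x)).
Proof.
move=> oU fu Cf; apply/Ck_mxP => // i j.
have H : Ck k U (fun x => (\det (f x))^-1 * ((-1) ^+ (j + i) * \det (row' j (col' i (f x))))).
  apply: CkM => //; last first.
    apply: CkZ => //; apply: Ck_det => //; apply/Ck_mxP => // a b.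
    have /Ck_mxP := Cf => /(_ oU (lift j a) (lift i b)).
    by apply: eq_Ck => // x _; rewrite !mxE.
  apply: CkV => //; last exact: Ck_det.
  by move=> x /fu; rewrite unitmxE unitfE.
apply: (eq_Ck oU _ H) => x Ux; rewrite /invmx (fu x Ux) !mxE /cofactor.
by [].
Qed.

End CkTheory.
Arguments Ck_derivable {R V W k U f} v {x}.
Arguments Ck_derive {R V W k U f} v.

(** * Symmetry of second derivatives; derivatives of matrix expressions *)

Section MatrixDerivatives.
Variable R : realType.
Implicit Types V W : normedModType R.

Lemma derive_shiftE V W (f : V -> W) (a x v : V) :
  'D_v (fun y => f (a + y)) x = 'D_v f (a + x).
Proof.
rewrite /derive.
suff -> : (fun h : R => h^-1 *: (((fun y => f (a + y)) \o shift x) (h *: v) - f (a + x))) =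
  (fun h : R => h^-1 *: ((f \o shift (a + x)) (h *: v) - f (a + x))) by [].
by apply/funext => h /=; rewrite addrCA.
Qed.

Lemma derivable_shiftE V W (f : V -> W) (a x v : V) :
  derivable f (a + x) v -> derivable (fun y => f (a + y)) x v.
Proof.
rewrite /derivable.
suff -> : (fun h : R => h^-1 *: (((fun y => f (a + y)) \o shift x) (h *: v) - f (a + x))) =
  (fun h : R => h^-1 *: ((f \o shift (a + x)) (h *: v) - f (a + x))) by [].
by apply/funext => h /=; rewrite addrCA.
Qed.

Lemma is_derive_addf V W (f g : V -> W) x v df dg : is_derive x v f df -> is_derive x v g dg ->
  is_derive x v (fun y => f y + g y) (df + dg).
Proof. by move=> Hf Hg; exact: (is_deriveD Hf Hg). Qed.

Lemma is_derive_subf V W (f g : V -> W) x v df dg : is_derive x v f df -> is_derive x v g dg ->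
  is_derive x v (fun y => f y - g y) (df - dg).
Proof. by move=> Hf Hg; exact: (is_deriveB Hf Hg). Qed.

(** Two applications of the mean value theorem: to [y |-> f (h v + y) - f y] along [u], then to
    ['D_u f] along [v]. The left-hand side is symmetric in [u] and [v], which is what Schwarz's
    theorem needs. *)
Lemma second_difference V (B : set V) (f : V -> R) (x u v : V) (h : R) : h != 0 ->
  (forall s t : R, 0 <= s <= 1 -> 0 <= t <= 1 -> B (t *: (h *: v) + (s *: (h *: u) + x))) ->
  (forall y, B y -> derivable f y u) -> (forall y, B y -> derivable ('D_u f) y v) ->
  exists2 y, B y & f (h *: v + (h *: u + x)) - f (h *: u + x) - (f (h *: v + x) - f x) =
    h ^+ 2 * 'D_v ('D_u f) y.
Proof.
move=> h0 HB du dvu.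
pose F y := f (h *: v + y) - f y.
have B0 s : 0 <= s <= 1 -> B (s *: (h *: u) + x).
  by move=> s01; have := HB s 0 s01; rewrite scale0r add0r; apply; rewrite lexx ler01.
have B1 s : 0 <= s <= 1 -> B (h *: v + (s *: (h *: u) + x)).
  by move=> s01; have := HB s 1 s01; rewrite scale1r; apply; rewrite lexx ler01.
have dF s : 0 <= s <= 1 -> is_derive (s *: (h *: u) + x) (h *: u) F
    (h *: 'D_u f (h *: v + (s *: (h *: u) + x)) - h *: 'D_u f (s *: (h *: u) + x)).
  move=> s01.
  have [d1 E1] := deriveZv h (du _ (B1 s s01)); have [d2 E2] := deriveZv h (du _ (B0 s s01)).
  rewrite -E1 -E2 -(derive_shiftE f (h *: v)).
  exact: (is_derive_subf (DeriveDef (derivable_shiftE d1) erefl) (DeriveDef d2 erefl)).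
have [s s01 ] := @MVT_line _ _ F x (h *: u) (fun s s01 => @ex_derive _ _ _ _ _ _ _ (dF s s01)).
rewrite /F => ->; have [_ ->] := dF s s01.
have dG t : 0 <= t <= 1 -> is_derive (t *: (h *: v) + (s *: (h *: u) + x)) (h *: v) ('D_u f)
    (h *: 'D_v ('D_u f) (t *: (h *: v) + (s *: (h *: u) + x))).
  by move=> t01; apply: deriveZv; apply: dvu; apply: HB.
have [t t01 E] := @MVT_line _ _ ('D_u f) (s *: (h *: u) + x) (h *: v)
  (fun t t01 => @ex_derive _ _ _ _ _ _ _ (dG t t01)).
exists (t *: (h *: v) + (s *: (h *: u) + x)); first exact: HB.
by rewrite -scalerBr E; have [_ ->] := dG t t01; rewrite /GRing.scale /= mulrA expr2.
Qed.

(** Both mixed derivatives, taken at points close to [x], equal the same second difference divided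
    by [h ^+ 2]; continuity moves both points to [x]. *)
Lemma derive_symm V (U : set V) (f : V -> R) x u v : open U -> Ck 2 U f -> U x ->
  'D_u ('D_v f) x = 'D_v ('D_u f) x.
Proof.
move=> oU Cf Ux; apply/eqP; rewrite -subr_eq0 -normr_le0; apply/ler_addgt0Pl => e e0; rewrite addr0.
have e2 : 0 < e / 2 by rewrite divr_gt0.
have /nbhs_ballP[r /= r0 rU] : nbhs x U by exact: open_nbhs_nbhs.
have c1 := Ck_cont (Ck_derive v (Ck_derive u Cf)) Ux.
have c2 := Ck_cont (Ck_derive u (Ck_derive v Cf)) Ux.
move/cvgrPdist_le : c1 => /(_ _ e2) /nbhs_ballP[s /= s0 sP].
move/cvgrPdist_le : c2 => /(_ _ e2) /nbhs_ballP[s' /= s0' sP'].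
pose d := Num.min r (Num.min s s'); have d0 : 0 < d by rewrite !lt_min r0 s0.
have nuv : 0 < `|u| + `|v| + 1 by rewrite ltr_wpDl // addr_ge0.
(* Small enough that the whole parallelogram spanned by [h u] and [h v] lies in the ball on which
   both mixed derivatives vary by at most [e / 2]. *)
pose h : R := d / (`|u| + `|v| + 1) / 2.
have h0 : 0 < h by rewrite !divr_gt0.
have hd : h * (`|u| + `|v|) < d.
  have : h * (`|u| + `|v| + 1) = d / 2 by rewrite /h mulrAC divfK // gt_eqF.
  by lra.
move: h h0 hd => h h0 hd.
have inB (a b : V) : `|a| + `|b| = `|u| + `|v| ->
  forall p q : R, 0 <= p <= 1 -> 0 <= q <= 1 -> ball x d (q *: (h *: a) + (p *: (h *: b) + x)).
  move=> ab p q /andP[p0 p1] /andP[q0 q1].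
  rewrite -ball_normE /= addrA opprD addrCA subrr addr0 normrN.
  apply: le_lt_trans hd; apply: le_trans (ler_normD _ _) _.
  rewrite -ab !normrZ (ger0_norm p0) (ger0_norm q0) (ger0_norm (ltW h0)) mulrDr.
  by apply: lerD; rewrite ler_piMl // mulr_ge0 // ltW.
have dr y : ball x d y -> ball x r y by apply: le_ball; rewrite ge_min lexx.
have ds y : ball x d y -> ball x s y by apply: le_ball; rewrite !ge_min lexx !orbT.
have ds' y : ball x d y -> ball x s' y by apply: le_ball; rewrite !ge_min lexx !orbT.
have D1 a y : ball x d y -> derivable f y a.
  by move=> /dr /rU Uy; exact: (Ck_derivable a Cf Uy).
have D2 a b y : ball x d y -> derivable ('D_a f) y b.
  by move=> /dr /rU Uy; exact: (Ck_derivable b (Ck_derive a Cf) Uy).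
have [y By Ey] := @second_difference _ _ f x u v h (lt0r_neq0 h0)
   (inB v u (addrC _ _)) (D1 u) (D2 u v).
have [z Bz Ez] := @second_difference _ _ f x v u h (lt0r_neq0 h0)
   (inB u v erefl) (D1 v) (D2 v u).
have yz : 'D_v ('D_u f) y = 'D_u ('D_v f) z.
  apply: (@mulfI _ (h ^+ 2)); first by rewrite expf_neq0 // gt_eqF.
  move: Ez; rewrite (addrCA (h *: u) (h *: v) x) => Ez; rewrite -[LHS]Ey -[RHS]Ez.
  by move: (f (_ + (_ + x))) (f (_ *: u + x)) (f (_ *: v + x)) (f x) => a b c c'; ring.
rewrite (_ : _ - _ = ('D_u ('D_v f) x - 'D_u ('D_v f) z) - ('D_v ('D_u f) x - 'D_v ('D_u f) y)).
  rewrite (splitr e); apply: le_trans (ler_normB _ _) _; apply: lerD.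
    exact/sP'/ds'.
  exact/sP/ds.
rewrite yz; move: ('D_u ('D_v f) x) ('D_u ('D_v f) z) ('D_v ('D_u f) x) => a b c; ring.
Qed.

Lemma is_derive_mxP V a b (f : V -> 'M[R]_(a, b)) x v (df : 'M[R]_(a, b)) :
  (forall i j, is_derive x v (fun y => f y i j) (df i j)) -> is_derive x v f df.
Proof.
move=> H.
have d : derivable f x v by apply/derivable_mxP => i j; have [] := H i j.
by split=> //; rewrite derive_mx //; apply/matrixP => i j; rewrite mxE; have [_ ->] := H i j.
Qed.

Lemma is_derive_coord V a b (f : V -> 'M[R]_(a, b)) x v (df : 'M[R]_(a, b)) i j :
  is_derive x v f df -> is_derive x v (fun y => f y i j) (df i j).
Proof.
move=> [d <-]; have d' : derivable (fun y => f y i j) x v by move/derivable_mxP : d; apply.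
by split=> //; rewrite derive_mx // mxE.
Qed.

Lemma is_derive_sumr V W (I : Type) (r : seq I) (P : pred I) (f : I -> V -> W) x v (df : I -> W) :
  (forall i, P i -> is_derive x v (f i) (df i)) ->
  is_derive x v (fun y => \sum_(i <- r | P i) f i y) (\sum_(i <- r | P i) df i).
Proof.
move=> H; elim: r => [|i r IH].
  rewrite big_nil; have -> : (fun y => \sum_(i <- [::] | P i) f i y) = fun=> (0 : W).
    by apply/funext => y; rewrite big_nil.
  exact: is_derive_cst.
rewrite big_cons; case: ifPn => Pi; last first.
  have -> : (fun y => \sum_(j <- i :: r | P j) f j y) = fun y => \sum_(j <- r | P j) f j y.
    by apply/funext => y; rewrite big_cons (negbTE Pi).
  exact: IH.
have -> : (fun y => \sum_(j <- i :: r | P j) f j y) = f i + fun y => \sum_(j <- r | P j) f j y.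
  by apply/funext => y; rewrite big_cons Pi.
by apply: is_deriveD; exact: H.
Qed.

Lemma is_derive_mulr V (f g : V -> R) x v (df dg : R) :
  is_derive x v f df -> is_derive x v g dg ->
  is_derive x v (fun y => f y * g y) (df * g x + f x * dg).
Proof.
move=> Hf Hg; have := is_deriveM Hf Hg; rewrite addrC /GRing.scale /=.
by rewrite (mulrC (g x)).
Qed.

Lemma is_derive_mulmx V a b c (f : V -> 'M[R]_(a, b)) (g : V -> 'M[R]_(b, c)) x v (df : 'M[R]_(a, b)) (dg : 'M[R]_(b, c)) :
  is_derive x v f df -> is_derive x v g dg ->
  is_derive x v (fun y => f y *m g y) (df *m g x + f x *m dg).
Proof.
move=> Hf Hg; apply: is_derive_mxP => i j; rewrite !mxE -big_split /=.
have -> : (fun y => (f y *m g y) i j) = fun y => \sum_l f y i l * g y l j.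
  by apply/funext => y; rewrite mxE.
apply: is_derive_sumr => l _; apply: is_derive_mulr; exact: is_derive_coord.
Qed.

Lemma is_derive_trmx V a b (f : V -> 'M[R]_(a, b)) x v (df : 'M[R]_(a, b)) :
  is_derive x v f df -> is_derive x v (fun y => (f y)^T) df^T.
Proof.
move=> Hf; apply: is_derive_mxP => i j; rewrite mxE.
have -> : (fun y => (f y)^T i j) = fun y => f y j i by apply/funext => y; rewrite mxE.
exact: is_derive_coord.
Qed.

Lemma is_derive_dot V n (G : V -> 'M[R]_n) (a b : V -> 'rV[R]_n) x v (dG : 'M[R]_n) (da db : 'rV[R]_n) :
  is_derive x v G dG -> is_derive x v a da -> is_derive x v b db ->
  is_derive x v (fun y => dot (G y) (a y) (b y))
    (dot dG (a x) (b x) + dot (G x) da (b x) + dot (G x) (a x) db).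
Proof.
move=> HG Ha Hb.
have H := is_derive_coord 0 0 (is_derive_mulmx (is_derive_mulmx Ha HG) (is_derive_trmx Hb)).
have addE (A B : 'M[R]_1) : (A + B) 0 0 = A 0 0 + B 0 0 by rewrite mxE.
by apply: is_derive_eq H _; rewrite mulmxDl !addE /dot [X in X + _ = _]addrC.
Qed.

Lemma is_derive_prod V (I : eqType) (r : seq I) (f : I -> V -> R) x v (df : I -> R) : uniq r ->
  (forall i, is_derive x v (f i) (df i)) ->
  is_derive x v (fun y => \prod_(i <- r) f i y)
    (\sum_(i <- r) df i * \prod_(j <- r | j != i) f j x).
Proof.
move=> + H; elim: r => [_|i r IH /= /andP[ir ur]].
  rewrite big_nil; have -> : (fun y => \prod_(i <- [::]) f i y) = fun=> (1 : R).
    by apply/funext => y; rewrite big_nil.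
  exact: is_derive_cst.
have -> : (fun y => \prod_(j <- i :: r) f j y) = fun y => f i y * \prod_(j <- r) f j y.
  by apply/funext => y; rewrite big_cons.
apply: is_derive_eq (is_derive_mulr (H i) (IH ur)) _.
rewrite big_cons big_cons eqxx /= mulr_sumr; congr (_ * _ + _).
  rewrite [RHS]big_seq_cond [LHS]big_seq; apply: eq_bigl => j.
  by case jr : (j \in r) => //=; apply/esym/negP => /eqP ji; rewrite -ji jr in ir.
rewrite [RHS]big_seq [LHS]big_seq; apply: eq_bigr => j jr.
have ij : i != j by apply/negP => /eqP ij; rewrite ij jr in ir.
by rewrite big_cons ij mulrCA.
Qed.

Lemma is_derive_det V n (f : V -> 'M[R]_n) x v (df : 'M[R]_n) :
  is_derive x v f df -> is_derive x v (fun y => \det (f y)) (\tr (\adj (f x) *m df)).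
Proof.
move=> Hf.
have -> : \tr (\adj (f x) *m df) = \sum_i \sum_j df i j * cofactor (f x) i j.
  rewrite mxtrace_mulC /mxtrace; apply: eq_bigr => i _; rewrite mxE.
  by apply: eq_bigr => j _; rewrite !mxE.
(* Row [i] of [f x] is replaced by row [i] of the derivative. Expanding along that row gives the
   cofactors of [f x], and the Leibniz sum gives the terms of the product rule. *)
pose A (i : 'I_n) := \matrix_(k, l) (if k == i then df k l else f x k l).
have E i : \sum_j df i j * cofactor (f x) i j = \det (A i).
  rewrite (expand_det_row _ i); apply: eq_bigr => j _; rewrite mxE eqxx; congr (_ * _).
  rewrite /cofactor; congr (_ * \det _); apply/matrixP => k l.
  by rewrite !mxE eq_sym (negbTE (neq_lift i k)).
under eq_bigr do rewrite E /determinant.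
rewrite exchange_big /=; rewrite /determinant.
apply: is_derive_sumr => s _; rewrite -mulr_sumr.
have := is_derive_mulr (is_derive_cst ((-1) ^+ s : R) x v)
  (is_derive_prod (index_enum_uniq 'I_n) (fun i : 'I_n => is_derive_coord i (s i) Hf)).
rewrite mul0r add0r => H; apply: is_derive_eq H _; congr (_ * _).
apply: eq_bigr => i _; rewrite [RHS](bigD1 i) //= /A mxE eqxx; congr (_ * _).
by apply: eq_bigr => j ji; rewrite mxE (negbTE ji).
Qed.

(** Derivability comes from the cofactor formula; the value is then forced by differentiating
    [f y *m invmx (f y) = 1]. *)
Lemma is_derive_invmx V n k (U : set V) (f : V -> 'M[R]_n) x v (df : 'M[R]_n) : open U -> U x ->
  (forall y, U y -> f y \in unitmx) -> Ck k.+1 U f -> is_derive x v f df ->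
  is_derive x v (fun y => invmx (f y)) (- (invmx (f x) *m df *m invmx (f x))).
Proof.
move=> oU Ux fu Cf Hf.
have di := Ck_derivable v (Ck_invmx oU fu Cf) Ux.
split=> //; set d := 'D_v _ x.
have Hd : is_derive x v (fun y => invmx (f y)) d by split.
have [_] := is_derive_mulmx Hf Hd.
rewrite (@near_eq_derive _ _ _ _ (cst 1%:M)); last first.
  by apply: (near_open oU Ux) => y Uy; rewrite mulmxV //; exact: fu.
rewrite derive_cst => /eqP; rewrite eq_sym addrC addr_eq0 => /eqP /(congr1 (mulmx (invmx (f x)))).
by rewrite mulmxA mulVmx ?fu // mul1mx mulmxN mulmxA.
Qed.

End MatrixDerivatives.

(** * Inner products given by Gram matrices *)

Section Dot.
Variables (R : realType) (n : nat).
Implicit Types (G : 'M[R]_n) (u v w : 'rV[R]_n).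

Lemma dotDl G u v w : dot G (u + v) w = dot G u w + dot G v w.
Proof. by rewrite /dot !mulmxDl mxE. Qed.

Lemma dotDr G u v w : dot G u (v + w) = dot G u v + dot G u w.
Proof. by rewrite /dot linearD mulmxDr mxE. Qed.

Lemma dotZl G c u v : dot G (c *: u) v = c * dot G u v.
Proof. by rewrite /dot -!scalemxAl mxE. Qed.

Lemma dotZr G c u v : dot G u (c *: v) = c * dot G u v.
Proof. by rewrite /dot linearZ /= -scalemxAr mxE. Qed.

Lemma dotNl G u v : dot G (- u) v = - dot G u v.
Proof. by rewrite -scaleN1r dotZl mulN1r. Qed.

Lemma dotNr G u v : dot G u (- v) = - dot G u v.
Proof. by rewrite -scaleN1r dotZr mulN1r. Qed.

Lemma dotBl G u v w : dot G (u - v) w = dot G u w - dot G v w.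
Proof. by rewrite dotDl dotNl. Qed.

Lemma dotBr G u v w : dot G u (v - w) = dot G u v - dot G u w.
Proof. by rewrite dotDr dotNr. Qed.

Lemma dot0l G v : dot G 0 v = 0.
Proof. by rewrite /dot !mul0mx mxE. Qed.

Lemma dot0r G v : dot G v 0 = 0.
Proof. by rewrite -(scale0r v) dotZr mul0r. Qed.

Lemma dotZm c G u v : dot (c *: G) u v = c * dot G u v.
Proof. by rewrite /dot -scalemxAr -scalemxAl mxE. Qed.

Lemma dotC G u v : G^T = G -> dot G u v = dot G v u.
Proof.
move=> sG; rewrite /dot.
have -> : u *m G *m v^T = (v *m G *m u^T)^T by rewrite !trmx_mul trmxK sG mulmxA.
by rewrite mxE.
Qed.

Lemma dot_sumE G u v : dot G u v = \sum_i \sum_j G i j * u 0 i * v 0 j.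
Proof.
rewrite /dot mxE exchange_big /=; apply: eq_bigr => j _; rewrite mxE mxE mulr_suml.
by apply: eq_bigr => i _; rewrite (mulrC (u 0 i)).
Qed.

Lemma dot_delta G i j : dot G (delta_mx 0 i) (delta_mx 0 j) = G i j.
Proof. by rewrite /dot -rowE trmx_delta -colE !mxE. Qed.

Lemma dot_inj G u v : G \in unitmx -> (forall w, dot G u w = dot G v w) -> u = v.
Proof.
move=> uG H; suff : u *m G = v *m G by apply: (can_inj (mulmxK uG)).
apply/rowP => j; have := H (delta_mx 0 j).
by rewrite /dot trmx_delta -!colE !mxE.
Qed.

Lemma dot_congr m (J : 'M[R]_(m, n)) G (a b : 'rV[R]_m) :
  dot (J *m G *m J^T) a b = dot G (a *m J) (b *m J).
Proof. by rewrite /dot trmx_mul !mulmxA. Qed.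

Lemma dot_invmx G (d : 'rV[R]_n) v : G \in unitmx -> G^T = G ->
  dot G (d *m invmx G) v = (d *m v^T) 0 0.
Proof. by move=> uG sG; rewrite /dot -(mulmxA d) mulVmx // mulmx1. Qed.

Definition spd G : Prop := G^T = G /\ forall v, v != 0 -> 0 < dot G v v.

Lemma spd_unit G : spd G -> G \in unitmx.
Proof.
move=> [sG pG]; rewrite -row_free_unit; apply/row_freeP; apply: contrapT => H.
have : kermx G != 0.
  apply/eqP => /eqP; rewrite kermx_eq0 => /row_freeP; exact: H.
move/rowV0Pn => [v vk v0]; have := pG v v0.
by rewrite /dot (sub_kermxP vk) mul0mx mxE ltxx.
Qed.

Lemma dot_ge0 G v : spd G -> 0 <= dot G v v.
Proof.
by move=> [sG pG]; have [->|v0] := eqVneq v 0; [rewrite dot0l|rewrite ltW // pG].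
Qed.

Lemma dot_CS G u v : spd G -> dot G u v ^+ 2 <= dot G u u * dot G v v.
Proof.
move=> H; have [sG pG] := H.
have [->|v0] := eqVneq v 0; first by rewrite !dot0r expr0n mulr0.
have Gv := pG v v0.
(* This vector is a multiple of the component of [u] orthogonal to [v]. *)
have := dot_ge0 (dot G v v *: u - dot G u v *: v) H.
rewrite !(dotBl, dotBr, dotZl, dotZr) (dotC v u sG).
have -> : dot G v v * (dot G v v * dot G u u - dot G u v * dot G u v) -
  dot G u v * (dot G v v * dot G u v - dot G u v * dot G v v)
  = dot G v v * (dot G u u * dot G v v - dot G u v ^+ 2) by ring.
by rewrite pmulr_rge0 // subr_ge0.
Qed.

End Dot.

(** * The Koszul formula *)

Section Koszul.
Variable R : realType.

(** The Koszul expression, that is the Christoffel symbol of the first kind contracted with three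
    vectors. In this form no matrix inverse and no index sums appear. *)
Definition low n (G : 'rV[R]_n -> 'M[R]_n) (y u v w : 'rV[R]_n) : R :=
  2^-1 * (dot ('D_u G y) v w + dot ('D_v G y) u w - dot ('D_w G y) u v).

Lemma derive_mx_delta n a b (G : 'rV[R]_n -> 'M[R]_(a, b)) y u i j :
  differentiable G y -> 'D_u G y i j = \sum_k u 0 k * pd k (fun z => G z i j) y.
Proof.
move=> dG.
have dGij : differentiable (fun z => G z i j) y.
  exact: (differentiable_comp dG (differentiable_coord _ i j)).
rewrite derive_mx ?mxE ?derive_delta //; exact: diff_derivable.
Qed.

Lemma dot_derive_sumE n (G : 'rV[R]_n -> 'M[R]_n) y u v w : differentiable G y ->
  dot ('D_u G y) v w =
  \sum_i \sum_j \sum_l u 0 i * v 0 j * w 0 l * pd i (fun z => G z j l) y.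
Proof.
move=> dG; rewrite dot_sumE.
under eq_bigr do (under eq_bigr do rewrite derive_mx_delta // !mulr_suml).
under eq_bigr do rewrite exchange_big /=.
rewrite exchange_big /=; do 3!(apply: eq_bigr => ? _); by ring.
Qed.

Lemma christoffel_lowE n (G : 'rV[R]_n -> 'M[R]_n) y u v w :
  G y \in unitmx -> (G y)^T = G y -> differentiable G y ->
  dot (G y) (christoffel_form G y u v) w = low G y u v w.
Proof.
move=> uG sG dG.
pose L : 'rV[R]_n := \row_l \sum_i \sum_j u 0 i * v 0 j * (2^-1 * (pd i (fun z => G z j l) y + pd j (fun z => G z i l) y
     - pd l (fun z => G z i j) y)).
have sI k l : invmx (G y) k l = invmx (G y) l k.
  by rewrite -[in RHS]sG -trmx_inv mxE.
have -> : christoffel_form G y u v = L *m invmx (G y).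
  apply/rowP => k; rewrite !mxE.
  under [RHS]eq_bigr do rewrite mxE mulr_suml.
  rewrite [RHS]exchange_big /=; apply: eq_bigr => i _.
  under [RHS]eq_bigr do rewrite mulr_suml.
  rewrite [RHS]exchange_big /=; apply: eq_bigr => j _.
  rewrite /christoffel !mulr_suml; apply: eq_bigr => l _.
  rewrite (sI k l); move: (pd i _ y) (pd j _ y) (pd l _ y) => p1 p2 p3; ring.
rewrite (dot_invmx _ _ uG sG) mxE /low !(dot_derive_sumE _ _ _ dG).
under [LHS]eq_bigr do rewrite !mxE mulr_suml.
rewrite exchange_big /=.
have -> : \sum_i \sum_j \sum_l v 0 i * u 0 j * w 0 l * pd i (fun z => G z j l) y =
   \sum_i \sum_j \sum_l u 0 i * v 0 j * w 0 l * pd j (fun z => G z i l) y.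
  by rewrite exchange_big /=; do 3!(apply: eq_bigr => ? _); ring.
have -> : \sum_i \sum_j \sum_l w 0 i * u 0 j * v 0 l * pd i (fun z => G z j l) y =
   \sum_i \sum_j \sum_l u 0 i * v 0 j * w 0 l * pd l (fun z => G z i j) y.
  rewrite exchange_big /=; apply: eq_bigr => i _; rewrite exchange_big /=.
  by do 2!(apply: eq_bigr => ? _); ring.
rewrite -big_split -sumrB mulr_sumr /=; apply: eq_bigr => i _.
under [LHS]eq_bigr do rewrite mulr_suml.
rewrite exchange_big -big_split -sumrB mulr_sumr /=; apply: eq_bigr => j _.
rewrite -big_split -sumrB mulr_sumr /=; apply: eq_bigr => l _.
by ring.
Qed.

Lemma dot_deriveE n (G : 'rV[R]_n -> 'M[R]_n) y u v w : derivable G y u ->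
  is_derive y u (fun z => dot (G z) v w) (dot ('D_u G y) v w).
Proof.
move=> dG; have := is_derive_dot (DeriveDef dG erefl) (is_derive_cst v y u) (is_derive_cst w y u).
by rewrite dot0l dot0r !addr0.
Qed.

Lemma derive_sym n (G : 'rV[R]_n -> 'M[R]_n) y u (U : set 'rV[R]_n) : open U -> U y ->
  (forall z, U z -> (G z)^T = G z) -> derivable G y u -> ('D_u G y)^T = 'D_u G y.
Proof.
move=> oU Uy sG dG; have [_ <-] := is_derive_trmx (DeriveDef dG erefl).
by apply: near_eq_derive; apply: near_open oU Uy _ => z; exact: sG.
Qed.

Lemma derive_symm_mx m a b (U : set 'rV[R]_m) (F : 'rV[R]_m -> 'M[R]_(a, b)) y u v : open U -> U y ->
  Ck 2 U F -> 'D_u ('D_v F) y = 'D_v ('D_u F) y.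
Proof.
move=> oU Uy CF; apply/matrixP => i j.
have CFij := (Ck_mxP _ _ oU).1 CF i j.
have E p q : 'D_p ('D_q F) y i j = 'D_p ('D_q (fun z => F z i j)) y.
  rewrite derive_mx ?mxE; last exact: (Ck_derivable p (Ck_derive q CF) Uy).
  apply: near_eq_derive; apply: near_open oU Uy _ => z Uz.
  by rewrite derive_mx ?mxE //; exact: (Ck_derivable q CF Uz).
exact: etrans (E u v) (etrans (derive_symm u v oU CFij Uy) (esym (E v u))).
Qed.

(* The Koszul formula of an induced metric: tangential parts of the ambient
   covariant derivative are intrinsic. *)
Lemma low_induced m n (U : set 'rV[R]_m) (U' : set 'rV[R]_n) (F : 'rV[R]_m -> 'rV[R]_n)
    (g : 'rV[R]_m -> 'M[R]_m) (G : 'rV[R]_n -> 'M[R]_n) y u v w :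
  open U -> open U' -> U y -> (forall z, U z -> U' (F z)) -> Ck 2 U F -> Ck 1 U' G ->
  (forall z, U' z -> (G z)^T = G z) ->
  (forall z, U z -> g z = 'J F z *m G (F z) *m ('J F z)^T) ->
  low g y u v w = dot (G (F y)) ('D_u ('D_v F) y) ('D_w F y)
     + low G (F y) ('D_u F y) ('D_v F y) ('D_w F y).
Proof.
move=> oU oU' Uy FU CF CG sG gE.
have dF z : U z -> differentiable F z by move=> Uz; exact: (Ck1_differentiable_mx oU CF).
have dG : differentiable G (F y) by apply: (Ck1_differentiable_mx oU' CG); exact: FU.
have Cg : Ck 1 U g.
  have CJ := Ck_jacobian oU CF.
  have H := Ck_mulmx oU (Ck_mulmx oU CJ (Ck_comp_mx oU oU' FU (CkW CF) CG)) (Ck_trmx oU CJ).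
  by apply: eq_Ck oU _ H => z /gE ->.
have E a b c : dot ('D_a g y) b c = dot ('D_('D_a F y) G (F y)) ('D_b F y) ('D_c F y) +
   dot (G (F y)) ('D_a ('D_b F) y) ('D_c F y) + dot (G (F y)) ('D_b F y) ('D_a ('D_c F) y).
  have [_ <-] := dot_deriveE b c (Ck_derivable a Cg Uy).
  have dDF e : is_derive y a ('D_e F) ('D_a ('D_e F) y).
    by apply: DeriveDef => //; exact: (Ck_derivable a (Ck_derive e CF) Uy).
  have dFa : derivable F y a by exact: diff_derivable (dF y Uy).
  have dGF := is_derive_comp dFa dG.
  have [_ <-] := is_derive_dot dGF (dDF b) (dDF c).
  apply: near_eq_derive; apply: near_open oU Uy _ => z Uz.
  by rewrite gE // dot_congr !jacE //; exact: dF.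
(* By symmetry of second derivatives the terms in the second derivatives of [F] cancel in pairs,
   except the two copies of [D_u D_v F] paired with ['D_w F]. *)
have alg (GF : 'M[R]_n) (Fu Fv Fw duv dvu duw dwu dvw dwv : 'rV[R]_n) (l1 l2 l3 : R) :
    GF^T = GF -> dvu = duv -> dwu = duw -> dwv = dvw ->
    2^-1 * ((l1 + dot GF duv Fw + dot GF Fv duw) + (l2 + dot GF dvu Fw + dot GF Fu dvw)
      - (l3 + dot GF dwu Fv + dot GF Fu dwv)) = dot GF duv Fw + 2^-1 * (l1 + l2 - l3).
  by move=> sGF -> -> ->; rewrite (dotC Fv duw sGF); move: (dot _ _ _) (dot _ _ _) (dot _ _ _) => a b c; field.
rewrite /low !E; apply: alg.
- exact/sG/FU.
- exact: (derive_symm_mx v u oU Uy CF).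
- exact: (derive_symm_mx w u oU Uy CF).
- exact: (derive_symm_mx w v oU Uy CF).
Qed.

End Koszul.

(** * The covariant Hessian under immersions and changes of coordinates *)

Section Covariance.
Variable R : realType.

(** The covariant Hessian [nabla df] in coordinates; the Christoffel correction makes it a
    tensor. *)
Definition hess n (G : 'rV[R]_n -> 'M[R]_n) (f : 'rV[R]_n -> R) (y u v : 'rV[R]_n) : R :=
  'D_u ('D_v f) y - 'D_(christoffel_form G y u v) f y.

Lemma is_derive_cmulr (V : normedModType R) (c : R) (f : V -> R) x v (df : R) :
  is_derive x v f df -> is_derive x v (fun y => c * f y) (c * df).
Proof. by move=> Hf; have := is_derive_mulr (is_derive_cst c x v) Hf; rewrite mul0r add0r. Qed.

Lemma second_chain m n (U : set 'rV[R]_m) (U' : set 'rV[R]_n) (F : 'rV[R]_m -> 'rV[R]_n)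
    (f : 'rV[R]_n -> R) y u v :
  open U -> open U' -> U y -> (forall z, U z -> U' (F z)) -> Ck 2 U F -> Ck 2 U' f ->
  'D_u ('D_v (f \o F)) y = 'D_('D_u F y) ('D_('D_v F y) f) (F y) + 'D_('D_u ('D_v F) y) f (F y).
Proof.
move=> oU oU' Uy FU CF Cf.
have dF z : U z -> differentiable F z by move=> Uz; exact: (Ck1_differentiable_mx oU CF).
have df z : U' z -> differentiable f z by exact: (Ck1_differentiable oU' Cf).
have dDf e z : U' z -> differentiable ('D_e f) z.
  exact: (Ck1_differentiable oU' (Ck_derive e Cf)).
have dFy a : derivable F y a by exact: diff_derivable (dF y Uy).
have E z : U z -> 'D_v (f \o F) z = \sum_i ('D_v F z) 0 i * 'D_(delta_mx 0 i) f (F z).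
  move=> Uz; have dFz : derivable F z v by exact: diff_derivable (dF z Uz).
  have [_ ->] := is_derive_comp dFz (df _ (FU z Uz)).
  by rewrite derive_delta //; exact/df/FU.
rewrite (near_eq_derive u (near_open oU Uy E)).
have H : is_derive y u (fun z => \sum_i ('D_v F z) 0 i * 'D_(delta_mx 0 i) f (F z))
   (\sum_i (('D_u ('D_v F) y) 0 i * 'D_(delta_mx 0 i) f (F y) +
     ('D_v F y) 0 i * 'D_('D_u F y) ('D_(delta_mx 0 i) f) (F y))).
  apply: is_derive_sumr => i _; apply: is_derive_mulr.
    apply: is_derive_coord; apply: DeriveDef => //.
    exact: (Ck_derivable u (Ck_derive v CF) Uy).
  exact: (is_derive_comp (dFy u) (dDf (delta_mx 0 i) _ (FU y Uy))).
have [_ ->] := H; rewrite big_split /= [LHS]addrC; congr (_ + _); last first.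
  by rewrite [RHS]derive_delta //; exact/df/FU.
set a := 'D_u F y; set b := 'D_v F y.
have Eb z : U' z -> 'D_b f z = \sum_i b 0 i * 'D_(delta_mx 0 i) f z.
  by move=> Uz; rewrite derive_delta //; exact: df.
rewrite (near_eq_derive a (near_open oU' (FU y Uy) Eb)).
have H2 : is_derive (F y) a (fun z => \sum_i b 0 i * 'D_(delta_mx 0 i) f z)
   (\sum_i b 0 i * 'D_a ('D_(delta_mx 0 i) f) (F y)).
  apply: is_derive_sumr => i _; apply: is_derive_cmulr.
  by apply: DeriveDef => //; exact: (Ck_derivable a (Ck_derive _ Cf) (FU y Uy)).
by have [_ ->] := H2.
Qed.

Section Induced.
Variables (m n : nat) (U : set 'rV[R]_m) (U' : set 'rV[R]_n) (F : 'rV[R]_m -> 'rV[R]_n).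
Variables (g : 'rV[R]_m -> 'M[R]_m) (G : 'rV[R]_n -> 'M[R]_n).
Hypotheses (oU : open U) (oU' : open U') (FU : forall z, U z -> U' (F z)).
Hypotheses (CF : Ck 2 U F) (CG : Ck 1 U' G) (Cg : Ck 1 U g).
Hypotheses (sG : forall z, U' z -> spd (G z)) (sg : forall z, U z -> spd (g z)).
Hypothesis gE : forall z, U z -> g z = 'J F z *m G (F z) *m ('J F z)^T.

(** The ambient covariant derivative along [u] of the field [dF(v)], with [v] of constant
    coordinates; its normal part is the second fundamental form. *)
Definition cov_accel y u v : 'rV[R]_n :=
  'D_u ('D_v F) y + christoffel_form (G) (F y) ('D_u F y) ('D_v F y).

Lemma diff_ind y : U y -> differentiable F y.
Proof. by move=> Uy; exact: (Ck1_differentiable_mx oU CF). Qed.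

Lemma dot_cov_accel y u v w : U y ->
  dot (g y) (christoffel_form g y u v) w = dot (G (F y)) (cov_accel y u v) (w *m 'J F y).
Proof.
move=> Uy; have UFy := FU Uy.
have dg : differentiable g y by exact: (Ck1_differentiable_mx oU Cg).
have dG : differentiable G (F y) by exact: (Ck1_differentiable_mx oU' CG).
rewrite (christoffel_lowE _ _ _ (spd_unit (sg Uy)) (proj1 (sg Uy)) dg).
rewrite (low_induced u v w oU oU' Uy FU CF CG) //; last by move=> z /sG [].
rewrite /cov_accel dotDl (christoffel_lowE _ _ _ (spd_unit (sG UFy)) (proj1 (sG UFy)) dG).
by rewrite jacE //; exact: diff_ind.
Qed.

(** The Koszul formula of the induced metric says that both sides have the same inner products with
    tangent vectors: the tangential part of the ambient connection is the intrinsic one. *)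
Lemma tangential_accel y u v : U y ->
  cov_accel y u v *m G (F y) *m ('J F y)^T *m invmx (g y) = christoffel_form g y u v.
Proof.
move=> Uy; have ug := spd_unit (sg Uy).
apply: (@dot_inj _ _ (g y)) => // w.
by rewrite dot_cov_accel // /dot trmx_mul !mulmxA mulmxKV.
Qed.

(** The Gauss formula for Hessians: restricting [f] changes its Hessian by the derivative of [f]
    along the normal part of the acceleration. *)
Lemma hess_induced (f : 'rV[R]_n -> R) y u v : Ck 2 U' f -> U y ->
  hess g (f \o F) y u v - hess G f (F y) ('D_u F y) ('D_v F y) =
  'D_(cov_accel y u v - christoffel_form g y u v *m 'J F y) f (F y).
Proof.
move=> Cf Uy; have UFy := FU Uy.
have df : differentiable f (F y) by exact: (Ck1_differentiable oU' Cf).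
rewrite /hess (second_chain u v oU oU' Uy FU CF Cf) /cov_accel.
have dFy a : derivable F y a by exact: diff_derivable (diff_ind Uy).
have [_ ->] := is_derive_comp (dFy (christoffel_form g y u v)) df.
rewrite jacE; last exact: diff_ind.
set a := 'D_u ('D_v F) y; set c := christoffel_form _ (F y) _ _; set d := 'D_(christoffel_form g y u v) F y.
have -> : 'D_(a + c - d) f (F y) = 'D_a f (F y) + 'D_c f (F y) - 'D_d f (F y).
  by rewrite !deriveE // !(linearD, linearN).
move: ('D_a f (F y)) ('D_c f (F y)) ('D_d f (F y)) ('D_('D_u F y) _ _) => p q r s; ring.
Qed.

End Induced.

Section ChangeOfCoordinates.
Variables (n : nat) (U U' : set 'rV[R]_n) (F : 'rV[R]_n -> 'rV[R]_n).
Variables (g G : 'rV[R]_n -> 'M[R]_n).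
Hypotheses (oU : open U) (oU' : open U') (FU : forall z, U z -> U' (F z)).
Hypotheses (sG : forall z, U' z -> spd (G z)) (sg : forall z, U z -> spd (g z)).
Hypothesis gE : forall z, U z -> g z = 'J F z *m G (F z) *m ('J F z)^T.
Hypothesis JF : forall z, U z -> 'J F z \in unitmx.

(** When the Jacobian is invertible every vector is tangent, so the normal part of the acceleration
    vanishes. This is the transformation law of the connection. *)
Lemma christoffel_change y u v : Ck 2 U F -> Ck 1 U' G -> Ck 1 U g -> U y ->
  christoffel_form g y u v *m 'J F y = cov_accel F G y u v.
Proof.
move=> CF CG Cg Uy; apply: (@dot_inj _ _ (G (F y))); first exact/spd_unit/sG/FU.
move=> w; rewrite -(mulmxKV (JF Uy) w) -dot_congr -gE //.
exact: (dot_cov_accel oU oU' FU CF CG Cg sG sg gE).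
Qed.

Lemma hess_change (f : 'rV[R]_n -> R) y u v : Ck 2 U F -> Ck 1 U' G -> Ck 1 U g -> Ck 2 U' f -> U y ->
  hess g (f \o F) y u v = hess G f (F y) ('D_u F y) ('D_v F y).
Proof.
move=> CF CG Cg Cf Uy; apply/eqP; rewrite -subr_eq0.
have := hess_induced g G oU oU' FU CF u v Cf Uy.
by rewrite (christoffel_change u v CF CG Cg Uy) subrr derive0 => ->.
Qed.

End ChangeOfCoordinates.

End Covariance.

Local Opaque dot derive.

(** * The curvature operator: symmetries and tensoriality *)

Section Curvature.
Variable R : realType.

Section Bilinear.
Variables (n : nat) (G : 'rV[R]_n -> 'M[R]_n) (y : 'rV[R]_n).

Lemma christoffel_formDr u v v' :
  christoffel_form G y u (v + v') = christoffel_form G y u v + christoffel_form G y u v'.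
Proof.
apply/rowP => k; rewrite !mxE -big_split /=; apply: eq_bigr => i _.
by rewrite -big_split /=; apply: eq_bigr => j _; rewrite mxE; ring.
Qed.

Lemma christoffel_formZl c u v : christoffel_form G y (c *: u) v = c *: christoffel_form G y u v.
Proof.
apply/rowP => k; rewrite !mxE mulr_sumr; apply: eq_bigr => i _.
by rewrite mulr_sumr; apply: eq_bigr => j _; rewrite mxE; ring.
Qed.

Lemma christoffel_formZr c u v : christoffel_form G y u (c *: v) = c *: christoffel_form G y u v.
Proof.
apply/rowP => k; rewrite !mxE mulr_sumr; apply: eq_bigr => i _.
by rewrite mulr_sumr; apply: eq_bigr => j _; rewrite mxE; ring.
Qed.

End Bilinear.

Section Local.
Variables (n : nat) (U : set 'rV[R]_n) (G : 'rV[R]_n -> 'M[R]_n).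
Hypotheses (oU : open U) (sG : forall z, U z -> spd (G z)).

Lemma Ck_christoffel k l i j : Ck k.+1 U G -> Ck k U (christoffel G l i j).
Proof.
move=> CG; have CGij a b := (Ck_mxP _ _ oU).1 CG a b.
have CI : Ck k U (fun z => invmx (G z)).
  by apply: Ck_invmx => //; [move=> z /sG /spd_unit|exact: CkW].
apply: Ck_sum => // s _; apply: CkM => //.
  by apply: CkZ => //; move/Ck_mxP : CI; exact.
by apply: CkB => //; [apply: CkD => //|]; exact: Ck_derive.
Qed.

Lemma Ck_christoffel_form k u v : Ck k.+1 U G -> Ck k U (fun z => christoffel_form G z u v).
Proof.
move=> CG; apply/Ck_mxP => // a l.
have H : Ck k U (fun z => \sum_i \sum_j christoffel G l i j z * (u 0 i * v 0 j)).
  apply: Ck_sum => // i _; apply: Ck_sum => // j _; apply: CkM => //; last exact: Ck_cst.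
  exact: Ck_christoffel.
apply: eq_Ck oU _ H => z _; rewrite mxE; do 2!(apply: eq_bigr => ? _); by rewrite mulrA.
Qed.

Lemma christoffel_formC y u v : Ck 1 U G -> U y ->
  christoffel_form G y u v = christoffel_form G y v u.
Proof.
move=> CG Uy; have uG := spd_unit (sG Uy); have dG := Ck1_differentiable_mx oU CG Uy.
apply: (dot_inj uG) => w; rewrite !(christoffel_lowE _ _ _ uG (proj1 (sG Uy)) dG) /low.
have E (a b c d : R) : c = d -> 2^-1 * (a + b - c) = 2^-1 * (b + a - d) by move=> ->; rewrite (addrC a).
apply: E; apply: dotC.
exact: derive_sym oU Uy (fun z Uz => proj1 (sG Uz)) (Ck_derivable w CG Uy).
Qed.

(** Compatibility of the Levi-Civita connection with the metric: the antisymmetric Koszul terms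
    cancel in the sum. *)
Lemma dot_christoffel_compat y u v w : Ck 1 U G -> U y ->
  dot ('D_u G y) v w = dot (G y) (christoffel_form G y u v) w + dot (G y) v (christoffel_form G y u w).
Proof.
move=> CG Uy; have uG := spd_unit (sG Uy); have dG := Ck1_differentiable_mx oU CG Uy.
have sGy := proj1 (sG Uy); rewrite (dotC v _ sGy).
rewrite !(christoffel_lowE _ _ _ uG sGy dG) /low.
have sD e := derive_sym oU Uy (fun z Uz => proj1 (sG Uz)) (Ck_derivable e CG Uy).
have E (a a' b c : R) : a = a' -> a = 2^-1 * (a + b - c) + 2^-1 * (a' + c - b) by move=> <-; lra.
by apply: E; apply: dotC; exact: sD.
Qed.

Lemma is_derive_christoffel (V : normedModType R) (p a b : V -> 'rV[R]_n) x t (dp da db : 'rV[R]_n) :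
  Ck 2 U G -> U (p x) -> is_derive x t p dp -> is_derive x t a da -> is_derive x t b db ->
  is_derive x t (fun z => christoffel_form G (p z) (a z) (b z))
    ('D_dp (fun z => christoffel_form G z (a x) (b x)) (p x) +
      christoffel_form G (p x) da (b x) + christoffel_form G (p x) (a x) db).
Proof.
move=> CG Upx [dpx Dp] Ha Hb.
have CC l i j := Ck_christoffel l i j CG.
have dC l i j : differentiable (christoffel G l i j) (p x) by exact: Ck1_differentiable (CC l i j) _.
have HC l i j : is_derive x t (fun z => christoffel G l i j (p z)) ('D_dp (christoffel G l i j) (p x)).
  by rewrite -Dp; exact: (is_derive_comp dpx (dC l i j)).
apply: is_derive_mxP => r l; rewrite (ord1 r).
have -> : (fun z => christoffel_form G (p z) (a z) (b z) 0 l) =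
    fun z => \sum_i \sum_j christoffel G l i j (p z) * a z 0 i * b z 0 j.
  by apply/funext => z; rewrite mxE.
have H : is_derive x t (fun z => \sum_i \sum_j christoffel G l i j (p z) * a z 0 i * b z 0 j)
   (\sum_i \sum_j ((('D_dp (christoffel G l i j) (p x)) * a x 0 i + christoffel G l i j (p x) * da 0 i) * b x 0 j
     + christoffel G l i j (p x) * a x 0 i * db 0 j)).
  apply: is_derive_sumr => i _; apply: is_derive_sumr => j _.
  exact: (is_derive_mulr (is_derive_mulr (HC l i j) (is_derive_coord 0 i Ha)) (is_derive_coord 0 j Hb)).
apply: is_derive_eq H _; rewrite !mxE.
have -> : 'D_dp (fun z => christoffel_form G z (a x) (b x)) (p x) 0 l =
    \sum_i \sum_j 'D_dp (christoffel G l i j) (p x) * a x 0 i * b x 0 j.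
  have Hz : is_derive (p x) dp (fun z => \sum_i \sum_j a x 0 i * b x 0 j * christoffel G l i j z)
     (\sum_i \sum_j a x 0 i * b x 0 j * 'D_dp (christoffel G l i j) (p x)).
    apply: is_derive_sumr => i _; apply: is_derive_sumr => j _; apply: is_derive_cmulr.
    by apply: DeriveDef => //; exact: diff_derivable.
  rewrite derive_mx ?mxE; last exact: (Ck_derivable dp (Ck_christoffel_form _ _ CG) Upx).
  have -> : (fun z => christoffel_form G z (a x) (b x) 0 l) =
    (fun z => \sum_i \sum_j a x 0 i * b x 0 j * christoffel G l i j z).
    by apply/funext => z; rewrite mxE; do 2!(apply: eq_bigr => ? _); rewrite [RHS]mulrC mulrA.
  have [_ ->] := Hz; do 2!(apply: eq_bigr => ? _); by rewrite mulrC mulrA.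
rewrite -!big_split /=; apply: eq_bigr => i _; rewrite -!big_split /=; apply: eq_bigr => j _.
by move: ('D_dp _ _) (christoffel _ _ _ _ _) => c d; ring.
Qed.

(** For fields with constant coordinates the bracket vanishes, and the index formula becomes the
    commutator of two covariant derivatives. *)
Lemma riemann_opE y u v w : Ck 2 U G -> U y -> riemann_op G y u v w =
  'D_u (fun z => christoffel_form G z v w) y - 'D_v (fun z => christoffel_form G z u w) y
  + christoffel_form G y u (christoffel_form G y v w) - christoffel_form G y v (christoffel_form G y u w).
Proof.
move=> CG Uy; apply/rowP => l; rewrite !mxE.
have dC l' i j : differentiable (christoffel G l' i j) y by exact: Ck1_differentiable (Ck_christoffel l' i j CG) _.
have DE a b c : 'D_a (fun z => christoffel_form G z b c) y 0 l =
    \sum_i \sum_j \sum_k pd i (christoffel G l j k) y * a 0 i * b 0 j * c 0 k.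
  rewrite derive_mx ?mxE; last exact: (Ck_derivable a (Ck_christoffel_form _ _ CG) Uy).
  have -> : (fun z => christoffel_form G z b c 0 l) =
    (fun z => \sum_j \sum_k b 0 j * c 0 k * christoffel G l j k z).
    by apply/funext => z; rewrite mxE; do 2!(apply: eq_bigr => ? _); rewrite [RHS]mulrC mulrA.
  have Hz : is_derive y a (fun z => \sum_j \sum_k b 0 j * c 0 k * christoffel G l j k z)
     (\sum_j \sum_k b 0 j * c 0 k * 'D_a (christoffel G l j k) y).
    apply: is_derive_sumr => i _; apply: is_derive_sumr => j _; apply: is_derive_cmulr.
    by apply: DeriveDef => //; exact: diff_derivable.
  have [_ ->] := Hz.
  under eq_bigr do (under eq_bigr do rewrite derive_delta // mulr_sumr).
  under eq_bigr do rewrite exchange_big /=.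
  rewrite exchange_big /=; do 3!(apply: eq_bigr => ? _); rewrite /pd.
  by move: ('D_ _ _ _) => d; ring.
rewrite !DE.
have QE a b c : \sum_i \sum_j christoffel G l i j y * a 0 i * christoffel_form G y b c 0 j =
   \sum_i \sum_j \sum_k (\sum_s christoffel G s j k y * christoffel G l i s y) * a 0 i * b 0 j * c 0 k.
  apply: eq_bigr => i _.
  under eq_bigr do rewrite mxE mulr_sumr.
  rewrite exchange_big /=; apply: eq_bigr => j _.
  under eq_bigr do rewrite mulr_sumr.
  rewrite exchange_big /=; apply: eq_bigr => k _.
  by rewrite !mulr_suml; apply: eq_bigr => s _; ring.
rewrite !QE.
rewrite [X in _ = _ - X + _ - _]exchange_big [X in _ = _ - _ + _ - X]exchange_big /=.
rewrite -sumrB -big_split -sumrB /=; apply: eq_bigr => i _.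
rewrite -sumrB -big_split -sumrB /=; apply: eq_bigr => j _.
rewrite -sumrB -big_split -sumrB /=; apply: eq_bigr => k _.
rewrite /riemann sumrB; move: (pd _ _ _) (pd _ _ _) (\sum_s _) (\sum_s _) => a b c d; ring.
Qed.

(** The second derivatives of [<a, b>], with [a] and [b] constant, commute. Written out by metric
    compatibility applied twice, their commutator is [<R a, b> + <a, R b>]. *)
Lemma dot_riemann_anti y u v a b : Ck 2 U G -> U y ->
  dot (G y) (riemann_op G y u v a) b = - dot (G y) a (riemann_op G y u v b).
Proof.
move=> CG Uy.
have sGy := proj1 (sG Uy).
have DD p q : 'D_p ('D_q (fun z => dot (G z) a b)) y =
    dot (G y) ('D_p (fun z => christoffel_form G z q a) y) b
    + dot (G y) (christoffel_form G y p (christoffel_form G y q a)) b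
    + dot (G y) (christoffel_form G y q a) (christoffel_form G y p b)
    + (dot (G y) a ('D_p (fun z => christoffel_form G z q b) y)
    + dot (G y) a (christoffel_form G y p (christoffel_form G y q b))
    + dot (G y) (christoffel_form G y p a) (christoffel_form G y q b)).
  have dGp : is_derive y p G ('D_p G y) by apply: DeriveDef => //; exact: (Ck_derivable p CG Uy).
  have dch e : is_derive y p (fun z => christoffel_form G z q e) ('D_p (fun z => christoffel_form G z q e) y).
    by apply: DeriveDef => //; exact: (Ck_derivable p (Ck_christoffel_form q e CG) Uy).
  have E z : U z -> 'D_q (fun z => dot (G z) a b) z =
      dot (G z) (christoffel_form G z q a) b + dot (G z) a (christoffel_form G z q b).
    move=> Uz; have [_ ->] := dot_deriveE a b (Ck_derivable q CG Uz).
    by rewrite (dot_christoffel_compat q a b (CkW CG) Uz).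
  rewrite (near_eq_derive p (near_open oU Uy E)).
  have [_ ->] := is_derive_addf (is_derive_dot dGp (dch a) (is_derive_cst b y p))
     (is_derive_dot dGp (is_derive_cst a y p) (dch b)).
  rewrite dot0r dot0l !(dot_christoffel_compat p _ _ (CkW CG) Uy) /cst.
  move: (dot _ _ _) (dot _ _ _) (dot _ _ _) (dot _ _ _) (dot _ _ _) (dot _ _ _) => ? ? ? ? ? ?; ring.
have Cdot : Ck 2 U (fun z => dot (G z) a b).
  have H : Ck 2 U (fun z => \sum_i \sum_j G z i j * (a 0 i * b 0 j)).
    apply: Ck_sum => // i _; apply: Ck_sum => // j _; apply: CkM => //; last exact: Ck_cst.
    by move/Ck_mxP : CG; exact.
  by apply: eq_Ck oU _ H => z _; rewrite dot_sumE; do 2!(apply: eq_bigr => ? _); rewrite mulrA.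
have := derive_symm u v oU Cdot Uy; rewrite !DD !riemann_opE //.
rewrite !(dotDl, dotDr, dotNl, dotNr).
move: (dot _ _ _) (dot _ _ _) (dot _ _ _) (dot _ _ _) (dot _ _ _) (dot _ _ _) => ? ? ? ? ? ?.
move: (dot _ _ _) (dot _ _ _) (dot _ _ _) (dot _ _ _) => ? ? ? ? ?; lra.
Qed.

Lemma riemann_op_anti y u v w : riemann_op G y v u w = - riemann_op G y u v w.
Proof.
apply/rowP => l; rewrite !mxE exchange_big -sumrN; apply: eq_bigr => i _; rewrite -sumrN.
apply: eq_bigr => j _; rewrite -sumrN; apply: eq_bigr => k _.
have -> : riemann G j i k l y = - riemann G i j k l y.
  rewrite /riemann !sumrB; move: (pd _ _ _) (pd _ _ _) (\sum_s _) (\sum_s _) => a b c d; ring.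
by move: (riemann _ _ _ _ _ _) => a; ring.
Qed.

End Local.

Section Change.
Variables (n : nat) (U U' : set 'rV[R]_n) (F : 'rV[R]_n -> 'rV[R]_n).
Variables (g G : 'rV[R]_n -> 'M[R]_n).
Hypotheses (oU : open U) (oU' : open U') (FU : forall z, U z -> U' (F z)).
Hypotheses (sG : forall z, U' z -> spd (G z)) (sg : forall z, U z -> spd (g z)).
Hypothesis gE : forall z, U z -> g z = 'J F z *m G (F z) *m ('J F z)^T.
Hypothesis JF : forall z, U z -> 'J F z \in unitmx.
Hypotheses (CF : Ck 3 U F) (CG : Ck 2 U' G) (Cg : Ck 2 U g).

(** Obtained by differentiating the transformation law of the connection. The third derivatives of
    [F] and the mixed terms are symmetric in [u] and [v], hence cancel in the commutator. *)
Lemma riemann_change y u v w : U y ->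
  riemann_op g y u v w *m 'J F y = riemann_op G (F y) ('D_u F y) ('D_v F y) ('D_w F y).
Proof.
move=> Uy; have UFy := FU Uy.
have dF z : U z -> differentiable F z by move=> Uz; exact: (Ck1_differentiable_mx oU CF).
have chg a b z (Uz : U z) := christoffel_change oU oU' FU sG sg gE JF a b (CkW CF) (CkW CG) (CkW Cg) Uz.
have DJ (c a : 'rV[R]_n) : c *m 'D_a (jacobian F) y = 'D_a ('D_c F) y.
  have CJ := Ck_jacobian oU CF.
  have := is_derive_mulmx (is_derive_cst c y a) (DeriveDef (Ck_derivable a CJ Uy) erefl).
  rewrite mul0mx add0r => -[_ <-]; apply: near_eq_derive.
  by apply: near_open oU Uy _ => z Uz; rewrite /cst jacE //; exact: dF.
(* The transformation law with [b] and [w] fixed, differentiated along [a]. *)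
have X a b : 'D_a (fun z => christoffel_form g z b w) y *m 'J F y =
    'D_a ('D_b ('D_w F)) y + ('D_('D_a F y) (fun z => christoffel_form G z ('D_b F y) ('D_w F y)) (F y)
     + christoffel_form G (F y) ('D_a ('D_b F) y) ('D_w F y)
     + christoffel_form G (F y) ('D_b F y) ('D_a ('D_w F) y)) - 'D_a ('D_(christoffel_form g y b w) F) y.
  have CJ := Ck_jacobian oU CF.
  have d1 := DeriveDef (Ck_derivable a (Ck_christoffel_form oU sg b w Cg) Uy) erefl.
  have [_ E1] := is_derive_mulmx d1 (DeriveDef (Ck_derivable a CJ Uy) erefl).
  have dFa : is_derive y a F ('D_a F y) by apply: DeriveDef => //; exact: diff_derivable (dF y Uy).
  have dDF e : is_derive y a ('D_e F) ('D_a ('D_e F) y).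
    by apply: DeriveDef => //; exact: (Ck_derivable a (Ck_derive e CF) Uy).
  have dDDF : is_derive y a ('D_b ('D_w F)) ('D_a ('D_b ('D_w F)) y).
    by apply: DeriveDef => //; exact: (Ck_derivable a (Ck_derive b (Ck_derive w CF)) Uy).
  have [_ E2] := is_derive_addf dDDF (is_derive_christoffel oU' sG CG UFy dFa (dDF b) (dDF w)).
  move: E1; rewrite DJ (near_eq_derive a (near_open oU Uy (chg b w))) E2 => ->.
  by rewrite addrK.
rewrite (riemann_opE oU sg) // (riemann_opE oU' sG) // !(mulmxDl, mulNmx) !X !chg // /cov_accel.
rewrite -!(jacE _ (dF y Uy)) !chg // /cov_accel !jacE; try exact: dF.
have alg (a a' d p q c e p' r f s t Z Y : 'rV[R]_n) : a = a' -> p = p' -> Z = r + s -> Y = q + t ->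
    a + (d + p + q) - c - (a' + (e + p' + r) - f) + (c + Z) - (f + Y) = d - e + s - t.
  by move=> -> -> -> ->; apply/rowP => i; rewrite !mxE; ring.
apply: alg.
- exact: (derive_symm_mx u v oU Uy (Ck_derive w CF)).
- exact: (congr1 (fun z => christoffel_form G (F y) z ('D_w F y)) (derive_symm_mx u v oU Uy (CkW CF))).
- exact: christoffel_formDr.
- exact: christoffel_formDr.
Qed.

End Change.

End Curvature.

Local Transparent dot derive.

Lemma dot0m (R : realType) n (u v : 'rV[R]_n) : dot 0 u v = 0.
Proof. by rewrite -(scale0r (0 : 'M[R]_n)) dotZm mul0r. Qed.

Lemma is_derive_comp1 (R : realType) (V : normedModType R) (f : V -> R) (g : R -> R) x v (df dg : R) :
  is_derive x v f df -> is_derive (f x) (1 : R) g dg -> is_derive x v (g \o f) (df * dg).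
Proof.
move=> [d E] [d1 E1]; have dd : differentiable g (f x) by apply/derivable1_diffP.
have H := is_derive_comp d dd; apply: is_derive_eq H _.
rewrite E deriveE // -[X in 'd _ _ X](mulr1 df) -/(df *: (1 : R)) linearZ /= -deriveE //.
by rewrite E1.
Qed.

Lemma is_derive_invf (R : realType) (V : normedModType R) (f : V -> R) x v (df : R) :
  f x != 0 -> is_derive x v f df -> is_derive x v (fun y => (f y)^-1) (- f x ^- 2 * df).
Proof.
move=> f0 [d E]; apply: DeriveDef; first exact: derivableV.
by rewrite deriveV // E.
Qed.

(** * A Sturm comparison in one variable *)

Section Sturm.
Variable R : realType.

Lemma sqrtV_is_derive (F : R -> R) s f : 0 < F s -> is_derive s 1 F f ->
  is_derive s 1 (fun t => (Num.sqrt (F t))^-1) (- 2^-1 * f * (Num.sqrt (F s))^-1 ^+ 3).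
Proof.
move=> F0 HF; have q0 : Num.sqrt (F s) != 0 by rewrite gt_eqF // sqrtr_gt0.
have H1 : is_derive s 1 (Num.sqrt \o F) ((2 * Num.sqrt (F s))^-1 * f).
  by apply: is_derive1_comp; exact: is_derive1_sqrt.
have H := @is_deriveV R (Num.sqrt \o F) s _ 1 q0 H1; apply: is_derive_eq H _.
rewrite /GRing.scale /= invfM; field.
by rewrite q0.
Qed.

(** The differential inequality says that [phi = s / sqrt F] satisfies [phi'' <= (w''/w) phi]. The
    Wronskian [w phi' - w' phi] vanishes at 0 and is nonincreasing, so it is at most 0 at [T];
    multiplying by [F^(3/2)] gives the conclusion. *)
Lemma sturm_comparison (F F1 w w1 w2 : R -> R) (T : R) : 0 < T ->
  (forall s : R, is_derive s 1 F (F1 s)) -> (forall s : R, derivable F1 s 1) -> (forall s : R, 0 < F s) ->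
  (forall s : R, is_derive s 1 w (w1 s)) -> (forall s : R, is_derive s 1 w1 (w2 s)) ->
  w 0 = 0 -> (forall s : R, 0 < s -> 0 < w s) ->
  (forall s : R, 0 < s -> s < T ->
    3 / 2 * F1 s ^+ 2 / F s - 2 / s * F1 s - 2 * (w2 s / w s) * F s <= 'D_1 F1 s) ->
  w T * (F T - 2^-1 * T * F1 T) <= w1 T * T * F T.
Proof.
move=> T0 dF dF1 F0 dw dw1 w0 wpos ineq.
pose psi (s : R) := (Num.sqrt (F s))^-1.
have psi0 (s : R) : 0 < psi s by rewrite invr_gt0 sqrtr_gt0.
have psi2 (s : R) : psi s ^+ 2 * F s = 1 by rewrite exprVn sqr_sqrtr ?ltW // mulVf // gt_eqF.
have dpsi (s : R) : is_derive s 1 psi (- 2^-1 * F1 s * psi s ^+ 3) by exact: sqrtV_is_derive.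
pose k (s : R) := psi s + s * (- 2^-1 * F1 s * psi s ^+ 3).
have did (s : R) : is_derive s 1 (fun t : R => t) (1 : R) by exact: is_derive_id.
have dpsi3 (s : R) : is_derive s 1 (fun t => psi t ^+ 3) (3 * psi s ^+ 2 * (- 2^-1 * F1 s * psi s ^+ 3)).
  have H := is_derive_mulr (is_derive_mulr (dpsi s) (dpsi s)) (dpsi s).
  have -> : (fun t => psi t ^+ 3) = (fun t => psi t * psi t * psi t).
    by apply/funext => t; rewrite !exprS expr0 mulr1 mulrA.
  by apply: is_derive_eq H _; ring.
pose f2 (s : R) := 'D_1 F1 s.
have dF2 (s : R) : is_derive s 1 F1 (f2 s) by exact: DeriveDef.
have dk (s : R) : is_derive s 1 k (- F1 s * psi s ^+ 3 - 2^-1 * s * f2 s * psi s ^+ 3 + 3 / 4 * s * F1 s ^+ 2 * psi s ^+ 5).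
  have H := is_derive_addf (dpsi s) (is_derive_mulr (did s) (is_derive_mulr (is_derive_cmulr (- 2^-1) (dF2 s)) (dpsi3 s))).
  by apply: is_derive_eq H _; field.
(* The Wronskian; here [k] is the derivative of [s * psi s]. *)
pose W (s : R) := w s * k s - w1 s * (s * psi s).
have dW (s : R) : is_derive s 1 W (w s * (- F1 s * psi s ^+ 3 - 2^-1 * s * f2 s * psi s ^+ 3 + 3 / 4 * s * F1 s ^+ 2 * psi s ^+ 5)
   - w2 s * (s * psi s)).
  have H := is_derive_subf (is_derive_mulr (dw s) (dk s)) (is_derive_mulr (dw1 s) (is_derive_mulr (did s) (dpsi s))).
  by apply: is_derive_eq H _; rewrite /k; ring.
have W0 : W 0 = 0 by rewrite /W w0 !mul0r mulr0 subr0.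
have WT : W T <= W 0.
  apply: (@ler0_derive1_le_cc _ W 0 T) => //; rewrite ?in_itv /= ?lexx ?ltW //.
  - move=> s; rewrite in_itv /= => /andP[s0 sT]; rewrite derive1E; have [_ ->] := dW s.
    have ws := wpos s s0; have := ineq s s0 sT; rewrite -/(f2 s).
    have -> : F1 s ^+ 2 = F1 s ^+ 2 * (psi s ^+ 2 * F s) by rewrite psi2 mulr1.
    move: (F0 s) (psi0 s) (psi2 s); move: (F s) (F1 s) (f2 s) (psi s) (w s) (w2 s) ws => F_ F1_ f_ q_ w_ w2_ w_0 F_0 q_0 qF I.
    have w_n : w_ != 0 by rewrite gt_eqF.
    have F_n : F_ != 0 by rewrite gt_eqF.
    have s_n : s != 0 by rewrite gt_eqF.
    have -> : w_ * (- F1_ * q_ ^+ 3 - 2^-1 * s * f_ * q_ ^+ 3 + 3 / 4 * s * (F1_ ^+ 2 * (q_ ^+ 2 * F_)) * q_ ^+ 5) - w2_ * (s * q_)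
      = 2^-1 * w_ * s * q_ ^+ 3 * (3 / 2 * (F1_ ^+ 2 * (q_ ^+ 2 * F_)) * q_ ^+ 2 - 2 / s * F1_ - f_) - w2_ * (s * q_).
      by field.
    have -> : w2_ * (s * q_) = 2^-1 * w_ * s * q_ ^+ 3 * (2 * (w2_ / w_) * F_).
      have -> : 2^-1 * w_ * s * q_ ^+ 3 * (2 * (w2_ / w_) * F_) = w2_ * (s * (q_ * (q_ ^+ 2 * F_))) by field.
      by rewrite qF mulr1.
    rewrite -mulrBr; apply: mulr_ge0_le0.
      by rewrite !mulr_ge0 ?exprn_ge0 ?invr_ge0 // ltW.
    have E : 3 / 2 * (F1_ ^+ 2 * (q_ ^+ 2 * F_)) / F_ = 3 / 2 * (F1_ ^+ 2 * (q_ ^+ 2 * F_)) * q_ ^+ 2.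
      apply: (@mulIf _ F_) => //; by rewrite mulfVK // qF mulr1 -[RHS]mulrA qF mulr1.
    by move: I; rewrite E; lra.
  - by apply: derivable_within_continuous => s _; have [] := dW s.
move: WT; rewrite W0 /W subr_le0 /k.
move: (F0 T) (psi0 T) (psi2 T); move: (F T) (F1 T) (psi T) (w T) (w1 T) => F_ F1_ q_ w_ w1_ F_0 q_0 qF I.
have q3 : 0 < q_ ^+ 3 by rewrite exprn_gt0.
rewrite -(ler_pM2r q3).
have -> : w_ * (F_ - 2^-1 * T * F1_) * q_ ^+ 3 = w_ * (q_ * (q_ ^+ 2 * F_) + T * (- 2^-1 * F1_ * q_ ^+ 3)) by ring.
have -> : w1_ * T * F_ * q_ ^+ 3 = w1_ * (T * (q_ * (q_ ^+ 2 * F_))) by ring.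
by rewrite qF !mulr1.
Qed.

End Sturm.

(** * Metrics for which the lines through 0 are geodesics *)

Section NormalCoordinates.
Variables (R : realType) (n : nat) (G : 'rV[R]_n -> 'M[R]_n).
Hypotheses (CG : Ck 2 setT G) (sG : forall z, spd (G z)).
Hypothesis geo : forall z, christoffel_form G z z z = 0.

Let oT : open [set: 'rV[R]_n] := openT.

Let dG z : differentiable G z.
Proof. exact: (Ck1_differentiable_mx oT CG). Qed.

Let drG z v : derivable G z v.
Proof. exact: (Ck_derivable v CG). Qed.

Arguments drG : clear implicits.
Arguments dG : clear implicits.

Lemma dot_line_is_derive (e a b : 'rV[R]_n) (t : R) :
  is_derive t 1 (fun s : R => dot (G (s *: e)) a b) (dot ('D_e G (t *: e)) a b).
Proof.
have [d E] := dot_deriveE a b (drG (t *: e) e).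
split.
  have := (derivable_lineP (fun z => dot (G z) a b) 0 e t).1; rewrite addr0 => /(_ d).
  by under eq_fun do rewrite addr0.
rewrite -E -[t *: e in RHS]addr0 -derive_lineE; congr ('D_1 _ t); apply/funext => s.
by rewrite addr0.
Qed.

Lemma christoffel_ray (e : 'rV[R]_n) (t : R) : t != 0 -> christoffel_form G (t *: e) e e = 0.
Proof.
move=> t0; have := geo (t *: e); rewrite christoffel_formZl christoffel_formZr scalerA => /eqP.
by rewrite scaler_eq0 mulf_eq0 (negbTE t0) /= => /eqP.
Qed.

(** Geodesics have constant speed: by metric compatibility the derivative of the squared speed along
    the ray is twice [<Gamma(z, z), z>], which is 0. *)
Lemma radial_norm z : dot (G z) z z = dot (G 0) z z.
Proof.
pose f (s : R) := dot (G (s *: z)) z z.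
have df (s : R) : is_derive s 1 f (dot ('D_z G (s *: z)) z z) by exact: dot_line_is_derive.
have [s] : exists2 s : R, s \in `]0, 1[%R & f 1 - f 0 = dot ('D_z G (s *: z)) z z * (1 - 0).
  apply: (@MVT _ f (fun s => dot ('D_z G (s *: z)) z z)) => //.
  by apply: derivable_within_continuous => s _; have [] := df s.
rewrite in_itv /= => /andP[s0 _]; rewrite /f scale1r scale0r.
rewrite (dot_christoffel_compat oT (fun z _ => sG z) _ _ _ (CkW CG) I) christoffel_ray ?gt_eqF //.
by rewrite dot0l dot0r addr0 mul0r => /eqP; rewrite subr_eq0 => /eqP.
Qed.

Lemma radial_norm_derive z u :
  dot ('D_u G z) z z + 2 * dot (G z) z u = 2 * dot (G 0) z u.
Proof.
have sGz := proj1 (sG z); have sG0 := proj1 (sG 0).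
have did : is_derive z u (fun x : 'rV[R]_n => x) u by exact: is_derive_id.
have [_ E1] := is_derive_dot (DeriveDef (drG z u) erefl) did did.
have [_ E2] := is_derive_dot (is_derive_cst (G 0) z u) did did.
have E : (fun y : 'rV[R]_n => dot (G y) y y) = (fun y => dot (cst (G 0) y) y y).
  by apply/funext => y; rewrite radial_norm.
have alg (D A B : 'M[R]_n) x : A^T = A -> B^T = B -> x = dot D z z + dot A u z + dot A z u ->
    x = dot 0 z z + dot B u z + dot B z u -> dot D z z + 2 * dot A z u = 2 * dot B z u.
  by move=> sA sB; rewrite dot0m (dotC u z sA) (dotC u z sB) => -> H; lra.
by move: E1; rewrite E => E1; exact: (alg _ _ _ _ sGz sG0 E1 E2).
Qed.

(** * The Gauss lemma *)
Lemma gauss z u : dot (G z) z u = dot (G 0) z u.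
Proof.
(* The derivative of [f] turns out to be the constant [dot (G 0) z u]: for [s > 0] the vanishing of
   [Gamma(z, z)], lowered by Koszul, relates ['D_z G] to ['D_u G], and [radial_norm_derive]
   evaluates the latter. *)
pose f (s : R) := s * dot (G (s *: z)) z u.
have df (s : R) : is_derive s 1 f (dot (G (s *: z)) z u + s * dot ('D_z G (s *: z)) z u).
  have H := is_derive_mulr (is_derive_id s (1 : R)) (dot_line_is_derive z z u s).
  by apply: is_derive_eq H _; rewrite mul1r.
have [s] : exists2 s : R, s \in `]0, 1[%R & f 1 - f 0 = (dot (G (s *: z)) z u + s * dot ('D_z G (s *: z)) z u) * (1 - 0).
  apply: (@MVT _ f (fun s => dot (G (s *: z)) z u + s * dot ('D_z G (s *: z)) z u)) => //.
  by apply: derivable_within_continuous => s _; have [] := df s.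
rewrite in_itv /= => /andP[s0 _]; rewrite /f scale1r mul1r mul0r !subr0 mulr1 => ->.
have sn : s != 0 by rewrite gt_eqF.
have := christoffel_lowE z z u (spd_unit (sG (s *: z))) (proj1 (sG (s *: z))) (dG (s *: z)).
rewrite christoffel_ray // dot0l /low.
have alg (D1 D2 A B : 'M[R]_n) : dot D2 (s *: z) (s *: z) + 2 * dot A (s *: z) u = 2 * dot B (s *: z) u ->
    0 = 2^-1 * (dot D1 z u + dot D1 z u - dot D2 z z) -> dot A z u + s * dot D1 z u = dot B z u.
  rewrite !(dotZl, dotZr); move: (dot D1 z u) (dot D2 z z) (dot A z u) (dot B z u) => a b c d H1 H2.
  have {}H2 : b = 2 * a by lra.
  apply: (@mulfI _ (2 * s)); first by rewrite mulf_neq0.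
  by move: H1; rewrite H2; lra.
exact: alg (radial_norm_derive (s *: z) u).
Qed.

Lemma gauss_derive z a b : dot ('D_a G z) z b + dot (G z) a b = dot (G 0) a b.
Proof.
have did : is_derive z a (fun x : 'rV[R]_n => x) a by exact: is_derive_id.
have dcst : is_derive z a (fun x : 'rV[R]_n => (b : 'rV[R]_n)) (0 : 'rV[R]_n) by exact: is_derive_cst.
have [_ E1] := is_derive_dot (DeriveDef (drG z a) erefl) did dcst.
have [_ E2] := is_derive_dot (is_derive_cst (G 0) z a) did dcst.
have E : (fun y : 'rV[R]_n => dot (G y) y b) = (fun y => dot (cst (G 0) y) y b).
  by apply/funext => y; rewrite gauss.
by move: E1; rewrite E E2 dot0m !dot0r !addr0 add0r.
Qed.

(* Along a ray the connection in the radial direction is half the derivative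
   of the metric, because the curl of the radial covector field vanishes. *)
Lemma dot_christoffel_radial (e a b : 'rV[R]_n) (s : R) : s != 0 ->
  dot (G (s *: e)) (christoffel_form G (s *: e) e a) b = 2^-1 * dot ('D_e G (s *: e)) a b.
Proof.
move=> s0; have sGz := proj1 (sG (s *: e)).
rewrite (christoffel_lowE _ _ _ (spd_unit (sG (s *: e))) sGz (dG (s *: e))) /low.
have alg (D1 D2 D3 A B : 'M[R]_n) : A^T = A -> B^T = B ->
    dot D1 (s *: e) b + dot A a b = dot B a b -> dot D2 (s *: e) a + dot A b a = dot B b a ->
    2^-1 * (dot D3 a b + dot D1 e b - dot D2 e a) = 2^-1 * dot D3 a b.
  move=> sA sB; rewrite !dotZl (dotC b a sA) (dotC b a sB) => H1 H2.
  have -> : dot D1 e b = dot D2 e a by apply: (mulfI s0); lra.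
  by rewrite addrK.
exact: (alg _ _ _ _ _ sGz (proj1 (sG 0)) (gauss_derive (s *: e) a b) (gauss_derive (s *: e) b a)).
Qed.

Lemma is_derive_scalel (e : 'rV[R]_n) (s : R) : is_derive s 1 (fun t : R => t *: e) e.
Proof.
split; first by apply: diff_derivable; exact: differentiableZl.
by have := derive_lineE (fun z : 'rV[R]_n => z) 0 e s; under eq_fun do rewrite addr0; rewrite derive_id.
Qed.

Lemma is_derive_ray (W : normedModType R) (f : 'rV[R]_n -> W) (e : 'rV[R]_n) (s : R) :
  differentiable f (s *: e) -> is_derive s 1 (fun t : R => f (t *: e)) ('D_e f (s *: e)).
Proof.
move=> df; have [dd E] := is_derive_scalel e s; have := is_derive_comp dd df; by rewrite E.
Qed.

(** Differentiating [Gamma_z(z, z) = 0] at [z = s e] along [p] gives [s^2 D_p Gamma(e, e) + 2 s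
    Gamma(e, p) = 0]. *)
Lemma christoffel_ray_derive (e p : 'rV[R]_n) (s : R) : s != 0 ->
  'D_p (fun z => christoffel_form G z e e) (s *: e) = - (2 / s) *: christoffel_form G (s *: e) e p.
Proof.
move=> s0; have sGT z : [set: 'rV[R]_n] z -> spd (G z) by move=> _; exact: sG.
have did : is_derive (s *: e) p (fun x : 'rV[R]_n => x) p by exact: is_derive_id.
have [_ E] := is_derive_christoffel oT sGT CG I did did did.
have E0 : (fun z => christoffel_form G z z z) = cst (0 : 'rV[R]_n) by apply/funext => z; rewrite geo.
have E1 : (fun z => christoffel_form G z (s *: e) (s *: e)) = (s * s) *: (fun z => christoffel_form G z e e).
  by apply/funext => z; rewrite christoffel_formZl christoffel_formZr scalerA.
have d1 : derivable (fun z => christoffel_form G z e e) (s *: e) p.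
  exact: (Ck_derivable p (Ck_christoffel_form oT sGT e e CG)).
move: E; rewrite E0 derive_cst E1 (deriveZ (s * s) d1).
rewrite (christoffel_formC oT sGT p _ (CkW CG) I) christoffel_formZl.
have alg (D C : 'rV[R]_n) : 0 = (s * s) *: D + s *: C + s *: C -> D = - (2 / s) *: C.
  move=> /esym H; apply/(scalerI (mulf_neq0 s0 s0)); apply/eqP; rewrite -subr_eq0; apply/eqP.
  rewrite -[RHS]H -addrA; congr (_ + _); rewrite scalerA -scalerDl -scaleNr; congr (_ *: _).
  by field.
exact: alg.
Qed.

(** A Riccati equation: the radial curvature is expressed by the operator [Gamma(e, .)] and its
    radial derivative, the term in [2 / s] accounting for the rescaling of Jacobi fields by [s]. *)
Lemma riemann_radial (e p : 'rV[R]_n) (s : R) : s != 0 ->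
  riemann_op G (s *: e) p e e = - (2 / s) *: christoffel_form G (s *: e) e p
    - 'D_e (fun z => christoffel_form G z e p) (s *: e)
    - christoffel_form G (s *: e) e (christoffel_form G (s *: e) e p).
Proof.
move=> s0; have sGT z : [set: 'rV[R]_n] z -> spd (G z) by move=> _; exact: sG.
rewrite (riemann_opE oT sGT) // christoffel_ray_derive // christoffel_ray //.
have -> : (fun z => christoffel_form G z p e) = (fun z => christoffel_form G z e p).
  by apply/funext => z; exact: (christoffel_formC oT sGT p e (CkW CG) I).
have -> : christoffel_form G (s *: e) p 0 = 0 by rewrite -[X in christoffel_form _ _ _ X](scale0r 0) christoffel_formZr scale0r.
by rewrite (christoffel_formC oT sGT p e (CkW CG) I) addr0.
Qed.

Lemma riemann_opZl c y u v z : riemann_op G y (c *: u) v z = c *: riemann_op G y u v z.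
Proof.
apply/rowP => l; rewrite !mxE mulr_sumr; apply: eq_bigr => i _; rewrite mulr_sumr.
apply: eq_bigr => j _; rewrite mulr_sumr; apply: eq_bigr => k _; rewrite mxE.
by rewrite (mulrCA _ c) -!mulrA.
Qed.

(** The Euclidean norm of the metric at the origin, which becomes the distance to the pole. *)
Definition rho0 (y : 'rV[R]_n) : R := Num.sqrt (dot (G 0) y y).

Variables w w1 w2 : R -> R.
Hypotheses (dw : forall s : R, is_derive s 1 w (w1 s)) (dw1 : forall s : R, is_derive s 1 w1 (w2 s)).
Hypotheses (w0 : w 0 = 0) (wpos : forall s, 0 < s -> 0 < w s).
Hypothesis curv : forall y u, y != 0 -> row_free (col_mx y u) ->
  - (w2 (rho0 y) / w (rho0 y)) <= sectional G y y u.

Lemma row_free_orthogonal (e p : 'rV[R]_n) (H : 'M[R]_n) : spd H -> e != 0 -> p != 0 ->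
  dot H e p = 0 -> row_free (col_mx e p).
Proof.
move=> sH e0 p0 ep; have [sHT pH] := sH.
rewrite -kermx_eq0; apply/rowV0P => c /sub_kermxP.
rewrite -[c]hsubmxK mul_row_col => E.
have cE (b : 'M[R]_1) (v : 'rV[R]_n) : b *m v = b 0 0 *: v by rewrite {1}[b]mx11_scalar mul_scalar_mx.
move: E; rewrite !cE => E.
have : dot H (lsubmx c 0 0 *: e + rsubmx c 0 0 *: p) e = 0 by rewrite E dot0l.
have : dot H (lsubmx c 0 0 *: e + rsubmx c 0 0 *: p) p = 0 by rewrite E dot0l.
rewrite !(dotDl, dotZl) (dotC p e sHT) ep !mulr0 add0r addr0 => /eqP H1 /eqP H2.
move: H1 H2; rewrite !mulf_eq0 !(gt_eqF (pH _ _)) // !orbF => /eqP H1 /eqP H2.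
rewrite [lsubmx c]mx11_scalar [rsubmx c]mx11_scalar H1 H2.
by rewrite -[LHS]/(row_mx _ _) (_ : 0%:M = 0) ?row_mx0 // raddf0.
Qed.

(** For [e] of unit length and [p] orthogonal to it, the Gauss lemma reduces the denominator of the
    sectional curvature at [s e] to [s^2 |p|^2]. *)
Lemma radial_curvature (e p : 'rV[R]_n) (s : R) : 0 < s -> dot (G 0) e e = 1 ->
  dot (G 0) e p = 0 ->
  - (w2 s / w s) * dot (G (s *: e)) p p <= dot (G (s *: e)) (riemann_op G (s *: e) p e e) p.
Proof.
move=> s0 e1 ep; have sGT z : [set: 'rV[R]_n] z -> spd (G z) by move=> _; exact: sG.
have [->|p0] := eqVneq p 0; first by rewrite !dot0r mulr0.
have sn : s != 0 by rewrite gt_eqF.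
have en : e != 0 by apply/eqP => e0; move: e1; rewrite e0 dot0l => /eqP; rewrite eq_sym oner_eq0.
have sen : s *: e != 0 by rewrite scaler_eq0 (negbTE sn).
have rs : rho0 (s *: e) = s by rewrite /rho0 dotZl dotZr e1 mulr1 -expr2 sqrtr_sqr gtr0_norm.
have Gep : dot (G (s *: e)) e p = 0.
  by apply: (mulfI sn); rewrite -dotZl gauss dotZl ep !mulr0.
have Gee : dot (G (s *: e)) e e = 1.
  by apply: (mulfI sn); rewrite -dotZl gauss dotZl e1.
have Gpp : 0 < dot (G (s *: e)) p p by have [_] := sG (s *: e); apply.
have Gsep : dot (G (s *: e)) (s *: e) p = 0 by rewrite dotZl Gep mulr0.
have := curv sen (row_free_orthogonal (sG (s *: e)) sen p0 Gsep).
rewrite rs /sectional Gsep expr0n /= subr0 riemann_opZl dotZl dotZr dotZl dotZr Gee.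
have -> : dot (G (s *: e)) (riemann_op G (s *: e) e p p) e = dot (G (s *: e)) (riemann_op G (s *: e) p e e) p.
  have := dot_riemann_anti oT sGT e p p e CG I => ->.
  rewrite (riemann_op_anti G (s *: e) p e e) dotNr opprK; apply: dotC; exact: (proj1 (sG _)).
rewrite ler_pdivlMr; last by rewrite !mulr1 !mulr_gt0.
have s2 : 0 < s * s by rewrite mulr_gt0.
move: (dot _ _ _) (dot _ _ _) => a b H; rewrite -(ler_pM2l s2) -(mulrA s s a); apply: le_trans H.
by rewrite le_eqVlt; apply/orP; left; apply/eqP; ring.
Qed.

(* With [p] the vector dual to a covector that is constant in the coordinates,
   [F = |p|^2] satisfies [F'' >= 3/2 F'^2/F - 2/s F' - 2 (w''/w) F], that is
   [phi = s / sqrt F] satisfies [phi'' <= (w''/w) phi]. *)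
Lemma normal_metric_comparison (e u : 'rV[R]_n) (T : R) : 0 < T -> dot (G 0) e e = 1 ->
  dot (G 0) e u = 0 ->
  w T * (dot (G (T *: e)) u u + 2^-1 * T * dot ('D_e G (T *: e)) u u) <= w1 T * T * dot (G (T *: e)) u u.
Proof.
move=> T0 e1 eu; have sGT z : [set: 'rV[R]_n] z -> spd (G z) by move=> _; exact: sG.
have [->|u0] := eqVneq u 0; first by rewrite !dot0r !(mulr0, addr0).
pose xi := u *m G (T *: e).
pose p (s : R) := xi *m invmx (G (s *: e)).
have uG z : G z \in unitmx by exact/spd_unit/sG.
have pG (s : R) : p s *m G (s *: e) = xi by rewrite /p mulmxKV.
have pT : p T = u by rewrite /p /xi mulmxK.
have xi0 : xi != 0.
  by apply/eqP => /(congr1 (mulmx^~ (invmx (G (T *: e))))); rewrite /xi mulmxK // mul0mx => /eqP; rewrite (negbTE u0).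
have p0 (s : R) : p s != 0.
  by apply/eqP => ps; move: (pG s); rewrite ps mul0mx => /esym /eqP; rewrite (negbTE xi0).
have dotp (s : R) a : dot (G (s *: e)) a (p s) = (a *m xi^T) 0 0.
  by rewrite /dot -mulmxA -{1}(proj1 (sG (s *: e))) -trmx_mul pG.
have ep (s : R) : s != 0 -> dot (G 0) e (p s) = 0.
  move=> s0; apply: (mulfI s0); rewrite mulr0 -dotZl -gauss dotp.
  have : dot (G 0) (T *: e) u = 0 by rewrite dotZl eu mulr0.
  rewrite -gauss /dot -mulmxA -{1}(proj1 (sG (T *: e))) -trmx_mul -/xi -!scalemxAl !mxE => /eqP.
  by rewrite mulf_eq0 (gt_eqF T0) /= => /eqP ->; rewrite mulr0.
pose F s := dot (G (s *: e)) (p s) (p s).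
have FE (s : R) : F s = (p s *m xi^T) 0 0 by exact: dotp.
have Fpos (s : R) : 0 < F s by have [_] := sG (s *: e); apply.
pose D (s : R) := 'D_e G (s *: e).
have dp (s : R) : is_derive s 1 p (- (p s *m D s *m invmx (G (s *: e)))).
  have CI := Ck_invmx oT (fun z _ => uG z) CG.
  have [_ Ei] := is_derive_invmx (U := setT) oT I (fun z _ => uG z) CG (DeriveDef (drG (s *: e) e) erefl).
  have H := is_derive_ray (Ck1_differentiable_mx oT CI I : differentiable _ (s *: e)).
  have H2 := is_derive_mulmx (is_derive_cst xi s (1 : R)) H.
  apply: is_derive_eq H2 _; rewrite Ei mul0mx add0r /cst mulmxN; congr (- _).
  by rewrite /p !mulmxA.
pose F1 s := - dot (D s) (p s) (p s).
have entD (A B : 'M[R]_1) : (A + B) 0 0 = A 0 0 + B 0 0 by rewrite mxE.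
have dF (s : R) : is_derive s 1 F (F1 s).
  have H := is_derive_coord 0 0 (is_derive_mulmx (dp s) (is_derive_cst xi^T s (1 : R))).
  have -> : F = fun t => (p t *m cst xi^T t) 0 0 by apply/funext => t; exact: FE.
  apply: is_derive_eq H _; rewrite mulmx0 addr0 /cst mulNmx mxE; congr (- _); rewrite /dot.
  have -> : (p s)^T = invmx (G (s *: e)) *m xi^T by rewrite /p trmx_mul trmx_inv (proj1 (sG (s *: e))).
  by rewrite !mulmxA.
have dD (s : R) : derivable (fun t : R => D t) s 1.
  have dDG : differentiable ('D_e G) (s *: e) by exact: (Ck1_differentiable_mx oT (Ck_derive e CG)).
  by have [] := is_derive_ray dDG.
have dF1 (s : R) : derivable F1 s 1.
  by have [] := is_deriveN (is_derive_dot (DeriveDef (dD s) erefl) (dp s) (dp s)).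
have D_C (s : R) a b : s != 0 -> dot (D s) a b = 2 * dot (G (s *: e)) (christoffel_form G (s *: e) e a) b.
  by move=> s0; rewrite dot_christoffel_radial // mulrA mulfV // mul1r.
pose C (s : R) a := christoffel_form G (s *: e) e a.
(* The radial derivative of the metric is twice [Gamma(e, .)], hence [p' = - 2 Gamma(e, p)]. *)
have dp' (s : R) : s != 0 -> - (p s *m D s *m invmx (G (s *: e))) = (-2) *: C s (p s).
  move=> s0; rewrite scaleNr; congr (- _); apply: (dot_inj (uG (s *: e))) => b.
  rewrite dotZl -D_C // /dot mulmxKV //.
have symC (s : R) a b : s != 0 -> dot (G (s *: e)) (C s a) b = dot (G (s *: e)) a (C s b).
  move=> s0; rewrite [RHS]dotC ?(proj1 (sG _)) //; apply: (@mulfI _ 2) => //.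
  rewrite -!D_C //; apply: dotC.
  exact: derive_sym oT I (fun z _ => proj1 (sG z)) (drG (s *: e) e).
have F1E (s : R) : s != 0 -> F1 s = (-2) * dot (G (s *: e)) (C s (p s)) (p s).
  by move=> s0; rewrite /F1 D_C // mulNr.
have D1F1 (s : R) : 0 < s -> 'D_1 F1 s =
    (-2) * dot (G (s *: e)) ('D_e (fun z => christoffel_form G z e (p s)) (s *: e)) (p s)
    + 4 * dot (G (s *: e)) (C s (p s)) (C s (p s)).
  move=> s0; have sn : s != 0 by rewrite gt_eqF.
  have near_s : \forall t \near s, F1 t = (-2) * (C t (p t) *m cst xi^T t) 0 0.
    apply: near_open (@open_gt R 0) s0 _ => t /= t0.
    by rewrite F1E ?gt_eqF // dotp.
  rewrite (near_eq_derive (1 : R) near_s).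
  have dl := is_derive_scalel e s.
  have dps := dp s; rewrite dp' // in dps.
  have H := is_derive_cmulr (-2) (is_derive_coord 0 0 (is_derive_mulmx
    (is_derive_christoffel oT sGT CG I dl (is_derive_cst e s (1 : R)) dps) (is_derive_cst xi^T s (1 : R)))).
  have [_ ->] := H; rewrite mulmx0 addr0 /cst -(dotp s).
  have -> : christoffel_form G (s *: e) 0 (p s) = 0.
    by rewrite -[X in christoffel_form _ _ X _](scale0r 0) christoffel_formZl scale0r.
  rewrite addr0 dotDl christoffel_formZr dotZl -/(C s (p s)) -/(C s (C s (p s))) (symC s _ _ sn).
  move: (dot _ _ _) (dot _ _ _) => a b; ring.
have ineq (s : R) : 0 < s -> s < T ->
    3 / 2 * F1 s ^+ 2 / F s - 2 / s * F1 s - 2 * (w2 s / w s) * F s <= 'D_1 F1 s.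
  move=> s0 _; have sn : s != 0 by rewrite gt_eqF.
  have := radial_curvature s0 e1 (ep s sn).
  rewrite riemann_radial // !dotBl dotZl D1F1 // F1E // -/(C s (p s)) -/(C s (C s (p s))) (symC s (C s (p s)) (p s) sn).
  (* The second derivative of [F] contains [6 |Gamma(e, p)|^2], of which 4 come from differentiating
     [p] and 2 from the Riccati equation. Cauchy-Schwarz bounds it below by
     [6 <Gamma(e, p), p>^2 / F], that is by [3/2 F'^2 / F]. *)
  have := dot_CS (C s (p s)) (p s) (sG (s *: e)).
  have := Fpos s; rewrite /F.
  move: (dot _ (p s) (p s)) (dot _ (C s (p s)) (C s (p s))) (dot _ (C s (p s)) (p s)) (dot _ ('D_ _ _ _) _).
  move: (w2 s / w s) => k f cc c d f0 CS H.
  have CS' : c ^+ 2 / f <= cc by rewrite ler_pdivrMr.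
  have -> : 3 / 2 * (-2 * c) ^+ 2 / f = 6 * (c ^+ 2 / f).
    by field; rewrite gt_eqF.
  have E : - (2 / s) * c = - (2 / s * c) by ring.
  have E2 : 2 / s * (-2 * c) = - 2 * (2 / s * c) by ring.
  move: H CS'; rewrite E E2; move: (2 / s * c) (c ^+ 2 / f) => x y.
  have -> : - k * f = - (k * f) by ring.
  have -> : 2 * k * f = 2 * (k * f) by ring.
  move: (k * f) => z; lra.
have := sturm_comparison T0 dF dF1 Fpos dw dw1 w0 wpos ineq.
rewrite /F /F1 pT -/(D T); move: (dot _ _ _) (dot _ _ _) => a b.
by rewrite mulrN opprK.
Qed.

Lemma rho0_gt0 y : y != 0 -> 0 < rho0 y.
Proof. by move=> y0; rewrite sqrtr_gt0; have [_] := sG 0; apply. Qed.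

Lemma rho0_sqr y : rho0 y ^+ 2 = dot (G 0) y y.
Proof. by rewrite sqr_sqrtr // dot_ge0. Qed.

Lemma rho0_is_derive (y v : 'rV[R]_n) : y != 0 -> is_derive y v rho0 (dot (G 0) y v / rho0 y).
Proof.
move=> y0; have r0 := rho0_gt0 y0.
have did : is_derive y v (fun x : 'rV[R]_n => x) v by exact: is_derive_id.
have H := is_derive_dot (is_derive_cst (G 0) y v) did did.
have ds : is_derive (dot (G 0) y y) (1 : R) Num.sqrt (2 * rho0 y)^-1.
  by apply: is_derive1_sqrt; rewrite -rho0_sqr exprn_gt0.
have H2 := is_derive_comp1 H ds; apply: is_derive_eq H2 _.
rewrite dot0m add0r /cst (dotC v y (proj1 (sG 0))).
by move: (dot _ _ _) => a; field; rewrite gt_eqF.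
Qed.

(** The derivative of [rho0] along the Christoffel vector is an inner product with [y]; the Gauss
    lemma lets it be taken at [y] instead of 0, where the Koszul formula evaluates it. *)
Lemma hess_rho0 (y u : 'rV[R]_n) : y != 0 ->
  hess G rho0 y u u = (dot (G y) u u + 2^-1 * dot ('D_y G y) u u) / rho0 y - dot (G 0) y u ^+ 2 / rho0 y ^+ 3.
Proof.
move=> y0; have r0 := rho0_gt0 y0; have sGy := proj1 (sG y).
have oU : open [set z : 'rV[R]_n | z != 0].
  rewrite (_ : [set z | z != 0] = ~` [set 0]); last by apply/seteqP; split=> z /= /eqP.
  apply: closed_openC; apply: accessible_closed_set1.
  exact: (hausdorff_accessible (@norm_hausdorff R 'rV[R]_n)).
have E1 : 'D_u ('D_u rho0) y = dot (G 0) u u / rho0 y - dot (G 0) y u ^+ 2 / rho0 y ^+ 3.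
  have E z : z != 0 -> 'D_u rho0 z = dot (G 0) z u * (rho0 z)^-1 by move=> z0; have [_ ->] := rho0_is_derive u z0.
  rewrite (near_eq_derive u (near_open oU y0 E)).
  have did : is_derive y u (fun x : 'rV[R]_n => x) u by exact: is_derive_id.
  have dcst : is_derive y u (fun x : 'rV[R]_n => (u : 'rV[R]_n)) (0 : 'rV[R]_n) by exact: is_derive_cst.
  have H1 := is_derive_dot (is_derive_cst (G 0) y u) did dcst.
  have rn : rho0 y != 0 by rewrite gt_eqF.
  have H2 := is_derive_mulr H1 (is_derive_invf rn (rho0_is_derive u y0)).
  have [_ E2] := H2; rewrite [LHS]E2 dot0m dot0r add0r addr0 /cst /=.
  by move: (dot _ _ _) (dot _ _ _) => a b; field.
rewrite /hess E1; have [_ ->] := rho0_is_derive (christoffel_form G y u u) y0.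
rewrite -(gauss y (christoffel_form _ _ _ _)) (dotC y _ sGy) (christoffel_lowE _ _ _ (spd_unit (sG y)) sGy (dG y)) /low.
have := gauss_derive y u u; have sD := derive_sym oT I (fun z _ => proj1 (sG z)) (drG y u).
have alg (D1 D2 A B : 'M[R]_n) (r : R) : r != 0 -> D1^T = D1 -> dot D1 y u + dot A u u = dot B u u ->
    dot B u u / r - dot B y u ^+ 2 / r ^+ 3 - 2^-1 * (dot D1 u y + dot D1 u y - dot D2 u u) / r =
    (dot A u u + 2^-1 * dot D2 u u) / r - dot B y u ^+ 2 / r ^+ 3.
  move=> rn sD1; rewrite (dotC u y sD1) => <-.
  by move: (dot _ _ _) (dot _ _ _) (dot _ _ _) (dot _ _ _) => a b c d; field.
by apply: alg => //; rewrite gt_eqF.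
Qed.

(** * Hessian comparison in normal coordinates *)
Lemma hess_rho0_le (y u : 'rV[R]_n) : y != 0 ->
  hess G rho0 y u u <= w1 (rho0 y) / w (rho0 y) * (dot (G y) u u - ('D_u rho0 y) ^+ 2).
Proof.
move=> y0; have r0 := rho0_gt0 y0; have sGy := proj1 (sG y); have sG0 := proj1 (sG 0).
have rn : rho0 y != 0 by rewrite gt_eqF.
rewrite hess_rho0 //; have [_ ->] := rho0_is_derive u y0.
have := rho0_sqr y; set r := rho0 y in r0 rn *; move=> r2.
(* Split [u] into a multiple of [y] and a part [p] orthogonal to it. The radial part drops out of
   the Hessian and of [|u|^2 - (D_u rho0)^2], so the comparison is needed for [p] only. *)
pose e := r^-1 *: y; pose c := dot (G 0) y u / r ^+ 2; pose p := u - c *: y.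
have re : r *: e = y by rewrite /e scalerA mulfV // scale1r.
have e1 : dot (G 0) e e = 1 by rewrite dotZl dotZr -r2; field.
have yp : dot (G 0) y p = 0 by rewrite dotBr dotZr -r2 /c; field.
have ep : dot (G 0) e p = 0 by rewrite dotZl yp mulr0.
have := normal_metric_comparison r0 e1 ep; rewrite re.
have DeE : 'D_e G y = r^-1 *: 'D_y G y by have [_ ->] := deriveZv r^-1 (drG y y).
have Dy v : dot ('D_y G y) y v = 0.
  by have := gauss_derive y y v; rewrite gauss -[RHS]add0r => /addIr.
have sD := derive_sym oT I (fun z _ => proj1 (sG z)) (drG y y).
have uE : u = p + c *: y by rewrite /p subrK.
move: p yp ep uE => p yp ep uE.
have Gu : dot (G y) u u = dot (G y) p p + (c * r) ^+ 2.
  rewrite uE !(dotDl, dotDr, dotZl, dotZr) (dotC p y sGy) !gauss yp -r2; ring.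
have Du : dot ('D_y G y) u u = dot ('D_y G y) p p.
  by rewrite {1 2}uE !(dotDl, dotDr, dotZl, dotZr) (dotC p y sD) !Dy !(mulr0, addr0).
rewrite Gu Du DeE dotZm.
have cE : dot (G 0) y u = c * r ^+ 2 by rewrite /c divfK // expf_neq0.
rewrite cE; have w_0 := wpos r0.
move: (w r) (w1 r) (dot _ p p) (dot _ p p) w_0 => w_ w1_ b a w_0 H.
have wn : w_ != 0 by rewrite gt_eqF.
have -> : (a + (c * r) ^+ 2 + 2^-1 * b) / r - (c * r ^+ 2) ^+ 2 / r ^+ 3 = (a + 2^-1 * b) / r by field.
have -> : w1_ / w_ * (a + (c * r) ^+ 2 - (c * r ^+ 2 / r) ^+ 2) = w1_ * r * a / w_ / r by field; rewrite wn rn.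
rewrite ler_pM2r ?invr_gt0 // ler_pdivlMr // mulrC.
by move: H; rewrite (_ : 2^-1 * r * (r^-1 * b) = 2^-1 * b) //; field.
Qed.

End NormalCoordinates.

(** * Uniqueness for the geodesic equation *)

Section OdeTools.
Variable R : realType.

(** To the right of [t0] the function [phi t * expR (- C t)] is nonincreasing, to the left
    [phi t * expR (C t)] is nondecreasing; both vanish at [t0] and are nonnegative. *)
Lemma gronwall0 (phi dphi : R -> R) (t0 r C : R) :
  (forall t, ball t0 r t -> is_derive t (1 : R) phi (dphi t)) ->
  (forall t, ball t0 r t -> 0 <= phi t) ->
  (forall t, ball t0 r t -> `|dphi t| <= C * phi t) -> phi t0 = 0 ->
  forall t, ball t0 r t -> phi t = 0.
Proof.
move=> dp p0 bd pt0 t bt.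
have bE s : ball t0 r s = (t0 - r < s < t0 + r) :> Prop.
  by rewrite -ball_normE /= ltr_distlC.
have key (k : R) (s : R) : ball t0 r s ->
    is_derive s (1 : R) (fun s => phi s * expR (k * s)) ((dphi s + k * phi s) * expR (k * s)).
  move=> bs; have H := is_derive_mulr (dp s bs) (is_derive_comp1
     (is_derive_cmulr k (is_derive_id s (1 : R))) (is_derive_expR (k * s))).
  by apply: is_derive_eq H _; rewrite /= mulr1; ring.
have bt0 : ball t0 r t0.
  by move: bt; rewrite !bE => /andP[a b]; apply/andP; split; lra.
apply/eqP; rewrite eq_le p0 // andbT.
have [tt0|/ltW tt0] := leP t0 t.
- have H : phi t * expR (- C * t) <= phi t0 * expR (- C * t0).
    have bs s : s \in `[t0, t]%R -> ball t0 r s.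
      by move: bt bt0; rewrite in_itv /= !bE => /andP[a b] /andP[c d] /andP[e f]; apply/andP; split; lra.
    apply: (@ler0_derive1_le_cc _ (fun s => phi s * expR (- C * s)) t0 t) => //; rewrite ?in_itv /= ?lexx ?tt0 //.
    + move=> s /subset_itv_oo_cc /bs /key k; by have [] := k (- C).
    + move=> s /subset_itv_oo_cc /bs bts; rewrite derive1E; have [_ ->] := key (- C) s bts.
      apply: mulr_le0_ge0; last exact: expR_ge0.
      have := bd s bts; rewrite ler_norml => /andP[_]; lra.
    + by apply: derivable_within_continuous => s /bs /key k; have [] := k (- C).
  by move: H; rewrite pt0 mul0r pmulr_lle0 // expR_gt0.
- have H : phi t * expR (C * t) <= phi t0 * expR (C * t0).
    have bs s : s \in `[t, t0]%R -> ball t0 r s.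
      by move: bt bt0; rewrite in_itv /= !bE => /andP[a b] /andP[c d] /andP[e f]; apply/andP; split; lra.
    apply: (@ger0_derive1_le_cc _ (fun s => phi s * expR (C * s)) t t0) => //; rewrite ?in_itv /= ?lexx ?tt0 //.
    + move=> s /subset_itv_oo_cc /bs /key k; by have [] := k C.
    + move=> s /subset_itv_oo_cc /bs bts; rewrite derive1E; have [_ ->] := key C s bts.
      apply: mulr_ge0; last exact: expR_ge0.
      have := bd s bts; rewrite ler_norml => /andP[+ _]; lra.
    + by apply: derivable_within_continuous => s /bs /key k; have [] := k C.
  by move: H; rewrite pt0 mul0r pmulr_lle0 // expR_gt0.
Qed.

(** Continuous partials are bounded near [x0], and the mean value theorem on segments of a ball does
    the rest. A finite family is treated at once so that all Christoffel symbols share one constant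
    and one radius. *)
Lemma C1_lipschitz_near n (I : finType) (U : set 'rV[R]_n) (f : I -> 'rV[R]_n -> R) x0 :
  open U -> (forall k, Ck 1 U (f k)) -> U x0 ->
  exists L, 0 <= L /\ exists2 r, 0 < r & forall a b, ball x0 r a -> ball x0 r b ->
    forall k, `|f k a - f k b| <= L * `|a - b|.
Proof.
move=> oU Cf Ux.
have /nbhs_ballP[r /= r0 rU] : nbhs x0 U by exact: open_nbhs_nbhs.
pose M k (i : 'I_n) := `|'D_(delta_mx 0 i) (f k) x0| + 1.
have HM : \forall y \near x0, forall q : I * 'I_n, `|'D_(delta_mx 0 q.2) (f q.1) y| <= M q.1 q.2.
  have H (q : I * 'I_n) : \forall y \near x0, `|'D_(delta_mx 0 q.2) (f q.1) y| <= M q.1 q.2.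
    have /cvgrPdist_le /(_ 1 ltr01) := Ck_cont (Ck_derive (delta_mx 0 q.2) (Cf q.1)) Ux.
    apply: filterS => y; rewrite /M => H; rewrite -lerBlDl; apply: le_trans H.
    by rewrite distrC; apply: le_trans (lerB_dist _ _) _.
  exact: (@filter_forall _ _ _ (nbhs x0) _ H).
move/nbhs_ballP : HM => [s /= s0 sM].
have M0 k i : 0 <= M k i by rewrite addr_ge0.
exists (\sum_k \sum_i M k i); split; first by do 2!(apply: sumr_ge0 => ? _).
exists (Num.min r s); first by rewrite lt_min r0.
move=> a b Ba Bb k.
have inb (t : R) : 0 <= t <= 1 -> ball x0 (Num.min r s) (t *: (a - b) + b).
  move: Ba Bb; rewrite -!ball_normE /= => Ba Bb /andP[t0 t1].
  have -> : x0 - (t *: (a - b) + b) = t *: (x0 - a) + (1 - t) *: (x0 - b).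
    by apply/rowP => i; rewrite !mxE; ring.
  apply: le_lt_trans (ler_normD _ _) _; rewrite !normrZ !ger0_norm ?subr_ge0 //.
  set m := Num.min r s in Ba Bb *.
  have [->|t1'] := eqVneq t 0; first by rewrite mul0r add0r subr0 mul1r.
  have tp : 0 < t by rewrite lt_neqAle eq_sym t1'.
  have H1 : t * `|x0 - a| < t * m by rewrite ltr_pM2l.
  have H2 : (1 - t) * `|x0 - b| <= (1 - t) * m by rewrite ler_wpM2l ?subr_ge0 // ltW.
  by have := ltr_leD H1 H2; rewrite -mulrDl (addrC t) subrK mul1r.
have inU (t : R) : 0 <= t <= 1 -> U (t *: (a - b) + b).
  by move=> /inb H; apply: rU; apply: le_ball H; rewrite ge_min lexx.
have [t t01] := @MVT_line _ _ (f k) b (a - b) (fun t t01 => Ck_derivable (a - b) (Cf k) (inU t t01)).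
rewrite subrK => ->.
rewrite derive_delta; last exact: (Ck1_differentiable oU (Cf k) (inU t t01)).
rewrite mulr_suml; apply: le_trans (ler_norm_sum _ _ _) _; rewrite (bigD1 k) //= ler_wpDr //.
  by apply: sumr_ge0 => j _; rewrite mulr_ge0 // sumr_ge0.
rewrite mulr_suml; apply: ler_sum => i _.
rewrite normrM mulrC; apply: ler_pM => //; last exact: le_mx_norm.
by apply: (sM _ _ (k, i)); apply: le_ball (inb t t01); rewrite ge_min lexx orbT.
Qed.

Lemma sqr_norm_le_sum n (a : 'rV[R]_n) : `|a| ^+ 2 <= \sum_i a 0 i ^+ 2.
Proof.
have S0 : 0 <= \sum_i a 0 i ^+ 2 by apply: sumr_ge0 => i _; exact: sqr_ge0.
rewrite -[leRHS]sqr_sqrtr // ler_sqr ?nnegrE ?sqrtr_ge0 //.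
apply: mx_norm_le; first exact: sqrtr_ge0.
move=> i j; rewrite (ord1 i) -sqrtr_sqr; apply: ler_wsqrtr.
by rewrite (bigD1 j) //= lerDl; apply: sumr_ge0 => k _; exact: sqr_ge0.
Qed.

Lemma cont_norm_bound (f : R -> R) t0 : {for t0, continuous f} ->
  \forall t \near t0, `|f t| <= `|f t0| + 1.
Proof.
move/cvgrPdist_le => /(_ 1 ltr01); apply: filterS => t H.
rewrite -lerBlDl; apply: le_trans H; rewrite distrC; exact: lerB_dist.
Qed.

(** Gronwall applied to [phi = |x - y|^2 + |x' - y'|^2]. The derivative of [phi] is bounded by a
    multiple of [phi] because the Christoffel symbols are Lipschitz near [x t0] and the velocities
    are bounded near [t0]. *)
Lemma geodesic_ode_unique n (U : set 'rV[R]_n) (G : 'rV[R]_n -> 'M[R]_n) (I : set R)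
    (x y : R -> 'rV[R]_n) (t0 : R) :
  open U -> (forall z, U z -> spd (G z)) -> Ck 2 U G -> open I -> I t0 ->
  (forall t, I t -> U (x t)) -> (forall t, I t -> U (y t)) -> Ck 2 I x -> Ck 2 I y ->
  (forall t, I t -> 'D_1 ('D_1 x) t + christoffel_form G (x t) ('D_1 x t) ('D_1 x t) = 0) ->
  (forall t, I t -> 'D_1 ('D_1 y) t + christoffel_form G (y t) ('D_1 y t) ('D_1 y t) = 0) ->
  x t0 = y t0 -> 'D_1 x t0 = 'D_1 y t0 -> \forall t \near t0, x t = y t.
Proof.
move=> oU sG CG oI It0 Ux Uy Cx Cy ex ey xy0 dxy0.
pose f (q : 'I_n * ('I_n * 'I_n)) := christoffel G q.1 q.2.1 q.2.2.
have Cf q : Ck 1 U (f q) by exact: (Ck_christoffel oU sG _ _ _ CG).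
have [L [L0 [r r0 HL]]] := C1_lipschitz_near oU Cf (Ux t0 It0).
pose K := \sum_q (`|f q (x t0)| + 1).
pose V := \sum_i (`|'D_1 x t0 0 i| + 1).
have cx : {for t0, continuous x} := Ck_cont Cx It0.
have cy : {for t0, continuous y} := Ck_cont Cy It0.
have nx : \forall t \near t0, ball (x t0) r (x t) by apply: cx; exact: nbhsx_ballx.
have ny : \forall t \near t0, ball (x t0) r (y t) by rewrite xy0; apply: cy; exact: nbhsx_ballx.
have boundv (z : R -> 'rV[R]_n) : Ck 2 I z -> 'D_1 z t0 = 'D_1 x t0 ->
    \forall t \near t0, forall i : 'I_n, `|'D_1 z t 0 i| <= V.
  move=> Cz Ez; have H (i : 'I_n) : \forall t \near t0, `|'D_1 z t 0 i| <= V.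
    have := cont_norm_bound (cont_coord (i := 0) (j := i) (Ck_cont (Ck_derive (1 : R) Cz) It0)).
    apply: filterS => t /le_trans; apply; rewrite Ez /V (bigD1 i) //= lerDl.
    by apply: sumr_ge0 => k _; rewrite addr_ge0.
  exact: (@filter_forall _ _ _ (nbhs t0) _ H).
have nK : \forall t \near t0, forall q, `|f q (y t)| <= K.
  have H q : \forall t \near t0, `|f q (y t)| <= K.
    have cfy : {for t0, continuous (f q \o y)}.
      by apply: continuous_comp => //; exact: (Ck_cont (Cf q) (Uy t0 It0)).
    apply: filterS (cont_norm_bound cfy) => t /le_trans; apply.
    by rewrite /= -xy0 /K (bigD1 q) //= lerDl; apply: sumr_ge0 => k _; rewrite addr_ge0.
  exact: (@filter_forall _ _ _ (nbhs t0) _ H).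
have nI : \forall t \near t0, I t by exact: open_nbhs_nbhs.
have bvx := boundv x Cx erefl; have bvy := boundv y Cy (esym dxy0).
have : nbhs t0 [set t | [/\ I t, ball (x t0) r (x t), ball (x t0) r (y t), forall q, `|f q (y t)| <= K &
   (forall i : 'I_n, `|'D_1 x t 0 i| <= V) /\ (forall i : 'I_n, `|'D_1 y t 0 i| <= V)]].
  have n1 := filterI nI nx; have n2 := filterI ny nK; have n3 := filterI bvx bvy.
  have FF : Filter (nbhs t0) by exact: nbhs_filter.
  have n5 := filterI (n2 FF) (n3 FF); have n6 := filterI (n1 FF) (n5 FF); apply: filterS (n6 FF).
  by move=> t /= [[? ?] [[? ?] [? ?]]].
move=> /nbhs_ballP[s /= s0 Hs].
pose a t := x t - y t; pose b t := 'D_1 x t - 'D_1 y t.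
pose db t := christoffel_form G (y t) ('D_1 y t) ('D_1 y t) - christoffel_form G (x t) ('D_1 x t) ('D_1 x t).
pose phi t := \sum_i (a t 0 i * a t 0 i + b t 0 i * b t 0 i).
pose dphi t := \sum_i ((b t 0 i * a t 0 i + a t 0 i * b t 0 i) + (db t 0 i * b t 0 i + b t 0 i * db t 0 i)).
have dz (z : R -> 'rV[R]_n) t : Ck 2 I z -> I t -> is_derive t (1 : R) z ('D_1 z t).
  by move=> Cz It; apply: DeriveDef => //; exact: (Ck_derivable (1 : R) Cz It).
have ddz (z : R -> 'rV[R]_n) t : Ck 2 I z -> I t -> is_derive t (1 : R) ('D_1 z) ('D_1 ('D_1 z) t).
  by move=> Cz It; apply: DeriveDef => //; exact: (Ck_derivable (1 : R) (Ck_derive (1 : R) Cz) It).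
pose M := n%:R * (n%:R * (L * V * V + 2 * K * V)).
have K0 : 0 <= K by apply: sumr_ge0 => q _; rewrite addr_ge0.
have V0 : 0 <= V by apply: sumr_ge0 => q _; rewrite addr_ge0.
have M0 : 0 <= M by rewrite !mulr_ge0 // addr_ge0 // !mulr_ge0.
have a_le t i : `|a t 0 i| <= `|a t| by exact: le_mx_norm.
have b_le t i : `|b t 0 i| <= `|b t| by exact: le_mx_norm.
have phi_ge t : `|a t| ^+ 2 + `|b t| ^+ 2 <= phi t.
  rewrite /phi big_split /=; apply: lerD; apply: le_trans (sqr_norm_le_sum _) _; apply: ler_sum => i _; by rewrite expr2.
have dbM t i : ball t0 s t -> `|db t 0 i| <= M * (`|a t| + `|b t|).
  move=> /(Hs t)[It bx bY HK [Hx Hy]].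
  rewrite /db !mxE -sumrB; apply: le_trans (ler_norm_sum _ _ _) _.
  have -> : M * (`|a t| + `|b t|) = \sum_(i0 < n) \sum_(j < n) (L * V * V + 2 * K * V) * (`|a t| + `|b t|).
    by rewrite sumr_const card_ord sumr_const card_ord -mulrnA -(mulr_natl (_ * _) (n * n)) natrM /M; ring.
  apply: ler_sum => j _; rewrite -sumrB; apply: le_trans (ler_norm_sum _ _ _) _; apply: ler_sum => k _.
  have h1 := HL _ _ bY bx (i, (j, k)); have h2 := HK (i, (j, k)); rewrite /f /= in h1 h2.
  have h3 := b_le t j; have h4 := b_le t k; have Ea : `|y t - x t| = `|a t| by rewrite distrC.
  rewrite Ea in h1; move: h1 h2 h3 h4 (Hx j) (Hx k) (Hy j) (Hy k); rewrite /b !mxE.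
  move: (christoffel _ _ _ _ _) (christoffel _ _ _ _ _) => d c.
  move: ('D_1 x t 0 j) ('D_1 x t 0 k) ('D_1 y t 0 j) ('D_1 y t 0 k) => xj xk yj yk h1 h2 h3 h4 hxj hxk hyj hyk.
  (* The difference of two cubic terms is split so that each summand contains exactly one
     difference: of symbols, or of one velocity component. *)
  have -> : c * yj * yk - d * xj * xk = (c - d) * xj * xk - c * (xj - yj) * yk - c * xj * (xk - yk) by ring.
  apply: le_trans (ler_normB _ _) _; rewrite !normrM.
  have n1 : `|c - d| * `|xj| * `|xk| <= L * `|a t| * V * V by rewrite !ler_pM ?mulr_ge0.
  have n2 : `|c| * `|xj - yj| * `|yk| <= K * `|'D_1 x t - 'D_1 y t| * V by rewrite !ler_pM ?mulr_ge0.
  have n3 : `|c| * `|xj| * `|xk - yk| <= K * V * `|'D_1 x t - 'D_1 y t| by rewrite !ler_pM ?mulr_ge0.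
  have n4 := ler_normB ((c - d) * xj * xk) (c * (xj - yj) * yk); rewrite !normrM in n4.
  have p1 : 0 <= 2 * K * V * `|a t| by rewrite !mulr_ge0.
  have p2 : 0 <= L * V * V * `|'D_1 x t - 'D_1 y t| by rewrite !mulr_ge0.
  move: n1 n2 n3 n4 p1 p2.
  have -> : (L * V * V + 2 * K * V) * (`|a t| + `|'D_1 x t - 'D_1 y t|) = L * `|a t| * V * V + 2 * K * V * `|a t|
    + L * V * V * `|'D_1 x t - 'D_1 y t| + 2 * (K * V * `|'D_1 x t - 'D_1 y t|) by ring.
  have -> : K * `|'D_1 x t - 'D_1 y t| * V = K * V * `|'D_1 x t - 'D_1 y t| by ring.
  lra.
have fin (p1 q1 p2 q2 S N : R) : p1 <= p2 -> q1 <= q2 -> p2 <= S / 2 -> q2 <= 2 * (N * S) -> 0 <= S ->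
    p1 *+ 2 + q1 *+ 2 <= (2 + 4 * N) * S.
  have -> : (2 + 4 * N) * S = 2 * S + 4 * (N * S) by ring.
  rewrite (mulr2n p1) (mulr2n q1); move: (N * S) => A; lra.
have phi0 : phi t0 = 0.
  by rewrite /phi big1 // => i _; rewrite /a /b xy0 dxy0 !subrr !mxE !mul0r addr0.
have Z t : ball t0 s t -> phi t = 0.
  apply: (@gronwall0 phi dphi t0 s (n%:R * (2 + 4 * M))) => //.
  - move=> u /(Hs u)[Iu _ _ _ _]; apply: is_derive_sumr => i _.
    have Ha := is_derive_coord 0 i (is_derive_subf (dz x u Cx Iu) (dz y u Cy Iu)).
    have Hb := is_derive_coord 0 i (is_derive_subf (ddz x u Cx Iu) (ddz y u Cy Iu)).
    have E : 'D_1 ('D_1 x) u - 'D_1 ('D_1 y) u = db u.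
      have /eqP := ex u Iu; have /eqP := ey u Iu; rewrite !addr_eq0 => /eqP -> /eqP ->.
      by rewrite opprK addrC.
    rewrite E in Hb.
    exact: (is_derive_addf (is_derive_mulr Ha Ha) (is_derive_mulr Hb Hb)).
  - by move=> u _; apply: sumr_ge0 => i _; rewrite -!expr2 addr_ge0 // sqr_ge0.
  - move=> u bu; apply: (@le_trans _ _ (n%:R * (2 + 4 * M) * (`|a u| ^+ 2 + `|b u| ^+ 2))); last first.
      by apply: ler_wpM2l; [rewrite mulr_ge0 // addr_ge0 // mulr_ge0|exact: phi_ge].
    apply: le_trans (ler_norm_sum _ _ _) _.
    have : forall i : 'I_n, true -> `|(b u 0 i * a u 0 i + a u 0 i * b u 0 i) + (db u 0 i * b u 0 i + b u 0 i * db u 0 i)| <=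
       (2 + 4 * M) * (`|a u| ^+ 2 + `|b u| ^+ 2).
      move=> i _; rewrite (mulrC (b u 0 i) (a u 0 i)) (mulrC (b u 0 i) (db u 0 i)) -!mulr2n.
      apply: le_trans (ler_normD _ _) _; rewrite !normrMn !normrM.
      have h1 := a_le u i; have h2 := b_le u i; have h3 := dbM u i bu.
      have h4 : `|a u 0 i| * `|b u 0 i| <= `|a u| * `|b u| by apply: ler_pM.
      have h5 : `|db u 0 i| * `|b u 0 i| <= M * (`|a u| + `|b u|) * `|b u| by apply: ler_pM.
      have h6 : `|a u| * `|b u| <= (`|a u| ^+ 2 + `|b u| ^+ 2) / 2.
        by have := sqr_ge0 (`|a u| - `|b u|); rewrite sqrrB; lra.
      have h7 : M * (`|a u| + `|b u|) * `|b u| <= 2 * (M * (`|a u| ^+ 2 + `|b u| ^+ 2)).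
        rewrite -mulrA [leRHS]mulrCA; apply: ler_wpM2l => //; rewrite mulrDl -expr2.
        have q1 := sqr_ge0 (`|a u|); have q2 := sqr_ge0 (`|b u|); move: h6 q1 q2.
        by move: (`|a u| ^+ 2) (`|b u| ^+ 2) (`|a u| * `|b u|) => A B C; lra.
      apply: (fin _ _ _ _ _ _ h4 h5 h6 h7); by rewrite addr_ge0 // sqr_ge0.
    move=> /ler_sum /le_trans; apply.
    by rewrite sumr_const card_ord -(mulr_natl (_ * _) n) mulrA.
apply/nbhs_ballP; exists s => //= t bt; apply/eqP; rewrite -subr_eq0 -/(a t) -normr_le0.
rewrite -(ler_pXn2r (n := 2)) ?nnegrE // expr0n /=.
have := phi_ge t; rewrite (Z t bt); have := sqr_ge0 `|b t|; lra.
Qed.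

End OdeTools.

(** * Changes of charts, curves and geodesics *)

Section JacobianChain.
Variable R : realType.

Lemma jac_comp m n p (f : 'rV[R]_m -> 'rV[R]_n) (g : 'rV[R]_n -> 'rV[R]_p) x :
  differentiable f x -> differentiable g (f x) -> 'J (g \o f) x = 'J f x *m 'J g (f x).
Proof.
move=> df dg; have dfv v : derivable f x v by exact: diff_derivable.
have dgf : differentiable (g \o f) x by exact: differentiable_comp.
apply/row_matrixP => i; apply: etrans (etrans (rowE _ _) (jacE _ dgf)) _.
have [_ ->] := is_derive_comp (dfv (delta_mx 0 i)) dg.
by rewrite rowE mulmxA (jacE _ df) (jacE _ dg).
Qed.

Lemma jac_near m n (f g : 'rV[R]_m -> 'rV[R]_n) x : (\forall y \near x, f y = g y) ->
  differentiable f x -> differentiable g x -> 'J f x = 'J g x.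
Proof.
move=> fg df dg; apply/row_matrixP => i.
exact: (etrans (etrans (rowE _ _) (jacE _ df)) (etrans (near_eq_derive _ fg) (esym (etrans (rowE _ _) (jacE _ dg))))).
Qed.

Lemma open_neq0 (V : normedModType R) : open [set z : V | z != 0].
Proof.
rewrite (_ : [set z | z != 0] = ~` [set 0]); last by apply/seteqP; split=> z /= /eqP.
apply: closed_openC; apply: accessible_closed_set1.
exact: (hausdorff_accessible (@norm_hausdorff R V)).
Qed.

Lemma jac_id n (x : 'rV[R]_n) : 'J (fun y : 'rV[R]_n => y) x = 1%:M.
Proof.
have did : differentiable (fun y : 'rV[R]_n => y) x by exact: (Ck1_differentiable_mx openT (@Ck_id _ _ 1 setT) I).
by apply/row_matrixP => i; apply: etrans (etrans (rowE _ _) (jacE _ did)) _; rewrite derive_id rowE mulmx1.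
Qed.

Lemma open_setI_preimage (T T' : topologicalType) (A : set T) (B : set T') (f : T -> T') :
  open A -> open B -> (forall x, A x -> {for x, continuous f}) -> open (A `&` f @^-1` B).
Proof.
move=> oA oB cf; rewrite openE => x [Ax Bfx]; rewrite /interior.
apply: filterI; first exact: open_nbhs_nbhs.
by apply: (cf x Ax); exact: open_nbhs_nbhs.
Qed.

End JacobianChain.

Section Charts.
Variables (R : realType) (n : nat) (M : manifold R n).

Lemma chart_at_dom (x : M) : cdom (atlas M (chart_at x)) x.
Proof. by rewrite /chart_at; case: ex_minnP => k /asboolP. Qed.

Definition transition j k := cmap (atlas M k) \o cinv (atlas M j).

Definition transition_dom j k := cimg (atlas M j) `&` cinv (atlas M j) @^-1` cdom (atlas M k).

Lemma open_chart_preimage j (D : set M) : open D -> open (cimg (atlas M j) `&` cinv (atlas M j) @^-1` D).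
Proof.
move=> oD; apply: open_setI_preimage => //; first exact: cimg_open.
by move=> x; exact: cinv_cont.
Qed.

Lemma transition_open j k : open (transition_dom j k).
Proof. by apply: open_chart_preimage; exact: cdom_open. Qed.

Lemma Ck_transition i j k : Ck i (transition_dom j k) (transition j k).
Proof. exact: atlas_smooth. Qed.

End Charts.

(** * Curves and geodesics on a manifold *)

Section Geodesics.
Variables (R : realType) (n : nat) (N : riemannian R n).

Lemma curve_dom_open (c : R -> N) k : smooth_curve c -> open (c @^-1` cdom (atlas N k)).
Proof.
move=> [cc _]; rewrite -[X in open X]setTI; apply: open_setI_preimage; first exact: openT.
  exact: cdom_open.
by move=> x _; exact: cc.
Qed.

Lemma Ck_curve (c : R -> N) i k : smooth_curve c -> Ck i (c @^-1` cdom (atlas N k)) (cmap (atlas N k) \o c).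
Proof. by move=> [_ /(_ k i)]; rewrite setTI. Qed.

Lemma spd_metric k y : cimg (atlas N k) y -> spd (metric N k y).
Proof. by move=> ky; split; [exact: metric_sym|exact: metric_pos]. Qed.

Lemma derive1_funE (V : normedModType R) (f : R -> V) : derive1 f = 'D_1 f.
Proof. by apply/funext => t; exact: derive1E. Qed.

Lemma geodesic_eq (c : R -> N) k t : geodesic c -> cdom (atlas N k) (c t) ->
  let x := cmap (atlas N k) \o c in
  'D_1 ('D_1 x) t + christoffel_form (metric N k) (x t) ('D_1 x t) ('D_1 x t) = 0.
Proof.
move=> [_ /(_ k t) H] /H; cbv zeta; rewrite /derive1n /=.
by rewrite (derive1_funE (cmap (atlas N k) \o c)) (derive1_funE ('D_1 _)).
Qed.

Lemma cont_derive_curve (c : R -> N) k t : smooth_curve c -> cdom (atlas N k) (c t) ->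
  {for t, continuous ('D_1 (cmap (atlas N k) \o c))}.
Proof. by move=> sc It; exact: (Ck_cont (Ck_derive (1 : R) (Ck_curve 1 k sc)) It). Qed.

(** Connectedness of [R]: the times at which position and velocity agree form a set that is open by
    local uniqueness and closed by the Hausdorff property and continuity of velocities. *)
Lemma geodesic_unique (c c' : R -> N) : geodesic c -> geodesic c' -> c 0 = c' 0 ->
  velocity c 0 = velocity c' 0 -> c = c'.
Proof.
move=> gc gc' c0 v0; have [sc _] := gc; have [sc' _] := gc'.
pose u (z : R -> N) k := 'D_1 (cmap (atlas N k) \o z).
pose A := [set t | c t = c' t /\ u c (chart_at (c t)) t = u c' (chart_at (c t)) t].
have near_A t : A t -> exists2 O : set R, open O /\ O t & forall s, O s -> c s = c' s.
  move=> [ct ut]; set k := chart_at (c t) in ut.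
  pose I := c @^-1` cdom (atlas N k) `&` c' @^-1` cdom (atlas N k).
  have oI : open I by apply: openI; exact: curve_dom_open.
  have It : I t by split; rewrite /= -?ct; exact: chart_at_dom.
  have H := @geodesic_ode_unique R n (cimg (atlas N k)) (metric N k) I (cmap (atlas N k) \o c)
    (cmap (atlas N k) \o c') t (@cimg_open _ _ _ (atlas N k)) (fun z Hz => spd_metric Hz) (@metric_smooth R n N k 2) oI It.
  have {H} : \forall s \near t, (cmap (atlas N k) \o c) s = (cmap (atlas N k) \o c') s.
    refine (H _ _ _ _ _ _ _ ut).
    - by move=> s [cs _]; exact: cmap_img.
    - by move=> s [_ cs]; exact: cmap_img.
    - by apply: sub_Ck (Ck_curve _ _ sc); exact: subIsetl.
    - by apply: sub_Ck (Ck_curve _ _ sc'); exact: subIsetr.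
    - by move=> s [cs _]; exact: geodesic_eq.
    - by move=> s [_ cs]; exact: geodesic_eq.
    - by congr cmap.
  have nI : nbhs t I by exact: open_nbhs_nbhs.
  move=> nE; have := filterI nI nE => /(_ (nbhs_filter t)).
  rewrite nbhsE => -[W [oO Ot] OE]; exists W; first by split.
  move=> s Os; have [[I1 I2] E] := OE s Os.
  by rewrite -(cmapK I1) -(cmapK I2); congr cinv.
have u_near (O : set R) k s : open O -> O s -> (forall r, O r -> c r = c' r) -> u c k s = u c' k s.
  by move=> oO Os OE; apply: near_eq_derive; apply: near_open oO Os _ => r Or /=; rewrite OE.
have oA : open A.
  rewrite openE => t /near_A [W [oO Ot] OE]; rewrite /interior nbhsE.
  exists W; first (by split); move=> s Os; split; [exact: OE|exact: (u_near W _ s oO Os OE)].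
have cA : closed A.
  move=> t clt.
  have ct : c t = c' t.
    apply: (@carrier_hausdorff R n N) => P Q nP nQ.
    have nt : nbhs t (c @^-1` P `&` c' @^-1` Q).
      apply: filterI; [exact: (proj1 sc t I P nP)|exact: (proj1 sc' t I Q nQ)].
    have [s [[cs _] [Ps Qs]]] := clt _ nt.
    by exists (c s); split => //; rewrite cs.
  split; first exact: ct.
  set k := chart_at (c t).
  have It : cdom (atlas N k) (c t) by exact: chart_at_dom.
  have It' : cdom (atlas N k) (c' t) by rewrite -ct.
  have cu : {for t, continuous (u c k)} := cont_derive_curve sc It.
  have cu' : {for t, continuous (u c' k)} := cont_derive_curve sc' It'.
  (* If the velocities differed at the limit time they would differ nearby, although some time of
     [A] is nearby and the curves coincide around it. All velocities are read in the one chart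
     [k]. *)
  apply/eqP; rewrite -subr_eq0; apply: contraT => d0.
  have cd : {for t, continuous (fun s => u c k s - u c' k s)} by exact: (cvgB cu cu').
  have /clt [s [As /= /eqP]] : nbhs t [set s | u c k s - u c' k s != 0].
    have : nbhs (u c k t - u c' k t) [set z | z != 0].
      apply: open_nbhs_nbhs; split; last exact: d0.
      exact: open_neq0.
    exact: (cd [set z | z != 0]).
  have [W [oO Os] OE] := near_A s As.
  by rewrite (u_near W k s oO Os OE) subrr.
have A0 : A 0.
  split; first exact: c0.
  by move: v0; rewrite /velocity !derive1E -c0; exact: id.
have AT : A = setT.
  have : connected [set: R] by apply/connected_intervalP.
  apply; first by exists 0.
    by exists A => //; rewrite setTI.
  by exists A => //; rewrite setTI.
by apply/funext => t; have [ct _] : A t by rewrite AT.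
Qed.

End Geodesics.

(** * Smooth functions of one real variable *)

Section SmoothReal.
Variable R : realType.

Lemma Ck_derive1 (W : normedModType R) k (U : set R) (f df : R -> W) : open U ->
  (forall x, U x -> is_derive x (1 : R) f (df x)) -> Ck k U df -> Ck k.+1 U f.
Proof.
move=> oU fd Cd.
have dv (v x : R) : U x -> is_derive x v f (v *: df x).
  move=> Ux; have [d1 e1] := fd x Ux.
  have := deriveZv v d1; rewrite e1 (_ : v *: 1 = v) //; exact: mulr1.
split=> [x Ux|v].
  have [d1 _] := fd x Ux.
  by apply: differentiable_continuous; apply/derivable1_diffP.
split=> [x Ux|]; first by have [] := dv v x Ux.
apply: (@eq_Ck _ _ _ k U (fun x => v *: df x)) => // [x Ux|]; first by have [_ ->] := dv v x Ux.
elim: k df {fd dv} Cd => [|k IH] df [cd dd].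
  by split=> // x Ux; apply: cvgZr; exact: cd.
split=> [x Ux|u]; first by apply: cvgZr; exact: cd.
have [du Du] := dd u; split=> [x Ux|]; first by apply: derivableZ; exact: du.
apply: (@eq_Ck _ _ _ k U (fun x => v *: 'D_u df x)) => // [x Ux|]; last exact: IH.
by rewrite deriveZ //; exact: du.
Qed.

Lemma Ck_expR k : Ck k [set: R] (@expR R).
Proof.
elim: k => [|k IH]; first by split=> // x _; exact: continuous_expR.
by apply: (Ck_derive1 openT _ IH) => x _; exact: is_derive_expR.
Qed.

Lemma Ck_powR k (a : R) : Ck k [set x : R | 0 < x] (fun x => x `^ a).
Proof.
have oU : open [set x : R | 0 < x] by exact: open_gt.
elim: k a => [|k IH] a.
  split=> // x x0; have [d1 _] := is_derive1_powR a x0.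
  by apply: differentiable_continuous; apply/derivable1_diffP.
apply: (Ck_derive1 oU (fun x x0 => is_derive1_powR a x0)).
by apply: CkZ => //; exact: IH.
Qed.

Lemma Ck_sqrt k : Ck k [set x : R | 0 < x] (@Num.sqrt R).
Proof.
by apply: (@eq_Ck _ _ _ k _ (fun x : R => x `^ 2^-1)); [exact: open_gt|move=> x /= /ltW x0; rewrite powR12_sqrt|exact: Ck_powR].
Qed.

Lemma rho0_smooth n (G : 'rV[R]_n -> 'M[R]_n) k : spd (G 0) -> Ck k [set y | y != 0] (rho0 G).
Proof.
move=> sG.
apply: (@Ck_comp1 _ _ k _ [set x : R | 0 < x] (fun y => dot (G 0) y y)).
- exact: open_neq0.
- by move=> y /= y0; have [_] := sG; exact.
- have oU := @open_neq0 R 'rV[R]_n.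
  apply: (@eq_Ck _ _ _ k _ (fun y : 'rV[R]_n => (y *m G 0 *m y^T) 0 0)) => //.
  have /(Ck_mxP _ _ oU) : Ck k [set y : 'rV[R]_n | y != 0] (fun y : 'rV[R]_n => y *m G 0 *m y^T); last exact.
  have Cy : Ck k [set y : 'rV[R]_n | y != 0] (fun y : 'rV[R]_n => y) := Ck_id _ _.
  by apply: Ck_mulmx (Ck_mulmx _ _ (Ck_cst _ _ _)) (Ck_trmx _ _).
- exact: Ck_sqrt.
Qed.

End SmoothReal.

(** * The metric pulled back by the exponential map *)

Section NormalChart.
Variables (R : realType) (n : nat) (N : riemannian R n).
Variables (expo : 'rV[R]_n -> N) (loga : N -> 'rV[R]_n).
Hypotheses (sE : smooth_into setT expo) (sL : smooth_from loga).
Hypotheses (EK : cancel expo loga) (LK : cancel loga expo).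

Definition echart k := cmap (atlas N k) \o expo.
Definition edom k := expo @^-1` cdom (atlas N k).
Definition lchart k := loga \o cinv (atlas N k).

Lemma open_edom k : open (edom k).
Proof.
rewrite /edom -[X in open X]setTI; apply: open_setI_preimage; first exact: openT.
  exact: cdom_open.
by move=> x _; apply: (proj1 sE).
Qed.

Arguments open_edom k : clear implicits.

Lemma Ck_echart i k : Ck i (edom k) (echart k).
Proof. by have := proj2 sE k i; rewrite setTI. Qed.

Lemma Ck_lchart i k : Ck i (cimg (atlas N k)) (lchart k).
Proof. exact: sL. Qed.

Lemma echart_img k z : edom k z -> cimg (atlas N k) (echart k z).
Proof. exact: cmap_img. Qed.

Lemma lchartK k z : edom k z -> lchart k (echart k z) = z.
Proof. by move=> kz; rewrite /lchart /echart /= cmapK. Qed.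

Lemma lchart_dom k q : cimg (atlas N k) q -> edom k (lchart k q).
Proof. by move=> kq; rewrite /edom /lchart /= LK; exact: cinv_dom. Qed.

Lemma echartK k q : cimg (atlas N k) q -> echart k (lchart k q) = q.
Proof. by move=> kq; rewrite /lchart /echart /= LK cinvK. Qed.

Lemma echart_differentiable k z : edom k z -> differentiable (echart k) z.
Proof. by move=> kz; exact: (Ck1_differentiable_mx (open_edom k) (Ck_echart 1 k) kz). Qed.

(** [lchart k] is a smooth left inverse of [echart k], so the chain rule gives an inverse of the
    Jacobian. *)
Lemma jac_echart_unit k z : edom k z -> 'J (echart k) z \in unitmx.
Proof.
move=> kz; have oc := @cimg_open _ _ _ (atlas N k).
have dE := echart_differentiable kz.
have dL : differentiable (lchart k) (echart k z) :=
  Ck1_differentiable_mx oc (Ck_lchart 1 k) (echart_img kz).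
have H : 'J (echart k) z *m 'J (lchart k) (echart k z) = 1%:M.
  apply: etrans (esym (jac_comp dE dL)) (etrans _ (jac_id z)).
  apply: jac_near; last exact: (Ck1_differentiable_mx openT (@Ck_id _ _ 1 setT) I).
    by apply: (near_open (open_edom k) kz) => y; exact: lchartK.
  exact: differentiable_comp.
exact: (proj1 (mulmx1_unit H)).
Qed.

Definition emetric_in k z := 'J (echart k) z *m metric N k (echart k z) *m ('J (echart k) z)^T.

(** The metric of N in normal coordinates. It is defined through the preferred chart around
    [expo z]; [emetricE] shows that any other chart gives the same matrix. *)
Definition emetric z := emetric_in (chart_at (expo z)) z.

Lemma emetricE k z : edom k z -> emetric z = emetric_in k z.
Proof.
move=> kz; set j := chart_at (expo z); have jz : edom j z by exact: chart_at_dom.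
have qj := echart_img jz.
have back y : edom j y -> cinv (atlas N j) (echart j y) = expo y by move=> jy; rewrite /echart /= cmapK.
have kq : cdom (atlas N k) (cinv (atlas N j) (echart j z)) by rewrite back.
have tz : transition_dom N j k (echart j z) by split.
have dT : differentiable (transition N j k) (echart j z) :=
  Ck1_differentiable_mx (@transition_open _ _ N j k) (@Ck_transition _ _ N 1 j k) tz.
have dE := echart_differentiable jz; have dE' := echart_differentiable kz.
have JE : 'J (echart k) z = 'J (echart j) z *m 'J (transition N j k) (echart j z).
  apply: etrans (jac_near _ dE' (differentiable_comp dE dT)) (jac_comp dE dT).
  apply: (near_open (open_edom j) jz) => y jy.
  by rewrite /transition /= (back y jy).
have tE : transition N j k (echart j z) = echart k z by rewrite /transition /= (back z jz).
have alg (A B G G' : 'M[R]_n) (C : 'M[R]_n) : G = B *m G' *m B^T -> C = A *m B ->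
    A *m G *m A^T = C *m G' *m C^T by move=> -> ->; rewrite trmx_mul !mulmxA.
apply: alg JE; rewrite -tE; exact: metric_change qj kq.
Qed.

Lemma Ck_emetric i : Ck i setT emetric.
Proof.
apply: Ck_local => z _; set k := chart_at (expo z); exists (edom k); first exact: chart_at_dom.
have oe := open_edom k.
apply: (eq_Ck oe (f := emetric_in k)); first by move=> y ky; rewrite (emetricE ky).
have CJ : Ck i (edom k) (jacobian (echart k)) := Ck_jacobian oe (Ck_echart i.+1 k).
apply: Ck_mulmx => //; last exact: Ck_trmx.
apply: Ck_mulmx => //.
apply: (Ck_comp_mx oe (@cimg_open _ _ _ (atlas N k)) (@echart_img k) (Ck_echart i k)).
exact: metric_smooth.
Qed.

Lemma spd_congr (J G : 'M[R]_n) : J \in unitmx -> spd G -> spd (J *m G *m J^T).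
Proof.
move=> uJ [sG pG]; split; first by rewrite !trmx_mul trmxK sG mulmxA.
move=> v v0; rewrite dot_congr; apply: pG; apply: contraNneq v0 => vJ.
by rewrite -(mulmxK uJ v) vJ mul0mx.
Qed.

Lemma spd_emetric z : spd (emetric z).
Proof.
have kz : edom (chart_at (expo z)) z by exact: chart_at_dom.
apply: spd_congr; first exact: jac_echart_unit.
apply: spd_metric; exact: echart_img.
Qed.

Lemma dot_emetric k z u v : edom k z ->
  dot (emetric z) u v = dot (metric N k (echart k z)) ('D_u (echart k) z) ('D_v (echart k) z).
Proof.
move=> kz; rewrite (emetricE kz); apply: etrans (dot_congr _ _ _ _) _.
have dE := echart_differentiable kz.
by congr dot; exact: jacE.
Qed.

End NormalChart.

(** * Affine reparametrization of geodesics *)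

Section Rays.
Variables (R : realType) (n : nat) (N : riemannian R n).

Lemma is_derive_rescale (W : normedModType R) (x : R -> W) (a s : R) :
  derivable x (a * s) 1 -> is_derive s (1 : R) (fun t => x (a * t)) (a *: 'D_1 x (a * s)).
Proof.
move=> dx.
have E : (fun t : R => x (a * t)) = fun t : R => x (t *: a + 0).
  by apply/funext => t; rewrite addr0 /GRing.scale /= mulrC.
have P : s *: a + 0 = a * s by rewrite addr0 /GRing.scale /= mulrC.
have [d1 e1] := deriveZv a dx.
have a1 : a *: (1 : R) = a by exact: mulr1.
rewrite a1 in d1 e1; rewrite E; split.
  by apply/derivable_lineP; rewrite P.
by rewrite derive_lineE P.
Qed.

Lemma geodesicP (c : R -> N) : geodesic c <-> smooth_curve c /\
  forall k t, cdom (atlas N k) (c t) -> let x := cmap (atlas N k) \o c in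
  'D_1 ('D_1 x) t + christoffel_form (metric N k) (x t) ('D_1 x t) ('D_1 x t) = 0.
Proof.
split=> [gc|[sc H]].
  exact: (conj (proj1 gc) (fun k t => @geodesic_eq R n N c k t gc)).
split; first exact: sc.
move=> k t /H; cbv zeta; rewrite /derive1n /=.
by rewrite (derive1_funE (cmap (atlas N k) \o c)) (derive1_funE ('D_1 _)).
Qed.

Lemma smooth_rescale (c : R -> N) (a : R) : smooth_curve c -> smooth_curve (fun t => c (a * t)).
Proof.
move=> sc; have [cc _] := sc.
have ca (t : R) : {for t, continuous (fun t : R => a * t)} by apply: cvgM; [exact: cvg_cst|exact: cvg_id].
split=> [t _|k i]; first by apply: continuous_comp; [exact: ca|exact: cc].
have oI := @curve_dom_open _ _ N c k sc.
have oJ : open ((fun t => c (a * t)) @^-1` cdom (atlas N k)).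
  rewrite -[X in open X]setTI; apply: open_setI_preimage; [exact: openT|exact: cdom_open|].
  by move=> t _; apply: continuous_comp; [exact: ca|exact: cc].
rewrite setTI; apply/(Ck_mxP _ _ oJ) => p q.
apply: (@Ck_comp1 _ _ i _ (c @^-1` cdom (atlas N k)) (fun t : R => a * t) (fun t => (cmap (atlas N k) \o c) t p q)) => //.
  by apply: CkZ => //; exact: Ck_id.
by move/(Ck_mxP _ _ oI): (Ck_curve i k sc).
Qed.

(** Both the acceleration and the Christoffel term are homogeneous of degree 2 in the velocity. *)
Lemma geodesic_rescale (c : R -> N) (a : R) : geodesic c -> geodesic (fun t => c (a * t)).
Proof.
move=> gc; have [sc _] := gc; have sc' := smooth_rescale a sc.
apply/geodesicP; split; first exact: sc'.
move=> k t kt /=; set x := cmap (atlas N k) \o c.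
have oI := @curve_dom_open _ _ N c k sc; have oJ := @curve_dom_open _ _ N _ k sc'.
have Cx := Ck_curve 2 k sc.
have d1 s : c (a * s) \in cdom (atlas N k) -> 'D_1 (fun t => x (a * t)) s = a *: 'D_1 x (a * s).
  by move=> /set_mem ks; have [_ ->] := is_derive_rescale (Ck_derivable (1 : R) Cx ks).
have dd : derivable ('D_1 x) (a * t) 1 := Ck_derivable (1 : R) (Ck_derive (1 : R) Cx) kt.
have d2 : 'D_1 ('D_1 (fun t => x (a * t))) t = a *: (a *: 'D_1 ('D_1 x) (a * t)).
  have -> : 'D_1 ('D_1 (fun t => x (a * t))) t = 'D_1 (fun s => a *: 'D_1 x (a * s)) t.
    by apply: near_eq_derive; apply: near_open oJ kt _ => s ks; apply: d1; exact: mem_set.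
  have [e1 e2] := is_derive_rescale dd.
  by apply: etrans (deriveZ a e1) _; rewrite e2.
have alg (A B G : 'rV[R]_n) : A = a *: (a *: B) -> B + G = 0 -> A + a *: (a *: G) = 0.
  by move=> -> H; rewrite -!scalerDr H !scaler0.
apply: etrans (alg _ _ _ d2 (geodesic_eq gc kt)); congr (_ + _).
apply: etrans (_ : _ = christoffel_form (metric N k) (x (a * t)) (a *: 'D_1 x (a * t)) (a *: 'D_1 x (a * t))) _.
  by congr christoffel_form; apply: d1; exact: mem_set.
by rewrite christoffel_formZl christoffel_formZr.
Qed.

Lemma velocity_rescale (c : R -> N) (a : R) : smooth_curve c ->
  velocity (fun t => c (a * t)) 0 = a *: velocity c 0.
Proof.
move=> sc; rewrite /velocity mulr0 !derive1E.
set k := chart_at (c 0); have k0 : cdom (atlas N k) (c (a * 0)) by rewrite mulr0; exact: chart_at_dom.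
have [_ e] := is_derive_rescale (Ck_derivable (1 : R) (Ck_curve 1 k sc) k0).
by apply: etrans e _; rewrite mulr0.
Qed.

End Rays.

(** * Rays from the pole and the distance function *)

Section Pole.
Variables (R : realType) (n : nat) (N : riemannian R n) (o : N).
Variables (expo : 'rV[R]_n -> N) (loga : N -> 'rV[R]_n).
Hypotheses (eE : is_exp o expo) (sE : smooth_into setT expo) (sL : smooth_from loga).
Hypotheses (EK : cancel expo loga) (LK : cancel loga expo).

Local Notation gh := (emetric (N:=N) expo).
Local Notation ec := (echart expo).

(** [is_exp] only describes the time-1 point of a geodesic for each vector. The geodesic with
    velocity [t *: v] is the rescaled geodesic of [v] by uniqueness, so the whole ray is one
    geodesic. *)
Lemma expo_ray v : geodesic (fun t : R => expo (t *: v)) /\ expo 0 = o.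
Proof.
have [c [gc c0 v0 _]] := eE v; have [sc _] := gc.
suff cE t : c t = expo (t *: v).
  have E : c = fun t : R => expo (t *: v) by apply/funext => t; exact: cE.
  by split; [rewrite -E|rewrite -(scale0r v) -cE c0].
have [c' [gc' c'0 v'0 ->]] := eE (t *: v).
have -> : c' = fun s => c (t * s); last by rewrite mulr1.
apply: geodesic_unique gc' (geodesic_rescale t gc) _ _; first by rewrite mulr0 c0.
by rewrite velocity_rescale // v0.
Qed.

Lemma expo0 : expo 0 = o. Proof. by have [] := expo_ray 0. Qed.

Lemma ray_derive k v (t : R) : edom (N:=N) expo k (t *: v) ->
  'D_1 (cmap (atlas N k) \o (fun t : R => expo (t *: v))) t = 'D_v (ec k) (t *: v).
Proof.
move=> kt; have [_ e] := is_derive_ray (echart_differentiable sE kt); exact: e.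
Qed.

(** Rays are geodesics of N, hence have zero covariant acceleration in the chart [k]; the
    transformation law carries this to normal coordinates. It is the hypothesis on which the Gauss
    lemma rests. *)
Lemma emetric_radial z : christoffel_form gh z z z = 0.
Proof.
set k := chart_at (expo z); have kz : edom (N:=N) expo k z by exact: chart_at_dom.
have oe := @open_edom _ _ _ _ sE k.
have kz1 : cdom (atlas N k) ((fun t : R => expo (t *: z)) 1) by rewrite scale1r; exact: kz.
have [gc _] := expo_ray z.
have geo := geodesic_eq gc kz1; cbv zeta in geo.
have oJ := @curve_dom_open _ _ N _ k (proj1 gc).
have dC : differentiable ('D_z (ec k)) (1 *: z).
  by apply: (Ck1_differentiable_mx oe (Ck_derive z (Ck_echart sE 2 k))); rewrite scale1r.
have d2 : 'D_1 ('D_1 (cmap (atlas N k) \o (fun t : R => expo (t *: z)))) 1 = 'D_z ('D_z (ec k)) z.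
  apply: etrans (_ : _ = 'D_1 (fun t : R => 'D_z (ec k) (t *: z)) 1) _.
    by apply: near_eq_derive; apply: near_open oJ kz1 _ => s ks; exact: ray_derive.
  by have [_ e] := is_derive_ray dC; apply: etrans e _; rewrite scale1r.
have kz' : edom (N:=N) expo k (1 *: z) by rewrite scale1r.
have d1 := ray_derive kz'; rewrite scale1r in d1.
have acc : cov_accel (ec k) (metric N k) z z z = 0.
  have alg (Gm : 'rV[R]_n -> 'M[R]_n) (a b c d y1 y2 : 'rV[R]_n) : a = b -> y1 = y2 -> c = d ->
      a + christoffel_form Gm y1 c c = 0 -> b + christoffel_form Gm y2 d d = 0 by move=> -> -> ->.
  have yE : (cmap (atlas N k) \o (fun t : R => expo (t *: z))) 1 = ec k z by rewrite /echart /= scale1r.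
  exact: (alg _ _ _ _ _ _ _ d2 yE d1 geo).
have uJ := jac_echart_unit sE sL EK kz.
have := @christoffel_change R n (edom (N:=N) expo k) (cimg (atlas N k)) (ec k) gh (metric N k)
  oe (@cimg_open _ _ _ _) (@echart_img _ _ _ expo k) (@spd_metric _ _ N k)
  (fun z _ => spd_emetric sE sL EK z) (fun y ky => emetricE sE ky)
  (fun y ky => jac_echart_unit sE sL EK ky) z z z (Ck_echart sE 2 k)
  (@metric_smooth _ _ N k 1) (sub_Ck (@subsetT _ _) (Ck_emetric sE 1)) kz.
rewrite acc => H; by rewrite -(mulmxK uJ (christoffel_form _ _ _ _)) H mul0mx.
Qed.

Lemma smooth_log_curve (c : R -> N) i : smooth_curve c -> Ck i setT (loga \o c).
Proof.
move=> sc; apply: Ck_local => t _; set k := chart_at (c t).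
exists (c @^-1` cdom (atlas N k)); first exact: chart_at_dom.
have oI := @curve_dom_open _ _ N c k sc.
apply: (eq_Ck oI (f := lchart loga k \o (cmap (atlas N k) \o c))).
  by move=> s ks; rewrite /lchart /= cmapK.
apply: (Ck_comp_mx oI (@cimg_open _ _ _ (atlas N k)) _ (Ck_curve i k sc) (Ck_lchart sL i k)).
by move=> s ks; exact: cmap_img.
Qed.

(** The Riemannian speed of a curve of N, read in normal coordinates. *)
Definition logspeed (y : R -> 'rV[R]_n) t := Num.sqrt (dot (gh (y t)) ('D_1 y t) ('D_1 y t)).

Lemma tnorm_velocity (c : R -> N) t : smooth_curve c ->
  tnorm (c t) (velocity c t) = logspeed (loga \o c) t.
Proof.
move=> sc; set y := loga \o c; have Cy : Ck 1 setT y := smooth_log_curve 1 sc.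
have cE s : c s = expo (y s) by rewrite /y /= LK.
apply: (congr1 Num.sqrt); set k := chart_at (c t).
have kt : edom (N:=N) expo k (y t) by rewrite /edom /= -cE; exact: chart_at_dom.
apply: etrans (esym (dot_emetric sE _ _ kt)).
have dy : derivable y t 1 := @Ck_derivable _ _ _ 0 setT y (1 : R) t Cy I.
have [_ e] := is_derive_comp dy (echart_differentiable sE kt).
have ev : velocity c t = 'D_('D_1 y t) (ec k) (y t).
  have E : cmap (atlas N k) \o c = ec k \o y by apply/funext => s; rewrite /echart /= -cE.
  by rewrite /velocity derive1E E.
have alg (k' : nat) (q q' v v' : 'rV[R]_n) : v = v' -> q = q' ->
  dot (metric N k' q) v v = dot (metric N k' q') v' v' by move=> -> ->.
exact: (alg k (coord (c t)) (ec k (y t)) _ _ ev (congr1 (cmap (atlas N k)) (cE t))).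
Qed.

Lemma cont_logspeed (y : R -> 'rV[R]_n) : Ck 1 setT y -> continuous (logspeed y).
Proof.
move=> Cy t; apply: continuous_comp; last exact: sqrt_continuous.
have Cd : Ck 0 setT ('D_1 y) := Ck_derive (1 : R) Cy.
have CG : Ck 0 setT (gh \o y) := Ck_comp_mx openT openT (fun _ _ => I) (CkW Cy) (Ck_emetric sE 0).
have CM : Ck 0 setT (fun t => 'D_1 y t *m gh (y t) *m ('D_1 y t)^T).
  exact: (Ck_mulmx openT (Ck_mulmx openT Cd CG) (Ck_trmx openT Cd)).
by apply: (Ck_cont (x := t) (proj1 (Ck_mxP _ _ openT) CM 0 0)).
Qed.

(** A regularization of [rho0] that is differentiable at the origin as well, since a curve from the
    pole passes through it. *)
Definition rhoe (e : R) (y : 'rV[R]_n) := Num.sqrt (dot (gh 0) y y + e).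

Lemma Rintegral_FTC (F f : R -> R) : (forall t, is_derive t (1 : R) F (f t)) -> continuous f ->
  \int[lebesgue_measure]_(t in `[0, 1]) f t = F 1 - F 0.
Proof.
move=> dF cf.
have cF t : {for t, continuous F} by apply: differentiable_continuous; apply/derivable1_diffP; have [] := dF t.
have := @continuous_FTC2 R f F 0 1 ltr01 (continuous_subspaceT cf).
rewrite /Rintegral => -> //; last by move=> t _; rewrite derive1E; have [_ ->] := dF t.
split; first by move=> t _; have [] := dF t.
  exact: cvg_at_right_filter (cF 0).
exact: cvg_at_left_filter (cF 1).
Qed.

Lemma Rintegral_le01 (f f' : R -> R) : continuous f -> continuous f' -> (forall t, f t <= f' t) ->
  \int[lebesgue_measure]_(t in `[0, 1]) f t <= \int[lebesgue_measure]_(t in `[0, 1]) f' t.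
Proof.
move=> cf cf' le; apply: le_Rintegral => //.
- apply: continuous_compact_integrable; [exact: segment_compact|exact: continuous_subspaceT].
- apply: continuous_compact_integrable; [exact: segment_compact|exact: continuous_subspaceT].
Qed.

(** Along the curve the derivative of [rhoe e] is [<y, y'>_0 / rhoe]. The Gauss lemma replaces the
    metric at 0 by the metric at [y], and Cauchy-Schwarz bounds the quotient by the speed; then
    integrate. *)
Lemma rhoe_le_arc (e : R) (c : R -> N) : 0 < e -> smooth_curve c ->
  rhoe e (loga (c 1)) <= rhoe e (loga (c 0)) + curve_length c.
Proof.
move=> e0 sc; set y := loga \o c.
have Cy2 : Ck 2 setT y := smooth_log_curve 2 sc; have Cy := CkW Cy2.
have dy t : is_derive t (1 : R) y ('D_1 y t) by split => //; exact: (Ck_derivable (1 : R) Cy I).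
have pos t : 0 < dot (gh 0) (y t) (y t) + e.
  by apply: ltr_wpDl e0; exact: dot_ge0 (spd_emetric sE sL EK 0).
have [sG0 _] := spd_emetric sE sL EK 0.
pose f t := dot (gh 0) (y t) ('D_1 y t) / rhoe e (y t).
have df t : is_derive t (1 : R) (rhoe e \o y) (f t).
  have h1 := is_derive_addf (is_derive_dot (is_derive_cst (gh 0) t 1) (dy t) (dy t)) (is_derive_cst e t 1).
  have h2 := is_derive_comp1 h1 (is_derive1_sqrt (pos t)).
  apply: is_derive_eq h2 _; rewrite /f /rhoe.
  have alg (G : 'M[R]_n) (a b : 'rV[R]_n) (r : R) : G^T = G -> 
    (dot 0 a a + dot G b a + dot G a b + 0) * (2 * r)^-1 = dot G a b / r.
    move=> sG; rewrite dot0m (dotC b a sG); move: (dot G a b) => z.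
    by have [->|r0] := eqVneq r 0; [rewrite mulr0 !invr0 !mulr0|field].
  exact: alg.
have c_rho : continuous (rhoe e \o y).
  by move=> t; apply: differentiable_continuous; apply/derivable1_diffP; have [] := df t.
have rpos t : 0 < rhoe e (y t) by rewrite sqrtr_gt0; exact: pos.
have cf : continuous f.
  move=> t; apply: cvgM; last by apply: cvgV; [rewrite gt_eqF|exact: c_rho].
  have CM : Ck 0 setT (fun t => y t *m gh 0 *m ('D_1 y t)^T).
    exact: (Ck_mulmx openT (Ck_mulmx openT (CkW Cy) (Ck_cst _ _ _)) (Ck_trmx openT (Ck_derive (1 : R) Cy))).
  exact: (Ck_cont (x := t) (proj1 (Ck_mxP _ _ openT) CM 0 0)).
have sp := cont_logspeed Cy.
have le : forall t, f t <= logspeed y t.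
  move=> t; rewrite ler_pdivrMr //.
  have CG := Ck_emetric sE 2.
  have sG := spd_emetric sE sL EK.
  rewrite -(gauss CG sG emetric_radial); apply: le_trans (ler_norm _) _.
  rewrite -sqrtr_sqr -sqrtrM; last exact: dot_ge0.
  rewrite ler_wsqrtr //; apply: le_trans (dot_CS _ _ (sG _)) _.
  rewrite mulrC; apply: ler_wpM2l; first exact: dot_ge0.
  have alg (A B : R) : A = B -> A <= B + e by move=> ->; rewrite lerDl ltW.
  exact: (alg _ _ (gauss CG sG emetric_radial (y t) (y t))).
have := Rintegral_le01 cf sp le; rewrite (Rintegral_FTC df cf).
rewrite -lerBlDl => H; apply: le_trans H _; rewrite /curve_length.
by under [leRHS]eq_Rintegral do rewrite tnorm_velocity //.
Qed.

Lemma rhoe_le_joined (e : R) (a b : N) (l : R) : 0 < e -> joined a b l ->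
  rhoe e (loga b) <= rhoe e (loga a) + l.
Proof.
move=> e0; elim=> {a b l} [c sc|x y z l l' _ H1 _ H2]; first exact: rhoe_le_arc.
by apply: le_trans H2 _; rewrite addrA lerD2r.
Qed.

Lemma rho0_le_joined (x : N) (l : R) : joined o x l -> rho0 gh (loga x) <= l.
Proof.
move=> jl; apply/ler_addgt0Pr => e e0.
(* With parameter [e ^+ 2] the regularized distance of the pole is exactly [e]. *)
have e20 : 0 < e ^+ 2 by rewrite exprn_gt0.
have := rhoe_le_joined e20 jl; rewrite -expo0 EK /rhoe dot0l add0r sqrtr_sqr gtr0_norm // addrC.
by rewrite (addrC e); apply: le_trans; rewrite /rho0 ler_wsqrtr // lerDr sqr_ge0.
Qed.

Lemma ray_length v : curve_length (fun t : R => expo (t *: v)) = rho0 gh v.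
Proof.
have [[sc _] _] := expo_ray v; rewrite /curve_length.
have sG := spd_emetric sE sL EK; have CG := Ck_emetric sE 2.
have E : (loga \o fun t : R => expo (t *: v)) = fun t : R => t *: v by apply/funext => t; rewrite /= EK.
under eq_Rintegral => t _.
  rewrite (tnorm_velocity t sc) E /logspeed.
  have [_ ->] := is_derive_scalel v t.
  have -> : dot (gh (t *: v)) v v = dot (gh 0) v v.
    have [->|t0] := eqVneq t 0; first by rewrite scale0r.
    have alg (A B : 'M[R]_n) : dot A (t *: v) v = dot B (t *: v) v -> dot A v v = dot B v v.
      by rewrite !dotZl => /(mulfI t0).
    exact: (alg _ _ (gauss CG sG emetric_radial (t *: v) v)).
  over.
by rewrite Rintegral_cst //= lebesgue_measure_itv /= lte_fin ltr01 oppr0 adde0 mulr1.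
Qed.

Lemma joined_ray v : joined o (expo v) (rho0 gh v).
Proof.
have [[sc _] e0] := expo_ray v.
by have := joined_arc sc; rewrite /= scale0r scale1r e0 ray_length.
Qed.

Lemma dist_expo v : dist o (expo v) = rho0 gh v.
Proof.
have lb : lbound [set l | joined o (expo v) l] (rho0 gh v).
  by move=> l /rho0_le_joined; rewrite EK.
apply/eqP; rewrite eq_le; apply/andP; split.
  by apply: ge_inf; [exists (rho0 gh v)|exact: joined_ray].
by apply: lb_le_inf => //; exists (rho0 gh v); exact: joined_ray.
Qed.

Lemma distE x : dist o x = rho0 gh (loga x).
Proof. by rewrite -{1}(LK x) dist_expo. Qed.

Lemma minimal_ray v : minimal_geodesic o (expo v) (fun t : R => expo (t *: v)).
Proof.
have [gc e0] := expo_ray v; split; [exact: gc|by rewrite scale0r|by rewrite scale1r|].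
by rewrite ray_length dist_expo.
Qed.

End Pole.

Lemma continuous_rho0 (R : realType) n (G : 'rV[R]_n -> 'M[R]_n) : continuous (rho0 G).
Proof.
move=> z; apply: continuous_comp; last exact: sqrt_continuous.
have C : Ck 0 setT (fun y : 'rV[R]_n => y *m G 0 *m y^T).
  exact: (Ck_mulmx openT (Ck_mulmx openT (Ck_id _ _) (Ck_cst _ _ _)) (Ck_trmx openT (Ck_id _ _))).
exact: (Ck_cont (x := z) (proj1 (Ck_mxP _ _ openT) C 0 0)).
Qed.

Lemma hess_near (R : realType) n (G : 'rV[R]_n -> 'M[R]_n) (U : set 'rV[R]_n) (f g : 'rV[R]_n -> R) y u v :
  open U -> U y -> (forall z, U z -> f z = g z) -> hess G f y u v = hess G g y u v.
Proof.
move=> oU Uy fg.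
have d a z : U z -> 'D_a f z = 'D_a g z.
  by move=> Uz; apply: near_eq_derive; exact: near_open oU Uz fg.
have dd : 'D_u ('D_v f) y = 'D_u ('D_v g) y.
  by apply: near_eq_derive; apply: near_open oU Uy _ => z; exact: d.
have alg (a b c e : R) : a = b -> c = e -> a - c = b - e by move=> -> ->.
exact: (alg _ _ _ _ dd (d _ _ Uy)).
Qed.

(** * Hessian comparison for the distance to the pole of N *)

Section PoleComparison.
Variables (R : realType) (n : nat) (N : riemannian R n) (o : N).
Variables (expo : 'rV[R]_n -> N) (loga : N -> 'rV[R]_n).
Hypotheses (eE : is_exp o expo) (sE : smooth_into setT expo) (sL : smooth_from loga).
Hypotheses (EK : cancel expo loga) (LK : cancel loga expo).

Local Notation gh := (emetric (N:=N) expo).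
Local Notation ec := (echart expo).
Local Notation distc k := (dist o \o cinv (atlas N k)).

Let sG := spd_emetric sE sL EK.

Lemma log_neq0 x : (x <> o) <-> (loga x != 0).
Proof.
split=> [xo|/eqP lx xo]; last by apply: lx; rewrite xo -(expo0 eE) EK.
by apply/eqP => lx; apply: xo; rewrite -(LK x) lx (expo0 eE).
Qed.

Definition off_pole k := cimg (atlas N k) `&` cinv (atlas N k) @^-1` [set x | x <> o].

Lemma off_poleE k : off_pole k = cimg (atlas N k) `&` lchart loga k @^-1` [set y | y != 0].
Proof. by apply/seteqP; split=> q [kq H]; split=> //; apply/log_neq0. Qed.

Lemma open_off_pole k : open (off_pole k).
Proof.
rewrite off_poleE; apply: open_setI_preimage; [exact: cimg_open|exact: open_neq0|].
by move=> q kq; exact: (Ck_cont (Ck_lchart sL 0 k) kq).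
Qed.

Lemma dist_lchart k q : cimg (atlas N k) q -> distc k q = rho0 gh (lchart loga k q).
Proof. by move=> kq /=; rewrite (distE eE sE sL EK LK). Qed.

Lemma Ck_dist i k : Ck i (off_pole k) (distc k).
Proof.
have oU := @open_off_pole k.
apply: (eq_Ck oU (f := rho0 gh \o lchart loga k)) => [q [kq _]|]; first by rewrite dist_lchart.
apply: (@Ck_comp _ _ _ i _ [set y | y != 0]) => //; first exact: open_neq0.
- by move=> q; rewrite off_poleE => -[].
- by apply: sub_Ck (Ck_lchart sL i k) => q [].
- exact: rho0_smooth (sG 0).
Qed.

Section Curvature.
Variable w : R -> R.
Hypotheses (ww : warping w) (curv : radial_curvature_ge o (fun r => - (derive1n 2 w r / w r))).

(** The curvature hypothesis is applied to the ray through [z], a minimal geodesic with final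
    velocity the image of [z], and pulled back by tensoriality of the curvature. *)
Lemma radial_sectional z u : z != 0 -> row_free (col_mx z u) ->
  - (derive1n 2 w (rho0 gh z) / w (rho0 gh z)) <= sectional gh z z u.
Proof.
move=> z0 fzu; set k := chart_at (expo z); have kz : edom (N:=N) expo k z by exact: chart_at_dom.
have xo : expo z <> o by apply/log_neq0; rewrite EK.
have oe := @open_edom _ _ _ _ sE k.
have dE := echart_differentiable sE kz.
have uJ := jac_echart_unit sE sL EK kz.
pose c := fun t : R => expo (t *: z).
have ev : velocity c 1 = 'D_z (ec k) z.
  have c1 : c 1 = expo z by rewrite /c scale1r.
  have k1 : edom (N:=N) expo k (1 *: z) by rewrite scale1r.
  by rewrite /velocity c1 derive1E; apply: etrans (ray_derive sE k1) _; rewrite scale1r.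
have free : row_free (col_mx (velocity c 1) ('D_u (ec k) z)).
  have -> : col_mx (velocity c 1) ('D_u (ec k) z) = col_mx z u *m 'J (ec k) z.
    by rewrite mul_col_mx; congr col_mx; [apply: etrans ev _|]; apply/esym/jacE.
  by rewrite /row_free mxrankMfree ?row_free_unit.
have := curv xo (minimal_ray eE sE sL EK LK z) free.
rewrite (dist_expo eE sE sL EK LK z); move/le_trans; apply.
have RE := @riemann_change R n (edom (N:=N) expo k) (cimg (atlas N k)) (ec k) gh (metric N k)
  oe (@cimg_open _ _ _ _) (@echart_img _ _ _ expo k) (@spd_metric _ _ N k)
  (fun z _ => sG z) (fun y ky => emetricE sE ky)
  (fun y ky => jac_echart_unit sE sL EK ky) (Ck_echart sE 3 k)
  (@metric_smooth _ _ N k 2) (sub_Ck (@subsetT _ _) (Ck_emetric sE 2)) z z u u kz.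
have alg (G : 'M[R]_n) (J G' : 'M[R]_n) (a a' z1 z2 u1 u2 : 'rV[R]_n) : G = J *m G' *m J^T -> a *m J = a' ->
    z1 *m J = z2 -> u1 *m J = u2 ->
    dot G' a' z2 / (dot G' z2 z2 * dot G' u2 u2 - dot G' z2 u2 ^+ 2) <=
    dot G a z1 / (dot G z1 z1 * dot G u1 u1 - dot G z1 u1 ^+ 2).
  by move=> -> <- <- <-; rewrite !dot_congr.
have := alg _ _ _ _ _ _ _ _ _ (emetricE sE kz) RE (jacE z dE) (jacE u dE).
have E (v v' u' : 'rV[R]_n) : v = v' -> sectional_curvature (expo z) v u' = sectional (metric N k) (ec k z) v' u'.
  by move=> ->.
rewrite (E _ _ _ ev); exact: id.
Qed.

(** The inequality proved in normal coordinates moves to an arbitrary chart because its two sides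
    are tensorial. *)
Lemma hess_dist_le k q a : off_pole k q ->
  hess (metric N k) (distc k) q a a <=
  eta w (distc k q) * (dot (metric N k q) a a - 'D_a (distc k) q ^+ 2).
Proof.
move=> kq; have [iq _] := kq.
have oU' := @open_off_pole k.
pose z := lchart loga k q; pose U := edom (N:=N) expo k `&` [set y | y != 0].
have ke : edom (N:=N) expo k z by exact: (lchart_dom LK).
have z0 : z != 0 by move: kq; rewrite off_poleE => -[].
have Uz : U z by [].
have oU : open U by apply: openI; [exact: open_edom|exact: open_neq0].
have dE := echart_differentiable sE ke.
have uJ := jac_echart_unit sE sL EK ke.
have [sw w0 _ wpos] := ww.
have dw s : is_derive s (1 : R) w (derive1 w s).
  by rewrite derive1E; split => //; exact: (Ck_derivable (1 : R) (sw 1) I).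
have dw1 s : is_derive s (1 : R) (derive1 w) (derive1n 2 w s).
  rewrite /derive1n /= [derive1 (derive1 w) s]derive1E; split => //.
  by rewrite derive1_funE; exact: (Ck_derivable (1 : R) (Ck_derive (1 : R) (sw 2)) I).
pose u := a *m invmx ('J (ec k) z).
have ua : 'D_u (ec k) z = a by apply: etrans (esym (jacE u dE)) _; rewrite mulmxKV.
have qE : ec k z = q by exact: (echartK LK).
have FU y : U y -> off_pole k (ec k y).
  move=> [ky y0]; split; first exact: echart_img.
  by apply/log_neq0; rewrite /echart /= cmapK // EK.
have fE y : U y -> (distc k \o ec k) y = rho0 gh y.
  by move=> [ky _] /=; rewrite /echart /= cmapK // (dist_expo eE sE sL EK LK).
have Cf := Ck_dist 2 k.
have hE := @hess_change R n U (off_pole k) (ec k) gh (metric N k) oU oU' FU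
  (fun q kq => spd_metric (proj1 kq)) (fun y _ => sG y) (fun y ky => emetricE sE (proj1 ky))
  (fun y ky => jac_echart_unit sE sL EK (proj1 ky)) (distc k) z u u
  (sub_Ck (@subIsetl _ _ _) (Ck_echart sE 2 k)) (sub_Ck (@subIsetl _ _ _) (@metric_smooth _ _ N k 1))
  (sub_Ck (@subsetT _ _) (Ck_emetric sE 1)) Cf Uz.
have hE' := etrans (esym (hess_near gh u u oU Uz fE)) hE.
have de : derivable (ec k) z u := diff_derivable dE.
have df : differentiable (distc k) (ec k z).
  by apply: (Ck1_differentiable oU' (Ck_dist 1 k)); exact: FU.
have [_ dE1] := is_derive_comp de df.
have dE2 : 'D_u (rho0 gh) z = 'D_('D_u (ec k) z) (distc k) (ec k z).
  apply: etrans dE1; apply: near_eq_derive; apply: near_open oU Uz _ => y Uy.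
  by rewrite -(fE y Uy).
have fz : rho0 gh z = distc k q by rewrite -(fE z Uz) -[RHS](congr1 (distc k) qE).
have main := hess_rho0_le (Ck_emetric sE 2) sG (emetric_radial eE sE sL EK) dw dw1 w0 wpos radial_sectional u z0.
have alg (G : 'M[R]_n) (H : 'rV[R]_n -> 'rV[R]_n -> R) (D : 'rV[R]_n -> 'rV[R]_n -> R) (b q' : 'rV[R]_n) (x x' y y' s s' : R) (G' : 'rV[R]_n -> 'M[R]_n) :
    b = a -> q' = q -> x = H q' b -> y = D q' b -> s = dot (G' q') b b -> s' = distc k q ->
    x <= derive1 w s' / w s' * (s - y ^+ 2) ->
    H q a <= eta w (distc k q) * (dot (G' q) a a - D q a ^+ 2).
  by move=> -> -> -> -> -> ->.
exact: (alg 0 (fun q a => hess (metric N k) (distc k) q a a) (fun q a => 'D_a (distc k) q) _ _ _ 0 _ 0 _ _ (metric N k) ua qE hE' dE2 (dot_emetric sE u u ke) fz main).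
Qed.

End Curvature.

(** Each coordinate is the inner product with a fixed vector, so Cauchy-Schwarz bounds it; this
    makes the sublevel sets of [rho0] bounded. *)
Lemma coord_le_rho0 (z : 'rV[R]_n) i : `|z 0 i| <= rho0 gh z * Num.sqrt (dot (gh 0) (delta_mx 0 i *m invmx (gh 0)) (delta_mx 0 i *m invmx (gh 0))).
Proof.
have [sG0 _] := sG 0; have uG := spd_unit (sG 0).
rewrite -sqrtrM; last exact: dot_ge0.
rewrite -sqrtr_sqr ler_wsqrtr //.
have <- : dot (gh 0) z (delta_mx 0 i *m invmx (gh 0)) = z 0 i.
  by rewrite dotC // dot_invmx // -rowE !mxE.
exact: dot_CS.
Qed.

(** The ball is the image under [expo] of a closed bounded set of coordinate vectors. *)
Lemma compact_closed_ball t : compact [set x | dist o x <= t].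
Proof.
have -> : [set x | dist o x <= t] = expo @` [set z | rho0 gh z <= t].
  apply/seteqP; split=> [x /=|_ [z /= zt <-]]; last by rewrite (dist_expo eE sE sL EK LK).
  by rewrite (distE eE sE sL EK LK) => xt; exists (loga x).
have cr : continuous (rho0 gh) by exact: continuous_rho0.
apply: continuous_compact.
  by apply: continuous_subspaceT => z; exact: (proj1 sE z I).
apply: bounded_closed_compact.
  pose K := \sum_i Num.sqrt (dot (gh 0) (delta_mx 0 i *m invmx (gh 0)) (delta_mx 0 i *m invmx (gh 0))).
  have K0 : 0 <= K by apply: sumr_ge0 => i _; exact: sqrtr_ge0.
  exists (t * K); split; first exact: num_real.
  move=> r tr z /= zt; have t0 : 0 <= t by apply: le_trans zt; exact: sqrtr_ge0.
  apply: mx_norm_le; first by apply: le_trans (ltW tr); exact: mulr_ge0.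
  move=> i j; rewrite (ord1 i); apply: le_trans (coord_le_rho0 z j) _; apply: le_trans (ltW tr).
  apply: ler_pM; [exact: sqrtr_ge0|exact: sqrtr_ge0|exact: zt|].
  by rewrite /K (bigD1 j) //= lerDl; apply: sumr_ge0 => l _; exact: sqrtr_ge0.
apply: (@closed_comp _ _ (rho0 gh) [set x | x <= t]); first by move=> z _; exact: cr.
exact: closed_le.
Qed.

End PoleComparison.

(** * Gradient, Laplacian and the flux of a radial function *)

Section Cholesky.
Variable R : realType.

(** Upper triangular with positive diagonal. The recursion splits off the first coordinate, in step
    with the recursion of [lebesgue_int]. *)
Fixpoint utri n : 'M[R]_n -> Prop :=
  match n with
  | 0 => fun _ => True
  | k.+1 => fun U => exists (a : R) (b : 'rV[R]_k) (U1 : 'M[R]_k),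
      [/\ utri U1, 0 < a & U = (block_mx (a%:M : 'M[R]_1) b 0 U1 : 'M[R]_(1 + k))]
  end.

Lemma utri_det n (U : 'M[R]_n) : utri U -> 0 < \det U.
Proof.
elim: n U => [|n IH] U /=; first by rewrite det_mx00.
by move=> [a [b [U' [tU a0] ->]]]; rewrite (@det_ublock _ 1 n) det_scalar1 mulr_gt0 // IH.
Qed.

(** Cholesky factorization from the lower right corner: factor that block first, solve for the
    off-diagonal row [b], and take the square root of the Schur complement. *)
Lemma spd_utri n (G : 'M[R]_n) : spd G -> exists2 U, utri U & G = U *m U^T.
Proof.
elim: n G => [|n IH] G.
  by move=> _; exists 0 => //; apply/matrixP => -[].
move: G; rewrite -[n.+1]/(1 + n)%N => G sG; have [symG pG] := sG.
set al := ulsubmx G; set be := ursubmx G; set G' := drsubmx G.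
have GE : G = block_mx al be be^T G'.
  by rewrite -[G in LHS]submxK; congr block_mx; rewrite -{1}symG -trmx_ursub.
have sG' : spd G'.
  split; first by rewrite /G' trmx_drsub symG.
  move=> v v0; have : row_mx 0 v != 0 :> 'rV[R]_(1 + n) by apply: contraNneq v0 => /(congr1 rsubmx); rewrite row_mxKr linear0 => ->.
  move/pG; rewrite /dot GE mul_row_block !mul0mx !add0r tr_row_mx mul_row_col trmx0 mulmx0 add0r; exact.
have [U' tU' GU] := IH _ sG'.
have uU : U' \in unitmx by rewrite unitmxE unitfE gt_eqF // utri_det.
have uG := spd_unit sG'; have [symG' _] := sG'.
pose b := be *m invmx (U'^T).
have bU : b *m U'^T = be by rewrite mulmxKV // unitmx_tr.
have bb : b *m b^T = be *m invmx G' *m be^T.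
  have : G' *m (invmx U'^T *m invmx U') = 1%:M.
    by rewrite GU -mulmxA [U'^T *m _]mulmxA mulmxV ?unitmx_tr // mul1mx mulmxV.
  move=> H; have GI : invmx G' = invmx U'^T *m invmx U' by rewrite -[LHS]mulmx1 -H mulKmx.
  by rewrite GI /b trmx_mul trmx_inv trmxK !mulmxA.
(* The Schur complement is the value of the quadratic form at the row with first entry 1 and
   remaining entries [- be G'^-1]. *)
have a0 : 0 < (al - b *m b^T) 0 0.
  have z0 : row_mx 1%:M (- (be *m invmx G')) != 0 :> 'rV[R]_(1 + n).
    apply/eqP => /(congr1 lsubmx); rewrite row_mxKl linear0 => /matrixP /(_ 0 0).
    by rewrite !mxE /= => /eqP; rewrite oner_eq0.
  have := pG _ z0; rewrite /dot GE mul_row_block !mul1mx tr_row_mx mul_row_col trmx1 mulmx1.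
  by rewrite !mulNmx mulmxKV // subrr mul0mx addr0 bb.
pose a := Num.sqrt ((al - b *m b^T) 0 0).
exists (block_mx (a%:M : 'M[R]_1) b 0 U' : 'M[R]_(1 + n)).
  by exists a, b, U'; split => //; rewrite sqrtr_gt0.
rewrite GE tr_block_mx trmx0 (@mulmx_block _ 1 n 1 n 1 n) !mulmx0 !mul0mx !add0r -GU bU tr_scalar_mx.
congr block_mx; last by rewrite -{1}bU trmx_mul trmxK.
have aa : a%:M *m a%:M = al - b *m b^T.
  rewrite -scalar_mxM -expr2 sqr_sqrtr ?ltW //; apply/matrixP => i j.
  by rewrite !ord1 [LHS]mxE eqxx mulr1n.
by rewrite aa addrNK.
Qed.

(** The rows of [B] form a [G]-orthonormal basis; traces with respect to [G] become sums over
    them. *)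
Lemma spd_orthonormal n (G : 'M[R]_n) : spd G -> exists2 B : 'M[R]_n, B *m G *m B^T = 1%:M & invmx G = B^T *m B.
Proof.
move=> sG; have uG := spd_unit sG; have [U tU GU] := spd_utri sG.
have uU : U \in unitmx by rewrite unitmxE unitfE gt_eqF // utri_det.
have e : invmx U *m G *m (invmx U)^T = 1%:M.
  by rewrite GU !mulmxA mulVmx // mul1mx trmx_inv mulmxV // unitmx_tr.
exists (invmx U) => //.
rewrite -[LHS]mulmx1.
suff <- : G *m ((invmx U)^T *m invmx U) = 1%:M by rewrite mulKmx.
by rewrite GU -mulmxA [U^T *m _]mulmxA trmx_inv mulmxV ?unitmx_tr // mul1mx mulmxV.
Qed.

End Cholesky.

(** * Gradient, Hessian and Laplacian in a chart *)

Section ChartOperators.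
Variables (R : realType) (n : nat).
Implicit Types (G : 'rV[R]_n -> 'M[R]_n) (f : 'rV[R]_n -> R) (y u v : 'rV[R]_n).

Definition egrad G f y : 'rV[R]_n := (\row_i pd i f y) *m invmx (G y).
Definition gn2 G f y := dot (G y) (egrad G f y) (egrad G f y).
Definition hessmx G f y := \matrix_(i, j) hess G f y (delta_mx 0 i) (delta_mx 0 j).
Definition lapl G f y := \sum_i \sum_j invmx (G y) i j * hessmx G f y i j.

Lemma derive_pdE f y v : differentiable f y -> 'D_v f y = ((\row_i pd i f y) *m v^T) 0 0.
Proof.
by move=> df; rewrite (derive_delta v df) mxE; apply: eq_bigr => i _; rewrite !mxE mulrC.
Qed.

Lemma egradE G f y v : spd (G y) -> differentiable f y -> dot (G y) (egrad G f y) v = 'D_v f y.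
Proof.
move=> sG df; have [symG _] := sG.
by rewrite dot_invmx ?(derive_pdE v df) //; exact: spd_unit.
Qed.

Lemma gn2E G f y : spd (G y) -> differentiable f y -> gn2 G f y = 'D_(egrad G f y) f y.
Proof. exact: egradE. Qed.

(** Bilinearity of the Hessian, in the form in which [tr_orthonormal] can take its trace. *)
Lemma hess_dot G f y u v (U : set 'rV[R]_n) : open U -> U y -> Ck 2 U f -> Ck 1 U G ->
  (forall z, U z -> spd (G z)) -> hess G f y u v = dot (hessmx G f y) u v.
Proof.
move=> oU Uy Cf CG sG.
have df : differentiable f y := Ck1_differentiable oU Cf Uy.
have dd a : differentiable ('D_a f) y := Ck1_differentiable oU (Ck_derive a Cf) Uy.
have lin1 a b : 'D_a ('D_b f) y = \sum_i a 0 i * 'D_(delta_mx 0 i) ('D_b f) y by exact: derive_delta.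
have symm a b : 'D_a ('D_b f) y = 'D_b ('D_a f) y by exact: (derive_symm a b oU Cf Uy).
have lin2 a b : 'D_a ('D_b f) y = \sum_i \sum_j a 0 i * b 0 j * 'D_(delta_mx 0 i) ('D_(delta_mx 0 j) f) y.
  rewrite lin1; apply: eq_bigr => i _; rewrite symm lin1 big_distrr /=; apply: eq_bigr => j _.
  by rewrite mulrA symm.
rewrite dot_sumE {1}/hess (derive_delta _ df) lin2.
have -> : \sum_k christoffel_form G y u v 0 k * 'D_(delta_mx 0 k) f y =
    \sum_i \sum_j u 0 i * v 0 j * \sum_k christoffel G k i j y * 'D_(delta_mx 0 k) f y.
  under eq_bigr do rewrite mxE big_distrl /=.
  rewrite exchange_big /=; apply: eq_bigr => i _.
  under eq_bigr do rewrite big_distrl /=.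
  rewrite exchange_big /=; apply: eq_bigr => j _; rewrite big_distrr /=; apply: eq_bigr => k _; ring.
rewrite -sumrB; apply: eq_bigr => i _; rewrite -sumrB; apply: eq_bigr => j _.
rewrite mxE /hess (derive_delta _ df).
have -> : \sum_k christoffel_form G y (delta_mx 0 i) (delta_mx 0 j) 0 k * 'D_(delta_mx 0 k) f y =
   \sum_k christoffel G k i j y * 'D_(delta_mx 0 k) f y.
  apply: eq_bigr => k _; congr (_ * _); rewrite mxE (bigD1 i) //= (bigD1 j) //= !mxE !eqxx !mulr1.
  rewrite big1 ?addr0 => [|j' jj]; last by rewrite !mxE (negPf jj) andbF mulr0.
  rewrite big1 ?addr0 // => i' ii; rewrite big1 // => j' _.
  by rewrite !mxE (negPf ii) andbF mulr0 mul0r.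
ring.
Qed.

Lemma tr_orthonormal (G H B : 'M[R]_n) : invmx G = B^T *m B ->
  \sum_i \sum_j invmx G i j * H i j = \sum_a dot H (row a B) (row a B).
Proof.
move=> ->.
transitivity (\sum_i \sum_j \sum_a H i j * B a i * B a j).
  apply: eq_bigr => i _; apply: eq_bigr => j _; rewrite mxE big_distrl /=.
  by apply: eq_bigr => a _; rewrite mxE; ring.
under eq_bigr do rewrite exchange_big /=.
rewrite exchange_big /=; apply: eq_bigr => a _; rewrite dot_sumE.
by apply: eq_bigr => i _; apply: eq_bigr => j _; rewrite !mxE.
Qed.

End ChartOperators.

Section OperatorChange.
Variables (R : realType) (n : nat).
Variables (U U' : set 'rV[R]_n) (F : 'rV[R]_n -> 'rV[R]_n) (g G : 'rV[R]_n -> 'M[R]_n).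
Hypotheses (oU : open U) (oU' : open U') (FU : forall z, U z -> U' (F z)).
Hypotheses (sG : forall z, U' z -> spd (G z)) (sg : forall z, U z -> spd (g z)).
Hypothesis gE : forall z, U z -> g z = 'J F z *m G (F z) *m ('J F z)^T.
Hypothesis JF : forall z, U z -> 'J F z \in unitmx.
Hypotheses (CF : Ck 2 U F) (CG : Ck 1 U' G) (Cg : Ck 1 U g).
Variables (f : 'rV[R]_n -> R) (y : 'rV[R]_n).
Hypotheses (Cf : Ck 2 U' f) (Uy : U y).

Let dF : differentiable F y := Ck1_differentiable_mx oU CF Uy.
Let df : differentiable f (F y) := Ck1_differentiable oU' Cf (FU Uy).
Let dfF : differentiable (f \o F) y := differentiable_comp dF df.

Lemma derive_chart v : 'D_v (f \o F) y = 'D_(v *m 'J F y) f (F y).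
Proof.
have dv : derivable F y v := diff_derivable dF.
have [_ e] := is_derive_comp dv df; apply: etrans e _.
exact: (congr1 (fun a => 'D_a f (F y)) (esym (jacE v dF))).
Qed.

Lemma egrad_change : egrad g (f \o F) y *m 'J F y = egrad G f (F y).
Proof.
apply: (dot_inj (spd_unit (sG (FU Uy)))) => w.
have alg (a b c : 'rV[R]_n) (J : 'M[R]_n) (A B : 'M[R]_n) : J \in unitmx -> A = J *m B *m J^T ->
    dot A a (w *m invmx J) = dot B b w -> dot B (a *m J) w = dot B b w.
  by move=> uJ -> <-; rewrite dot_congr mulmxKV.
apply: (alg _ _ 0 _ _ _ (JF Uy) (gE Uy)).
apply: etrans (egradE _ (sg Uy) dfF) _; apply: etrans (derive_chart _) _.
apply: etrans (esym (egradE _ (sG (FU Uy)) df)).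
by congr ('D_ _ f (F y)); exact: (mulmxKV (JF Uy)).
Qed.

Lemma gn2_change : gn2 g (f \o F) y = gn2 G f (F y).
Proof.
have alg (a b : 'rV[R]_n) (J A B : 'M[R]_n) : A = J *m B *m J^T -> a *m J = b -> dot A a a = dot B b b.
  by move=> -> <-; rewrite dot_congr.
exact: (alg _ _ _ _ _ (gE Uy) egrad_change).
Qed.

Lemma hess_changeJ u v : hess g (f \o F) y u v = hess G f (F y) (u *m 'J F y) (v *m 'J F y).
Proof.
apply: etrans (hess_change oU oU' FU sG sg gE JF u v CF CG Cg Cf Uy) _.
have alg (a b c d : 'rV[R]_n) : a = b -> c = d -> hess G f (F y) a c = hess G f (F y) b d by move=> -> ->.
exact: (alg _ _ _ _ (esym (jacE u dF)) (esym (jacE v dF))).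
Qed.

Lemma orthonormal_inv (C A : 'M[R]_n) : C *m A *m C^T = 1%:M -> invmx A = C^T *m C.
Proof.
move=> H; have uC : C \in unitmx by rewrite -mulmxA in H; exact: (proj1 (mulmx1_unit H)).
have uA : A \in unitmx.
  have : C *m (A *m C^T) = 1%:M by rewrite mulmxA.
  by move/mulmx1_unit => [_]; rewrite unitmx_mul => /andP[].
have : A *m (C^T *m C) = 1%:M.
  apply: (can_inj (mulKmx uC)); rewrite !mulmxA H mul1mx mulmx1; by [].
by move=> E; rewrite -[LHS]mulmx1 -E mulKmx.
Qed.

(** A frame orthonormal for [g] is carried by the Jacobian to one orthonormal for [G], so the two
    traces agree term by term. *)
Lemma lapl_change : lapl g (f \o F) y = lapl G f (F y).
Proof.
have [B BgB invg] := spd_orthonormal (sg Uy).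
have CfF : Ck 2 U (f \o F) := Ck_comp oU oU' FU CF Cf.
have H1 a b := hess_dot a b oU Uy CfF Cg sg.
have H2 a b := hess_dot a b oU' (FU Uy) Cf CG sG.
have invG : invmx (G (F y)) = (B *m 'J F y)^T *m (B *m 'J F y).
  have alg (A J C : 'M[R]_n) : A = J *m C *m J^T -> B *m A *m B^T = 1%:M ->
      invmx C = (B *m J)^T *m (B *m J).
    by move=> -> H; apply: orthonormal_inv; rewrite trmx_mul !mulmxA -[RHS]H !mulmxA.
  exact: (alg _ _ _ (gE Uy) BgB).
apply: etrans (tr_orthonormal _ invg) (etrans _ (esym (tr_orthonormal _ invG))).
apply: eq_bigr => a _; apply: etrans (esym (H1 _ _)) _; apply: etrans (hess_changeJ _ _) _.
by apply: etrans (H2 _ _) _; rewrite row_mul.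
Qed.

(** The p-Laplacian divided by [|grad h|^(p-2)], as long as the gradient does not vanish. *)
Definition radial_op p A h : R := lapl A h y + (p - 2) * hess A h y (egrad A h y) (egrad A h y) / gn2 A h y.

End OperatorChange.

Lemma powR_pred (R : realType) (x a : R) : 0 < x -> x `^ a = x * x `^ (a - 1).
Proof.
move=> x0; rewrite -[X in X * _](powRr1 (ltW x0)) -powRD; first by congr (_ `^ _); ring.
by rewrite (gt_eqF x0) implybT.
Qed.

(** * Divergence of the flux field *)

Section Divergence.
Variables (R : realType) (n : nat).
Variables (U : set 'rV[R]_n) (G : 'rV[R]_n -> 'M[R]_n) (f : 'rV[R]_n -> R).
Hypotheses (oU : open U) (sG : forall z, U z -> spd (G z)).
Hypotheses (CG : Ck 1 U G) (Cf : Ck 2 U f).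

Lemma spd_det_gt0 m (A : 'M[R]_m) : spd A -> 0 < \det A.
Proof.
move=> /spd_utri[T tT ->]; rewrite det_mulmx det_tr; apply: mulr_gt0; exact: utri_det.
Qed.

Lemma is_derive_sqrtdet y v : U y -> is_derive y v (fun z => Num.sqrt (\det (G z)))
  (Num.sqrt (\det (G y)) * (2^-1 * \tr (invmx (G y) *m 'D_v G y))).
Proof.
move=> Uy; have dG : derivable G y v := Ck_derivable v CG Uy.
have d0 := spd_det_gt0 (sG Uy).
have uG := spd_unit (sG Uy).
have h := is_derive_comp1 (is_derive_det (DeriveDef dG erefl)) (is_derive1_sqrt d0).
apply: is_derive_eq h _.
have alg (A D : 'M[R]_n) : A \in unitmx -> 0 < \det A ->
  \tr (\adj A *m D) * (2 * Num.sqrt (\det A))^-1 = Num.sqrt (\det A) * (2^-1 * \tr (invmx A *m D)).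
  move=> uA A0; rewrite /invmx uA -scalemxAl mxtraceZ; move: (\tr _) => t.
  have s0 : Num.sqrt (\det A) != 0 by rewrite gt_eqF // sqrtr_gt0.
  have sE : \det A = Num.sqrt (\det A) ^+ 2 by rewrite sqr_sqrtr // ltW.
  by move: (Num.sqrt _) s0 sE => s s0 ->; field.
exact: alg.
Qed.

Lemma is_derive_egrad y v : U y -> is_derive y v (egrad G f)
  (((\row_k 'D_v ('D_(delta_mx 0 k) f) y) - egrad G f y *m 'D_v G y) *m invmx (G y)).
Proof.
move=> Uy; have dG : derivable G y v := Ck_derivable v CG Uy.
have uG z : U z -> G z \in unitmx by move=> Uz; exact: spd_unit (sG Uz).
have h2 := is_derive_invmx oU Uy uG CG (DeriveDef dG erefl).
have h1 : is_derive y v (fun z => \row_i pd i f z) (\row_k 'D_v ('D_(delta_mx 0 k) f) y).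
  apply: is_derive_mxP => i j; rewrite [X in is_derive _ _ _ X]mxE.
  have -> : (fun z => (\row_i pd i f z) i j) = 'D_(delta_mx 0 j) f by apply/funext => z; rewrite mxE.
  by split=> //; exact: (Ck_derivable v (Ck_derive (delta_mx 0 j) Cf) Uy).
apply: is_derive_eq (is_derive_mulmx h1 h2) _.
by rewrite mulmxBl mulmxN /egrad !mulmxA.
Qed.

Lemma derive_hess_row y v w : U y -> ((\row_k 'D_v ('D_(delta_mx 0 k) f) y) *m w^T) 0 0 = 'D_v ('D_w f) y.
Proof.
move=> Uy; have dd : differentiable ('D_v f) y := Ck1_differentiable oU (Ck_derive v Cf) Uy.
apply: etrans _ (esym (derive_symm v w oU Cf Uy)).
have alg (h h' : 'I_n -> R) : (forall k, h k = h' k) ->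
    ((\row_k h k) *m w^T) 0 0 = \sum_k w 0 k * h' k.
  by move=> hh; rewrite mxE; apply: eq_bigr => k _; rewrite !mxE mulrC hh.
apply: etrans (alg _ _ (fun k => derive_symm v (delta_mx 0 k) oU Cf Uy)) _.
exact: (esym (derive_delta w dd)).
Qed.

Lemma hess_lowE y u v : U y -> hess G f y u v = 'D_u ('D_v f) y - low G y u v (egrad G f y).
Proof.
move=> Uy; have [symG _] := sG Uy; have uG := spd_unit (sG Uy).
have dG : differentiable G y by exact: (Ck1_differentiable_mx oU CG Uy).
have df : differentiable f y := Ck1_differentiable oU Cf Uy.
have := christoffel_lowE u v (egrad G f y) uG symG dG.
rewrite dotC // => E; have := egradE (christoffel_form G y u v) (sG Uy) df; rewrite E => E'.
exact: (congr1 (fun t => 'D_u ('D_v f) y - t) (esym E')).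
Qed.

Lemma is_derive_gn2 y v : U y -> is_derive y v (gn2 G f) (2 * hess G f y v (egrad G f y)).
Proof.
move=> Uy; have [symG _] := sG Uy; have uG := spd_unit (sG Uy).
have dG : derivable G y v := Ck_derivable v CG Uy.
have he := is_derive_egrad v Uy.
apply: is_derive_eq (is_derive_dot (DeriveDef dG erefl) he he) _.
have E := derive_hess_row v (egrad G f y) Uy.
have symD : ('D_v G y)^T = 'D_v G y.
  by apply: (derive_sym oU Uy) dG => z Uz; have [] := sG Uz.
have alg (A D : 'M[R]_n) (e d : 'rV[R]_n) (x q : R) : A \in unitmx -> A^T = A ->
   (d *m e^T) 0 0 = x -> q = 2^-1 * dot D e e ->
   dot D e e + dot A ((d - e *m D) *m invmx A) e + dot A e ((d - e *m D) *m invmx A) = 2 * (x - q).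
  move=> uA sA <- ->; rewrite [dot A e _]dotC // dot_invmx // mulmxBl.
  have sE (M M' : 'M[R]_1) : (M - M') 0 0 = M 0 0 - M' 0 0 by rewrite !mxE.
  by rewrite sE -/(dot D e e); field.
have lowE : low G y v (egrad G f y) (egrad G f y) = 2^-1 * dot ('D_v G y) (egrad G f y) (egrad G f y).
  by rewrite /low addrK.
apply: etrans (alg _ _ _ _ _ _ uG symG E lowE) _.
exact: (congr1 (fun t => 2 * t) (esym (hess_lowE v (egrad G f y) Uy))).
Qed.

(** Besides the Laplacian, the coordinate divergence of the gradient produces a trace of
    ['D_grad G]; it is exactly what the derivative of the density [sqrt (det G)] compensates. *)
Lemma sum_derive_egrad y : U y ->
  \sum_i (((\row_k 'D_(delta_mx 0 i) ('D_(delta_mx 0 k) f) y) - egrad G f y *m 'D_(delta_mx 0 i) G y) *m invmx (G y)) 0 i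
  = lapl G f y - 2^-1 * \tr (invmx (G y) *m 'D_(egrad G f y) G y).
Proof.
move=> Uy; have [symG _] := sG Uy; have uG := spd_unit (sG Uy).
have symD v : ('D_v G y)^T = 'D_v G y.
  by apply: (derive_sym oU Uy) (Ck_derivable v CG Uy) => z Uz; have [] := sG Uz.
have symI : (invmx (G y))^T = invmx (G y) by rewrite trmx_inv symG.
have alg (I De : 'M[R]_n) (D : 'I_n -> 'M[R]_n) (h : 'I_n -> 'I_n -> R) (e : 'rV[R]_n) (H : 'I_n -> 'I_n -> R) :
    I^T = I -> (forall i, (D i)^T = D i) ->
    (forall i k, H i k = h i k - 2^-1 * (dot (D i) (delta_mx 0 k) e + dot (D k) (delta_mx 0 i) e - De i k)) ->
    \sum_i (((\row_k h i k) - e *m D i) *m I) 0 i = (\sum_i \sum_k I i k * H i k) - 2^-1 * \tr (I *m De).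
  move=> sI sD HE.
  have sI' i k : I i k = I k i by rewrite -{1}sI mxE.
  pose a i k := dot (D i) (delta_mx 0 k) e.
  have aE i k : a i k = (e *m D i) 0 k.
    by rewrite /a dotC ?sD // /dot trmx_delta -colE !mxE.
  have -> : \tr (I *m De) = \sum_i \sum_k I i k * De i k.
    rewrite /mxtrace [RHS]exchange_big /=; apply: eq_bigr => i _; rewrite mxE.
    by apply: eq_bigr => k _; rewrite sI'.
  have -> : \sum_i (((\row_k h i k) - e *m D i) *m I) 0 i = \sum_i \sum_k I i k * (h i k - a i k).
    by apply: eq_bigr => i _; rewrite mxE; apply: eq_bigr => k _; rewrite aE (sI' i k) [X in X * _]mxE [(\row_ _ _) _ _]mxE [X in _ + X]mxE mulrC.
  have S : \sum_i \sum_k I i k * a k i = \sum_i \sum_k I i k * a i k.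
    by rewrite exchange_big /=; apply: eq_bigr => i _; apply: eq_bigr => k _; rewrite sI'.
  have -> : \sum_i \sum_k I i k * H i k = \sum_i \sum_k I i k * (h i k - 2^-1 * a i k) - 2^-1 * (\sum_i \sum_k I i k * a k i) + 2^-1 * \sum_i \sum_k I i k * De i k.
    rewrite !mulr_sumr -sumrB -big_split /=; apply: eq_bigr => i _.
    rewrite !mulr_sumr -sumrB -big_split /=; apply: eq_bigr => k _.
    rewrite HE -/(a i k) -/(a k i); ring.
  rewrite S addrK !mulr_sumr -sumrB; apply: eq_bigr => i _.
  rewrite !mulr_sumr -sumrB; apply: eq_bigr => k _; by field.
rewrite /lapl.
apply: (alg _ _ (fun i => 'D_(delta_mx 0 i) G y) (fun i k => 'D_(delta_mx 0 i) ('D_(delta_mx 0 k) f) y)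
  (egrad G f y) (fun i k => hessmx G f y i k) symI (fun i => symD _)) => i k.
have hm : hessmx G f y i k = hess G f y (delta_mx 0 i) (delta_mx 0 k) by rewrite mxE.
apply: etrans hm (etrans (hess_lowE _ _ Uy) _).
exact: (congr1 (fun t : R => 'D_(delta_mx 0 i) ('D_(delta_mx 0 k) f) y - 2^-1 *
  (dot ('D_(delta_mx 0 i) G y) (delta_mx 0 k) (egrad G f y) +
   dot ('D_(delta_mx 0 k) G y) (delta_mx 0 i) (egrad G f y) - t)) (dot_delta ('D_(egrad G f y) G y) i k)).
Qed.

Variables (A A' : R -> R) (a : R).

(** With [a = (p - 2) / 2] this is the field [A(f) |grad f|^(p-2) grad f], since [gn2] is the
    squared norm. *)
Definition flux z : 'rV[R]_n := (A (f z) * gn2 G f z `^ a) *: egrad G f z.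

Lemma div_flux y : U y -> is_derive (f y) (1 : R) A (A' (f y)) -> 0 < gn2 G f y ->
  \sum_i pd i (fun z => Num.sqrt (\det (G z)) * flux z 0 i) y =
  Num.sqrt (\det (G y)) * gn2 G f y `^ a *
   (A' (f y) * gn2 G f y + A (f y) *
     (2 * a * hess G f y (egrad G f y) (egrad G f y) / gn2 G f y + lapl G f y)).
Proof.
move=> Uy dA T0.
set e := egrad G f y; set s := Num.sqrt (\det (G y)).
have df : differentiable f y := Ck1_differentiable oU Cf Uy.
have dfv v : is_derive y v f (dot (G y) e v).
  split; first exact: diff_derivable.
  exact: (esym (egradE v (sG Uy) df)).
pose Pd v := (dot (G y) e v * A' (f y)) * gn2 G f y `^ a +
    A (f y) * (2 * hess G f y v e * (a * gn2 G f y `^ (a - 1))).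
have hP v : is_derive y v (fun z => A (f z) * gn2 G f z `^ a) (Pd v).
  exact: is_derive_mulr (is_derive_comp1 (dfv v) dA) (is_derive_comp1 (is_derive_gn2 v Uy) (is_derive1_powR a T0)).
pose De v := ((\row_k 'D_v ('D_(delta_mx 0 k) f) y) - e *m 'D_v G y) *m invmx (G y).
pose sd v := s * (2^-1 * \tr (invmx (G y) *m 'D_v G y)).
have hi i : pd i (fun z => Num.sqrt (\det (G z)) * flux z 0 i) y =
   sd (delta_mx 0 i) * ((A (f y) * gn2 G f y `^ a) * e 0 i) + s * (Pd (delta_mx 0 i) * e 0 i + (A (f y) * gn2 G f y `^ a) * De (delta_mx 0 i) 0 i).
  have h1 := is_derive_sqrtdet (delta_mx 0 i) Uy.
  have h2 := is_derive_coord 0 i (is_derive_egrad (delta_mx 0 i) Uy).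
  have h3 := is_derive_mulr h1 (is_derive_mulr (hP (delta_mx 0 i)) h2).
  have E : (fun z => Num.sqrt (\det (G z)) * flux z 0 i) = fun z => Num.sqrt (\det (G z)) * ((A (f z) * gn2 G f z `^ a) * egrad G f z 0 i).
    by apply/funext => z; rewrite /flux mxE.
  rewrite /pd E; have [_ ->] := h3; exact: erefl.
have symG : (G y)^T = G y by have [] := sG Uy.
have lin_P : \sum_i Pd (delta_mx 0 i) * e 0 i = Pd e.
  have hl i : hess G f y (delta_mx 0 i) e = dot (hessmx G f y) (delta_mx 0 i) e by exact: (hess_dot _ _ oU Uy Cf CG sG).
  have he : hess G f y e e = dot (hessmx G f y) e e by exact: (hess_dot _ _ oU Uy Cf CG sG).
  have dl (M : 'M[R]_n) (b : 'rV[R]_n) : \sum_i dot M (delta_mx 0 i) b * e 0 i = dot M e b.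
    rewrite dot_sumE; apply: eq_bigr => i _; rewrite dot_sumE (bigD1 i) //= [X in _ + X]big1 ?addr0.
      rewrite big_distrl /=; apply: eq_bigr => j _; rewrite mxE !eqxx /= mulr1; ring.
    by move=> j ji; rewrite big1 // => k _; rewrite mxE (negPf ji) andbF mulr0 mul0r.
  rewrite /Pd he -(dl (hessmx G f y) e) -(dl (G y) e).
  rewrite [in RHS]mulr_suml [in RHS]mulr_suml [in RHS]mulr_sumr [in RHS]mulr_suml [in RHS]mulr_sumr -big_split /=.
  by apply: eq_bigr => i _; rewrite hl (dotC e) //; ring.
have lin_s : \sum_i sd (delta_mx 0 i) * e 0 i = sd e.
  have hE v : 'D_v (fun z => Num.sqrt (\det (G z))) y = sd v by have [_] := is_derive_sqrtdet v Uy.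
  have Cs : Ck 1 U (fun z => Num.sqrt (\det (G z))).
    apply: (@Ck_comp1 _ _ 1 U [set x : R | 0 < x] (fun z => \det (G z))) => //.
    - by move=> z Uz; exact: spd_det_gt0 (sG Uz).
    - exact: Ck_det.
    - exact: Ck_sqrt.
  rewrite -hE (derive_delta e (Ck1_differentiable oU Cs Uy)); apply: eq_bigr => i _.
  by rewrite hE mulrC.
transitivity ((\sum_i sd (delta_mx 0 i) * e 0 i) * (A (f y) * gn2 G f y `^ a) + s * (\sum_i Pd (delta_mx 0 i) * e 0 i) + s * (A (f y) * gn2 G f y `^ a) * \sum_i De (delta_mx 0 i) 0 i).
  rewrite mulr_suml !mulr_sumr -!big_split /=; apply: eq_bigr => i _; rewrite hi; ring.
rewrite lin_P lin_s (_ : \sum_i De _ 0 i = lapl G f y - 2^-1 * \tr (invmx (G y) *m 'D_e G y)); last exact: sum_derive_egrad.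
rewrite /Pd /sd.
have -> : gn2 G f y `^ a = gn2 G f y * gn2 G f y `^ (a - 1).
  exact: powR_pred.
rewrite -/(gn2 G f y); move: (hess _ _ _ _ _) (lapl _ _ _) (\tr _) (gn2 G f y `^ (a - 1)) => hh ll tt pw.
have g0 : gn2 G f y != 0 by rewrite gt_eqF.
by field.
Qed.

End Divergence.

Section InducedBound.
Variables (R : realType) (m n : nat) (S : riemannian R m) (N : riemannian R n) (X : S -> N).
Hypothesis imm : isometric_immersion X.

Lemma imm_cont (x : S) : {for x, continuous X}.
Proof.
have [sX _] := imm; set i := chart_at x.
have xi : cdom (atlas S i) x by exact: chart_at_dom.
have [cX _] := sX i.
apply: (@near_eq_cont _ _ (X \o cinv (atlas S i) \o cmap (atlas S i))).
  have : nbhs x (cdom (atlas S i)) by apply: open_nbhs_nbhs; split => //; exact: cdom_open.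
  by apply: filterS => z iz /=; rewrite cmapK.
apply: continuous_comp; first exact: cmap_cont.
by apply: cX; exact: cmap_img.
Qed.

Definition imm_map i k := cmap (atlas N k) \o X \o cinv (atlas S i).

Lemma open_imm_preimage i (D : set N) : open D -> open (cimg (atlas S i) `&` cinv (atlas S i) @^-1` (X @^-1` D)).
Proof.
move=> oD; apply: open_setI_preimage; first exact: cimg_open.
  by rewrite -[X in open X]setTI; apply: open_setI_preimage => //; [exact: openT|move=> x _; exact: imm_cont].
by move=> y; exact: cinv_cont.
Qed.

Lemma Ck_imm_map i k j : Ck j (cimg (atlas S i) `&` cinv (atlas S i) @^-1` (X @^-1` cdom (atlas N k))) (imm_map i k).
Proof. by have [sX _] := imm; exact: (proj2 (sX i) k j). Qed.

End InducedBound.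

(** * The distance restricted to the submanifold *)

Section Constellation.
Variables (R : realType) (m n : nat) (S : riemannian R m) (N : riemannian R n) (X : S -> N) (o : N).
Variables (expo : 'rV[R]_n -> N) (loga : N -> 'rV[R]_n).
Hypotheses (eE : is_exp o expo) (sE : smooth_into setT expo) (sL : smooth_from loga).
Hypotheses (EK : cancel expo loga) (LK : cancel loga expo).
Hypothesis imm : isometric_immersion X.

Local Notation distc k := (dist o \o cinv (atlas N k)).

Definition rdist (x : S) := dist o (X x).
Definition rchart i := rdist \o cinv (atlas S i).
Definition rdom i := cimg (atlas S i) `&` cinv (atlas S i) @^-1` (X @^-1` [set z | z <> o]).

Lemma open_neq_pole : open [set z : N | z <> o].
Proof.
rewrite (_ : [set z | z <> o] = ~` [set o]) //; apply: closed_openC; apply: accessible_closed_set1.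
exact: hausdorff_accessible (@carrier_hausdorff _ _ N).
Qed.

Lemma open_rdom i : open (rdom i).
Proof. by apply: open_imm_preimage => //; exact: open_neq_pole. Qed.

Definition rdom_in i k := cimg (atlas S i) `&` cinv (atlas S i) @^-1` (X @^-1` (cdom (atlas N k) `&` [set z | z <> o])).

Lemma open_rdom_in i k : open (rdom_in i k).
Proof. by apply: open_imm_preimage => //; apply: openI; [exact: cdom_open|exact: open_neq_pole]. Qed.

Lemma imm_map_dom i k y : rdom_in i k y -> off_pole o k (imm_map X i k y).
Proof.
by move=> [iy [ky yo]]; split; [exact: cmap_img|rewrite /imm_map /= cmapK].
Qed.

Lemma rchart_near i k y : rdom_in i k y -> (distc k \o imm_map X i k) y = rchart i y.
Proof. by move=> [iy [ky _]] /=; rewrite /imm_map /= cmapK. Qed.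

Lemma Ck_imm_in i k j : Ck j (rdom_in i k) (imm_map X i k).
Proof. by apply: sub_Ck (Ck_imm_map imm i k j) => y [iy [ky _]]; split. Qed.

Lemma Ck_rchart i j : Ck j (rdom i) (rchart i).
Proof.
apply: Ck_local => y [iy yo]; set k := chart_at (X (cinv (atlas S i) y)).
exists (rdom_in i k); first by split => //; split => //; exact: chart_at_dom.
have oI := @open_rdom_in i k.
apply: (eq_Ck oI (@rchart_near i k)).
apply: (Ck_comp oI (@open_off_pole _ _ N o expo loga eE sL EK LK k) (@imm_map_dom i k) (Ck_imm_in i k j)).
exact: (Ck_dist eE sE sL EK LK).
Qed.

Section AtPoint.
Variables (i k : nat) (y : 'rV[R]_m).
Hypothesis yD : rdom_in i k y.
Let F := imm_map X i k.
Let g := metric S i.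
Let G := metric N k.
Let f := rchart i.
Let oI := @open_rdom_in i k.
Let oP := @open_off_pole _ _ N o expo loga eE sL EK LK k.
Let sg z : rdom_in i k z -> spd (g z). Proof. by case=> iz _; exact: spd_metric. Qed.
Let sG z : off_pole o k z -> spd (G z). Proof. by case=> iz _; exact: spd_metric. Qed.
Let gE z : rdom_in i k z -> g z = 'J F z *m G (F z) *m ('J F z)^T.
Proof. by case=> iz [kz _]; have [_ H] := imm; exact: (H i k z iz kz). Qed.
Let CF := Ck_imm_in i k 2.
Let CG : Ck 1 (off_pole o k) G := sub_Ck (@subIsetl _ _ _) (@metric_smooth _ _ N k 1).
Let Cg : Ck 1 (rdom_in i k) g := sub_Ck (@subIsetl _ _ _) (@metric_smooth _ _ S i 1).
Let Cf' := Ck_dist eE sE sL EK LK 2 k.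
Let Cf : Ck 2 (rdom_in i k) f.
Proof. by apply: sub_Ck (Ck_rchart i 2) => z [iz [_ zo]]; split. Qed.
Let dF : differentiable F y := Ck1_differentiable_mx oI CF yD.
Let qD := imm_map_dom yD.
Let df' : differentiable (distc k) (F y) := Ck1_differentiable oP Cf' qD.
Let df : differentiable f y := Ck1_differentiable oI Cf yD.

Lemma derive_rchart v : 'D_v f y = 'D_(v *m 'J F y) (distc k) (F y).
Proof.
have [_ e] := is_derive_comp (diff_derivable (v := v) dF) df'.
apply: etrans (near_eq_derive v _) (etrans e _).
  by apply: near_open oI yD _ => z zD; exact: (esym (rchart_near zD)).
exact: (congr1 (fun a => 'D_a (distc k) (F y)) (esym (jacE v dF))).
Qed.

Definition second_acc u v := cov_accel F G y u v - christoffel_form g y u v *m 'J F y.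

(** The pairing of the second fundamental form with the ambient gradient is the difference between
    the intrinsic Hessian of the restriction and the ambient Hessian on tangent vectors. *)
Lemma hess_second u v :
  dot (G (F y)) (egrad G (distc k) (F y)) (second_acc u v) =
  hess g f y u v - hess G (distc k) (F y) (u *m 'J F y) (v *m 'J F y).
Proof.
apply: etrans (egradE _ (sG qD) df') _.
apply: etrans (esym (hess_induced g G oI oP (@imm_map_dom i k) CF u v Cf' yD)) _.
have h1 := hess_near g u v oI yD (@rchart_near i k).
have alg (a b c d : 'rV[R]_n) (x z : R) : x = z -> a = b -> c = d ->
  x - hess G (distc k) (F y) a c = z - hess G (distc k) (F y) b d by move=> -> -> ->.
exact: (alg _ _ _ _ _ _ h1 (esym (jacE u dF)) (esym (jacE v dF))).
Qed.

Lemma normal_acc u v : let W := cov_accel F G y u v in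
  W - W *m G (F y) *m ('J F y)^T *m invmx (g y) *m 'J F y = second_acc u v.
Proof.
have H := tangential_accel oI oP (@imm_map_dom i k) CF CG Cg sG sg gE u v yD.
exact: (congr1 (fun c => cov_accel F G y u v - c *m 'J F y) H).
Qed.

Section Bounds.
Variable w : R -> R.
Hypotheses (ww : warping w) (curv : radial_curvature_ge o (fun r => - (derive1n 2 w r / w r))).
Let et := eta w (f y).

Lemma hess_restr_le v : hess G (distc k) (F y) (v *m 'J F y) (v *m 'J F y) <=
  et * (dot (g y) v v - ('D_v f y) ^+ 2).
Proof.
have fE : distc k (F y) = f y := rchart_near yD.
have alg (A J B : 'M[R]_n) : True by [].
have H := hess_dist_le eE sE sL EK LK ww curv (v *m 'J F y) qD.
have e1 : dot (G (F y)) (v *m 'J F y) (v *m 'J F y) = dot (g y) v v.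
  by rewrite (gE yD); exact: esym (dot_congr _ _ _ _).
have alg2 (x s s' t t' r r' : R) : s = s' -> t = t' -> r = r' ->
  x <= eta w r * (s - t ^+ 2) -> x <= eta w r' * (s' - t' ^+ 2) by move=> -> -> ->.
exact: (alg2 _ _ _ _ _ _ _ e1 (esym (derive_rchart v)) fE H).
Qed.

Let T2 := gn2 g f y.

(** Summing the Hessian bound over an orthonormal frame of S: the unit lengths add up to [m] and the
    squared derivatives of [f] to [T2]. *)
Lemma trace_restr_le : \sum_a \sum_b invmx (g y) a b * hess G (distc k) (F y) (delta_mx 0 a *m 'J F y) (delta_mx 0 b *m 'J F y)
  <= et * (m%:R - T2).
Proof.
have [B BgB invg] := spd_orthonormal (sg yD).
pose J := 'J F y.
pose H := J *m hessmx G (distc k) (F y) *m J^T.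
have HE u v : hess G (distc k) (F y) (u *m J) (v *m J) = dot H u v.
  apply: etrans (hess_dot _ _ oP qD Cf' CG sG) _; exact: (esym (dot_congr _ _ _ _)).
have -> : \sum_a \sum_b invmx (g y) a b * hess G (distc k) (F y) (delta_mx 0 a *m J) (delta_mx 0 b *m J)
    = \sum_a \sum_b invmx (g y) a b * H a b.
  apply: eq_bigr => a _; apply: eq_bigr => b _; congr (_ * _).
  by apply: etrans (HE _ _) _; exact: dot_delta.
rewrite (tr_orthonormal _ invg).
have bb a : dot (g y) (row a B) (row a B) = 1.
  have := congr1 (fun M : 'M[R]_m => M a a) BgB; rewrite !mxE eqxx mulr1n => <-.
  rewrite /dot mxE; apply: eq_bigr => j _; rewrite -row_mul !mxE; congr (_ * _).
have [symg _] := sg yD.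
have T2E : T2 = \sum_a ('D_(row a B) f y) ^+ 2.
  have D a : 'D_(row a B) f y = (egrad g f y *m g y *m B^T) 0 a.
    apply: etrans (esym (egradE _ (sg yD) df)) _; rewrite /dot !mxE; apply: eq_bigr => j _; rewrite !mxE; congr (_ * _).
  under eq_bigr do rewrite D.
  have alg (e : 'rV[R]_m) (A : 'M[R]_m) : A \in unitmx -> A^T = A -> invmx A = B^T *m B -> dot A e e = \sum_a ((e *m A *m B^T) 0 a) ^+ 2.
    move=> uA sA iA; transitivity ((e *m A *m B^T *m (e *m A *m B^T)^T) 0 0).
      rewrite !trmx_mul trmxK sA !mulmxA -[e *m A *m B^T *m B]mulmxA -iA mulmxK //.
    by rewrite [LHS]mxE; apply: eq_bigr => a _; rewrite [X in _ * X]mxE.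
  exact: alg (spd_unit (sg yD)) symg invg.
have sum1 : \sum_(a < m) 1 = m%:R :> R by rewrite sumr_const card_ord.
rewrite T2E -sum1 -sumrB mulr_sumr; apply: ler_sum => a _; rewrite -HE -(bb a).
exact: hess_restr_le.
Qed.

End Bounds.
End AtPoint.

Section Main.
Variables (w gg lam h : R -> R) (p : R).
Hypotheses (ww : warping w) (hc : constellation X o w gg lam h) (p2 : 2 <= p).
Variable x : S.
Hypothesis xo : X x <> o.
Let i := chart_at x.
Let k := chart_at (X x).
Let y := coord x.
Let f := rchart i.
Let g := metric S i.

Let iy : cimg (atlas S i) y. Proof. by apply: cmap_img; exact: chart_at_dom. Qed.
Let xE : cinv (atlas S i) y = x. Proof. by rewrite cmapK //; exact: chart_at_dom. Qed.
Let yD : rdom_in i k y.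
Proof. by split => //; split; rewrite xE //; exact: chart_at_dom. Qed.
Let qE : imm_map X i k y = coord (X x). Proof. by rewrite /imm_map /= xE. Qed.

Lemma tangencyE : tangency X o x = Num.sqrt (gn2 g f y). Proof. by []. Qed.

Lemma fyE : f y = dist o (X x). Proof. by rewrite /f /rchart /rdist /= xE. Qed.

Lemma second_formE u v : second_form X x u v = second_acc i k y u v.
Proof.
rewrite -(normal_acc yD) /second_form /normal_part /gram /cov_accel.
have dF : differentiable (imm_map X i k) y := Ck1_differentiable_mx (@open_rdom_in i k) (Ck_imm_in i k 2) yD.
have alg (W W' c : 'rV[R]_n) (A : 'M[R]_n) (q q' : 'rV[R]_n) (a b a' b' : 'rV[R]_n) (J : 'M[R]_(m, n)) : q = q' -> a = a' -> b = b' ->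
   W + christoffel_form (metric N k) q a b - (W + christoffel_form (metric N k) q a b) *m metric N k q *m J^T *m invmx (g y) *m J =
   W + christoffel_form (metric N k) q' a' b' - (W + christoffel_form (metric N k) q' a' b') *m metric N k q' *m J^T *m invmx (g y) *m J by move=> -> -> ->.
exact: (alg _ 0 0 0 _ _ _ _ _ _ _ (esym qE) (jacE u dF) (jacE v dF)).
Qed.

Lemma ambient_second u v : dot (gram (X x)) (grad_ambient X o x) (second_form X x u v) =
  hess g f y u v - hess (metric N k) (dist o \o cinv (atlas N k)) (imm_map X i k y) (u *m 'J (imm_map X i k) y) (v *m 'J (imm_map X i k) y).
Proof.
rewrite second_formE; apply: etrans (hess_second yD u v).
have alg (q q' : 'rV[R]_n) z : q = q' -> dot (metric N k q) (egrad (metric N k) (dist o \o cinv (atlas N k)) q) z =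
  dot (metric N k q') (egrad (metric N k) (dist o \o cinv (atlas N k)) q') z by move=> ->.
exact: (alg _ _ _ (esym qE)).
Qed.

(** By the Gauss formula the Laplacian is at most [eta (m - T^2) - m h] and the Hessian in the unit
    gradient direction at most [eta (1 - T^2) - lam]. Adding [p - 2] times the latter gives the
    balance minus [(p - 1) eta T^2]. *)
Lemma radial_op_le : 0 < gn2 g f y ->
  radial_op y p g f <= balance m p w lam h (f y) - eta w (f y) * ((p - 1) * gn2 g f y).
Proof.
move=> T0; have [curv _ /(_ x xo) [_ hB hC]] := hc.
set T2 := gn2 g f y in T0 *; set e := egrad g f y.
(* In dimension 0 the gradient would vanish; nonzero [m] allows clearing the normalization of the
   mean curvature. *)
have m0 : (m%:R : R) != 0.
  rewrite pnatr_eq0; apply/eqP => m0; move: T0; rewrite /T2 /gn2 -/e.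
  suff -> : e = 0 by rewrite dot0l ltxx.
  by apply/rowP => j; have := leq_ltn_trans (leq0n j) (ltn_ord j); rewrite [in X in (_ < X)%N]m0.
pose Hn u v := hess (metric N k) (dist o \o cinv (atlas N k)) (imm_map X i k y) (u *m 'J (imm_map X i k) y) (v *m 'J (imm_map X i k) y).
have AS u v : dot (gram (X x)) (grad_ambient X o x) (second_form X x u v) = hess g f y u v - Hn u v by exact: ambient_second.
have CE : m%:R * mean_convexity X o x = \sum_a \sum_b invmx (g y) a b * Hn (delta_mx 0 a) (delta_mx 0 b) - lapl g f y.
  have dsum (I : finType) (A : 'M[R]_n) u (v : I -> 'rV[R]_n) : dot A u (\sum_a v a) = \sum_a dot A u (v a).
    by apply: (big_morph (dot A u)); [move=> a b; exact: dotDr|exact: dot0r].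
  rewrite /mean_convexity /mean_curvature dotZr mulrN mulrA mulfV // mul1r dsum.
  under eq_bigr do rewrite dsum.
  rewrite /lapl -sumrN -sumrB; apply: eq_bigr => a _; rewrite -sumrN -sumrB; apply: eq_bigr => b _.
  rewrite dotZr AS -/g -mulrN opprB mulrBr mulrBr; congr (_ - _).
  by congr (_ * _); rewrite mxE.
have trH := trace_restr_le yD ww (let: And3 c _ _ := hc in c).
have HU := hess_restr_le yD ww (let: And3 c _ _ := hc in c).
pose s := Num.sqrt T2; have s0 : 0 < s by rewrite sqrtr_gt0.
have s2 : s ^+ 2 = T2 by rewrite sqr_sqrtr // ltW.
have dfy : differentiable f y.
  have oR := @open_rdom i; have yR : rdom i y by split => //; rewrite /preimage /= xE.
  exact: (Ck1_differentiable oR (Ck_rchart i 1) yR).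
have sg : spd (g y) by exact: spd_metric.
have De : 'D_e f y = T2 := esym (gn2E sg dfy).
(* The forms are quadratic, so normalizing the gradient divides them by [T2]. *)
have BE : radial_second_form X o x = Hn e e / T2 - hess g f y e e / T2.
  rewrite /radial_second_form /radial_unit tangencyE -/T2 -/s AS opprB.
  have oI := @open_rdom_in i k.
  have Cf : Ck 2 (rdom_in i k) f by apply: sub_Ck (Ck_rchart i 2) => z [iz [_ zo]]; split.
  have Cg : Ck 1 (rdom_in i k) g := sub_Ck (@subIsetl _ _ _) (@metric_smooth _ _ S i 1).
  have sgI z : rdom_in i k z -> spd (g z) by case=> iz _; exact: spd_metric.
  have hd u v : hess g f y u v = dot (hessmx g f y) u v := hess_dot u v oI yD Cf Cg sgI.
  have oP := @open_off_pole _ _ N o expo loga eE sL EK LK k.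
  have Cf' := Ck_dist eE sE sL EK LK 2 k.
  have CG : Ck 1 (off_pole o k) (metric N k) := sub_Ck (@subIsetl _ _ _) (@metric_smooth _ _ N k 1).
  have sGP z : off_pole o k z -> spd (metric N k z) by case=> iz _; exact: spd_metric.
  have hn u v : Hn u v = dot (hessmx (metric N k) (dist o \o cinv (atlas N k)) (imm_map X i k y)) (u *m 'J (imm_map X i k) y) (v *m 'J (imm_map X i k) y)
     := hess_dot _ _ oP (imm_map_dom yD) Cf' CG sGP.
  have gr : grad_restr X o x = e by [].
  rewrite gr !hd !hn -!scalemxAl !dotZl !dotZr !mulrA -invfM -expr2 s2 [T2^-1 * _]mulrC [T2^-1 * _]mulrC; by [].
have HE : Hn e e <= eta w (f y) * (T2 - T2 ^+ 2).
  have := HU e; have -> : dot (g y) e e = T2 by [].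
  by rewrite De.
have T20 : T2 != 0 by rewrite gt_eqF.
have HE2 : Hn e e / T2 <= eta w (f y) * (1 - T2).
  rewrite ler_pdivrMr //; have -> : eta w (f y) * (1 - T2) * T2 = eta w (f y) * (T2 - T2 ^+ 2) by ring.
  exact: HE.
have hCm : m%:R * h (f y) <= m%:R * mean_convexity X o x.
  by apply: ler_wpM2l => //; rewrite fyE.
(* Here [2 <= p] fixes the direction of the inequalities coming from [lam] and from the Hessian
   along the gradient. *)
have p20 : 0 <= p - 2 by rewrite subr_ge0.
have hBp : (p - 2) * lam (f y) <= (p - 2) * radial_second_form X o x.
  by apply: ler_wpM2l => //; rewrite fyE.
have HEp : (p - 2) * (Hn e e / T2) <= (p - 2) * (eta w (f y) * (1 - T2)) by exact: ler_wpM2l.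
rewrite CE in hCm; rewrite BE mulrBr in hBp.
rewrite /radial_op -/e -/T2 /balance -mulrA.
move: trH; rewrite -/T2; move: hCm hBp HEp.
move: (hess g f y e e / T2) (Hn e e / T2) (eta w (f y)) (lapl g f y) (h (f y)) (lam (f y)) => a1 a2 a3 a4 a5 a6.
rewrite /Hn /f -/f; move: (\sum_a _) => a7 H1 H2 H3 H4.
lra.
Qed.

End Main.
End Constellation.

(** * Lebesgue measure and the Riemannian volume *)

Section ProductMeasure.
Local Open Scope ereal_scope.
Context d1 d2 (T1 : measurableType d1) (T2 : measurableType d2) (R : realType).
Variables (m1 : {sigma_finite_measure set T1 -> \bar R}) (m2 : {sigma_finite_measure set T2 -> \bar R}).

Lemma prod_sigma_finite : sigma_finite setT (m1 \x m2).
Proof.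
have /sigma_finiteP[F [TF ndF Foo]] := sigma_finiteT m1.
have /sigma_finiteP[G [TG ndG Goo]] := sigma_finiteT m2.
exists (fun n => F n `*` G n).
  rewrite -setXTT TF TG predeqE => -[x y]; split.
    move=> [/= [n _ Fnx] [k _ Gky]]; exists (maxn n k) => //; split.
    - by move: x Fnx; exact/subsetPset/ndF/leq_maxl.
    - by move: y Gky; exact/subsetPset/ndG/leq_maxr.
  by move=> [n _ []/= ? ?]; split; exists n.
move=> k; have [? ?] := Foo k; have [? ?] := Goo k.
split; first exact: measurableX.
by rewrite product_measure1E// lte_mul_pinfty// ge0_fin_numE.
Qed.

(** A named copy of the product measure, so that it can carry the sigma-finite structure and be a
    factor of a further product. *)
Definition prod_measure (A : set (T1 * T2)%type) : \bar R := (m1 \x m2) A.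
HB.instance Definition _ := Measure.copy prod_measure (m1 \x m2).
HB.instance Definition _ := Measure_isSigmaFinite.Build _ _ _ prod_measure prod_sigma_finite.

Lemma prod_tonelli (f : (T1 * T2)%type -> \bar R) : measurable_fun [set: (T1 * T2)%type] f -> (forall x, 0 <= f x) ->
  \int[prod_measure]_z f z = \int[m1]_x \int[m2]_y f (x, y).
Proof. by move=> mf f0; exact: fubini_tonelli1. Qed.

End ProductMeasure.

(** The type and its measure are packaged together so that the recursion on the dimension can return
    both. *)
Record sigma_finite_space (R : realType) := SigmaFiniteSpace {
  sf_disp : measure_display;
  sf_type : measurableType sf_disp;
  sf_measure : {sigma_finite_measure set sf_type -> \bar R}
}.

Section Nest.
Variable R : realType.
Local Open Scope ereal_scope.

(* R^n as an iterated product of measurable spaces, on which Tonelli's theorem turns [lebesgue_int] into one integral *)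
Fixpoint nest (n : nat) : sigma_finite_space R :=
  match n with
  | 0%N => SigmaFiniteSpace (@dirac _ unit tt R : {sigma_finite_measure set unit -> \bar R})
  | k.+1 => SigmaFiniteSpace (prod_measure (@lebesgue_measure R) (sf_measure (nest k)))
  end.

Fixpoint to_rV (n : nat) : sf_type (nest n) -> 'rV[R]_n :=
  match n with
  | 0%N => fun _ => 0%R
  | k.+1 => fun p => (row_mx (p.1%:M : 'rV[R]_1) (to_rV p.2) : 'rV[R]_(1 + k))
  end.

Definition mu n := sf_measure (nest n).

Lemma row_mx_ord0 k (x : R) (v : 'rV[R]_k) : (row_mx (x%:M : 'rV[R]_1) v : 'rV[R]_(1 + k)) 0%R ord0 = x.
Proof. by have -> : ord0 = lshift k (ord0 : 'I_1) by [exact: val_inj]; rewrite row_mxEl mxE eqxx. Qed.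

Lemma row_mx_lift k (x : R) (v : 'rV[R]_k) j : (row_mx (x%:M : 'rV[R]_1) v : 'rV[R]_(1 + k)) 0%R (lift ord0 j) = v 0%R j.
Proof. by have -> : lift ord0 j = rshift 1 j by [exact: val_inj]; rewrite row_mxEr. Qed.

Lemma measurable_to_rV n i : measurable_fun setT (fun t : sf_type (nest n) => to_rV t 0%R i).
Proof.
elim: n i => [[]//|n IH] i.
case: (unliftP ord0 i) => [j|] ->.
  rewrite (_ : (fun _ => _) = (fun t : sf_type (nest n) => to_rV t 0%R j) \o snd); last first.
    by apply/funext => -[x t] /=; rewrite row_mx_lift.
  exact: measurableT_comp (IH j) measurable_snd.
rewrite (_ : (fun _ => _) = fst); first exact: measurable_fst.
by apply/funext => -[x t] /=; rewrite row_mx_ord0.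
Qed.

Arguments measurable_to_rV n i : clear implicits.

(** Measurability is tested after [to_rV], on the iterated product where Tonelli's theorem is
    available. *)
Definition mfun n (f : 'rV[R]_n -> \bar R) := measurable_fun setT (f \o @to_rV n).
Definition mset n (A : set 'rV[R]_n) := measurable (@to_rV n @^-1` A).

Lemma mfun_slice n (f : 'rV[R]_n.+1 -> \bar R) x : mfun f ->
  mfun (fun v : 'rV[R]_n => f (row_mx (x%:M : 'rV[R]_1) v : 'rV[R]_(1 + n))).
Proof. by move=> mf; exact: measurableT_comp mf (pair1_measurable x). Qed.

Lemma lebesgue_intE n (f : 'rV[R]_n -> \bar R) : mfun f -> (forall x, 0 <= f x) ->
  lebesgue_int f = \int[mu n]_t f (to_rV t).
Proof.
elim: n f => [|n IH] f mf f0 /=; first by rewrite integral_dirac // diracT mul1e.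
apply: etrans (esym (prod_tonelli (@lebesgue_measure R) (mu n) mf (fun x => f0 _))).
by apply: eq_integral => x _; rewrite IH //; exact: mfun_slice.
Qed.

Lemma lebesgue_int_ge0 n (f : 'rV[R]_n -> \bar R) : (forall x, 0 <= f x) -> 0 <= lebesgue_int f.
Proof.
by elim: n f => [|n IH] f f0 //=; apply: integral_ge0 => x _; exact: IH.
Qed.

Lemma measurable_slice_int n (f : 'rV[R]_n.+1 -> \bar R) : mfun f -> (forall x, 0 <= f x) ->
  measurable_fun setT (fun x : measurableTypeR R => lebesgue_int (fun v : 'rV[R]_n => f (row_mx (x%:M : 'rV[R]_1) v : 'rV[R]_(1 + n)))).
Proof.
move=> mf f0; have := @measurable_fun_fubini_tonelli_F _ _ _ _ _ (mu n) _ mf (fun x => f0 _).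
congr measurable_fun; apply/funext => x; rewrite /fubini_F lebesgue_intE //; exact: mfun_slice.
Qed.

Lemma measurable_affine (c a : R) : measurable_fun setT (fun x : measurableTypeR R => (c + x * a)%R : measurableTypeR R).
Proof. by apply: measurable_funD => //; apply: measurable_funM. Qed.

(** The pushforward of Lebesgue measure under the affine map, scaled by [a], agrees with Lebesgue
    measure on half-open intervals, hence everywhere. *)
Lemma integral_affine (c a : R) (h : measurableTypeR R -> \bar R) : (0 < a)%R ->
  measurable_fun setT h -> (forall x, 0 <= h x) ->
  \int[lebesgue_measure]_x h (c + x * a)%R = a^-1%:E * \int[lebesgue_measure]_x h x.
Proof.
move=> a0 mh h0; pose phi (x : measurableTypeR R) : measurableTypeR R := (c + x * a)%R.
have mphi : measurable_fun setT phi := @measurable_affine c a.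
have a0' : (0 <= a)%R by exact: ltW.
pose nu' := mscale (NngNum a0') (pushforward (@lebesgue_measure R) phi).
pose nu := nu' mphi.
have E A : measurable A -> lebesgue_measure A = nu A.
  apply: lebesgue_measure_unique => _ [[u v] /= uv <-].
  rewrite /nu /nu' /mscale /= /pushforward.
  have -> : phi @^-1` `]u, v] = `]((u - c) / a)%R, ((v - c) / a)%R]%classic.
    apply/seteqP; split=> x; rewrite /preimage /phi /= !in_itv /= ltr_pdivrMr // ler_pdivlMr // ltrBlDl lerBrDl //.
  rewrite !lebesgue_measure_itv /= !lte_fin ltr_pM2r ?invr_gt0 // ltrD2r.
  case: ifPn => _; last by rewrite mule0.
  by rewrite -!EFinD -EFinM -mulrBl mulrCA divff ?gt_eqF // mulr1; congr (_%:E); ring.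
rewrite [X in _ = _ * X](eq_measure_integral nu) => [|A mA _]; last exact: E.
rewrite [X in _ = _ * X]ge0_integral_mscale // ge0_integral_pushforward // preimage_setT.
by rewrite muleA -EFinM mulVf ?gt_eqF // mul1e.
Qed.

(** For a triangular matrix the first coordinate only translates the remaining ones, by [x *: b].
    The translation is absorbed in [c], and the induction leaves a one-dimensional affine
    substitution. *)
Lemma lebesgue_int_affine n (U : 'M[R]_n) (c : 'rV[R]_n) (f : 'rV[R]_n -> \bar R) : utri U ->
  mfun f -> (forall x, 0 <= f x) ->
  lebesgue_int (fun z => f (c + z *m U)%R) = ((\det U)^-1)%:E * lebesgue_int f.
Proof.
elim: n U c f => [|n IH] U c f.
  by move=> _ mf f0 /=; rewrite det_mx00 invr1 mul1e; congr f; apply/matrixP => ? [].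
move=> [a [b [U1 [tU1 a0 ->]]]] mf f0.
rewrite (@det_ublock _ 1 n) det_scalar1 invfM EFinM.
set c0 : R := c 0%R ord0; set c1 : 'rV[R]_n := rsubmx (c : 'rV[R]_(1 + n)).
have cE (x : R) (v : 'rV[R]_n) : ((c + (row_mx (x%:M : 'rV[R]_1) v : 'rV[R]_(1 + n)) *m (block_mx (a%:M : 'M[R]_1) b 0 U1 : 'M[R]_(1 + n)))%R : 'rV[R]_(1 + n))
    = row_mx ((c0 + x * a)%:M : 'rV[R]_1) (c1 + x *: b + v *m U1)%R.
  rewrite mul_row_block mulmx0 addr0 -scalar_mxM mul_scalar_mx -[c in LHS](hsubmxK (c : 'rV[R]_(1 + n))).
  rewrite -/c1 -addrA -[RHS]/(row_mx _ (c1 + (x *: b + v *m U1)))%R.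
  have -> : lsubmx (c : 'rV[R]_(1 + n)) = (c0%:M : 'rV[R]_1).
    by apply/rowP => i; rewrite !ord1 !mxE eqxx mulr1n; congr (c _ _); exact: val_inj.
  by apply: etrans (@add_row_mx R 1 1 n _ _ _ _) _; rewrite -raddfD.
rewrite /=.
under eq_integral => x _.
  under [X in lebesgue_int X]funext => v do rewrite cE.
  rewrite (IH U1 (c1 + x *: b)%R (fun v : 'rV[R]_n => f (row_mx ((c0 + x * a)%:M : 'rV[R]_1) v : 'rV[R]_(1 + n))) tU1); last 2 first.
  - exact: mfun_slice.
  - by move=> v; exact: f0.
  over.
have d0 : (0 <= (\det U1)^-1)%R by rewrite invr_ge0 ltW // utri_det.
have mh := measurable_slice_int mf f0.
have h0 (x : measurableTypeR R) : 0 <= lebesgue_int (fun v : 'rV[R]_n => f (row_mx (x%:M : 'rV[R]_1) v : 'rV[R]_(1 + n))).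
  by apply: lebesgue_int_ge0.
rewrite ge0_integralZl_EFin //; last exact: measurableT_comp mh (measurable_affine _ _).
rewrite [(a^-1)%:E * _]muleC -muleA; congr (_ * _); exact: (integral_affine c0 a0 mh h0).
Qed.

(** Used twice: as a mollifier in the change of variables and as a positive integrable function
    dominating everything of compact support. *)
Definition gaussian n (z : 'rV[R]_n) : R := expR (- dot 1%:M z z).

Lemma dot1E n (z : 'rV[R]_n) : dot 1%:M z z = (\sum_i z 0 i ^+ 2)%R.
Proof. by rewrite /dot mulmx1 mxE; apply: eq_bigr => i _; rewrite mxE expr2. Qed.

Lemma measurable_gaussian_comp d (T : measurableType d) n (p : T -> 'rV[R]_n) :
  (forall i, measurable_fun setT (fun t => p t 0%R i)) -> measurable_fun setT (gaussian (n:=n) \o p).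
Proof.
move=> mp; rewrite /gaussian /comp; apply: measurableT_comp; first exact: measurable_expR.
apply: measurableT_comp => //=; under eq_fun do rewrite dot1E.
by apply: measurable_sum => i; apply: measurable_funX.
Qed.

Lemma mfun_gaussian n : mfun (fun z : 'rV[R]_n => (gaussian z)%:E).
Proof.
apply: measurableT_comp => //; apply: (@measurable_gaussian_comp _ _ n (@to_rV n)) => i; exact: measurable_to_rV.
Qed.

Arguments mfun_gaussian n : clear implicits.

Lemma int_gaussian n : lebesgue_int (fun z : 'rV[R]_n => (gaussian z)%:E) = (Num.sqrt pi ^+ n)%:E.
Proof.
elim: n => [|n IH] /=; first by rewrite /gaussian dot0l oppr0 expR0 expr0.
have E (x : R) : lebesgue_int (fun v : 'rV[R]_n => (gaussian (row_mx (x%:M : 'rV[R]_1) v : 'rV[R]_(1 + n)))%:E) = (gauss_fun x)%:E * (Num.sqrt pi ^+ n)%:E.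
  have g0 k (z : 'rV[R]_k) : 0 <= (gaussian z)%:E by rewrite lee_fin expR_ge0.
  have ms := mfun_slice x (mfun_gaussian n.+1).
  rewrite -IH (lebesgue_intE (mfun_gaussian n)) // (lebesgue_intE ms) //.
  rewrite -ge0_integralZl_EFin //; last 2 first.
  - exact: mfun_gaussian.
  - exact: gauss_fun_ge0.
  apply: eq_integral => t _; rewrite -EFinM /gauss_fun -expRD; congr (expR _)%:E.
  rewrite !dot1E big_ord_recl row_mx_ord0 opprD; congr (_ - _)%R; apply: eq_bigr => i _; by rewrite row_mx_lift.
under eq_integral do rewrite E muleC.
rewrite ge0_integralZl_EFin //.
- by rewrite exprSr EFinM; congr (_ * _); exact: integralT_gauss.
- by move=> x _; rewrite lee_fin gauss_fun_ge0.
- by apply/measurable_EFinP; exact: measurable_gauss_fun.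
Qed.

End Nest.

(** * Measurability of open sets and of continuous functions *)

Section Measurability.
Variable R : realType.
Local Open Scope ereal_scope.

Lemma mset_box n (q : 'rV[R]_n) (r : R) : mset [set x : 'rV[R]_n | forall i, (`|x 0 i - q 0 i| < r)%R].
Proof.
rewrite /mset (_ : _ @^-1` _ = \bigcap_(i in [set: 'I_n]) [set t : sf_type (nest R n) | (`|to_rV t 0 i - q 0 i| < r)%R]); last first.
  by apply/seteqP; split=> t H; [move=> i _; exact: H|move=> i; exact: H].
apply: fin_bigcap_measurable; first exact: finite_finset.
move=> i _.
have -> : [set t : sf_type (nest R n) | (`|to_rV t 0 i - q 0 i| < r)%R] =
   setT `&` (fun t : sf_type (nest R n) => to_rV t 0%R i) @^-1` `](q 0 i - r)%R, (q 0 i + r)%R[%classic.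
  by rewrite setTI; apply/seteqP; split=> t; rewrite /preimage /= in_itv /= ltr_distl.
exact: (@measurable_to_rV R n i measurableT _ (measurable_itv _)).
Qed.

(** An open set is the union of the countably many boxes with rational centre and side parameter
    [1 / (k + 1)] that it contains. *)
Lemma mset_open n (W : set 'rV[R]_n) : open W -> mset W.
Proof.
move=> oW.
pose B (p : 'rV[rat]_n * nat) := [set x : 'rV[R]_n | forall i, (`|x 0 i - (map_mx ratr p.1) 0 i| < p.2.+1%:R^-1)%R].
pose C p := if `[< B p `<=` W >] then B p else set0.
have -> : W = \bigcup_p C p.
  apply/seteqP; split=> [x Wx|x [p _]]; last by rewrite /C; case: asboolP => // H; exact: H.
  have /nbhs_ballP[r /= r0 rW] : nbhs x W by exact: open_nbhs_nbhs.
  have r20 : (0 < r / 2)%R by rewrite divr_gt0.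
  have [k kr] := ltr_add_invr r20; rewrite add0r in kr.
  have k0 : (0 < k.+1%:R^-1 :> R)%R by rewrite invr_gt0.
  have qi i : {q : rat | (`|x 0 i - ratr q| < k.+1%:R^-1)%R}.
    apply: cid; have : (x 0 i - k.+1%:R^-1 < x 0 i + k.+1%:R^-1)%R by rewrite ltrBlDr -addrA ltrDl addr_gt0.
    by move/rat_in_itvoo => [q]; rewrite in_itv /= => H; exists q; rewrite distrC ltr_distl.
  have Bx : B (\row_i sval (qi i), k) x.
    by move=> i /=; rewrite !mxE; case: (qi i).
  exists (\row_i sval (qi i), k) => //; rewrite /C; case: asboolP => // -[]; move=> z Bz; apply: rW.
  rewrite -ball_normE /=; apply: (@le_lt_trans _ _ (2 * k.+1%:R^-1)%R); last by rewrite mulrC -ltr_pdivlMr.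
  apply: mx_norm_le; first by rewrite mulr_ge0 // ltW.
  move=> i j; rewrite (ord1 i) !mxE mulr2n mulrDl mul1r.
  have := Bx j; have := Bz j; rewrite !mxE /= => H1 H2.
  rewrite -(subrKA (ratr (sval (qi j)))); apply: le_trans (ler_normD _ _) _.
  by apply: lerD; [exact: ltW|rewrite distrC; exact: ltW].
rewrite /mset preimage_bigcup; apply: countable_bigcupT_measurable; first exact: countableP.
move=> p; rewrite /C; case: asboolP => _; first exact: mset_box.
by rewrite preimage_set0; exact: measurable0.
Qed.

Definition extend0 (T : Type) (A : set T) (f : T -> R) x := if x \in A then f x else 0%R.

Lemma extend0_in (T : Type) (A : set T) f (x : T) : A x -> extend0 A f x = f x.
Proof. by move=> Ax; rewrite /extend0 mem_set. Qed.

Lemma extend0_out (T : Type) (A : set T) f (x : T) : ~ A x -> extend0 A f x = 0%R.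
Proof. by move=> Ax; rewrite /extend0 memNset. Qed.

Lemma measurable_extend0 n (W : set 'rV[R]_n) (f : 'rV[R]_n -> R) : open W ->
  (forall x, W x -> {for x, continuous f}) -> measurable_fun setT (fun t : sf_type (nest R n) => extend0 W f (to_rV t)).
Proof.
move=> oW cf; apply: (measurability _ (RGenOInfty.measurableE R)) => _ [_ [a ->] <-].
rewrite setTI.
have oWa : open (W `&` f @^-1` [set y | (a < y)%R]) by apply: open_setI_preimage => //; exact: open_gt.
have mW := mset_open oW; have mWa := mset_open oWa.
have -> : (fun t : sf_type (nest R n) => extend0 W f (to_rV t)) @^-1` `]a, +oo[%classic =
   (@to_rV R n @^-1` (W `&` f @^-1` [set y | (a < y)%R])) `|` (if (a < 0)%R then ~` (@to_rV R n @^-1` W) else set0).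
  apply/seteqP; split=> t; rewrite /preimage /= in_itv /= andbT.
    have [Wt|Wt] := pselect (W (to_rV t)); first by rewrite extend0_in //; left.
    by rewrite extend0_out // => a0; right; rewrite a0.
  move=> [[Wt at']|]; first by rewrite extend0_in.
  by case: ifPn => // a0 Wt; rewrite extend0_out.
apply: measurableU => //; case: ifPn => _; last exact: measurable0.
exact: measurableC.
Qed.

Lemma measurable_extend0_affine n (W : set 'rV[R]_n) (f : 'rV[R]_n -> R) (x0 : 'rV[R]_n) (a : R) : open W ->
  (forall x, W x -> {for x, continuous f}) ->
  measurable_fun setT (fun t : sf_type (nest R n) => extend0 W f (x0 + a *: to_rV t)%R).
Proof.
move=> oW cf; have ca (x : 'rV[R]_n) : {for x, continuous (fun z : 'rV[R]_n => x0 + a *: z)%R}.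
  have c2 : {for x, continuous (fun z : 'rV[R]_n => a *: z)} by exact: scaler_continuous.
  exact: (cvgD (cvg_cst x0) c2).
have oW1 : open ((fun z : 'rV[R]_n => x0 + a *: z)%R @^-1` W).
  by rewrite -[X in open X]setTI; apply: open_setI_preimage => //; exact: openT.
apply: (@measurable_extend0 n _ (fun z => f (x0 + a *: z)%R) oW1) => x Wx.
by apply: (@continuous_comp _ _ _ (fun z : 'rV[R]_n => x0 + a *: z)%R f); [exact: ca|exact: cf].
Qed.

Lemma mfun_extend0 n (W : set 'rV[R]_n) (f : 'rV[R]_n -> R) : open W ->
  (forall x, W x -> {for x, continuous f}) -> mfun (fun x => (extend0 W f x)%:E).
Proof. by move=> oW cf; apply/measurable_EFinP; exact: measurable_extend0. Qed.

Lemma measurable_limn_einf d (T : measurableType d) (f : nat -> T -> \bar R) :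
  (forall k, measurable_fun setT (f k)) -> measurable_fun setT (fun x => limn_einf (f ^~ x)).
Proof.
move=> mf; apply: (emeasurable_fun_cvg (fun k x => einfs (f ^~ x) k)) => [k|x _].
  exact: measurable_fun_einfs.
by rewrite limn_einf_lim; exact: is_cvg_einfs.
Qed.

Lemma limn_einf_le (u : nat -> \bar R) C : (forall k, u k <= C) -> limn_einf u <= C.
Proof.
move=> uC; rewrite limn_einf_lim; apply: lime_le; first exact: is_cvg_einfs.
apply: nearW => k; apply: le_trans (uC k); apply: ereal_inf_lbound; by exists k => /=.
Qed.

Lemma fatou_le d (T : measurableType d) (m : {measure set T -> \bar R}) (f : nat -> T -> \bar R) (g : T -> \bar R) C :
  (forall k, measurable_fun setT (f k)) -> (forall k x, 0 <= f k x) -> measurable_fun setT g -> (forall x, 0 <= g x) ->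
  (forall x, g x <= limn_einf (f ^~ x)) -> (forall k, \int[m]_x f k x <= C) -> \int[m]_x g x <= C.
Proof.
move=> mf f0 mg g0 gf fC.
apply: (@le_trans _ _ (\int[m]_x limn_einf (f ^~ x))).
  by apply: ge0_le_integral => //; exact: measurable_limn_einf.
apply: le_trans (fatou m measurableT mf (fun k x _ => f0 k x)) _.
exact: limn_einf_le.
Qed.

Lemma utri_scalar n (a : R) : (0 < a)%R -> utri (a%:M : 'M[R]_n).
Proof.
move=> a0; elim: n => [//|n IH]; exists a, 0%R, a%:M; split => //.
exact: (@scalar_mx_block R 1 n a).
Qed.

End Measurability.

Lemma continuous_gaussian (R : realType) n : continuous (fun v : 'rV[R]_n => gaussian v).
Proof.
  have C : Ck 0 setT (fun y : 'rV[R]_n => y *m 1%:M *m y^T)%R.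
    exact: (Ck_mulmx openT (Ck_mulmx openT (Ck_id _ _) (Ck_cst _ _ _)) (Ck_trmx openT (Ck_id _ _))).
  move=> v; have cd : {for v, continuous (fun y : 'rV[R]_n => dot 1%:M y y)}.
    exact: (Ck_cont (x := v) (proj1 (Ck_mxP _ _ openT) C 0%R 0%R)).
  have cN : {for v, continuous (fun y : 'rV[R]_n => (- dot 1%:M y y)%R)} by exact: continuousN.
  exact: (continuous_comp cN (@continuous_expR R _)).
Qed.

(** * The change of variables formula *)

Section ChangeOfVariables.
Variables (R : realType) (n : nat).
Variables (W W' : set 'rV[R]_n) (phi psi : 'rV[R]_n -> 'rV[R]_n) (F : 'rV[R]_n -> R) (g : 'rV[R]_n -> \bar R).
Hypotheses (oW : open W) (W'W : forall y, W' y -> W (psi y)).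
Hypothesis psiK : forall y, W' y -> phi (psi y) = y.
Hypothesis dphi : forall x, W x -> differentiable phi x.
Hypothesis Jphi : forall x, W x -> 'J phi x \in unitmx.
Hypothesis cF : forall x, W x -> {for x, continuous F}.
Hypothesis F0 : forall x, 0 <= F x.
Hypothesis mg : mfun g.
Hypothesis gE : forall y, W' y -> g y = (F (psi y) / `|\det ('J phi (psi y))|)%:E.
Hypothesis g0 : forall y, ~ W' y -> g y = 0%E.

Local Open Scope ereal_scope.

Let eps (k : nat) : R := (k.+1%:R^-1)%R.
Let eps0 k : (0 < eps k)%R. Proof. by rewrite invr_gt0. Qed.

Let Ft := extend0 W F.
Let Ft0 x : (0 <= Ft x)%R. Proof. by rewrite /Ft /extend0; case: ifP. Qed.
Let pt x : 'rV[R]_n := \row_i extend0 W (fun z => phi z 0%R i) x.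
Let ptE x : W x -> pt x = phi x.
Proof. by move=> Wx; apply/rowP => i; rewrite mxE extend0_in. Qed.

(** The mollified graph of [phi]: its mass concentrates where [phi x] is close to [y]. Integrating
    it in the two orders compares the two sides of the formula. *)
Let H k x y : R := (Ft x * (gaussian ((eps k)^-1 *: (pt x - y)) * (eps k)^-1 ^+ n))%R.
Let H0 k x y : (0 <= H k x y)%R.
Proof. by rewrite mulr_ge0 // mulr_ge0 ?expR_ge0 // exprn_ge0 // invr_ge0 ltW. Qed.

Let c := (Num.sqrt (pi : R) ^+ n)%R.
Let c0 : (0 < c)%R. Proof. by rewrite exprn_gt0 // sqrtr_gt0 pi_gt0. Qed.

Let mFt : measurable_fun setT (fun t : sf_type (nest R n) => Ft (to_rV t)).
Proof. exact: measurable_extend0. Qed.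

Let cphi i x : W x -> {for x, continuous (fun z => phi z 0%R i)}.
Proof. by move=> Wx; apply: cont_coord; exact: differentiable_continuous (dphi Wx). Qed.

Let mpt i : measurable_fun setT (fun t : sf_type (nest R n) => pt (to_rV t) 0%R i).
Proof.
have -> : (fun t : sf_type (nest R n) => pt (to_rV t) 0%R i) = fun t => extend0 W (fun z => phi z 0%R i) (to_rV t).
  by apply/funext => t; rewrite mxE.
apply: measurable_extend0 => // x Wx; exact: cphi.
Qed.

Let mH k : measurable_fun setT (fun p : (sf_type (nest R n) * sf_type (nest R n))%type => (H k (to_rV p.1) (to_rV p.2))%:E).
Proof.
apply/measurable_EFinP; apply: measurable_funM; first exact: measurableT_comp mFt measurable_fst.
apply: measurable_funM => //.
apply: (@measurable_gaussian_comp R _ _ n (fun p : (sf_type (nest R n) * sf_type (nest R n))%type => (eps k)^-1 *: (pt (to_rV p.1) - to_rV p.2))%R) => i.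
have -> : (fun p : (sf_type (nest R n) * sf_type (nest R n))%type => ((eps k)^-1 *: (pt (to_rV p.1) - to_rV p.2))%R 0%R i) =
  fun p => ((eps k)^-1 * (pt (to_rV p.1) 0%R i - to_rV p.2 0%R i))%R.
  by apply/funext => p; rewrite mxE [in X in (_ * X)%R]mxE [in X in (_ + X)%R]mxE.
apply: measurable_funM => //; apply: measurable_funB.
  exact: measurableT_comp (mpt i) measurable_fst.
exact: measurableT_comp (@measurable_to_rV R n i) measurable_snd.
Qed.

Lemma gaussianN (z : 'rV[R]_n) : gaussian (- z)%R = gaussian z.
Proof. by rewrite /gaussian dotNl dotNr opprK. Qed.

Let int_kernel k x : \int[mu R n]_t (H k x (to_rV t))%:E = (Ft x * c)%:E.
Proof.
pose U : 'M[R]_n := ((eps k)^-1)%:M.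
pose c1 : 'rV[R]_n := (- ((eps k)^-1 *: pt x))%R.
have ie : (0 < (eps k)^-1)%R by rewrite invr_gt0.
have E y : (H k x y)%:E = (Ft x * (eps k)^-1 ^+ n)%:E * (gaussian (c1 + y *m U)%R)%:E.
  rewrite -EFinM /H -(gaussianN (c1 + _)%R) mul_mx_scalar /c1 opprD opprK scalerBr; congr (_%:E); ring.
have mG : mfun (fun y => (gaussian (c1 + y *m U)%R)%:E).
  apply/measurable_EFinP; apply: (@measurable_gaussian_comp R _ _ n (fun t => (c1 + to_rV t *m U)%R)) => i.
  have -> : (fun t : sf_type (nest R n) => (c1 + to_rV t *m U)%R 0%R i) = fun t => (c1 0%R i + (eps k)^-1 * to_rV t 0%R i)%R.
    by apply/funext => t; rewrite mul_mx_scalar !mxE.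
  by apply: measurable_funD => //; apply: measurable_funM => //; exact: measurable_to_rV.
under eq_integral do rewrite E.
rewrite ge0_integralZl_EFin //; last 2 first.
- by move=> t _; rewrite lee_fin expR_ge0.
- by rewrite mulr_ge0 // exprn_ge0 // ltW.
rewrite -(lebesgue_intE mG) => [|y]; last by rewrite lee_fin expR_ge0.
rewrite (lebesgue_int_affine c1 (f := fun y => (gaussian y)%:E) (utri_scalar n ie) (@mfun_gaussian R n)) => [|y]; last by rewrite lee_fin expR_ge0.
rewrite int_gaussian -!EFinM det_scalar; congr (_%:E).
have en : ((eps k)^-1 ^+ n != 0)%R by rewrite expf_neq0 // gt_eqF.
by rewrite -mulrA; congr (_ * _)%R; rewrite mulrA divff // mul1r.
Qed.

Let Hint k x0 y : \int[mu R n]_t (H k (to_rV t) y)%:E =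
  \int[mu R n]_t (Ft (x0 + eps k *: to_rV t) * gaussian ((eps k)^-1 *: (pt (x0 + eps k *: to_rV t) - y)))%:E.
Proof.
have mHy : mfun (fun x => (H k x y)%:E).
  apply/measurable_EFinP; apply: measurable_funM => //; apply: measurable_funM => //.
  apply: (@measurable_gaussian_comp R _ _ n (fun t => (eps k)^-1 *: (pt (to_rV t) - y))%R) => i.
  have -> : (fun t : sf_type (nest R n) => ((eps k)^-1 *: (pt (to_rV t) - y))%R 0%R i) = fun t => ((eps k)^-1 * (pt (to_rV t) 0%R i - y 0%R i))%R.
    by apply/funext => t; rewrite mxE [in X in (_ * X)%R]mxE [in X in (_ + X)%R]mxE.
  by apply: measurable_funM => //; apply: measurable_funB.
have Hy0 x : 0 <= (H k x y)%:E by rewrite lee_fin.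
have aff := lebesgue_int_affine x0 (utri_scalar n (eps0 k)) mHy Hy0.
have e0 : (0 <= eps k)%R by exact: ltW.
have en : (0 < eps k ^+ n)%R by rewrite exprn_gt0.
have mH' : mfun (fun z : 'rV[R]_n => (H k (x0 + z *m (eps k)%:M)%R y)%:E).
  have mF1 := measurable_extend0_affine x0 (eps k) oW cF.
  apply/measurable_EFinP; rewrite /H /comp; under eq_fun do rewrite mul_mx_scalar.
  apply: measurable_funM; first exact: mF1.
  apply: measurable_funM => //.
  apply: (@measurable_gaussian_comp R _ _ n (fun t => (eps k)^-1 *: (pt (x0 + eps k *: to_rV t) - y))%R) => i.
  have -> : (fun t : sf_type (nest R n) => ((eps k)^-1 *: (pt (x0 + eps k *: to_rV t) - y))%R 0%R i) = fun t => ((eps k)^-1 * (extend0 W (fun z => phi z 0%R i) (x0 + eps k *: to_rV t) - y 0%R i))%R.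
    by apply/funext => t; rewrite mxE [in X in (_ * X)%R]mxE [in X in (_ + X)%R]mxE [pt _ _ _]mxE.
  apply: measurable_funM => //; apply: measurable_funB => //.
  apply: measurable_extend0_affine => // x Wx; exact: cphi.
rewrite -(lebesgue_intE mHy) //.
have -> : lebesgue_int (fun x => (H k x y)%:E) = (eps k ^+ n)%:E * lebesgue_int (fun z : 'rV[R]_n => (H k (x0 + z *m (eps k)%:M)%R y)%:E).
  have alg (a : R) (L : \bar R) : (0 < a)%R -> L = a%:E * ((a^-1)%:E * L).
    by move=> a0; rewrite muleA -EFinM divff ?gt_eqF // mul1e.
  apply: etrans (alg _ _ en) _; congr (_ * _); rewrite -[X in (X^-1)%:E](det_scalar n (eps k)).
  exact: (esym aff).
rewrite (lebesgue_intE mH') => [|z]; last by rewrite lee_fin.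
rewrite -ge0_integralZl_EFin //; last exact: ltW.
apply: eq_integral => t _; rewrite -EFinM /H mul_mx_scalar; congr (_%:E).
rewrite exprVn mulrC -!mulrA mulVf ?gt_eqF // mulr1; by [].
Qed.

Let eps_cvg : eps k @[k --> \oo] --> (0%R : R).
Proof. exact: cvg_harmonic. Qed.

(** After the substitution [x = x0 + eps z] the difference quotient of [phi] converges to its
    differential. *)
Let kernel_cvg x0 (z : 'rV[R]_n) : W x0 ->
  (Ft (x0 + eps k *: z)%R * gaussian ((eps k)^-1 *: (pt (x0 + eps k *: z) - phi x0))%R)%:E @[k --> \oo] -->
  (F x0 * gaussian (z *m 'J phi x0)%R)%:E.
Proof.
move=> Wx; have dx := dphi Wx.
have ax : (x0 + eps k *: z)%R @[k --> \oo] --> x0.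
  rewrite -[X in _ --> X]addr0 -[X in (x0 + X)%R](scale0r z).
  by apply: cvgD; [exact: cvg_cst|apply: cvgZl; exact: eps_cvg].
have nW : \forall k \near \oo, W (x0 + eps k *: z)%R by apply: (ax W); exact: open_nbhs_nbhs.
apply: cvg_EFin; first exact: nearW.
apply: cvgM.
  apply: (@cvg_trans _ ((F (x0 + eps k *: z)%R) @[k --> \oo])).
    by apply: near_eq_cvg; apply: filterS nW => k Wk; rewrite /= /Ft extend0_in.
  exact: cvg_comp ax (cF Wx).
have dq : ((eps k)^-1 *: (pt (x0 + eps k *: z) - phi x0))%R @[k --> \oo] --> (z *m 'J phi x0)%R.
  have -> : (z *m 'J phi x0)%R = 'D_z phi x0 by exact: jacE.
  apply: (@cvg_trans _ (((eps k)^-1 *: ((phi \o shift x0) (eps k *: z) - phi x0))%R @[k --> \oo])).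
    by apply: near_eq_cvg; apply: filterS nW => k Wk; rewrite /= ptE // (addrC x0).
  have D : (h^-1 *: ((phi \o shift x0) (h *: z) - phi x0))%R @[h --> (0%R : R)^'] --> 'D_z phi x0 := diff_derivable (v := z) dx.
  apply: cvg_comp D; move=> P /= nP.
  have nP' : nbhs (0%R : R) (fun h => (h != 0)%R -> P h) by exact: nP.
  have e : \forall k \near \oo, (eps k != 0)%R -> P (eps k) by exact: (eps_cvg nP').
  by apply: filterS e => k Pk; apply: Pk; exact: lt0r_neq0 (eps0 k).
apply: cvg_comp dq _.
exact: continuous_gaussian.
Qed.

(** The integrand depends on [A] only through [A *m A^T]. The Cholesky factor has the same product
    and is triangular, so the affine substitution applies. *)
Lemma int_gaussian_linear (A : 'M[R]_n) : A \in unitmx ->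
  \int[mu R n]_t (gaussian (to_rV t *m A)%R)%:E = (c / `|\det A|)%:E.
Proof.
move=> uA.
have sA : spd (A *m A^T)%R.
  have -> : (A *m A^T = A *m 1%:M *m A^T)%R by rewrite mulmx1.
  apply: spd_congr => //; split; first exact: trmx1.
  move=> v v0; rewrite dot1E lt_def sumr_ge0 ?andbT => [|i _]; last exact: sqr_ge0.
  apply: contraNneq v0 => /eqP; rewrite psumr_eq0 => [/allP z0|i _]; last exact: sqr_ge0.
  by apply/eqP/rowP => i; rewrite mxE; apply/eqP; rewrite -sqrf_eq0; apply: z0; rewrite mem_index_enum.
have [U tU UE] := spd_utri sA.
have E (v : 'rV[R]_n) : gaussian (v *m A)%R = gaussian (0 + v *m U)%R.
  rewrite add0r /gaussian -!dot_congr !mulmx1 UE; by [].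
have dU : \det U = `|\det A|%R.
  have U0 := utri_det tU.
  have : (\det U ^+ 2 = `|\det A| ^+ 2)%R by rewrite real_normK ?num_real // !expr2 -{2}(det_tr A) -{2}(det_tr U) -!det_mulmx UE.
  by move/eqP; rewrite eqrXn2 // ?ltW // => /eqP.
under eq_integral do rewrite E.
have mG : mfun (fun y => (gaussian (0 + y *m U)%R)%:E).
  apply/measurable_EFinP; apply: (@measurable_gaussian_comp R _ _ n (fun t => (0 + to_rV t *m U)%R)) => i.
  have -> : (fun t : sf_type (nest R n) => (0 + to_rV t *m U)%R 0%R i) = fun t => (\sum_j to_rV t 0%R j * U j i)%R.
    by apply/funext => t; rewrite add0r mxE.
  by apply: measurable_sum => j; apply: measurable_funM => //; exact: measurable_to_rV.
rewrite -(lebesgue_intE mG) => [|y]; last by rewrite lee_fin expR_ge0.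
rewrite (lebesgue_int_affine 0%R (f := fun y => (gaussian y)%:E) tU (@mfun_gaussian R n)) => [|y]; last by rewrite lee_fin expR_ge0.
by rewrite int_gaussian -EFinM dU mulrC.
Qed.

(** Integrated in [y], the kernel gives [c] times [F]. Integrated in [x] at fixed [y] it has, by
    Fatou, lower limit at least [c * g y]. A second use of Fatou in [y] yields one inequality; the
    opposite one is the same statement for the inverse map. *)
Lemma change_of_variables_le : lebesgue_int g <= lebesgue_int (fun x => (extend0 W F x)%:E).
Proof.
have g_ge0 y : 0 <= g y.
  have [Wy|Wy] := pselect (W' y); last by rewrite g0.
  by rewrite gE // lee_fin divr_ge0.
have mFt' : mfun (fun x => (Ft x)%:E) by exact/measurable_EFinP.
rewrite (lebesgue_intE mg) // (lebesgue_intE mFt') => [|x]; last by rewrite lee_fin.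
(* Off [W'] the function [g] vanishes. On [W'] the inner integral is rescaled around the preimage
   [x0 = psi y], where the kernel converges pointwise. *)
have cg t : (c%:E * g (to_rV t)) <= limn_einf (fun k => \int[mu R n]_s (H k (to_rV s) (to_rV t))%:E).
  have [Wy|Wy] := pselect (W' (to_rV t)); last first.
    rewrite g0 // mule0; rewrite limn_einf_lim; apply: lime_ge; first exact: is_cvg_einfs.
    apply: nearW => k; apply: le_ereal_inf_tmp => _ [j /= _ <-]; apply: integral_ge0 => s _; by rewrite lee_fin.
  set y := to_rV t in Wy *; pose x0 := psi y; have Wx : W x0 by exact: W'W.
  have fx : phi x0 = y by exact: psiK.
  have -> : c%:E * g y = \int[mu R n]_s (F x0 * gaussian (to_rV s *m 'J phi x0)%R)%:E.
    under eq_integral do rewrite EFinM.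
    rewrite ge0_integralZl_EFin //; last 2 first.
    - by move=> s _; rewrite lee_fin expR_ge0.
    - apply/measurable_EFinP; apply: (@measurable_gaussian_comp R _ _ n (fun t => (to_rV t *m 'J phi x0)%R)) => i.
      have -> : (fun t : sf_type (nest R n) => (to_rV t *m 'J phi x0)%R 0%R i) = fun t => (\sum_j to_rV t 0%R j * 'J phi x0 j i)%R.
        by apply/funext => s; rewrite mxE.
      by apply: measurable_sum => j; apply: measurable_funM => //; exact: measurable_to_rV.
    rewrite int_gaussian_linear; last exact: Jphi.
    by rewrite gE // -!EFinM -/x0; congr (_%:E); rewrite mulrCA.
  have mE k : measurable_fun setT (fun s : sf_type (nest R n) => (Ft (x0 + eps k *: to_rV s) * gaussian ((eps k)^-1 *: (pt (x0 + eps k *: to_rV s) - y)))%:E).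
    apply/measurable_EFinP; apply: measurable_funM; first exact: measurable_extend0_affine.
    apply: (@measurable_gaussian_comp R _ _ n (fun t => (eps k)^-1 *: (pt (x0 + eps k *: to_rV t) - y))%R) => i.
    have -> : (fun t : sf_type (nest R n) => ((eps k)^-1 *: (pt (x0 + eps k *: to_rV t) - y))%R 0%R i) = fun t => ((eps k)^-1 * (extend0 W (fun z => phi z 0%R i) (x0 + eps k *: to_rV t) - y 0%R i))%R.
      by apply/funext => s; rewrite mxE [in X in (_ * X)%R]mxE [in X in (_ + X)%R]mxE [pt _ _ _]mxE.
    apply: measurable_funM => //; apply: measurable_funB => //.
    apply: measurable_extend0_affine => // x Wz; exact: cphi.
  have E0 k s : 0 <= (Ft (x0 + eps k *: to_rV s) * gaussian ((eps k)^-1 *: (pt (x0 + eps k *: to_rV s) - y)))%:E.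
    by rewrite lee_fin mulr_ge0 // expR_ge0.
  have := fatou (mu R n) measurableT mE (fun k s _ => E0 k s).
  rewrite (_ : (fun k => \int[mu R n]_x _) = fun k => \int[mu R n]_s (H k (to_rV s) y)%:E); last first.
    by apply/funext => k; rewrite (Hint k x0 y).
  apply: le_trans; rewrite le_eqVlt; apply/orP; left; apply/eqP; apply: eq_integral => s _.
  have kc := @kernel_cvg x0 (to_rV s) Wx; rewrite fx in kc; have [K _] := cvg_limn_einf_sup kc.
  exact: (esym K).
have mHy k : measurable_fun setT (fun t : sf_type (nest R n) => \int[mu R n]_s (H k (to_rV s) (to_rV t))%:E).
  by have := @measurable_fun_fubini_tonelli_G _ _ _ _ _ (mu R n) _ (mH k) (fun p => H0 k _ _).
have Hy0 k t : 0 <= \int[mu R n]_s (H k (to_rV s) (to_rV t))%:E.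
  by apply: integral_ge0 => s _; rewrite lee_fin.
have swap k : \int[mu R n]_t \int[mu R n]_s (H k (to_rV s) (to_rV t))%:E = c%:E * \int[mu R n]_t (Ft (to_rV t))%:E.
  have := @fubini_tonelli _ _ _ _ _ (mu R n) (mu R n) _ (mH k) (fun p => H0 k _ _).
  rewrite /fubini_F /fubini_G /= => <-.
  under eq_integral do rewrite int_kernel EFinM muleC.
  by rewrite ge0_integralZl_EFin // ?ltW // => t _; rewrite lee_fin.
have mcg : measurable_fun setT (fun t : sf_type (nest R n) => c%:E * g (to_rV t)).
  by apply: emeasurable_funM => //; exact: measurable_cst.
have cE0 : 0 <= c%:E by rewrite lee_fin ltW.
have H1 : \int[mu R n]_t (c%:E * g (to_rV t)) <= c%:E * \int[mu R n]_t (Ft (to_rV t))%:E.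
  apply: (fatou_le mHy Hy0 mcg _ cg) => [t|k]; first exact: mule_ge0.
  by rewrite swap.
have E : \int[mu R n]_t (c%:E * g (to_rV t)) = c%:E * \int[mu R n]_t g (to_rV t).
  by apply: ge0_integralZl_EFin => //; exact: ltW.
by move: H1; rewrite E lee_pmul2l // lte_fin.
Qed.

End ChangeOfVariables.

Section ContinuousReal.
Variables (R : realType) (T : topologicalType).
Implicit Types f g : T -> R.

Lemma cont_mulr f g x : {for x, continuous f} -> {for x, continuous g} -> {for x, continuous (fun z => f z * g z)}.
Proof. by move=> cf cg; exact: (cvgM cf cg). Qed.

Lemma cont_addr f g x : {for x, continuous f} -> {for x, continuous g} -> {for x, continuous (fun z => f z + g z)}.
Proof. by move=> cf cg; exact: (cvgD cf cg). Qed.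

Lemma cont_invr f x : f x != 0 -> {for x, continuous f} -> {for x, continuous (fun z => (f z)^-1)}.
Proof. by move=> f0 cf; exact: (cvgV f0 cf). Qed.

Lemma cont_oppr f x : {for x, continuous f} -> {for x, continuous (fun z => - f z)}.
Proof. by move=> cf; exact: (cvgN cf). Qed.

End ContinuousReal.

(** * The Riemannian volume integral and its independence of charts *)

Section Volume.
Variables (R : realType) (n : nat) (M : riemannian R n).
Local Notation U k := (cdom (atlas M k)).
Local Notation C k := (cimg (atlas M k)).
Local Notation ci k := (cinv (atlas M k)).

Definition density k y := Num.sqrt (\det (metric M k y)).

Lemma density_ge0 k y : 0 <= density k y. Proof. exact: sqrtr_ge0. Qed.

Lemma cont_density k y : C k y -> {for y, continuous (density k)}.
Proof.
move=> ky; have oC := @cimg_open _ _ _ (atlas M k).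
apply: (@continuous_comp _ _ _ (fun y => \det (metric M k y)) Num.sqrt); last exact: sqrt_continuous.
exact: (Ck_cont (Ck_det oC (@metric_smooth _ _ M k 0)) ky).
Qed.

Definition preim k (A : set M) := C k `&` ci k @^-1` A.
Definition cfun k (f : M -> R) y := f (ci k y) * density k y.
Definition cint k (A : set M) (f : M -> R) : \bar R := lebesgue_int (fun y => (extend0 (preim k A) (cfun k f) y)%:E).

Section Fixed.
Variable f : M -> R.
Hypotheses (cf : continuous f) (f0 : forall x, 0 <= f x).

Lemma cont_cfun k y : C k y -> {for y, continuous (cfun k f)}.
Proof.
move=> ky; apply: cont_mulr; last exact: cont_density.
by apply: (@continuous_comp _ _ _ (ci k) f); [exact: cinv_cont|exact: cf].
Qed.

Lemma cfun_ge0 k y : 0 <= cfun k f y.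
Proof. by rewrite mulr_ge0 // density_ge0. Qed.

Lemma extend0_ge0 k A y : (0 <= (extend0 (preim k A) (cfun k f) y)%:E)%E.
Proof. by rewrite lee_fin /extend0; case: ifP => // _; exact: cfun_ge0. Qed.

Lemma metric_det j k y : C j y -> U k (ci j y) ->
  density j y = `|\det ('J (transition M j k) y)| * density k (transition M j k y).
Proof.
move=> jy ky; have := metric_change jy ky; cbv zeta; rewrite -/(transition M j k) /density => ->.
rewrite !det_mulmx det_tr mulrAC -expr2 sqrtrM ?sqr_ge0 // sqrtr_sqr; by [].
Qed.

(** The square roots of the metric determinants differ by the Jacobian determinant of the transition
    map, as the change of variables requires. *)
Lemma cint_le i k D : open D -> D `<=` U i -> D `<=` U k -> (cint k D f <= cint i D f)%E.
Proof.
move=> oD Di Dk.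
have oW : open (preim i D) by exact: open_chart_preimage.
have oW' : open (preim k D) by exact: open_chart_preimage.
have tr j l y : D `<=` U l -> preim j D y -> ci l (transition M j l y) = ci j y.
  by move=> Dl [_ Dy]; rewrite /transition /= cmapK //; exact: Dl.
have W'W y : preim k D y -> preim i D (transition M k i y).
  move=> ky; have [_ Dy] := ky; split; first by apply: cmap_img; exact: Di.
  by rewrite /preimage /= tr.
have trK y : preim k D y -> transition M i k (transition M k i y) = y.
  move=> ky; rewrite {1}/transition /= (tr _ _ _ Di ky); have [ky' _] := ky; exact: cinvK.
have tdom x : preim i D x -> transition_dom M i k x.
  by move=> [ix Dx]; split => //; exact: Dk.
have dT x : preim i D x -> differentiable (transition M i k) x.
  move=> /tdom tx; exact: (Ck1_differentiable_mx (@transition_open _ _ M i k) (@Ck_transition _ _ M 1 i k) tx).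
have JT x : preim i D x -> 'J (transition M i k) x \in unitmx.
  move=> ix; have [ix' Dx] := ix; rewrite unitmxE unitfE; apply/eqP => d0.
  have := metric_det ix' (Dk _ Dx); rewrite d0 normr0 mul0r; apply/eqP.
  by rewrite gt_eqF // sqrtr_gt0; apply: spd_det_gt0; exact: spd_metric.
apply: (@change_of_variables_le R n (preim i D) (preim k D) (transition M i k) (transition M k i) (cfun i f)
   (fun y => (extend0 (preim k D) (cfun k f) y)%:E) oW W'W trK dT JT).
- by move=> x [ix _]; exact: cont_cfun.
- exact: cfun_ge0.
- by apply: mfun_extend0 => // y [ky _]; exact: cont_cfun.
- move=> y ky; rewrite extend0_in //; congr (_%:E).
  have iy := W'W y ky; have [iy' Dy] := iy.
  rewrite /cfun (tr _ _ _ Di ky) (metric_det iy' (Dk _ Dy)) trK //.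
  have d0 : `|\det ('J (transition M i k) (transition M k i y))| != 0.
    by rewrite normr_eq0 -unitfE -unitmxE; exact: JT.
  have alg (a b c : R) : a != 0 -> b * c = b * (a * c) / a by move=> a0; field.
  exact: alg.
- by move=> y ky; rewrite extend0_out.
Qed.

Lemma cint_eq i k D : open D -> D `<=` U i -> D `<=` U k -> cint k D f = cint i D f.
Proof. by move=> oD Di Dk; apply/eqP; rewrite eq_le !cint_le. Qed.

Definition mchart (A : set M) := forall k, mset (preim k A).

Lemma mchart_open A : open A -> mchart A.
Proof. by move=> oA k; apply: mset_open; exact: open_chart_preimage. Qed.

Lemma mchartD A B : mchart A -> mchart B -> mchart (A `\` B).
Proof.
move=> mA mB k; rewrite /mset (_ : _ @^-1` _ = (@to_rV R n @^-1` preim k A) `\` (@to_rV R n @^-1` preim k B)).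
  by apply: measurableD; [exact: mA|exact: mB].
apply/seteqP; split=> t; rewrite /preim /preimage /=; first by move=> [kt [At Bt]]; split => // -[].
by move=> [[kt At] Bt]; do 2 split => //; move=> Bt'; apply: Bt.
Qed.

Lemma mfun_cint k A : mchart A -> mfun (fun y => (extend0 (preim k A) (cfun k f) y)%:E).
Proof.
move=> mA; apply/measurable_EFinP.
have oC := @cimg_open _ _ _ (atlas M k).
have m1 := @measurable_extend0 R n (C k) (cfun k f) oC (@cont_cfun k).
have -> : (fun t => extend0 (preim k A) (cfun k f) (@to_rV R n t)) =
   (fun t => extend0 (C k) (cfun k f) (to_rV t) * \1_(@to_rV R n @^-1` preim k A) t).
  apply/funext => t; rewrite indicE; have [kA|kA] := pselect (preim k A (to_rV t)).
    by rewrite mem_set // mulr1 !extend0_in //; case: kA.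
  by rewrite memNset // mulr0 extend0_out.
by apply: measurable_funM => //; apply: measurable_indic; exact: mA.
Qed.

Lemma cintE k A : mchart A -> cint k A f = (\int[mu R n]_t (extend0 (preim k A) (cfun k f) (to_rV t))%:E)%E.
Proof. by move=> mA; apply: lebesgue_intE; [exact: mfun_cint|exact: extend0_ge0]. Qed.

Lemma cint_split k A B : mchart A -> mchart B -> cint k A f = (cint k (A `\` B) f + cint k (A `&` B) f)%E.
Proof.
move=> mA mB; have mD := mchartD mA mB.
have mI : mchart (A `&` B) by rewrite -setDD; exact: mchartD.
rewrite !cintE // -ge0_integralD //; last 4 first.
- by move=> t _; exact: extend0_ge0.
- exact: mfun_cint.
- by move=> t _; exact: extend0_ge0.
- exact: mfun_cint.
apply: eq_integral => t _; rewrite -EFinD; congr (_%:E).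
have [kt|kt] := pselect (C k (to_rV t)); last by rewrite !extend0_out ?addr0 // => -[].
have [At|At] := pselect (A (ci k (to_rV t))); last by rewrite !extend0_out ?addr0 // => -[_] // [] //.
have [Bt|Bt] := pselect (B (ci k (to_rV t))).
  by rewrite (extend0_out (A := preim k (A `\` B))) ?add0r ?extend0_in // => -[_ []].
by rewrite (extend0_out (A := preim k (A `&` B))) ?addr0 ?extend0_in // => -[_ []].
Qed.

Lemma cint_mono k A B : mchart A -> mchart B -> A `<=` B -> (cint k A f <= cint k B f)%E.
Proof.
move=> mA mB AB; rewrite (cint_split k mB mA) setIidr // leeDr //; apply: lebesgue_int_ge0 => y; exact: extend0_ge0.
Qed.

(** The points of [D] lying in none of the first [j] charts. The sets on which [chart_at] is
    constant have this form, and they are not open. *)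
Fixpoint least j (D : set M) : set M := if j is l.+1 then least l D `\` U l else D.

Lemma mchart_least j D : open D -> mchart (least j D).
Proof.
move=> oD; elim: j => [|j IH] /=; first exact: mchart_open.
by apply: mchartD => //; apply: mchart_open; exact: cdom_open.
Qed.

Lemma leastP j D x : least j D x <-> D x /\ forall l, (l < j)%N -> ~ U l x.
Proof.
elim: j => [|j IH] /=; first by split=> [Dx|[]].
split=> [[/IH [Dx H] Ux]|[Dx H]].
  by split=> // l; rewrite ltnS leq_eqVlt => /orP[/eqP ->|] //; exact: H.
by split; [apply/IH; split=> // l lj; apply: H; exact: ltnW|exact: H].
Qed.

Lemma least_setI j D E : least j D `&` E = least j (D `&` E).
Proof.
apply/seteqP; split=> x; first by move=> [/leastP[Dx H] Ex]; apply/leastP.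
by move=> /leastP[[Dx Ex] H]; split => //; apply/leastP.
Qed.

(** Chart independence holds on open sets and passes to differences by subtracting the part inside
    chart [j]; the subtraction is legitimate because that part has finite integral. *)
Lemma cint_least i k j D : (cint i (U i) f < +oo)%E -> open D -> D `<=` U i -> D `<=` U k ->
  cint k (least j D) f = cint i (least j D) f.
Proof.
move=> fin; elim: j D => [|j IH] D oD Di Dk; first exact: cint_eq.
have mD := mchart_least j oD; have mU := mchart_open (@cdom_open _ _ _ (atlas M j)).
have oI : open (D `&` U j) by apply: openI => //; exact: cdom_open.
have Ei := IH D oD Di Dk.
have EI := IH _ oI (subset_trans (@subIsetl _ _ _) Di) (subset_trans (@subIsetl _ _ _) Dk).
rewrite (cint_split k mD mU) (cint_split i mD mU) least_setI EI in Ei.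
have fI : cint i (least j (D `&` U j)) f \is a fin_num.
  rewrite ge0_fin_numE; last by apply: lebesgue_int_ge0 => y; exact: extend0_ge0.
  apply: le_lt_trans fin; apply: cint_mono.
  - exact: mchart_least.
  - by apply: mchart_open; exact: cdom_open.
  - by move=> x /leastP[[Dx _] _]; exact: Di.
by have := congr1 (fun z => z - cint i (least j (D `&` U j)) f)%E Ei; rewrite !addeK.
Qed.

Definition piece k := least k (U k).

Lemma mchart_piece k : mchart (piece k).
Proof. by apply: mchart_least; exact: cdom_open. Qed.

Lemma pieceP k x : piece k x <-> chart_at x = k.
Proof.
rewrite /chart_at; case: ex_minnP => j /asboolP jx jmin; split=> [/leastP[kx H]|<-].
  apply/eqP; rewrite eqn_leq jmin; last exact/asboolP.
  by rewrite leqNgt; apply/negP => /H; exact.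
apply/leastP; split=> // l lj lx; have := jmin l (asboolT lx); by rewrite leqNgt lj.
Qed.

Lemma volume_intE : volume_int f = (\sum_(k <oo) cint k (piece k) f)%E.
Proof.
apply: eq_eseriesr => k _; rewrite /cint; congr lebesgue_int; apply/funext => y.
case: asboolP => [[ky /pieceP kp]|H]; first by rewrite extend0_in.
by rewrite extend0_out // => -[ky kp]; apply: H; split => //; exact/pieceP.
Qed.

Lemma cint_support k A B : (forall x, A x -> ~ B x -> f x = 0) -> cint k A f = cint k (A `&` B) f.
Proof.
move=> fB; congr lebesgue_int; apply/funext => y; congr (_%:E).
have [ky|ky] := pselect (C k y); last by rewrite !extend0_out // => -[].
have [Ay|Ay] := pselect (A (ci k y)); last by rewrite !extend0_out // => -[_] // [].
have [By|By] := pselect (B (ci k y)); first by rewrite !extend0_in.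
by rewrite [RHS]extend0_out => [|[_ []//]]; rewrite extend0_in // /cfun fB // mul0r.
Qed.

(** Each piece can be moved to chart [i], where the pieces are disjoint and cover, so the series of
    integrals is one integral. *)
Lemma volume_chart i : (forall x, ~ U i x -> f x = 0) -> (cint i (U i) f < +oo)%E ->
  volume_int f = cint i (U i) f.
Proof.
move=> fU fin; rewrite volume_intE.
have E k : cint k (piece k) f = cint i (piece k) f.
  rewrite (@cint_support k _ (U i)) => [|x _]; last exact: fU.
  rewrite (@cint_support i _ (U i)) => [|x _]; last exact: fU.
  rewrite /piece least_setI; apply: cint_least => //.
  - by apply: openI; exact: cdom_open.
under eq_eseriesr do rewrite E.
rewrite cintE; last by apply: mchart_open; exact: cdom_open.
under eq_eseriesr do rewrite (cintE _ (mchart_piece _)).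
rewrite -integral_nneseries //; last 2 first.
- by move=> k; apply: mfun_cint; exact: mchart_piece.
- by move=> k t _; exact: extend0_ge0.
apply: eq_integral => t _.
have [it|it] := pselect (C i (to_rV t)); last first.
  rewrite extend0_out => [|[]//]; rewrite eseries0 // => k _ _; by rewrite extend0_out // => -[].
set x := ci i (to_rV t); set k := chart_at x.
rewrite (@nneseriesD1 _ _ k) //; last by move=> *; exact: extend0_ge0.
rewrite eseries0 ?adde0; last first.
  move=> j _ jk; rewrite extend0_out // => -[_ /pieceP kj]; move: jk; by rewrite -kj eqxx.
rewrite !extend0_in //; first by split => //; exact: cinv_dom.
by split => //; exact/pieceP.
Qed.

Lemma volume_ge0 : (0 <= volume_int f)%E.
Proof.
rewrite volume_intE; apply: nneseries_ge0 => k _ _; apply: lebesgue_int_ge0 => y; exact: extend0_ge0.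
Qed.

(** The quotient of the integrand by the Gaussian of the chart is continuous, hence bounded on [K];
    a multiple of the Gaussian then dominates. *)
Lemma cint_finite i K : compact K -> K `<=` U i -> (forall x, ~ K x -> f x = 0) -> (cint i (U i) f < +oo)%E.
Proof.
move=> cK KU fK.
pose q x := f x * (density i (cmap (atlas M i) x) / gaussian (cmap (atlas M i) x)).
have cq : {within K, continuous q}.
  apply: continuous_in_subspaceT => x /set_mem Kx; have Ux := KU x Kx.
  have cm : {for x, continuous (cmap (atlas M i))} by exact: cmap_cont.
  have cd : {for x, continuous (density i \o cmap (atlas M i))}.
    by apply: continuous_comp => //; apply: cont_density; exact: cmap_img.
  have cg : {for x, continuous (gaussian (n:=n) \o cmap (atlas M i))}.
    by apply: continuous_comp => //; exact: continuous_gaussian.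
  have gn0 : (gaussian (n:=n) \o cmap (atlas M i)) x != 0 by rewrite gt_eqF // expR_gt0.
  exact: (cont_mulr (@cf x) (cont_mulr cd (cont_invr gn0 cg))).
have [B [_ HB]] := compact_bounded (continuous_compact cq cK).
pose B1 := Num.max B 0 + 1.
have qB x : K x -> q x <= B1.
  move=> Kx; apply: le_trans (ler_norm _) _; apply: HB; last by exists x.
  by rewrite /B1 ltr_pwDr // le_max lexx.
have B10 : 0 <= B1 by rewrite /B1 addr_ge0 // le_max lexx orbT.
rewrite cintE; last by apply: mchart_open; exact: cdom_open.
apply: (@le_lt_trans _ _ (\int[mu R n]_t (B1%:E * (gaussian (to_rV t))%:E)))%E.
  apply: ge0_le_integral => //.
  - by move=> t _; exact: extend0_ge0.
  - by apply: mfun_cint; apply: mchart_open; exact: cdom_open.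
  - by apply: emeasurable_funM => //; exact: mfun_gaussian.
  move=> t _; rewrite -EFinM lee_fin; set y := to_rV t.
  have g0 : 0 < gaussian y by exact: expR_gt0.
  have [iy|iy] := pselect (preim i (U i) y); last by rewrite extend0_out // mulr_ge0 // ltW.
  rewrite extend0_in //; have [Ky|Ky] := pselect (K (ci i y)); last by rewrite /cfun fK // mul0r mulr_ge0 // ltW.
  have := qB _ Ky; rewrite /q cinvK; last by case: iy.
  by rewrite mulrA ler_pdivrMr.
rewrite ge0_integralZl_EFin //; last 2 first.
- by move=> t _; rewrite lee_fin expR_ge0.
- exact: mfun_gaussian.
rewrite -(lebesgue_intE (@mfun_gaussian R n)) => [|y]; last by rewrite lee_fin expR_ge0.
by rewrite int_gaussian -EFinM ltry.
Qed.

End Fixed.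

Lemma volume_add (f g : M -> R) : continuous f -> continuous g -> (forall x, 0 <= f x) -> (forall x, 0 <= g x) ->
  volume_int (fun x => f x + g x) = (volume_int f + volume_int g)%E.
Proof.
move=> cf cg f0 g0; have cfg : continuous (fun x => f x + g x) by move=> x; apply: cont_addr; [exact: cf|exact: cg].
have fg0 x : 0 <= f x + g x by rewrite addr_ge0.
rewrite !volume_intE -nneseriesD; last 2 first.
- by move=> k _ _; apply: lebesgue_int_ge0 => y; exact: extend0_ge0.
- by move=> k _ _; apply: lebesgue_int_ge0 => y; exact: extend0_ge0.
apply: eq_eseriesr => k _; have mp := @mchart_piece k.
rewrite !cintE // -ge0_integralD //; last 4 first.
- by move=> t _; exact: extend0_ge0.
- exact: mfun_cint.
- by move=> t _; exact: extend0_ge0.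
- exact: mfun_cint.
apply: eq_integral => t _; rewrite -EFinD; congr (_%:E); rewrite /extend0; case: ifP => _; last by rewrite addr0.
by rewrite /cfun mulrDl.
Qed.

Lemma volume_le (f g : M -> R) : continuous f -> continuous g -> (forall x, 0 <= f x <= g x) -> (volume_int f <= volume_int g)%E.
Proof.
move=> cf cg fg; have f0 x : 0 <= f x by case/andP: (fg x).
have g0 x : 0 <= g x by case/andP: (fg x) => a b; exact: le_trans b.
rewrite !volume_intE; apply: lee_nneseries => [k _ _|k _].
  by apply: lebesgue_int_ge0 => y; exact: extend0_ge0.
have mp := @mchart_piece k; rewrite !cintE //; apply: ge0_le_integral => //.
- by move=> t _; exact: extend0_ge0.
- exact: mfun_cint.
- exact: mfun_cint.
- move=> t _; rewrite lee_fin /extend0; case: ifP => // _; rewrite /cfun ler_wpM2r ?density_ge0 //.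
  by case/andP: (fg (ci k (to_rV t))).
Qed.

End Volume.

(** * The divergence theorem and the flux inequality *)

Section DivergenceIntegral.
Variable R : realType.

Definition box n (r : R) : set 'rV[R]_n := [set z | forall i, `|z 0 i| <= r].

Lemma compact_box n r : compact (@box n r).
Proof.
have -> : @box n r = [set v | forall i : 'I_n, `[- r, r]%classic (v ord0 i)].
  by apply/seteqP; split=> v H i; have := H i; rewrite /= in_itv /= ler_norml.
exact: (@rV_compact R n (fun _ => `[- r, r]%classic) (fun i => @segment_compact R _ _)).
Qed.

Lemma integrable_compact_support n (G : 'rV[R]_n -> R) K : continuous G -> compact K ->
  (forall z, ~ K z -> G z = 0) -> (mu R n).-integrable setT (fun t => (G (to_rV t))%:E).
Proof.
move=> cG cK GK.
have mG : measurable_fun setT (fun t : sf_type (nest R n) => G (to_rV t)).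
  have := @measurable_extend0 R n setT G openT (fun x _ => cG x).
  by under eq_fun do rewrite extend0_in //.
apply/integrableP; split; first exact/measurable_EFinP.
have cq : {within K, continuous (fun z => `|G z| / gaussian z)}.
  apply: continuous_subspaceT => z.
  have gn0 : gaussian z != 0 by rewrite gt_eqF // expR_gt0.
  have c1 : {for z, continuous (fun z => `|G z|)}.
    by apply: (@continuous_comp _ _ _ G Num.norm); [exact: cG|exact: norm_continuous].
  exact: (cont_mulr c1 (cont_invr gn0 (@continuous_gaussian R n z))).
have [B [_ HB]] := compact_bounded (continuous_compact cq cK).
pose B1 := Num.max B 0 + 1.
have qB z : K z -> `|G z| / gaussian z <= B1.
  move=> Kz; apply: le_trans (ler_norm _) _; apply: HB; last by exists z.
  by rewrite /B1 ltr_pwDr // le_max lexx.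
have B10 : 0 <= B1 by rewrite /B1 addr_ge0 // le_max lexx orbT.
apply: (@le_lt_trans _ _ (\int[mu R n]_t (B1%:E * (gaussian (to_rV t))%:E)))%E.
  apply: ge0_le_integral => //.
  - by apply: measurableT_comp => //; exact/measurable_EFinP.
  - by apply: emeasurable_funM => //; exact: mfun_gaussian.
  move=> t _; rewrite abse_EFin -EFinM lee_fin.
  have g0 : 0 < gaussian (to_rV t) by exact: expR_gt0.
  have [Kt|Kt] := pselect (K (to_rV t)); last by rewrite GK // normr0 mulr_ge0 // ltW.
  by rewrite -ler_pdivrMr //; exact: qB.
rewrite ge0_integralZl_EFin //; last 2 first.
- by move=> t _; rewrite lee_fin expR_ge0.
- exact: mfun_gaussian.
rewrite -(lebesgue_intE (@mfun_gaussian R n)) => [|y]; last by rewrite lee_fin expR_ge0.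
by rewrite int_gaussian -EFinM ltry.
Qed.

Lemma near_notbox n r (z : 'rV[R]_n) : ~ box r z -> \forall y \near z, ~ box r y.
Proof.
move=> zr; have : open (~` (@box n r)).
  by apply: closed_openC; apply: compact_closed; [exact: norm_hausdorff|exact: compact_box].
by rewrite openE => /(_ z zr).
Qed.

Lemma derive_notbox n r (h : 'rV[R]_n -> R) v z : (forall y, ~ box r y -> h y = 0) -> ~ box r z -> 'D_v h z = 0.
Proof.
move=> h0 zr; rewrite (@near_eq_derive _ _ _ h (fun _ => 0) z v) ?derive_cst //.
by apply: filterS (near_notbox zr) => y; exact: h0.
Qed.

(** The integral reduces to [[-r, r]], and the fundamental theorem gives boundary values that are
    0. *)
Lemma integral_derive1_0 (k dk : R -> R) r : 0 < r -> (forall x, is_derive x (1 : R) k (dk x)) -> continuous dk ->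
  (forall x, r <= `|x| -> k x = 0) -> (forall x, r < `|x| -> dk x = 0) ->
  (\int[lebesgue_measure]_x (dk x)%:E = 0)%E.
Proof.
move=> r0 kd cdk k0 dk0.
have ck x : {for x, continuous k} by apply: differentiable_continuous; apply/derivable1_diffP; have [] := kd x.
have rr : - r < r by rewrite (lt_trans (y := 0)) // oppr_lt0.
have mdk : measurable_fun setT dk by exact: continuous_measurable_fun.
have -> : (\int[lebesgue_measure]_x (dk x)%:E = \int[lebesgue_measure]_(x in `[(- r)%R, r]) (dk x)%:E)%E.
  rewrite [RHS]integral_mkcond; apply: eq_integral => x _; rewrite patchE.
  case: ifPn => // xr; rewrite dk0 // ltNge; apply/negP => xr'; move/negP: xr; apply.
  by rewrite inE /= in_itv /= -ler_norml.
rewrite (@continuous_FTC2 R dk k (- r) r rr (continuous_subspaceT cdk)).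
- by rewrite !k0 ?subee // ?normrN ger0_norm // ltW.
- split; first by move=> x _; have [] := kd x.
    exact: cvg_at_right_filter (ck _).
  exact: cvg_at_left_filter (ck _).
- by move=> x _; rewrite derive1E; have [_ ->] := kd x.
Qed.

Lemma row_mx_line n (x : R) (v : 'rV[R]_n) :
  (row_mx (x%:M : 'rV[R]_1) v : 'rV[R]_n.+1) = x *: (delta_mx 0 ord0 : 'rV[R]_n.+1) + (row_mx (0 : 'rV[R]_1) v : 'rV[R]_n.+1).
Proof.
have z0 : (0 : 'rV[R]_1) = (0 : R)%:M by rewrite raddf0.
apply/rowP => i; rewrite [RHS]mxE [X in X + _]mxE [X in _ * X]mxE eqxx /= z0.
case: (unliftP ord0 i) => [j|] ->; first by rewrite !row_mx_lift eq_sym (negPf (neq_lift _ _)) mulr0 add0r.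
by rewrite !row_mx_ord0 eqxx mulr1 addr0.
Qed.

Lemma slice_derive n (h : 'rV[R]_n.+1 -> R) (x : R) (v u : 'rV[R]_n) :
  'D_u (fun v : 'rV[R]_n => h (row_mx (x%:M : 'rV[R]_1) v : 'rV[R]_n.+1)) v = 'D_(row_mx (0 : 'rV[R]_1) u : 'rV[R]_n.+1) h (row_mx (x%:M : 'rV[R]_1) v : 'rV[R]_n.+1)
  /\ (derivable h (row_mx (x%:M : 'rV[R]_1) v : 'rV[R]_n.+1) (row_mx (0 : 'rV[R]_1) u : 'rV[R]_n.+1) -> derivable (fun v : 'rV[R]_n => h (row_mx (x%:M : 'rV[R]_1) v : 'rV[R]_n.+1)) v u).
Proof.
have E : (fun a : R => a^-1 *: (((fun v : 'rV[R]_n => h (row_mx (x%:M : 'rV[R]_1) v : 'rV[R]_n.+1)) \o shift v) (a *: u) - h (row_mx (x%:M : 'rV[R]_1) v : 'rV[R]_n.+1))) =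
  (fun a : R => a^-1 *: ((h \o shift (row_mx (x%:M : 'rV[R]_1) v : 'rV[R]_n.+1)) (a *: (row_mx (0 : 'rV[R]_1) u : 'rV[R]_n.+1)) - h (row_mx (x%:M : 'rV[R]_1) v : 'rV[R]_n.+1))).
  apply/funext => a /=; congr (_ *: (h _ - _)).
  rewrite (@scale_row_mx R 1 1 n) scaler0; apply/esym; apply: etrans (@add_row_mx R 1 1 n _ _ _ _) _; by rewrite add0r.
by split; [rewrite /derive E|rewrite /derivable E].
Qed.

Lemma slice_cont n (W : topologicalType) (h : 'rV[R]_n.+1 -> W) (x : R) : continuous h ->
  continuous (fun v : 'rV[R]_n => h (row_mx (x%:M : 'rV[R]_1) v : 'rV[R]_n.+1)).
Proof.
move=> ch v; apply: (@continuous_comp _ _ _ (fun v : 'rV[R]_n => (row_mx (x%:M : 'rV[R]_1) v : 'rV[R]_n.+1)) h); last exact: ch.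
apply/cont_mxP => i j; rewrite (ord1 i).
case: (unliftP ord0 j) => [k|] ->.
  rewrite (_ : (fun y : 'rV[R]_n => _) = (fun v : 'rV[R]_n => v 0 k)); last by apply/funext => y; rewrite row_mx_lift.
  exact: (Ck_cont (Ck_coord 0 setT k) I).
rewrite (_ : (fun y : 'rV[R]_n => _) = (fun v : 'rV[R]_n => x)); last by apply/funext => y; rewrite row_mx_ord0.
exact: cst_continuous.
Qed.

(** For the first coordinate, Fubini puts that variable inside and the fundamental theorem applies
    on each line. For the other coordinates it is kept outside and the slices are treated by
    induction. *)
Lemma integral_pd n (h : 'rV[R]_n -> R) (r : R) i : 0 < r -> Ck 1 setT h -> (forall z, ~ box r z -> h z = 0) ->
  (\int[mu R n]_t (pd i h (to_rV t))%:E = 0)%E.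
Proof.
elim: n h i => [h []//|n IH] h i r0 Ch h0.
have cp j : continuous (pd j h) by move=> z; exact: (Ck_cont (Ck_derive (delta_mx 0 j) Ch) I).
have imf := @integrable_compact_support n.+1 (pd i h) (box r) (cp i) (@compact_box _ r)
   (fun z zr => derive_notbox (delta_mx 0 i) h0 zr).
case: (unliftP ord0 i) imf => [j|] ->{i} imf; last first.
  apply: etrans (esym (@integral21_prod_meas1 _ _ _ _ _ (@lebesgue_measure R) (mu R n) _ imf)) _.
  rewrite -[RHS](integral0 (mu R n) setT); apply: eq_integral => t _ /=.
  pose e0 : 'rV[R]_n.+1 := delta_mx 0 ord0; pose q : 'rV[R]_n.+1 := row_mx (0 : 'rV[R]_1) (to_rV t).
  rewrite /fubini_G /=; under eq_integral do rewrite row_mx_line.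
  (* [h] is known to vanish only strictly outside the closed box, so the endpoints are moved out by
     1. *)
  have r1 : 0 < r + 1 by rewrite addr_gt0.
  have out x : r < `|x| -> ~ box r (x *: e0 + q).
    by move=> xr /(_ ord0); rewrite -row_mx_line row_mx_ord0 leNgt xr.
  apply: (@integral_derive1_0 (fun x => h (x *: e0 + q)) (fun x => pd ord0 h (x *: e0 + q)) (r + 1)) => //.
  - move=> x; split; first by apply/derivable_lineP; exact: (Ck_derivable e0 Ch I).
    by rewrite derive_lineE.
  - move=> x; apply: (@continuous_comp _ _ _ (fun x : R => x *: e0 + q) (pd ord0 h)); last exact: cp.
    by have [d _] := is_derive_addf (is_derive_scalel e0 x) (is_derive_cst q x 1); apply: differentiable_continuous; apply/derivable1_diffP.
  - by move=> x xr; apply: h0; apply: out; apply: lt_le_trans xr; rewrite ltrDl.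
  - by move=> x xr; apply: derive_notbox h0 _; apply: out; apply: lt_trans xr; rewrite ltrDl.
apply: etrans (esym (@integral12_prod_meas1 _ _ _ _ _ (@lebesgue_measure R) (mu R n) _ imf)) _.
rewrite -[RHS](integral0 (@lebesgue_measure R) setT); apply: eq_integral => x _ /=.
have de k : (delta_mx 0 (lift ord0 k) : 'rV[R]_n.+1) = row_mx (0 : 'rV[R]_1) (delta_mx 0 k).
  have z0 : (0 : 'rV[R]_1) = (0 : R)%:M by rewrite raddf0.
  apply/rowP => l; rewrite mxE eqxx /= z0; case: (unliftP ord0 l) => [l'|] ->.
    by rewrite row_mx_lift (inj_eq lift_inj) mxE eqxx.
  by rewrite row_mx_ord0 (negPf (neq_lift _ _)).
have E v k : pd (lift ord0 k) h (row_mx (x%:M : 'rV[R]_1) v : 'rV[R]_n.+1) = pd k (fun v : 'rV[R]_n => h (row_mx (x%:M : 'rV[R]_1) v : 'rV[R]_n.+1)) v.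
  by rewrite /pd de; have [-> _] := slice_derive h x v (delta_mx 0 k).
rewrite /fubini_F /=; under eq_integral do rewrite E.
apply: IH => //; last first.
  move=> z zr; apply: h0 => zr'; apply: zr => l; by have := zr' (lift ord0 l); rewrite row_mx_lift.
split; first by move=> v _; apply: slice_cont => z; exact: (Ck_cont Ch I).
move=> u; split=> [v _|].
  have [_ H] := slice_derive h x v u; apply: H; exact: (Ck_derivable _ Ch I).
split=> // v _; rewrite (_ : 'D_u _ = fun v : 'rV[R]_n => 'D_(row_mx (0 : 'rV[R]_1) u : 'rV[R]_n.+1) h (row_mx (x%:M : 'rV[R]_1) v : 'rV[R]_n.+1)).
  by apply: (@slice_cont n _ ('D_(row_mx (0 : 'rV[R]_1) u : 'rV[R]_n.+1) h) x) => z; exact: (Ck_cont (Ck_derive _ Ch) I).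
by apply/funext => v'; have [-> _] := slice_derive h x v' u.
Qed.

End DivergenceIntegral.

Section ChartSmoothness.
Variables (R : realType) (n : nat) (U : set 'rV[R]_n) (G : 'rV[R]_n -> 'M[R]_n) (f : 'rV[R]_n -> R).
Hypotheses (oU : open U) (Cf : Ck 2 U f) (CG : Ck 1 U G) (sG : forall z, U z -> spd (G z)).

Lemma Ck_egrad : Ck 1 U (egrad G f).
Proof.
have C1 : Ck 1 U (fun y => \row_i pd i f y).
  apply/Ck_mxP => // p q; rewrite (_ : (fun x => _) = 'D_(delta_mx 0 q) f); last by apply/funext => y; rewrite mxE.
  exact: Ck_derive Cf.
exact: (Ck_mulmx oU C1 (Ck_invmx oU (fun z Uz => spd_unit (sG Uz)) CG)).
Qed.

Lemma Ck_gn2 : Ck 1 U (gn2 G f).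
Proof.
have CM := Ck_mulmx oU (Ck_mulmx oU Ck_egrad CG) (Ck_trmx oU Ck_egrad).
exact: (proj1 (Ck_mxP _ _ oU) CM 0 0).
Qed.

Lemma Ck_sqrt_det : Ck 1 U (fun y => Num.sqrt (\det (G y))).
Proof.
exact: (@Ck_comp1 _ _ 1 _ [set x : R | 0 < x] (fun z => \det (G z)) _ oU (fun z Uz => spd_det_gt0 (sG Uz)) (Ck_det oU CG) (@Ck_sqrt R 1)).
Qed.

End ChartSmoothness.

Section NearOperators.
Variables (R : realType) (n : nat) (G : 'rV[R]_n -> 'M[R]_n) (U : set 'rV[R]_n) (f h : 'rV[R]_n -> R) (y : 'rV[R]_n).
Hypotheses (oU : open U) (Uy : U y) (fh : forall z, U z -> f z = h z).

Lemma egrad_near : egrad G f y = egrad G h y.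
Proof.
rewrite /egrad; congr (_ *m _); apply/rowP => i; rewrite !mxE.
by apply: near_eq_derive; exact: near_open oU Uy fh.
Qed.

Lemma gn2_near : gn2 G f y = gn2 G h y.
Proof. by rewrite /gn2 egrad_near. Qed.

Lemma radial_op_near p : radial_op y p G f = radial_op y p G h.
Proof.
rewrite /radial_op gn2_near egrad_near (hess_near _ _ _ oU Uy fh) /lapl.
congr (_ + _); apply: eq_bigr => i _; apply: eq_bigr => j _; congr (_ * _).
by rewrite !mxE; exact: hess_near oU Uy fh.
Qed.

End NearOperators.

(** * Gradient products and the p-Laplacian do not depend on the chart *)

Section OperatorTransition.
Variables (R : realType) (n : nat) (M : riemannian R n).
Local Notation U k := (cdom (atlas M k)).
Local Notation C k := (cimg (atlas M k)).
Local Notation ci k := (cinv (atlas M k)).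

Definition smooth2 (D : set M) (f : M -> R) := forall k, Ck 2 (preim k D) (f \o ci k).

Lemma open_preim k (D : set M) : open D -> open (preim k D).
Proof. exact: open_chart_preimage. Qed.

Section Fixed.
Variables (D : set M) (j k : nat) (y : 'rV[R]_n).
Hypotheses (oD : open D) (yD : preim j (D `&` U k) y).
Let T := transition M j k.
Let oI : open (preim j (D `&` U k)).
Proof. by apply: open_preim; apply: openI => //; exact: cdom_open. Qed.
Let oP : open (preim k D). Proof. exact: open_preim. Qed.
Let TP z : preim j (D `&` U k) z -> preim k D (T z).
Proof. by move=> [jz [Dz kz]]; split; [exact: cmap_img|rewrite /preimage /T /transition /= cmapK]. Qed.
Let sG z : preim k D z -> spd (metric M k z). Proof. by case=> kz _; exact: spd_metric. Qed.
Let sg z : preim j (D `&` U k) z -> spd (metric M j z). Proof. by case=> kz _; exact: spd_metric. Qed.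
Let gE z : preim j (D `&` U k) z -> metric M j z = 'J T z *m metric M k (T z) *m ('J T z)^T.
Proof. by move=> [jz [_ kz]]; exact: metric_change jz kz. Qed.
Let CT : Ck 2 (preim j (D `&` U k)) T.
Proof. by apply: sub_Ck (@Ck_transition _ _ M 2 j k) => z [jz [_ kz]]; split. Qed.
Let JT z : preim j (D `&` U k) z -> 'J T z \in unitmx.
Proof.
move=> jz; have := sg jz; rewrite (gE jz) => /spd_unit; rewrite unitmx_mul unitmx_mul.
by move=> /andP[/andP[]].
Qed.
Let CG : Ck 1 (preim k D) (metric M k) := sub_Ck (@subIsetl _ _ _) (@metric_smooth _ _ M k 1).
Let Cg : Ck 1 (preim j (D `&` U k)) (metric M j) := sub_Ck (@subIsetl _ _ _) (@metric_smooth _ _ M j 1).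
Let fT (f : M -> R) z : preim j (D `&` U k) z -> ((f \o ci k) \o T) z = (f \o ci j) z.
Proof. by move=> [jz [_ kz]]; rewrite /T /transition /= cmapK. Qed.

Lemma egrad_transition f : smooth2 D f -> egrad (metric M j) (f \o ci j) y *m 'J T y = egrad (metric M k) (f \o ci k) (T y).
Proof.
move=> sf; rewrite -(egrad_near _ oI yD (@fT f)).
exact: (egrad_change oI oP TP sG sg gE JT CT (sf k) yD).
Qed.

Lemma radial_op_transition p f : smooth2 D f -> radial_op y p (metric M j) (f \o ci j) = radial_op (T y) p (metric M k) (f \o ci k).
Proof.
move=> sf; rewrite -(radial_op_near _ oI yD (@fT f)).
have e1 := lapl_change oI oP TP sG sg gE JT CT CG Cg (sf k) yD.
have e2 := gn2_change oI oP TP sG sg gE JT CT (sf k) yD.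
have e3 := egrad_change oI oP TP sG sg gE JT CT (sf k) yD.
have e4 := hess_changeJ oI oP TP sG sg gE JT CT CG Cg (sf k) yD (egrad (metric M j) ((f \o ci k) \o T) y) (egrad (metric M j) ((f \o ci k) \o T) y).
have alg (l l' t t' h0 h1 : R) (u v : 'rV[R]_n) (B : 'rV[R]_n -> 'rV[R]_n -> R) : l = l' -> t = t' -> u = v ->
  h0 = B u u -> l + (p - 2) * h0 / t = l' + (p - 2) * B v v / t' by move=> -> -> -> ->.
exact: (alg _ _ _ _ _ 0 _ _ (fun u v => hess (metric M k) (f \o ci k) (T y) u v) e1 e2 e3 e4).
Qed.

Lemma dot_egrad_transition f h : smooth2 D f -> smooth2 D h ->
  dot (metric M j y) (egrad (metric M j) (f \o ci j) y) (egrad (metric M j) (h \o ci j) y) =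
  dot (metric M k (T y)) (egrad (metric M k) (f \o ci k) (T y)) (egrad (metric M k) (h \o ci k) (T y)).
Proof.
move=> sf sh; rewrite (gE yD); apply: etrans (dot_congr _ _ _ _) _.
by rewrite (egrad_transition sf) (egrad_transition sh).
Qed.

End Fixed.

Definition inner_grad (f h : M -> R) x := dot (gram x) (grad f x) (grad h x).

Lemma inner_grad_chart (D : set M) k y (f h : M -> R) : open D -> smooth2 D f -> smooth2 D h -> preim k D y ->
  inner_grad f h (ci k y) = dot (metric M k y) (egrad (metric M k) (f \o ci k) y) (egrad (metric M k) (h \o ci k) y).
Proof.
move=> oD sf sh [ky Dy]; apply/esym.
have yD : preim k (D `&` U (chart_at (ci k y))) y by split => //; split => //; exact: chart_at_dom.
exact: dot_egrad_transition oD yD _ _ sf sh.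
Qed.

Lemma radial_op_chart (D : set M) k y p (f : M -> R) : open D -> smooth2 D f -> preim k D y ->
  radial_op (coord (ci k y)) p (metric M (chart_at (ci k y))) (f \o ci (chart_at (ci k y))) = radial_op y p (metric M k) (f \o ci k).
Proof.
move=> oD sf [ky Dy]; apply/esym.
have yD : preim k (D `&` U (chart_at (ci k y))) y by split => //; split => //; exact: chart_at_dom.
exact: radial_op_transition oD yD _ _ sf.
Qed.

End OperatorTransition.

(** * The flux inequality for test functions supported in one chart *)

Section FluxInequality.
Variables (R : realType) (n : nat) (M : riemannian R n).
Local Notation U k := (cdom (atlas M k)).
Local Notation C k := (cimg (atlas M k)).
Local Notation ci k := (cinv (atlas M k)).
Variables (f : M -> R) (O : set M) (A A' : R -> R) (p : R).
Hypotheses (oO : open O) (sf : smooth2 O f).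
Hypothesis dA : forall x, O x -> is_derive (f x) (1 : R) A (A' (f x)).
Hypothesis CA : forall k, Ck 1 (preim k O) (A \o f \o ci k).
Hypothesis T0 : forall x, O x -> 0 < inner_grad f f x.
Hypothesis super : forall x, O x -> A' (f x) * inner_grad f f x +
  A (f x) * radial_op (coord x) p (metric M (chart_at x)) (f \o ci (chart_at x)) <= 0.

Let a := (p - 2) / 2.

(** The inner product of the field [A(f) |grad f|^(p-2) grad f] with the gradient of the test
    function. Outside [O] the field is undefined; the value 0 is harmless for [phi] supported in
    [O]. *)
Definition flux_pair (phi : M -> R) := extend0 O (fun x => A (f x) * inner_grad f f x `^ a * inner_grad phi f x).

Let fk k := f \o ci k.
Let X k := flux (metric M k) (fk k) A a.

Lemma flux_pair_chart k y phi : smooth2 setT phi -> preim k O y ->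
  flux_pair phi (ci k y) = 'D_(X k y) (phi \o ci k) y.
Proof.
move=> sp ky; have [iy Oy] := ky; rewrite /flux_pair extend0_in //.
have sp' : smooth2 O phi by move=> i; apply: sub_Ck (sp i) => z [].
have oC : open (preim k O) by exact: open_preim.
rewrite (inner_grad_chart oO sf sf ky) (inner_grad_chart oO sp' sf ky).
have sg := spd_metric iy.
have dp : differentiable (phi \o ci k) y := Ck1_differentiable oC (sp' k) ky.
rewrite (egradE _ sg dp) /X /flux.
have [_ e] := deriveZv (A (fk k y) * gn2 (metric M k) (fk k) y `^ a) (diff_derivable (v := egrad (metric M k) (fk k) y) dp).
exact: (esym e).
Qed.

Let CX k i : Ck 1 (preim k O) (fun y => density M k y * X k y 0 i).
Proof.
have oC : open (preim k O) by exact: open_preim.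
have Cg : Ck 1 (preim k O) (metric M k) := sub_Ck (@subIsetl _ _ _) (@metric_smooth _ _ M k 1).
have sg y : preim k O y -> spd (metric M k y) by case=> iy _; exact: spd_metric.
have Cgr : Ck 1 (preim k O) (egrad (metric M k) (fk k)) := Ck_egrad oC (sf k) Cg sg.
have Cgn : Ck 1 (preim k O) (gn2 (metric M k) (fk k)) := Ck_gn2 oC (sf k) Cg sg.
have gn0 y : preim k O y -> 0 < gn2 (metric M k) (fk k) y.
  by move=> ky; have [_ Oy] := ky; have := T0 Oy; rewrite (inner_grad_chart oO sf sf ky).
have E : (fun y => density M k y * X k y 0 i) = fun y => density M k y * ((A \o f \o ci k) y * gn2 (metric M k) (fk k) y `^ a * egrad (metric M k) (fk k) y 0 i).
  by apply/funext => y; rewrite /X /flux mxE.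
have Cd : Ck 1 (preim k O) (density M k) := Ck_sqrt_det oC Cg sg.
have Cp : Ck 1 (preim k O) (fun y => gn2 (metric M k) (fk k) y `^ a).
  exact: (@Ck_comp1 _ _ 1 _ [set x : R | 0 < x] (gn2 (metric M k) (fk k)) (fun x => x `^ a) oC gn0 Cgn (@Ck_powR R 1 a)).
have Cgi : Ck 1 (preim k O) (fun y => egrad (metric M k) (fk k) y 0 i) := proj1 (Ck_mxP _ _ oC) Cgr 0 i.
rewrite E; exact: (CkM oC Cd (CkM oC (CkM oC (CA k) Cp) Cgi)).
Qed.

Lemma div_flux_le0 k y : preim k O y -> \sum_i pd i (fun z => density M k z * X k z 0 i) y <= 0.
Proof.
move=> ky; have [iy Oy] := ky; have oC : open (preim k O) by exact: open_preim.
have sg z : preim k O z -> spd (metric M k z) by case=> iz _; exact: spd_metric.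
have Cg : Ck 1 (preim k O) (metric M k) := sub_Ck (@subIsetl _ _ _) (@metric_smooth _ _ M k 1).
have g0 : 0 < gn2 (metric M k) (fk k) y by have := T0 Oy; rewrite (inner_grad_chart oO sf sf ky).
have dA' : is_derive (fk k y) (1 : R) A (A' (fk k y)) by exact: dA.
have E := div_flux oC sg Cg (sf k) a ky dA' g0; rewrite -[X in X <= _]/(\sum_i pd i (fun z => Num.sqrt (\det (metric M k z)) * flux (metric M k) (fk k) A a z 0 i) y) E.
apply: mulr_ge0_le0; first by rewrite mulr_ge0 ?sqrtr_ge0 // powR_ge0.
have := super Oy; rewrite (inner_grad_chart oO sf sf ky) (radial_op_chart p oO sf ky).
by rewrite /radial_op /a [2 * _]mulrC divfK // addrC [lapl _ _ _ + _]addrC addrC.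
Qed.

Lemma flux_pair_out phi K x : closed K -> (forall z, ~ K z -> phi z = 0) -> ~ K x -> flux_pair phi x = 0.
Proof.
move=> cK pK Kx; rewrite /flux_pair; have [Ox|Ox] := pselect (O x); last by rewrite extend0_out.
rewrite extend0_in // (_ : inner_grad phi f x = 0) ?mulr0 // /inner_grad (_ : grad phi x = 0) ?dot0l //.
have oK : open (~` K) by exact: closed_openC.
have kx : preim (chart_at x) (~` K) (coord x).
  by split; [apply: cmap_img; exact: chart_at_dom|rewrite /preimage /= cmapK //; exact: chart_at_dom].
have oP : open (preim (chart_at x) (~` K)) by exact: open_preim.
have z0 z : preim (chart_at x) (~` K) z -> (phi \o ci (chart_at x)) z = (fun _ => 0) z by move=> [_ Kz]; exact: pK.
have e := egrad_near (metric M (chart_at x)) oP kx z0.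
apply: (etrans e); rewrite /egrad (_ : \row_i _ = 0) ?mul0mx //.
by apply/rowP => i; rewrite !mxE; exact: derive_cst.
Qed.

Section Support.
Variables (phi : M -> R) (K : set M).
Hypotheses (sp : smooth2 setT phi) (cK : compact K) (KO : K `<=` O) (pK : forall z, ~ K z -> phi z = 0).

Let clK : closed K. Proof. exact: compact_closed (@carrier_hausdorff _ _ M) cK. Qed.

Lemma flux_pair_cont : continuous (flux_pair phi).
Proof.
move=> x; have [Ox|Ox] := pselect (O x); last first.
  have Kx : ~ K x by move=> /KO.
  apply: (@near_eq_cont _ _ (fun _ : M => 0)); last exact: cst_continuous.
  have : nbhs x (~` K) by apply: open_nbhs_nbhs; split => //; exact: closed_openC.
  by apply: filterS => z Kz; rewrite (flux_pair_out clK pK Kz).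
set k := chart_at x; have kx : U k x by exact: chart_at_dom.
have oOk : open (O `&` U k) by apply: openI => //; exact: cdom_open.
have oC : open (preim k O) by exact: open_preim.
pose q y := \sum_i pd i (phi \o ci k) y * X k y 0 i.
have qE y : preim k O y -> flux_pair phi (ci k y) = q y.
  move=> ky; rewrite flux_pair_chart // /q.
  have dp : differentiable (phi \o ci k) y.
    have oT : open (preim k (@setT M)) by apply: open_preim; exact: openT.
    by apply: (Ck1_differentiable oT (sp k)); case: ky.
  by rewrite (derive_delta _ dp); apply: eq_bigr => i _; rewrite mulrC.
apply: (@near_eq_cont _ _ (q \o cmap (atlas M k))).
  have : nbhs x (O `&` U k) by apply: open_nbhs_nbhs.
  apply: filterS => z [Oz kz]; rewrite /= -qE ?cmapK //; split; first exact: cmap_img.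
  by rewrite /preimage /= cmapK.
apply: continuous_comp; first exact: cmap_cont.
have kxO : preim k O (cmap (atlas M k) x) by split; [exact: cmap_img|rewrite /preimage /= cmapK].
have Cq : Ck 0 (preim k O) q.
  have Ci i : Ck 0 (preim k O) (fun y => pd i (phi \o ci k) y * X k y 0 i).
    have C1 : Ck 0 (preim k O) (pd i (phi \o ci k)).
      by apply: sub_Ck (CkW (Ck_derive (delta_mx 0 i) (sp k))) => z [].
    have C2 : Ck 0 (preim k O) (fun y => (density M k y)^-1 * (density M k y * X k y 0 i)).
      apply: (CkM oC _ (CkW (CX k i))).
      split; last by [].
      move=> y ky; have [iy _] := ky.
      have d0 : density M k y != 0 by rewrite gt_eqF // sqrtr_gt0; exact: spd_det_gt0 (spd_metric iy).
      exact: (cont_invr d0 (cont_density iy)).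
    have C3 : Ck 0 (preim k O) (fun y => X k y 0 i).
      apply: (eq_Ck oC _ C2) => y ky; have [iy _] := ky; rewrite mulKf // gt_eqF // sqrtr_gt0.
      exact: spd_det_gt0 (spd_metric iy).
    exact: (CkM oC C1 C3).
  by apply: Ck_sum.
exact: (Ck_cont Cq kxO).
Qed.

(** Integration by parts: the field [phi X] times the density has compact support, so its divergence
    integrates to 0. That divergence is the integrand plus [phi] times a nonpositive divergence. The
    continuity and support statements are returned for the later integrability arguments. *)
Lemma chart_flux_ge0 k : K `<=` U k -> (forall x, 0 <= phi x) ->
  (0 <= \int[mu R n]_t (extend0 (C k) (cfun k (flux_pair phi)) (to_rV t))%:E)%E /\
  continuous (extend0 (C k) (cfun k (flux_pair phi))) /\
  (forall y, ~ (cmap (atlas M k) @` K) y -> extend0 (C k) (cfun k (flux_pair phi)) y = 0) /\ compact (cmap (atlas M k) @` K).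
Proof.
move=> KU p0; set K' := cmap (atlas M k) @` K; set H := extend0 (C k) (cfun k (flux_pair phi)).
have cK' : compact K'.
  apply: continuous_compact cK; apply: continuous_in_subspaceT => x /set_mem Kx; exact: cmap_cont (KU x Kx).
have clK' : closed K' by apply: compact_closed cK'; exact: norm_hausdorff.
have oK' : open (~` K') by exact: closed_openC.
have oC : open (C k) by exact: cimg_open.
have oP : open (preim k O) by exact: open_preim.
have K'P y : K' y -> preim k O y.
  by move=> [x Kx <-]; split; [apply: cmap_img; exact: KU|rewrite /preimage /= cmapK; [exact: KO|exact: KU]].
have outK y : C k y -> ~ K' y -> ~ K (ci k y).
  by move=> ky Ky Kc; apply: Ky; exists (ci k y) => //; rewrite cinvK.
have H0 y : ~ K' y -> H y = 0.
  move=> Ky; have [ky|ky] := pselect (C k y); last by rewrite /H extend0_out.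
  by rewrite /H extend0_in // /cfun (flux_pair_out clK pK (outK y ky Ky)) mul0r.
have cH : continuous H.
  move=> y; have [Ky|Ky] := pselect (K' y); last first.
    apply: (@near_eq_cont _ _ (fun _ => 0)); last exact: cst_continuous.
    by apply: near_open oK' Ky _ => z Kz; rewrite H0.
  have [ky _] := K'P y Ky.
  apply: (@near_eq_cont _ _ (cfun k (flux_pair phi))); last exact: cont_cfun flux_pair_cont _ _ ky.
  by apply: near_open oC ky _ => z kz; rewrite /H extend0_in.
split; last by [].
(* The components of the density times [phi X], extended by 0; they are C^1 on all of R^n because
   [K'] is a compact subset of the domain. *)
pose Y i := extend0 (preim k O) (fun y => (phi \o ci k) y * (density M k y * X k y 0 i)).
have Y0 i y : ~ K' y -> Y i y = 0.
  move=> Ky; have [ky|ky] := pselect (preim k O y); last by rewrite /Y extend0_out.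
  by rewrite /Y extend0_in //= pK ?mul0r //; apply: outK Ky; case: ky.
have Cphi : Ck 1 (preim k O) (phi \o ci k) by apply: sub_Ck (CkW (sp k)) => z [].
have CY i : Ck 1 setT (Y i).
  apply: Ck_local => y _; have [Ky|Ky] := pselect (K' y).
    exists (preim k O); first exact: K'P.
    apply: (eq_Ck oP (f := fun y => (phi \o ci k) y * (density M k y * X k y 0 i))) => [z kz|]; first by rewrite /Y extend0_in.
    exact: (CkM oP Cphi (CX k i)).
  exists (~` K') => //; apply: (eq_Ck oK' (f := fun _ => 0)) => [z Kz|]; first by rewrite Y0.
  exact: Ck_cst.
have [r [_ rK]] := compact_bounded cK'.
pose r1 := Num.max r 0 + 1.
have r10 : 0 < r1 by rewrite /r1 ltr_wpDl // le_max lexx orbT.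
have Kbox y : K' y -> box r1 y.
  move=> Ky i; apply: le_trans (le_mx_norm y 0 i) _; apply: rK => //.
  by rewrite /r1 ltr_pwDr // le_max lexx.
have Ybox i z : ~ box r1 z -> Y i z = 0 by move=> zr; apply: Y0 => /Kbox.
have iY i : (mu R n).-integrable setT (fun t => (pd i (Y i) (to_rV t))%:E).
  have cY : continuous (pd i (Y i)) by move=> z; exact: (Ck_cont (Ck_derive (delta_mx 0 i) (CY i)) I).
  exact: (integrable_compact_support cY (@compact_box R n r1) (fun z zr => derive_notbox (delta_mx 0 i) (Ybox i) zr)).
have iH : (mu R n).-integrable setT (fun t => (H (to_rV t))%:E) by exact: integrable_compact_support cH cK' H0.
have -> : (0 = \int[mu R n]_t (\sum_i (pd i (Y i) (to_rV t))%:E))%E.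
  rewrite integral_sum // big1 // => i _; exact: integral_pd (Ybox i).
apply: le_integral => //; first exact: integrable_sum.
move=> t _; rewrite sumEFin lee_fin; set y := to_rV t.
have [Ky|Ky] := pselect (K' y); last first.
  rewrite H0 // big1 // => i _; rewrite /pd (@near_eq_derive _ _ _ (Y i) (fun _ => 0)) ?derive_cst //.
  by apply: near_open oK' Ky _ => z Kz; exact: Y0.
have ky := K'P y Ky; have [iy Oy] := ky.
have dpi i : pd i (Y i) y = pd i (phi \o ci k) y * (density M k y * X k y 0 i) + (phi \o ci k) y * pd i (fun z => density M k z * X k z 0 i) y.
  have d1 : derivable (phi \o ci k) y (delta_mx 0 i) := Ck_derivable _ Cphi ky.
  have d2 : derivable (fun z => density M k z * X k z 0 i) y (delta_mx 0 i) := Ck_derivable _ (CX k i) ky.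
  have [_ e] := is_derive_mulr (DeriveDef d1 erefl) (DeriveDef d2 erefl).
  apply: etrans (near_eq_derive _ _) e.
  by apply: near_open oP ky _ => z kz; rewrite /Y extend0_in.
rewrite (eq_bigr _ (fun i _ => dpi i)) big_split /= /H extend0_in // /cfun flux_pair_chart //.
have dp : differentiable (phi \o ci k) y := Ck1_differentiable oP Cphi ky.
have -> : \sum_i pd i (phi \o ci k) y * (density M k y * X k y 0 i) = 'D_(X k y) (phi \o ci k) y * density M k y.
  by rewrite (derive_delta _ dp) mulr_suml; apply: eq_bigr => i _; rewrite /pd; ring.
rewrite gerDl -mulr_sumr; apply: mulr_ge0_le0; [exact: p0|exact: div_flux_le0].
Qed.

End Support.
End FluxInequality.

(** * Cutoff functions and the function Lambda *)

Section SmoothStep.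
Variable R : realType.

(* The functions t^-k e^(-1/t), extended by 0, are closed under differentiation up to linear combinations, which makes all of them smooth by a simultaneous induction. *)
Definition flat k (t : R) : R := if 0 < t then t^-1 ^+ k * expR (- t^-1) else 0.

Lemma flat_ge0 k t : 0 <= flat k t.
Proof. by rewrite /flat; case: ifP => // t0; rewrite mulr_ge0 ?expR_ge0 // exprn_ge0 // invr_ge0 ltW. Qed.

Lemma flat_gt0 k t : 0 < t -> 0 < flat k t.
Proof. by move=> t0; rewrite /flat t0 mulr_gt0 ?expR_gt0 // exprn_gt0 // invr_gt0. Qed.

Lemma flat_out k t : t <= 0 -> flat k t = 0.
Proof. by move=> t0; rewrite /flat ltNge t0. Qed.

(** With [s = 1/t] and [q = k + 2], the bound [e^s = (e^(s/q))^q >= (s/q)^q] leaves a factor [t^2].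
    A quadratic bound is what makes the derivative at 0 vanish. *)
Lemma flat_le k t : `|flat k t| <= (k.+2%:R ^+ k.+2) * t ^+ 2.
Proof.
rewrite ger0_norm ?flat_ge0 // /flat; case: ifP => t0; last by (apply: mulr_ge0; [exact: exprn_ge0|exact: sqr_ge0]).
set s := t^-1; have s0 : 0 < s by rewrite invr_gt0.
have -> : t = s^-1 by rewrite /s invrK.
set q : R := k.+2%:R; have q0 : 0 < q by rewrite ltr0n.
have e1 : (s / q) ^+ k.+2 <= expR s.
  have -> : expR s = expR (s / q) ^+ k.+2 by rewrite -expRM_natl mulrC divfK // gt_eqF.
  have le1 : s / q <= expR (s / q) by apply: le_trans (expR_ge1Dx _); rewrite lerDr.
  have n0 : 0 <= s / q by apply: divr_ge0; exact: ltW.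
  by apply: lerXn2r; rewrite ?nnegrE // expR_ge0.
rewrite expRN ler_pdivrMr ?expR_gt0 //.
have -> : s ^+ k = q ^+ k.+2 * s^-1 ^+ 2 * (s / q) ^+ k.+2.
  have alg (x P Q : R) : P != 0 -> Q != 0 -> x = Q * P^-1 * (x * P * Q^-1) by move=> P0 Q0; field; rewrite P0 Q0.
  have e2 : s ^+ k.+2 = s ^+ k * s ^+ 2 by rewrite -exprD addn2.
  by rewrite expr_div_n exprVn e2; apply: alg; rewrite expf_neq0 // gt_eqF.
by apply: ler_wpM2l => //; apply: mulr_ge0; apply: exprn_ge0; rewrite ?invr_ge0; exact: ltW.
Qed.

Lemma is_derive_sqr_bound (f : R -> R) C : f 0 = 0 -> (forall t, `|f t| <= C * t ^+ 2) -> is_derive (0 : R) (1 : R) f 0.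
Proof.
move=> f0 fC.
have C0 : 0 <= C by have := fC 1; rewrite expr1n mulr1; apply: le_trans.
have H : h^-1 *: ((f \o shift 0) (h *: 1) - f 0) @[h --> (0 : R)^'] --> (0 : R).
  apply/cvgrPdist_le => e e0; rewrite near_withinE.
  have C1 : 0 < C + 1 by rewrite ltr_wpDl.
  exists (e / (C + 1)) => /=; first by rewrite divr_gt0.
  move=> h /=; rewrite sub0r normrN => he h0.
  rewrite f0 subr0 sub0r normrN /shift addr0 (_ : h *: 1 = h); last exact: mulr1.
  rewrite normrM normfV ler_pdivrMl ?normr_gt0 //; apply: le_trans (fC h) _.
  rewrite -real_normK ?num_real // expr2 mulrA mulrC ler_pM2l ?normr_gt0 //.
  apply: (@le_trans _ _ ((C + 1) * `|h|)); first by rewrite ler_wpM2r // lerDl.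
  by rewrite mulrC -ler_pdivlMr // ltW.
by split; [apply/cvg_ex; exists 0|exact: cvg_lim H].
Qed.

Lemma is_derive_flat k t : is_derive t (1 : R) (flat k) (- k%:R * flat k.+1 t + flat k.+2 t).
Proof.
have [t0|t0|<-] := ltgtP 0 t; last first.
- rewrite !flat_out // mulr0 addr0; apply: is_derive_sqr_bound (flat_le k); exact: flat_out.
- rewrite !flat_out ?ltW // mulr0 addr0.
  have near0 : \forall s \near t, flat k s = 0.
    have oN : open [set s : R | s < 0] by exact: open_lt.
    exact: (@near_open _ _ _ (fun s => flat k s = 0) t oN t0 (fun s (s0 : s < 0) => flat_out k (ltW s0))).
  have E : 'D_1 (flat k) t = 0 by rewrite (near_eq_derive _ near0) derive_cst.
  split=> //; apply: (@near_eq_derivable _ _ _ (fun _ => 0)) => //.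
  by apply: filterS near0 => s ->.
have tn : t != 0 by rewrite gt_eqF.
have di : is_derive t (1 : R) (fun s : R => s^-1) (- t ^- 2) .
  by apply: is_derive_eq (is_derive_invf tn (is_derive_id t 1)) _; rewrite mulr1.
have d1 : is_derive t (1 : R) (fun s : R => s^-1 ^+ k) (k%:R * t^-1 ^+ k.-1 * (- t ^- 2)).
  elim: k => [|k IH]; first by apply: is_derive_eq (is_derive_cst (1 : R) t 1) _; rewrite !mul0r.
  rewrite (_ : (fun s => _) = fun s : R => s^-1 * s^-1 ^+ k); last by apply/funext => s; rewrite exprS.
  apply: is_derive_eq (is_derive_mulr di IH) _; move: (- t ^- 2) => u.
  by case: k {IH} => [|k] /=; rewrite ?exprS -[in RHS]natr1; ring.
have d2 : is_derive t (1 : R) (fun s : R => expR (- s^-1)) (t ^- 2 * expR (- t^-1)).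
  have dn : is_derive t (1 : R) (fun s : R => - s^-1) (t ^- 2) by apply: is_derive_eq (is_deriveN di) _; rewrite opprK.
  exact: (is_derive_comp1 dn (is_derive_expR (- t^-1))).
have d3 := is_derive_mulr d1 d2.
pose G (s : R) := s^-1 ^+ k * expR (- s^-1).
have oP : open [set s : R | 0 < s] by exact: open_gt.
have fl (s : R) : 0 < s -> G s = flat k s by rewrite /flat /G => ->.
have near1 := @near_open _ _ _ (fun s => G s = flat k s) t oP t0 fl.
have near2 := @near_open _ _ _ (fun s => flat k s = G s) t oP t0 (fun s s0 => esym (fl s s0)).
have E : - k%:R * flat k.+1 t + flat k.+2 t = (k%:R * t^-1 ^+ k.-1 * - t ^- 2) * expR (- t^-1) + t^-1 ^+ k * (t ^- 2 * expR (- t^-1)).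
  rewrite /flat t0 -!exprVn; case: k {d1 d3 near1 near2 G fl} => [|k] /=; first by rewrite !oppr0 !mul0r !add0r expr0 mul1r.
  rewrite !exprS; ring.
rewrite E; have [dd de] := d3.
by split; [exact: near_eq_derivable near1 dd|rewrite -de; exact: near_eq_derive near2].
Qed.

Lemma Ck_flat j k : Ck j setT (flat k).
Proof.
elim: j k => [|j IH] k.
  split=> // t _; have [d _] := is_derive_flat k t.
  by apply: differentiable_continuous; apply/derivable1_diffP.
apply: (Ck_derive1 openT (fun t _ => is_derive_flat k t)).
exact: (CkD openT (CkZ (- k%:R) openT (IH k.+1)) (IH k.+2)).
Qed.

(** The standard smooth transition, equal to 0 up to 1 and to 1 from 2 on; the denominator is
    positive since the two half-lines overlap. *)
Definition step (t : R) : R := flat 0 (t - 1) / (flat 0 (t - 1) + flat 0 (2 - t)).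

Lemma step_den t : 0 < flat 0 (t - 1) + flat 0 (2 - t).
Proof.
have [t1|t1] := ltP 1 t; first by rewrite ltr_pwDl ?flat_ge0 // flat_gt0 // subr_gt0.
by rewrite ltr_wpDl ?flat_ge0 // flat_gt0 // subr_gt0 (le_lt_trans t1) // ltr1n.
Qed.

Lemma step0 t : t <= 1 -> step t = 0.
Proof. by move=> t1; rewrite /step flat_out ?mul0r // subr_le0. Qed.

Lemma step1 t : 2 <= t -> step t = 1.
Proof.
move=> t2; rewrite /step [flat 0 (2 - t)]flat_out ?subr_le0 // addr0 divff // gt_eqF // flat_gt0 // subr_gt0.
by apply: lt_le_trans t2; rewrite ltr1n.
Qed.

Lemma step_ge0 t : 0 <= step t. Proof. by rewrite divr_ge0 ?flat_ge0 // ltW // step_den. Qed.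

Lemma step_le1 t : step t <= 1.
Proof. by rewrite ler_pdivrMr ?step_den // mul1r lerDl flat_ge0. Qed.

Let C1 j : Ck j setT (fun t : R => flat 0 (t - 1)).
Proof.
exact: (Ck_comp1 openT (fun _ _ => I) (CkB openT (Ck_id j setT) (Ck_cst j setT (1 : R))) (Ck_flat j 0)).
Qed.

Let C2 j : Ck j setT (fun t : R => flat 0 (2 - t)).
Proof.
exact: (Ck_comp1 openT (fun _ _ => I) (CkB openT (Ck_cst j setT (2 : R)) (Ck_id j setT)) (Ck_flat j 0)).
Qed.

Lemma Ck_step j : Ck j setT step.
Proof.
apply: (CkM openT (C1 j)); apply: (CkV openT) => [t _|]; first by rewrite gt_eqF // step_den.
exact: CkD openT (C1 j) (C2 j).
Qed.

(** The quotient rule for [step], using that the derivative of [flat 0] is [flat 2]. *)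
Definition dstep (t : R) := (flat 2 (t - 1) * flat 0 (2 - t) + flat 0 (t - 1) * flat 2 (2 - t)) / (flat 0 (t - 1) + flat 0 (2 - t)) ^+ 2.

Lemma is_derive_step t : is_derive t (1 : R) step (dstep t).
Proof.
have f2 s : - 0%:R * flat 1 s + flat 2 s = flat 2 s by rewrite oppr0 mul0r add0r.
have da : is_derive t (1 : R) (fun t : R => flat 0 (t - 1)) (flat 2 (t - 1)).
  have h := is_derive_comp1 (is_derive_subf (is_derive_id t 1) (is_derive_cst (1 : R) t 1)) (is_derive_flat 0 (t - 1)).
  by apply: is_derive_eq h _; rewrite f2 subr0 mul1r.
have db : is_derive t (1 : R) (fun t : R => flat 0 (2 - t)) (- flat 2 (2 - t)).
  have h := is_derive_comp1 (is_derive_subf (is_derive_cst (2 : R) t 1) (is_derive_id t 1)) (is_derive_flat 0 (2 - t)).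
  by apply: is_derive_eq h _; rewrite f2 sub0r mulN1r.
have d0 : flat 0 (t - 1) + flat 0 (2 - t) != 0 by rewrite gt_eqF // step_den.
have dc := @is_derive_invf _ _ (fun t : R => flat 0 (t - 1) + flat 0 (2 - t)) t 1 _ d0 (is_derive_addf da db).
have h := is_derive_mulr da dc.
apply: is_derive_eq h _; rewrite /dstep; move: d0.
move: (flat 0 (t - 1)) (flat 0 (2 - t)) (flat 2 (t - 1)) (flat 2 (2 - t)) => x y x' y' d0.
by field.
Qed.

Lemma dstep_ge0 t : 0 <= dstep t.
Proof. by rewrite divr_ge0 ?sqr_ge0 // addr_ge0 // mulr_ge0 // flat_ge0. Qed.

Lemma dstep0 t : t <= 1 -> dstep t = 0.
Proof.
move=> t1; have h k : flat k (t - 1) = 0 by rewrite flat_out // subr_le0.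
by rewrite /dstep !h !mul0r addr0 mul0r.
Qed.

Lemma dstep1 t : 2 <= t -> dstep t = 0.
Proof.
move=> t1; have h k : flat k (2 - t) = 0 by rewrite flat_out // subr_le0.
by rewrite /dstep !h !mulr0 addr0 mul0r.
Qed.

Lemma cont_dstep : continuous dstep.
Proof.
move=> t; have -> : dstep = 'D_1 step by apply/funext => s; have [_ ->] := is_derive_step s.
exact: (Ck_cont (Ck_derive (1 : R) (Ck_step 1)) I).
Qed.

Lemma dstep_bounded : exists2 C, 0 < C & forall t, dstep t <= C.
Proof.
have cK : {within `[1, 2]%classic, continuous dstep} by apply: continuous_subspaceT; exact: cont_dstep.
have [B [_ HB]] := compact_bounded (continuous_compact cK (@segment_compact R 1 2)).
exists (Num.max B 0 + 1); first by rewrite ltr_wpDl // le_max lexx orbT.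
move=> t; have [t1|t1] := leP t 1; first by rewrite dstep0 // addr_ge0 // le_max lexx orbT.
have [t2|t2] := leP 2 t; first by rewrite dstep1 // addr_ge0 // le_max lexx orbT.
apply: le_trans (ler_norm _) _; apply: HB; first by rewrite ltr_pwDr // le_max lexx.
by exists t => //; rewrite /= in_itv /= !ltW.
Qed.

End SmoothStep.

(** * Primitives on a half-line *)

Section Primitive.
Variables (R : realType) (f : R -> R) (a : R).
Hypothesis cf : forall t, a <= t -> {for t, continuous f}.

Lemma integrable_segment u : lebesgue_measure.-integrable `[a, u] (EFin \o f).
Proof.
apply: (@continuous_compact_integrable R f); first exact: segment_compact.
by apply: continuous_in_subspaceT => x /set_mem /=; rewrite in_itv /= => /andP[ax _]; exact: cf.
Qed.

Lemma is_derive_primitive x : a < x -> is_derive x (1 : R) (fun u => \int[lebesgue_measure]_(t in `[a, u]) f t) (f x).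
Proof.
move=> ax; have xu : x < x + 1 by rewrite ltrDl.
have [d e] := continuous_FTC1_closed xu (integrable_segment (x + 1)) ax (cf (ltW ax)).
exact: DeriveDef d (etrans (esym (derive1E _ _)) e).
Qed.

Hypothesis f0 : forall t, a <= t -> 0 <= f t.

Lemma primitiveE u : (\int[lebesgue_measure]_(t in `[a, u]) (f t)%:E = (\int[lebesgue_measure]_(t in `[a, u]) f t)%:E)%E.
Proof.
rewrite /Rintegral fineK //; apply: integrable_fin_num => //; exact: integrable_segment.
Qed.

Lemma primitive_homo x y : x <= y -> \int[lebesgue_measure]_(t in `[a, x]) f t <= \int[lebesgue_measure]_(t in `[a, y]) f t.
Proof.
move=> xy; rewrite -lee_fin -!primitiveE; apply: ge0_subset_integral => //.
- by have /integrableP[] := integrable_segment y.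
- by move=> t /=; rewrite in_itv /= => /andP[a_t _]; rewrite lee_fin f0.
- by move=> t /=; rewrite !in_itv /= => /andP[-> tx]; exact: le_trans xy.
Qed.

Lemma primitive_ge0 x : 0 <= \int[lebesgue_measure]_(t in `[a, x]) f t.
Proof.
rewrite -lee_fin -primitiveE; apply: integral_ge0 => t /=; rewrite in_itv /= => /andP[a_t _].
by rewrite lee_fin f0.
Qed.

Lemma primitive_bounded B : (forall x, \int[lebesgue_measure]_(t in `[a, x]) f t <= B) ->
  (\int[lebesgue_measure]_(t in `[a, +oo[) (f t)%:E <= B%:E)%E.
Proof.
move=> fB; rewrite itv_bndy_bigcup_BRight.
have h1 : {homo (fun i => `[a, a + i%:R]%classic) : i j / (i <= j)%N >-> (i <= j)%O}.
  move=> i j ij; rewrite subsetEset => t /=; rewrite !in_itv /= => /andP[-> ti]; apply: le_trans ti _.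
  by rewrite lerD2l ler_nat.
have h2 i : measurable_fun `[a, a + i%:R] (EFin \o f) by have /integrableP[] := integrable_segment (a + i%:R).
have h3 (i : nat) t : `[a, a + i%:R]%classic t -> (0%R <= (EFin \o f) t)%E.
  by move=> /=; rewrite in_itv /= => /andP[a_t _]; rewrite lee_fin f0.
have c := @ge0_nondecreasing_set_cvg_integral _ (measurableTypeR R) R (fun i => `[a, a + i%:R]%classic) (EFin \o f) lebesgue_measure h1 (fun i => measurable_itv _) h2 h3.
rewrite -(cvg_lim _ c) //; apply: lime_le; first exact: cvgP c.
by apply: nearW => i; rewrite primitiveE lee_fin.
Qed.

End Primitive.

(** * Smoothness, derivative and divergence of the weight [Lambda] *)

Section Weight.
Variables (R : realType) (m : nat) (p rho : R) (w g lam h : R -> R).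
Hypotheses (hw : warping w) (Cg : smooth_on setT g) (Cl : smooth_on setT lam) (Ch : smooth_on setT h).
Hypotheses (p2 : 2 <= p) (bal : forall r, 0 < r -> 0 <= balance m p w lam h r) (rho0 : 0 < rho).
Hypothesis gpos : forall t, rho <= t -> 0 < g t.
Local Notation La := (Lambda m p rho w g lam h).

Let p1 : 0 < p - 1. Proof. by rewrite subr_gt0 (lt_le_trans _ p2) // ltr1n. Qed.
Let Cw : smooth_on setT w. Proof. by case: hw. Qed.
Let wpos r : 0 < r -> 0 < w r. Proof. by case: hw => _ _ _; exact. Qed.
(** An open set containing the closed half-line from [rho], so that the calculus of [Ck] applies to
    the integrand at [rho] too. *)
Let G : set R := [set t | 0 < t] `&` (w @^-1` [set t | 0 < t]) `&` (g @^-1` [set t | 0 < t]).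

Let oG : open G.
Proof.
apply: openI; last by apply: open_comp; [move=> t _; exact: Ck_cont (Cg 0) _|exact: open_gt].
apply: openI; first exact: open_gt.
by apply: open_comp; [move=> t _; exact: Ck_cont (Cw 0) _|exact: open_gt].
Qed.

Let GP t : rho <= t -> G t.
Proof. by move=> rt; have t0 := lt_le_trans rho0 rt; split; [split => //; exact: wpos|exact: gpos]. Qed.

Definition rate t := balance m p w lam h t / ((p - 1) * g t ^+ 2).

Let oT := @openT R.

Let Cdw k : Ck k setT (derive1 w).
Proof. by rewrite derive1_funE; exact: Ck_derive (Cw k.+1). Qed.

Let Ceta k : Ck k G (eta w).
Proof.
apply: (CkM oG (sub_Ck (@subsetT _ _) (Cdw k))).
by apply: (CkV oG) => [t [[_ w0] _]|]; [rewrite gt_eqF|exact: sub_Ck (@subsetT _ _) (Cw k)].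
Qed.

Let Crate k : Ck k G rate.
Proof.
have S (V : normedModType R) (f : R -> V) : Ck k setT f -> Ck k G f by exact: sub_Ck (@subsetT _ _).
have Cb : Ck k G (balance m p w lam h).
  have C1 := CkB oG (CkB oG (CkZ (m%:R + p - 2) oG (Ceta k)) (CkZ m%:R oG (S _ _ (Ch k)))) (CkZ (p - 2) oG (S _ _ (Cl k))).
  exact: (eq_Ck oG (fun t _ => erefl) C1).
apply: (CkM oG Cb); apply: (CkV oG) => [t [_ g0]|].
  by apply: lt0r_neq0; apply: mulr_gt0 => //; exact: exprn_gt0.
exact: (CkZ (p - 1) oG (CkM oG (S _ _ (Cg k)) (S _ _ (Cg k)))).
Qed.

Lemma rate_ge0 t : rho <= t -> 0 <= rate t.
Proof.
move=> rt; apply: divr_ge0; first by apply: bal; exact: lt_le_trans rt.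
by apply: mulr_ge0; [exact: ltW|exact: sqr_ge0].
Qed.

Let crate t : rho <= t -> {for t, continuous rate}.
Proof. by move=> rt; exact: Ck_cont (Crate 0) (GP rt). Qed.

Let Q (r : R) := \int[lebesgue_measure]_(t in `[rho, r]) rate t.
Let D : set R := [set t | rho < t].
Let oD : open D. Proof. exact: open_gt. Qed.
Let DG : D `<=` G. Proof. by move=> t /= rt; apply: GP; exact: ltW. Qed.

Let dQ t : D t -> is_derive t (1 : R) Q (rate t). Proof. by move=> rt; exact: is_derive_primitive. Qed.

Let CQ k : Ck k D Q. Proof. exact: CkW (Ck_derive1 oD dQ (sub_Ck DG (Crate k))). Qed.

Let CE k : Ck k D (fun t => expR (- Q t)).
Proof.
have CN : Ck k D (fun t => - Q t).
  by apply: (eq_Ck oD _ (CkZ (-1) oD (CQ k))) => t _; rewrite mulN1r.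
exact: (Ck_comp1 oD (fun _ _ => I) CN (Ck_expR R k)).
Qed.

Lemma Ck_Lambda k : Ck k [set t | rho < t] La.
Proof. exact: (CkM oD (sub_Ck (@subsetT _ _) (Cw k)) (CE k)). Qed.

Lemma Lambda_gt0 t : rho < t -> 0 < La t.
Proof. by move=> rt; apply: mulr_gt0; [apply: wpos; exact: lt_trans rt|exact: expR_gt0]. Qed.

Lemma Lambda_le t : rho < t -> La t <= w t.
Proof.
move=> rt; apply: ler_piMr; first by apply/ltW/wpos; exact: lt_trans rt.
have q0 : 0 <= Q t := primitive_ge0 crate rate_ge0 t.
by rewrite -[X in _ <= X]expR0 ler_expR oppr_le0.
Qed.

Lemma is_derive_Lambda t : rho < t -> is_derive t (1 : R) La (La t * (eta w t - rate t)).
Proof.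
move=> rt; have dw : is_derive t (1 : R) w (derive1 w t).
  by rewrite derive1E; split => //; exact: Ck_derivable (Cw 1) _.
have dN : is_derive t (1 : R) (fun t => - Q t) (- rate t) by exact: is_deriveN (dQ rt).
have dE : is_derive t (1 : R) (fun t => expR (- Q t)) (- rate t * expR (- Q t)).
  exact: (is_derive_comp1 dN (is_derive_expR (- Q t))).
apply: is_derive_eq (is_derive_mulr dw dE) _.
have w0 : w t != 0 by apply/lt0r_neq0/wpos; exact: lt_trans rt.
by rewrite /Lambda /eta -/(rate _) -/(Q t); move: (expR _) => e; field.
Qed.

(** On the bounded segment up to [c], [Lambda] is at most [w] and has finite integral, so the
    divergence survives a change of the starting point. A starting point beyond [rho] is needed
    because [Lambda] is differentiated only there. *)
Lemma Lambda_unbounded c : rho < c -> (\int[lebesgue_measure]_(t in `[rho, +oo[) (La t)%:E)%E = +oo%E ->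
  forall B, exists t, B < \int[lebesgue_measure]_(s in `[c, t]) La s.
Proof.
move=> rc hdiv B; apply: contrapT => nB.
have cL t : c <= t -> {for t, continuous La} by move=> ct; apply: Ck_cont (Ck_Lambda 0) _; exact: lt_le_trans ct.
have L0 t : c <= t -> 0 <= La t by move=> ct; apply/ltW/Lambda_gt0; exact: lt_le_trans ct.
have i2 : (\int[lebesgue_measure]_(t in [set` `[c, +oo[%R]) (La t)%:E <= B%:E)%E.
  by apply: primitive_bounded => // x; rewrite leNgt; apply/negP => Bx; apply: nB; exists x.
have mL : measurable_fun [set` Interval (BRight rho) +oo%O] (EFin \o La).
  have -> : [set` Interval (BRight rho) +oo%O] = D.
    by apply/seteqP; split=> t; rewrite /D /= in_itv /= andbT.
  apply/measurable_EFinP; apply: open_continuous_measurable_fun oD _.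
  by move=> t; rewrite inE => rt; exact: Ck_cont (Ck_Lambda 0) rt.
have mw : measurable_fun setT w by apply: continuous_measurable_fun => t; exact: Ck_cont (Cw 0) I.
have i1 : (\int[lebesgue_measure]_(t in `]rho, c]) (La t)%:E <= (\int[lebesgue_measure]_(t in `[rho, c]) w t)%:E)%E.
  have w0 t : rho <= t -> 0 <= w t by move=> rt; apply/ltW/wpos; exact: lt_le_trans rt.
  have cw t : rho <= t -> {for t, continuous w} by move=> _; exact: Ck_cont (Cw 0) I.
  rewrite -(primitiveE cw) -integral_itv_obnd_cbnd; last by apply/measurable_EFinP; exact: measurable_funS mw.
  apply: ge0_le_integral => //.
  - by move=> t /=; rewrite in_itv /= => /andP[rt _]; rewrite lee_fin; apply/ltW/Lambda_gt0.
  - by apply: measurable_funS mL => //; move=> t /=; rewrite !in_itv /= andbT => /andP[].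
  - by apply/measurable_EFinP; exact: measurable_funS mw.
  - by move=> t /=; rewrite in_itv /= => /andP[rt _]; rewrite lee_fin; exact: Lambda_le.
have : (+oo <= (\int[lebesgue_measure]_(t in `[rho, c]) w t)%:E + B%:E :> \bar R)%E.
  rewrite -hdiv -integral_itv_obnd_cbnd //.
  have b1 : (BRight rho <= BRight c)%O by rewrite bnd_simp ltW.
  have b2 : (BRight c <= +oo)%O by [].
  have E := itv_bndbnd_setU b1 b2.
  rewrite E in mL *.
  rewrite ge0_integral_setU //.
  - apply: leeD; first exact: i1.
    apply: le_trans i2; apply: ge0_subset_integral => //.
    + apply: measurable_funS mL; first exact: measurableU.
      by rewrite -E => t /=; rewrite !in_itv /= !andbT; exact: lt_le_trans.
    + by move=> t /=; rewrite in_itv /= andbT => ct; rewrite lee_fin L0.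
    + by move=> t /=; rewrite !in_itv /= !andbT => /ltW.
  - by rewrite -E => t /=; rewrite in_itv /= andbT => rt; rewrite lee_fin; exact/ltW/Lambda_gt0.
  - apply/disj_setPS => t [] /=; rewrite !in_itv /= andbT => /andP[_ tc] /(le_lt_trans tc); by rewrite ltxx.
by rewrite -EFinD leye_eq.
Qed.

End Weight.

(** * Bumps, partitions and the global flux inequality *)

Section WeightProfile.
Variables (R : realType) (La : R -> R) (rho : R).
Hypotheses (CL : forall k, Ck k [set t | rho < t] La) (L0 : forall t, rho < t -> 0 < La t).
Hypothesis unb : forall c, rho < c -> forall B, exists t, B < \int[lebesgue_measure]_(s in `[c, t]) La s.

(** [W] is the primitive of [La] vanishing at [rho + 2]. Integration starts at [rho + 1], inside the
    region where [La] is smooth; the nonpositive zone up to [rho + 2] leaves an open overlap in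
    which every cutoff built from [W] is constant. *)
Lemma weight_profile : exists W : R -> R, [/\
  forall t, rho + 1 < t -> is_derive t (1 : R) W (La t),
  forall k, Ck k [set t | rho + 1 < t] W,
  forall t, t <= rho + 2 -> W t <= 0,
  (forall s t, s <= t -> W s <= W t) & forall B, exists t, B < W t].
Proof.
have c1 : rho < rho + 1 by rewrite ltrDl.
have cL t : rho + 1 <= t -> {for t, continuous La} by move=> ct; apply: Ck_cont (CL 0) _; exact: lt_le_trans ct.
have L1 t : rho + 1 <= t -> 0 <= La t by move=> ct; apply/ltW/L0; exact: lt_le_trans ct.
pose V t := \int[lebesgue_measure]_(s in `[rho + 1, t]) La s.
have dW t : rho + 1 < t -> is_derive t (1 : R) (fun t => V t - V (rho + 2)) (La t).
  move=> ct; apply: is_derive_eq (is_derive_subf (is_derive_primitive cL ct) (is_derive_cst (V (rho + 2)) t 1)) _.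
  by rewrite subr0.
have mW s t : s <= t -> V s - V (rho + 2) <= V t - V (rho + 2) by move=> st; rewrite lerD2r; exact: (primitive_homo cL L1 st).
exists (fun t => V t - V (rho + 2)); split=> //.
- move=> k; apply: CkW; have oU : open [set t : R | rho + 1 < t] by exact: open_gt.
  by apply: (Ck_derive1 oU dW); apply: sub_Ck (CL k) => t /=; exact: lt_trans.
- by move=> t /mW; rewrite subrr.
- by move=> B; have [t] := unb c1 (B + V (rho + 2)); exists t; rewrite ltrBrDr.
Qed.

End WeightProfile.

Section CompactIdeal.

(* If I did not contain K, the complements of its members would generate a proper filter on K without cluster point. *)
Lemma compact_ideal (T : topologicalType) (K : set T) (I : set T -> Prop) :
  I set0 -> (forall A B, A `<=` B -> I B -> I A) -> (forall A B, I A -> I B -> I (A `|` B)) ->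
  (forall x, K x -> exists2 V, nbhs x V & I V) -> compact K -> I K.
Proof.
move=> I0 IS IU IV cK; apply: contrapT => nK.
pose F : set_system T := [set A | I (K `\` A)].
have FF : ProperFilter F.
  split; first by rewrite /F /= setD0.
  split; first by rewrite /F /= setDT.
    by move=> A B FA FB; rewrite /F /= setDIr; exact: IU.
  by move=> A B AB; apply: IS; exact: setDS.
have FK : F K by rewrite /F /= setDv.
have [x [Kx cx]] := cK F FF FK; have [V xV IVx] := IV x Kx.
have FV : F (~` V) by apply: IS IVx => y [_ /contrapT].
by have [y [nVy Vy]] := cx _ _ FV xV.
Qed.

End CompactIdeal.

(** * Bump functions and finite covers *)

Section Bumps.
Variables (R : realType) (n : nat) (M : riemannian R n).
Local Notation U k := (cdom (atlas M k)).
Local Notation C k := (cimg (atlas M k)).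
Local Notation ci k := (cinv (atlas M k)).

(** The squared Euclidean norm; the norm of row vectors is the maximum norm, which is not smooth. *)
Definition sqnorm (z : 'rV[R]_n) : R := (z *m z^T) 0 0.

Lemma sqnormE z : sqnorm z = \sum_i z 0 i ^+ 2.
Proof. by rewrite /sqnorm mxE; apply: eq_bigr => i _; rewrite mxE expr2. Qed.

Lemma sqnorm_bound (z : 'rV[R]_n) r : 0 <= r -> sqnorm z <= r ^+ 2 -> `|z| <= r.
Proof.
move=> r0; rewrite sqnormE => zr; apply/mx_norm_le => //= i j; rewrite ord1.
rewrite -ler_sqr ?nnegrE // real_normK ?num_real //; apply: le_trans zr.
by rewrite (bigD1 j) //= lerDl sumr_ge0 // => l _; exact: sqr_ge0.
Qed.

Definition bump (chi : M -> R) := [/\ forall k j, Ck j (C k) (chi \o ci k), forall x, 0 <= chi x <= 1 &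
  exists k K, [/\ compact K, K `<=` U k & forall x, ~ K x -> chi x = 0]].

Lemma exists_bump (x : M) : exists2 chi, bump chi & nbhs x [set z | chi z = 1].
Proof.
set k := chart_at x; have kx : U k x by exact: chart_at_dom.
set y := cmap (atlas M k) x; have Cy : C k y by exact: cmap_img.
have [e e0 eC] : exists2 e : R, 0 < e & forall z, `|z - y| <= e -> C k z.
  have /nbhs_closedballP [e He] : nbhs y (C k) by apply: open_nbhs_nbhs; split => //; exact: cimg_open.
  exists e%:num => // z zy; apply: He; rewrite closed_ballE //= /closed_ball_ /=.
  by rewrite distrC.
(* Scaled so that [v] is 2 at Euclidean distance [e] from [y]: the step is then complete before the
   closed [e]-ball of the maximum norm ends, and has not begun near [y]. *)
pose v (z : 'rV[R]_n) := 2 / e ^+ 2 * sqnorm (z - y).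
pose psi (z : 'rV[R]_n) := 1 - step (v z).
pose K' := [set z | `|z - y| <= e].
have e2 : 0 < e ^+ 2 by exact: exprn_gt0.
have psi0 z : ~ K' z -> psi z = 0.
  move=> Kz; rewrite /psi step1 ?subrr // /v mulrAC ler_pdivlMr // ler_pM2l //.
  by rewrite leNgt; apply/negP => h; apply: Kz; apply: sqnorm_bound; exact: ltW.
have cK' : compact K'.
  have -> : K' = closed_ball_ Num.norm y e by apply/seteqP; split=> z; rewrite /K' /closed_ball_ /= distrC.
  apply: bounded_closed_compact; last exact: closed_closed_ball_.
  exists (e + `|y|); split; first exact: num_real.
  move=> r er z /= zy; apply/ltW/(le_lt_trans _ er).
  by rewrite -[z](subrK y) (le_trans (ler_normD _ _)) // lerD2r distrC.
pose K := ci k @` K'.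
have cK : compact K.
  apply: continuous_compact cK'; apply: continuous_in_subspaceT => z /set_mem Kz.
  exact: (cinv_cont (eC z Kz)).
have KU : K `<=` U k by move=> _ [z Kz <-]; apply: cinv_dom; exact: eC.
have clK : closed K by exact: compact_closed (@carrier_hausdorff _ _ M) cK.
pose chi := extend0 (U k) (psi \o cmap (atlas M k)).
have chiK z : ~ K z -> chi z = 0.
  move=> Kz; have [kz|kz] := pselect (U k z); last by rewrite /chi extend0_out.
  rewrite /chi extend0_in //= psi0 // => Kz'; apply: Kz; exists (cmap (atlas M k) z) => //.
  exact: cmapK.
have Cv j : Ck j setT v.
  have oT := @openT 'rV[R]_n.
  have Cz : Ck j setT (fun z : 'rV[R]_n => z - y) := CkD oT (Ck_id j setT) (Ck_cst j setT (- y)).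
  have CM := Ck_mulmx oT Cz (Ck_trmx oT Cz).
  exact: (CkZ (2 / e ^+ 2) oT (proj1 (Ck_mxP _ _ oT) CM 0 0)).
have Cpsi j : Ck j setT psi.
  have oT := @openT 'rV[R]_n.
  exact: (CkB oT (Ck_cst j setT (1 : R)) (Ck_comp1 oT (fun _ _ => I) (Cv j) (@Ck_step R j))).
exists chi; last first.
  pose B := v @^-1` [set t | t < 1].
  have oB : open B.
    have cv : continuous v by move=> z; exact: (@Ck_cont R _ _ 0 setT v z (Cv 0) I).
    by apply: open_comp; [move=> z _; exact: cv|exact: open_lt].
  have By : B y by rewrite /B /v /= subrr /sqnorm mul0mx mxE mulr0.
  have nB : nbhs x ((cmap (atlas M k)) @^-1` B).
    by apply: (cmap_cont kx); apply: open_nbhs_nbhs.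
  have nU : nbhs x (U k) by apply: open_nbhs_nbhs; split => //; exact: cdom_open.
  apply: filterS2 nB nU => z Bz kz; rewrite /= /chi extend0_in //= /psi step0 ?subr0 //; exact: ltW.
split.
- move=> l j; apply: Ck_local => z Cz; have [kz|kz] := pselect (U k (ci l z)).
    exists (C l `&` ci l @^-1` U k) => //.
    have oI : open (C l `&` ci l @^-1` U k) by apply: open_chart_preimage; exact: cdom_open.
    apply: (eq_Ck oI (f := psi \o transition M l k)) => [t [lt kt]|]; first by rewrite /= /chi extend0_in.
    exact: (Ck_comp oI (@openT 'rV[R]_n) (fun _ _ => I) (@Ck_transition _ _ M j l k) (Cpsi j)).
  have oI : open (C l `&` ci l @^-1` (~` K)) by apply: open_chart_preimage; exact: closed_openC.
  exists (C l `&` ci l @^-1` (~` K)); first by split => //; move=> /KU.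
  by apply: (eq_Ck oI (f := fun _ => 0)) => [t [lt kt]|]; [rewrite /= chiK|exact: Ck_cst].
- move=> z; have [kz|kz] := pselect (U k z); last by rewrite /chi extend0_out // lexx ler01.
  by rewrite /chi extend0_in //= /psi subr_ge0 step_le1 lerBlDr lerDl step_ge0.
- by exists k, K.
Qed.

(** The vanishing product says that some bump equals 1 at each point of [K]. This replaces a
    normalized partition of unity: peeling off [chi] and [1 - chi] in turn exhausts any function
    supported in [K]. *)
Lemma bump_cover (K : set M) : compact K ->
  exists2 s : seq (M -> R), (forall i, (i < size s)%N -> bump (nth (fun _ => 0) s i)) & forall x, K x -> \prod_(chi <- s) (1 - chi x) = 0.
Proof.
apply: (compact_ideal (I := fun K => exists2 s : seq (M -> R), (forall i, (i < size s)%N -> bump (nth (fun _ => 0) s i)) & forall x, K x -> \prod_(chi <- s) (1 - chi x) = 0)).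
- by exists [::].
- by move=> A B AB [s sb sB]; exists s => // x /AB; exact: sB.
- move=> A B [s sb sA] [t tb tB]; exists (s ++ t) => [i|x ABx].
    rewrite size_cat nth_cat => st; case: ifP => // si; first exact: sb.
    by apply: tb; rewrite ltn_subLR // leqNgt si.
  by rewrite big_cat /=; case: ABx => [/sA|/tB] ->; rewrite ?mul0r ?mulr0.
- move=> x Kx; have [chi bc nc] := exists_bump x; exists [set z | chi z = 1] => //.
  by exists [:: chi] => [[|i] si|z z1]; [exact: bc|by []|rewrite big_seq1 z1 subrr].
Qed.

End Bumps.

Section ManifoldCalculus.
Variables (R : realType) (n : nat) (M : riemannian R n).
Local Notation U k := (cdom (atlas M k)).
Local Notation C k := (cimg (atlas M k)).
Local Notation ci k := (cinv (atlas M k)).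

Lemma preimT k : preim k [set: M] = C k. Proof. exact: setIT. Qed.

Lemma Ck_chart_continuous (u : M -> R) : (forall k, Ck 0 (C k) (u \o ci k)) -> continuous u.
Proof.
move=> Cu x; set k := chart_at x; have kx : U k x by exact: chart_at_dom.
have H : {for x, continuous ((u \o ci k) \o cmap (atlas M k))}.
  apply: continuous_comp; first exact: cmap_cont.
  exact: (Ck_cont (Cu k) (cmap_img kx)).
apply: near_eq_cont H; have : nbhs x (U k) by apply: open_nbhs_nbhs; split => //; exact: cdom_open.
by apply: filterS => z kz; rewrite /= cmapK.
Qed.

Let sT (u : M -> R) : smooth2 [set: M] u -> forall x : M, differentiable (u \o ci (chart_at x)) (coord x).
Proof.
move=> su x; have oC : open (C (chart_at x)) by exact: cimg_open.
have C1 : Ck 1 (C (chart_at x)) (u \o ci (chart_at x)) by rewrite -preimT; exact: CkW (su _).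
exact: (Ck1_differentiable oC C1 (cmap_img (chart_at_dom x))).
Qed.

Lemma inner_gradD (a b f : M -> R) (x : M) : smooth2 [set: M] a -> smooth2 [set: M] b ->
  inner_grad (fun z => a z + b z) f x = inner_grad a f x + inner_grad b f x.
Proof.
move=> sa sb; rewrite /inner_grad -dotDl; congr dot; rewrite /grad -mulmxDl; congr (_ *m _).
apply/rowP => i; rewrite !mxE.
have da := diff_derivable (v := delta_mx 0 i) (sT sa x).
have db := diff_derivable (v := delta_mx 0 i) (sT sb x).
have [_ e] := is_derive_addf (DeriveDef da erefl) (DeriveDef db erefl); exact: e.
Qed.

Lemma inner_grad_comp (F : R -> R) (dF : R) (f h : M -> R) (D : set M) (x : M) : open D -> D x -> smooth2 D f ->
  is_derive (f x) (1 : R) F dF -> inner_grad (F \o f) h x = dF * inner_grad f h x.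
Proof.
move=> oD Dx sf dF1; rewrite /inner_grad -dotZl; congr dot; rewrite /grad scalemxAl; congr (_ *m _).
apply/rowP => i; rewrite !mxE; set k := chart_at x; have kx : U k x by exact: chart_at_dom.
have e0 : ci k (coord x) = x by exact: cmapK.
have oP : open (preim k D) by exact: open_preim.
have ky : preim k D (coord x) by split; [exact: cmap_img|rewrite /preimage /= e0].
have df : differentiable (f \o ci k) (coord x) := Ck1_differentiable oP (CkW (sf k)) ky.
have dv := diff_derivable (v := delta_mx 0 i) df.
have dF2 : is_derive ((f \o ci k) (coord x)) (1 : R) F dF by rewrite /= e0.
have [_ e] := is_derive_comp1 (DeriveDef dv erefl) dF2.
by apply: etrans e _; rewrite mulrC.
Qed.

End ManifoldCalculus.

(** * Finiteness and signed integrals *)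

Section FiniteVolume.
Variables (R : realType) (n : nat) (M : riemannian R n).
Local Notation U k := (cdom (atlas M k)).

Let clK (K : set M) : compact K -> closed K.
Proof. by move=> cK; exact: compact_closed (@carrier_hausdorff _ _ M) cK. Qed.

Lemma volume_chart_compact (h : M -> R) K k : continuous h -> (forall x, 0 <= h x) -> compact K -> K `<=` U k ->
  (forall x, ~ K x -> h x = 0) -> volume_int h = cint k (U k) h /\ (volume_int h < +oo)%E.
Proof.
move=> ch h0 cK KU hK; have fin := cint_finite ch h0 cK KU hK.
have e : volume_int h = cint k (U k) h by apply: (volume_chart ch h0 _ fin) => x kx; apply: hK => /KU.
by rewrite e.
Qed.

Lemma bump_continuous (chi : M -> R) : bump chi -> continuous chi.
Proof. by case=> Cc _ _; exact: Ck_chart_continuous (fun k => Cc k 0%N). Qed.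

(** Induction on the list of bumps: [chi h] is supported in one chart, and [(1 - chi) h] is killed
    by the product over the shorter list. *)
Lemma volume_finite (h : M -> R) K : continuous h -> (forall x, 0 <= h x) -> compact K ->
  (forall x, ~ K x -> h x = 0) -> (volume_int h < +oo)%E.
Proof.
move=> ch h0 cK hK; have [s sb sK] := bump_cover cK.
have hs x : h x * \prod_(chi <- s) (1 - chi x) = 0.
  by have [Kx|Kx] := pselect (K x); [rewrite sK ?mulr0|rewrite hK ?mul0r].
elim: s h sb ch h0 hK hs {sK} => [|chi s IH] h sb ch h0 hK hs.
  have hz x : h x = 0 by have := hs x; rewrite big_nil mulr1.
  by have [] := @volume_chart_compact h set0 0%N ch h0 (@compact0 _) (@sub0set _ _) (fun x _ => hz x).
have bc : bump chi by exact: (sb 0%N).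
have [_ c01 [k [K1 [cK1 K1U c0]]]] := bc; have cc := bump_continuous bc.
have c1 : continuous (fun x => chi x * h x) by move=> x; apply: cont_mulr; [exact: cc|exact: ch].
have c2 : continuous (fun x => (1 - chi x) * h x).
  move=> x; have c0x : {for x, continuous (fun _ : M => 1 : R)} by exact: cst_continuous.
  exact: (cont_mulr (cont_addr c0x (cont_oppr (cc x))) (ch x)).
have p1 x : 0 <= chi x * h x by apply: mulr_ge0 => //; case/andP: (c01 x).
have p2 x : 0 <= (1 - chi x) * h x by apply: mulr_ge0 => //; rewrite subr_ge0; case/andP: (c01 x).
have -> : h = fun x => chi x * h x + (1 - chi x) * h x by apply/funext => x; ring.
rewrite (volume_add c1 c2 p1 p2); apply: lte_add_pinfty.
  by have [] := volume_chart_compact c1 p1 cK1 K1U (fun x Kx => etrans (congr1 (fun t => t * h x) (c0 x Kx)) (mul0r _)).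
apply: IH => //.
- by move=> i si; exact: (sb i.+1).
- by move=> x Kx; rewrite hK ?mulr0.
- by move=> x; have := hs x; rewrite big_cons => <-; ring.
Qed.

Definition ppart (h : M -> R) (x : M) := (`|h x| + h x) / 2.
Definition npart (h : M -> R) (x : M) := (`|h x| - h x) / 2.

Let cabs (h : M -> R) : continuous h -> forall x : M, {for x, continuous (fun x => `|h x|)}.
Proof. by move=> ch x; apply: continuous_comp; [exact: ch|exact: norm_continuous]. Qed.

Lemma ppart_ge0 (h : M -> R) (x : M) : 0 <= ppart h x.
Proof. by rewrite divr_ge0 // -lerBlDr sub0r -normrN ler_norm. Qed.

Lemma npart_ge0 (h : M -> R) (x : M) : 0 <= npart h x.
Proof. by rewrite divr_ge0 // subr_ge0 ler_norm. Qed.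

Lemma ppart_cont (h : M -> R) : continuous h -> continuous (ppart h).
Proof.
move=> ch x; have c0x : {for x, continuous (fun _ : M => 2^-1 : R)} by exact: cst_continuous.
have H1 := cont_addr (@cabs h ch x) (ch x).
have H2 := cont_mulr H1 c0x.
exact: H2.
Qed.

Lemma npart_cont (h : M -> R) : continuous h -> continuous (npart h).
Proof.
move=> ch x; have c0x : {for x, continuous (fun _ : M => 2^-1 : R)} by exact: cst_continuous.
have H1 := cont_addr (@cabs h ch x) (cont_oppr (ch x)).
have H2 := cont_mulr H1 c0x.
exact: H2.
Qed.

(* The integral of h exists and is nonnegative, stated for the positive and negative parts because volume_int only makes sense for nonnegative functions. *)
Definition volume_nonneg (h : M -> R) :=
  [/\ continuous h, (volume_int (npart h) <= volume_int (ppart h))%E & (volume_int (ppart h) < +oo)%E].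

Let fin (h : M -> R) : (forall x, 0 <= h x) -> (volume_int h < +oo)%E -> volume_int h \is a fin_num.
Proof. by move=> h0 hf; rewrite ge0_fin_numE // volume_ge0. Qed.

(** The positive part of a sum is not the sum of positive parts, but the two differ by as much as
    the negative parts do; finite integrals allow this excess to be cancelled. *)
Lemma volume_nonnegD (a b : M -> R) : volume_nonneg a -> volume_nonneg b -> volume_nonneg (fun x => a x + b x).
Proof.
move=> [ca na fa] [cb nb fb]; have cab : continuous (fun x => a x + b x) by move=> x; apply: cont_addr; [exact: ca|exact: cb].
set c := fun x => a x + b x in cab *.
have cpa := ppart_cont ca; have cpb := ppart_cont cb; have cpc := ppart_cont cab.
have cna := npart_cont ca; have cnb := npart_cont cb; have cnc := npart_cont cab.
have cp : continuous (fun x => ppart a x + ppart b x) by move=> x; apply: cont_addr; [exact: cpa|exact: cpb].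
have cn : continuous (fun x => npart a x + npart b x) by move=> x; apply: cont_addr; [exact: cna|exact: cnb].
have p0 x : 0 <= ppart a x + ppart b x by rewrite addr_ge0 ?ppart_ge0.
have n0 x : 0 <= npart a x + npart b x by rewrite addr_ge0 ?npart_ge0.
have Fp : (volume_int (fun x => ppart a x + ppart b x)) \is a fin_num.
  by apply: fin => //; rewrite (volume_add cpa cpb (ppart_ge0 a) (ppart_ge0 b)); exact: lte_add_pinfty.
have fc : (volume_int (ppart c) < +oo)%E.
  have fs : (volume_int (fun x => (ppart a x + ppart b x)%R) < +oo)%E by move: Fp; rewrite ge0_fin_numE // volume_ge0.
  apply: le_lt_trans fs; apply: volume_le => // x; rewrite ppart_ge0 /= /ppart /c -mulrDl ler_pM2r // addrACA lerD2r; exact: ler_normD.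
split => //; rewrite -(leeD2rE _ _ Fp).
rewrite -(volume_add cnc cp (npart_ge0 c) p0).
(* Both sides equal the total of the four parts' balance: positive minus negative part is [a + b]
   for either decomposition. *)
have -> : (fun x => npart c x + (ppart a x + ppart b x)) = fun x => ppart c x + (npart a x + npart b x).
  by apply/funext => x; rewrite /npart /ppart /c; field.
rewrite (volume_add cpc cn (ppart_ge0 c) n0); apply: leeD => //.
by rewrite (volume_add cna cnb (npart_ge0 a) (npart_ge0 b)) (volume_add cpa cpb (ppart_ge0 a) (ppart_ge0 b)) leeD.
Qed.

Lemma volume_nonneg_le (b1 b2 : M -> R) : continuous b1 -> continuous b2 -> (forall x, 0 <= b1 x) -> (forall x, 0 <= b2 x) ->
  volume_nonneg (fun x => b1 x - b2 x) -> (volume_int b2 <= volume_int b1)%E.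
Proof.
move=> c1 c2 p1 p2 []; set h := fun x => b1 x - b2 x => ch nh fh.
rewrite -(leeD2rE _ _ (fin (ppart_ge0 h) fh)).
rewrite -(volume_add c2 (ppart_cont ch) p2 (ppart_ge0 h)).
have -> : (fun x => b2 x + ppart h x) = fun x => b1 x + npart h x by apply/funext => x; rewrite /ppart /npart /h; field.
by rewrite (volume_add c1 (npart_cont ch) p1 (npart_ge0 h)) leeD.
Qed.

End FiniteVolume.

(** * The flux inequality on the whole manifold *)

Section GlobalFlux.
Variables (R : realType) (n : nat) (M : riemannian R n).
Local Notation U k := (cdom (atlas M k)).
Local Notation C k := (cimg (atlas M k)).
Local Notation ci k := (cinv (atlas M k)).
Variables (f : M -> R) (O : set M) (A A' : R -> R) (p : R).
Hypotheses (oO : open O) (sf : smooth2 O f).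
Hypothesis dA : forall x, O x -> is_derive (f x) (1 : R) A (A' (f x)).
Hypothesis CA : forall k, Ck 1 (preim k O) (A \o f \o ci k).
Hypothesis T0 : forall x, O x -> 0 < inner_grad f f x.
Hypothesis super : forall x, O x -> A' (f x) * inner_grad f f x +
  A (f x) * radial_op (coord x) p (metric M (chart_at x)) (f \o ci (chart_at x)) <= 0.
Local Notation F := (flux_pair f O A p).

Lemma flux_pairD (a b : M -> R) : smooth2 [set: M] a -> smooth2 [set: M] b -> F (fun x => a x + b x) = fun x => F a x + F b x.
Proof.
move=> sa sb; apply/funext => x; have [Ox|Ox] := pselect (O x).
  have h1 phi : F phi x = A (f x) * inner_grad f f x `^ ((p - 2) / 2) * inner_grad phi f x by exact: extend0_in.
  by rewrite (h1 a) (h1 b) h1 (inner_gradD f x sa sb); exact: mulrDr.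
have h1 phi : F phi x = 0 by exact: extend0_out.
by rewrite !h1; exact: (esym (addr0 0)).
Qed.

(** In one chart the positive part of the integrand is its negative part plus the integrand itself,
    whose integral is nonnegative. *)
Lemma flux_chart phi K k : smooth2 [set: M] phi -> compact K -> K `<=` O -> K `<=` U k ->
  (forall x, 0 <= phi x) -> (forall x, ~ K x -> phi x = 0) -> volume_nonneg (F phi).
Proof.
move=> sp cK KO KU p0 pK.
have [H0 [cH [HK cK']]] := chart_flux_ge0 oO sf dA CA T0 super sp cK KO pK KU p0.
set H := extend0 (C k) (cfun k (F phi)) in H0 cH HK; set K' := cmap (atlas M k) @` K in HK cK'.
have clK : closed K by exact: compact_closed (@carrier_hausdorff _ _ M) cK.
have FK x : ~ K x -> F phi x = 0 by move=> Kx; exact: (@flux_pair_out _ _ _ f O A p phi K x clK pK Kx).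
have cF : continuous (F phi) by exact: (flux_pair_cont oO sf CA T0 sp cK KO pK).
have pz x : ~ K x -> ppart (F phi) x = 0 by move=> Kx; rewrite /ppart FK // normr0 addr0 mul0r.
have nz x : ~ K x -> npart (F phi) x = 0 by move=> Kx; rewrite /npart FK // normr0 subr0 mul0r.
have [ep fp] := volume_chart_compact (ppart_cont cF) (ppart_ge0 (F phi)) cK KU pz.
have [en fn] := volume_chart_compact (npart_cont cF) (npart_ge0 (F phi)) cK KU nz.
split => //; rewrite en ep.
have oU : open (U k) by exact: cdom_open.
have mU : mchart (U k) := mchart_open oU.
rewrite (cintE (npart_cont cF) (npart_ge0 (F phi)) k mU) (cintE (ppart_cont cF) (ppart_ge0 (F phi)) k mU).
have inU y : C k y -> preim k (U k) y by move=> ky; split => //; exact: cinv_dom.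
have outU y : ~ C k y -> ~ preim k (U k) y by move=> ky [].
have En y : extend0 (preim k (U k)) (cfun k (npart (F phi))) y = (`|H y| - H y) / 2.
  have [ky|ky] := pselect (C k y).
    rewrite extend0_in; last exact: inU.
    by rewrite /H extend0_in // /cfun /npart normrM (ger0_norm (density_ge0 M k y)); ring.
  rewrite extend0_out; last exact: outU.
  by rewrite /H extend0_out // normr0 subr0 mul0r.
have Ep y : extend0 (preim k (U k)) (cfun k (ppart (F phi))) y = (`|H y| - H y) / 2 + H y.
  have [ky|ky] := pselect (C k y).
    rewrite extend0_in; last exact: inU.
    by rewrite /H extend0_in // /cfun /ppart normrM (ger0_norm (density_ge0 M k y)); field.
  rewrite extend0_out; last exact: outU.
  by rewrite /H extend0_out // normr0 subr0 mul0r addr0.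
have iH := integrable_compact_support cH cK' HK.
have cN : continuous (fun y => (`|H y| - H y) / 2).
  move=> y; have c0y : {for y, continuous (fun _ : 'rV[R]_n => 2^-1 : R)} by exact: cst_continuous.
  have ca : {for y, continuous (fun y => `|H y|)} by apply: continuous_comp; [exact: cH|exact: norm_continuous].
  exact: (cont_mulr (cont_addr ca (cont_oppr (cH y))) c0y).
have NK y : ~ K' y -> (`|H y| - H y) / 2 = 0 by move=> Ky; rewrite HK // normr0 subr0 mul0r.
have iN := integrable_compact_support cN cK' NK.
under eq_integral => t _ do rewrite En.
under [X in (_ <= X)%E]eq_integral => t _ do rewrite Ep EFinD.
by rewrite integralD // leeDl.
Qed.

Let smoothM (a b : M -> R) : smooth2 [set: M] a -> smooth2 [set: M] b -> smooth2 [set: M] (fun x => a x * b x).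
Proof. by move=> sa sb k; have oP : open (preim k [set: M]) := open_preim openT; exact: (CkM oP (sa k) (sb k)). Qed.

(* A partition of unity reduces the inequality to one chart. *)
Lemma flux_global phi K : smooth2 [set: M] phi -> compact K -> K `<=` O ->
  (forall x, 0 <= phi x) -> (forall x, ~ K x -> phi x = 0) -> volume_nonneg (F phi).
Proof.
move=> sp cK KO p0 pK; have [s sb sK] := bump_cover cK.
have hs x : phi x * \prod_(chi <- s) (1 - chi x) = 0.
  by have [Kx|Kx] := pselect (K x); [rewrite sK ?mulr0|rewrite pK ?mul0r].
elim: s phi sb sp p0 pK hs {sK} => [|chi s IH] phi sb sp p0 pK hs.
  have hz x : phi x = 0 by have := hs x; rewrite big_nil mulr1.
  exact: (@flux_chart phi set0 0%N sp (@compact0 _) (@sub0set _ _) (@sub0set _ _) p0 (fun x _ => hz x)).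
have bc : bump chi by exact: (sb 0%N).
have [Cc c01 [k [K1 [cK1 K1U c0]]]] := bc.
have sc : smooth2 [set: M] chi by move=> j; rewrite preimT; exact: Cc.
have sc1 : smooth2 [set: M] (fun x => 1 - chi x).
  move=> j; have oP : open (preim j [set: M]) := open_preim openT.
  exact: (CkB oP (Ck_cst 2 _ (1 : R)) (sc j)).
have s1 := smoothM sc sp; have s2 := smoothM sc1 sp.
have e : phi = fun x => chi x * phi x + (1 - chi x) * phi x by apply/funext => x; ring.
rewrite {1}e flux_pairD //; apply: volume_nonnegD.
  have cI : compact (K `&` K1) by apply: compact_closedI => //; exact: compact_closed (@carrier_hausdorff _ _ M) cK1.
  apply: (@flux_chart _ (K `&` K1) k s1 cI).
  - by move=> x [/KO].
  - by move=> x [_ /K1U].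
  - by move=> x; apply: mulr_ge0 => //; case/andP: (c01 x).
  - move=> x nK; have [Kx|Kx] := pselect (K x); last by rewrite pK ?mulr0.
    by rewrite c0 ?mul0r // => K1x; apply: nK.
apply: IH => //.
- by move=> i si; exact: (sb i.+1).
- by move=> x; apply: mulr_ge0 => //; rewrite subr_ge0; case/andP: (c01 x).
- by move=> x Kx; rewrite pK ?mulr0.
- by move=> x; have := hs x; rewrite big_cons => <-; ring.
Qed.

End GlobalFlux.

(** * Parabolicity *)

Section PowerContinuity.
Variable R : realType.

Lemma cont_powR_norm (a : R) : 1 <= a -> continuous (fun s : R => `|s| `^ a).
Proof.
move=> a1 s; have [->|s0] := eqVneq s 0; last first.
  apply: (@continuous_comp _ _ _ (fun s : R => `|s|) (fun t : R => t `^ a)); first exact: norm_continuous.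
  by apply: (Ck_cont (@Ck_powR R 0 a)); rewrite /= normr_gt0.
have a0 : a != 0 by rewrite gt_eqF // (lt_le_trans _ a1).
apply/cvgrPdist_le => e e0; have m0 : 0 < Num.min 1 e by rewrite lt_min ltr01.
have : \forall t \near (0 : R), `|t| < Num.min 1 e by exact: nbhs0_lt.
apply: filterS => t te.
rewrite normr0 powR0 // sub0r normrN ger0_norm ?powR_ge0 //.
have [->|t0] := eqVneq t 0; first by rewrite normr0 powR0 // ltW.
have [t1 tE] : `|t| <= 1 /\ `|t| <= e by move: te; rewrite lt_min => /andP[/ltW ? /ltW ?].
apply: le_trans tE; rewrite -[X in _ <= X]powRr1 //; apply: ger_powR => //.
by rewrite normr_gt0 t0 t1.
Qed.

(** Here [s] is the slope of the cutoff, [l] the value of [La] and [G] the squared gradient of [f].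
    Since [s <= k <= 1] and [p - 1 >= 1], one has [s^p <= k s]; the remaining factors recombine into
    the flux density. *)
Lemma powR_energy_le (s k l G p : R) : 2 <= p -> 0 <= s -> s <= k -> k <= 1 -> 0 < l -> 0 < G ->
  Num.sqrt ((s * l) ^+ 2 * G) `^ p <= k * (s * (l * (l `^ (p - 1) * (G `^ ((p - 2) / 2) * G)))).
Proof.
move=> p2 s0 sk k1 l0 G0; have sl0 : 0 <= s * l by rewrite mulr_ge0 // ltW.
have pn : p != 0 by rewrite gt_eqF // (lt_le_trans _ p2).
rewrite sqrtrM ?sqr_ge0 // sqrtr_sqr ger0_norm // powRM ?sqrtr_ge0 // powRM ?(ltW l0) //.
rewrite (powR_pred p l0) -(powR12_sqrt (ltW G0)) -powRrM (powR_pred (2^-1 * p) G0).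
have -> : 2^-1 * p - 1 = (p - 2) / 2 by field.
have h : s `^ p <= k * s.
  have [->|sn] := eqVneq s 0; first by rewrite powR0 // mulr0.
  have sp : 0 < s by rewrite lt_def sn.
  rewrite (powR_pred p sp) mulrC ler_pM2r //; apply: (le_trans _ (sk)).
  rewrite -[X in _ <= X](powRr1 s0); apply: ger_powR; first by rewrite sp (le_trans sk).
  by rewrite lerBrDr.
have r0 : 0 <= l * (l `^ (p - 1) * (G `^ ((p - 2) / 2) * G)).
  by rewrite !mulr_ge0 ?powR_ge0 // ltW.
rewrite [leRHS]mulrA; apply: le_trans (ler_wpM2r r0 h).
by rewrite le_eqVlt; apply/orP; left; apply/eqP; ring.
Qed.

End PowerContinuity.

(** * Vanishing capacity of a sublevel set *)

Section Parabolicity.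
Variables (R : realType) (n : nat) (M : riemannian R n).
Local Notation U k := (cdom (atlas M k)).
Local Notation C k := (cimg (atlas M k)).
Local Notation ci k := (cinv (atlas M k)).

Lemma volume_scale (r : R) (f : M -> R) : continuous f -> (forall x, 0 <= f x) -> 0 <= r ->
  volume_int (fun x => r * f x) = (r%:E * volume_int f)%E.
Proof.
move=> cf f0 r0; have ck : continuous (fun _ : M => r) by exact: cst_continuous.
have crf : continuous (fun x => r * f x) by move=> x; exact: (cont_mulr (ck x) (cf x)).
have rf0 x : 0 <= r * f x by rewrite mulr_ge0.
rewrite !volume_intE -nneseriesZl; last by move=> k _; apply: lebesgue_int_ge0 => y; exact: extend0_ge0.
apply: eq_eseriesr => k _; have mp := @mchart_piece R n M k.
rewrite (cintE crf rf0 k mp) (cintE cf f0 k mp) -ge0_integralZl_EFin //; last 2 first.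
- by move=> t _; exact: extend0_ge0.
- exact: mfun_cint.
apply: eq_integral => t _; rewrite -EFinM; congr (_%:E); rewrite /extend0; case: ifP => _; last by rewrite mulr0.
by rewrite /cfun mulrA.
Qed.

Lemma cont_inner_grad (D : set M) (f : M -> R) (x : M) : open D -> smooth2 D f -> D x -> {for x, continuous (inner_grad f f)}.
Proof.
move=> oD sf Dx; set k := chart_at x; have kx : U k x by exact: chart_at_dom.
have oP : open (preim k D) by exact: open_preim.
have sg y : preim k D y -> spd (metric M k y) by case=> iy _; exact: spd_metric.
have Cg : Ck 1 (preim k D) (metric M k) := sub_Ck (@subIsetl _ _ _) (@metric_smooth _ _ M k 1).
have Cn := Ck_gn2 oP (sf k) Cg sg.
have kD : preim k D (cmap (atlas M k) x) by split; [exact: cmap_img|rewrite /preimage /= cmapK].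
have H : {for x, continuous (gn2 (metric M k) (f \o ci k) \o cmap (atlas M k))}.
  by apply: continuous_comp; [exact: cmap_cont|exact: (Ck_cont Cn kD)].
apply: near_eq_cont H; have nD : nbhs x (D `&` U k).
  by apply: open_nbhs_nbhs; split => //; apply: openI => //; exact: cdom_open.
apply: filterS nD => z [Dz kz] /=; rewrite -{2}(cmapK kz); apply/esym.
by apply: (inner_grad_chart oD sf sf); split; [exact: cmap_img|rewrite /preimage /= cmapK].
Qed.

Lemma grad_near_cst (D : set M) (u : M -> R) (a : R) (x : M) : open D -> D x -> (forall z, D z -> u z = a) -> grad u x = 0.
Proof.
move=> oD Dx ua; set k := chart_at x; have kx : U k x by exact: chart_at_dom.
have kD : preim k D (coord x) by split; [exact: cmap_img|rewrite /preimage /= cmapK].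
have oP : open (preim k D) by exact: open_preim.
have z0 z : preim k D z -> (u \o ci k) z = (fun _ => a) z by move=> [_ Dz]; exact: ua.
apply: etrans (egrad_near (metric M k) oP kD z0) _; rewrite /egrad (_ : \row_i _ = 0) ?mul0mx //.
by apply/rowP => i; rewrite !mxE; exact: derive_cst.
Qed.

Lemma inner_gradC (f h : M -> R) (x : M) : inner_grad f h x = inner_grad h f x.
Proof. by apply: dotC; apply: metric_sym; apply: cmap_img; exact: chart_at_dom. Qed.

Variables (f : M -> R) (p c b : R) (La W A' : R -> R).
Hypotheses (p2 : 2 <= p) (cb : c < b) (cf : continuous f) (cpt : forall t, compact [set x | f x <= t]).
Hypothesis sf : forall k j, Ck j (preim k [set x | c < f x]) (f \o ci k).
Hypotheses (CL : forall k, Ck k [set t | c < t] La) (L0 : forall t, c < t -> 0 < La t).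
Hypotheses (dW : forall t, c < t -> is_derive t (1 : R) W (La t)) (CW : forall k, Ck k [set t | c < t] W).
Hypotheses (W0 : forall t, t <= b -> W t <= 0) (mW : forall s t, s <= t -> W s <= W t) (unb : forall B, exists t, B < W t).
Let A t := La t `^ (p - 1).
Hypothesis dA : forall t, c < t -> is_derive t (1 : R) A (A' t).
Hypothesis T0 : forall x, c < f x -> 0 < inner_grad f f x.
Hypothesis super : forall x, c < f x -> A' (f x) * inner_grad f f x +
  A (f x) * radial_op (coord x) p (metric M (chart_at x)) (f \o ci (chart_at x)) <= 0.

Let O : set M := [set x | c < f x].
Let oO : open O.
Proof. by apply: (@open_comp _ _ f [set t : R | c < t]) => [x _|]; [exact: cf|exact: open_gt]. Qed.
Let oB : open [set x : M | f x < b].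
Proof. by apply: (@open_comp _ _ f [set t : R | t < b]) => [x _|]; [exact: cf|exact: open_lt]. Qed.
Let oc : open [set t : R | c < t]. Proof. exact: open_gt. Qed.
Let sO : smooth2 O f. Proof. by move=> k; exact: (sf k 2). Qed.
Let CAt j : Ck j [set t | c < t] A.
Proof. exact: (Ck_comp1 oc L0 (CL j) (@Ck_powR R j (p - 1))). Qed.
Let CA k : Ck 1 (preim k O) (A \o f \o ci k).
Proof.
have oP : open (preim k O) by exact: open_preim.
exact: (Ck_comp1 oP (fun z (kz : preim k O z) => proj2 kz) (sf k 1) (CAt 1)).
Qed.

(** [f] is only controlled where [c < f], but the profile vanishes where [f < b]. As [c < b], these
    two open sets cover the manifold. *)
Let cutoff_cont (F : R -> R) (E : M -> R) : (forall t, c < t -> {for t, continuous F}) -> (forall t, t <= b -> F t = 0) ->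
  (forall x, c < f x -> {for x, continuous E}) -> continuous (fun x => F (f x) * E x).
Proof.
move=> cF F0 cE x; have [cx|xc] := ltP c (f x).
  have H : {for x, continuous (F \o f)} by apply: continuous_comp; [exact: cf|exact: cF].
  exact: (cont_mulr H (cE x cx)).
have c0 : {for x, continuous (fun _ : M => 0 : R)} by exact: cst_continuous.
apply: near_eq_cont c0; have nB : nbhs x [set x | f x < b].
  by apply: open_nbhs_nbhs; split => //=; exact: le_lt_trans cb.
by apply: filterS nB => z /= /ltW zb; rewrite F0 // mul0r.
Qed.

Let cutoff_smooth (F : R -> R) : (forall j, Ck j [set t | c < t] F) -> (forall t, t <= b -> F t = 0) ->
  forall k j, Ck j (C k) ((F \o f) \o ci k).
Proof.
move=> CF F0 k j; apply: Ck_local => y ky; have [cy|yc] := ltP c (f (ci k y)).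
  have oP : open (preim k O) by exact: open_preim.
  exists (preim k O) => //.
  exact: (Ck_comp1 oP (fun z (kz : preim k O z) => proj2 kz) (sf k j) (CF j)).
have oP : open (preim k [set x | f x < b]) by exact: open_preim.
exists (preim k [set x | f x < b]); first by split => //=; exact: le_lt_trans cb.
apply: (eq_Ck oP (f := fun _ => 0)) => [z [_ /= /ltW zb]|]; first by rewrite F0.
exact: Ck_cst.
Qed.

Let a := (p - 2) / 2.
(** The pairing of the flux field with the gradient of [W(f)]; since [A] is the power [p - 1] of
    [La], it equals [La(f)^p |grad f|^p]. *)
Let e x := La (f x) * (A (f x) * (inner_grad f f x `^ a * inner_grad f f x)).

Let e_cont x : c < f x -> {for x, continuous e}.
Proof.
move=> cx; have c1 : {for x, continuous (La \o f)} by apply: continuous_comp; [exact: cf|exact: (Ck_cont (CL 0) cx)].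
have c2 : {for x, continuous (A \o f)} by apply: continuous_comp; [exact: cf|exact: (Ck_cont (CAt 0) cx)].
have c3 : {for x, continuous (inner_grad f f)} := cont_inner_grad oO sO cx.
have c4 : {for x, continuous ((fun t : R => t `^ a) \o inner_grad f f)}.
  by apply: continuous_comp; [exact: c3|exact: (Ck_cont (@Ck_powR R 0 a) (T0 cx))].
exact: (cont_mulr c1 (cont_mulr c2 (cont_mulr c4 c3))).
Qed.

Let e_ge0 x : c < f x -> 0 <= e x.
Proof. by move=> cx; rewrite !mulr_ge0 ?powR_ge0 // ltW // ?T0 ?L0. Qed.

Let dstep_cont (r : R) t : c < t -> {for t, continuous (fun t => dstep (W t / r))}.
Proof.
move=> ct; have cW := Ck_cont (CW 0) ct.
have cr : {for t, continuous (fun _ : R => r^-1)} by exact: cst_continuous.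
by apply: continuous_comp; [exact: (cont_mulr cW cr)|exact: cont_dstep].
Qed.

Let W_le1 (r t : R) : 1 <= r -> t <= b -> W t / r <= 1.
Proof.
move=> r1 tb; have r0 : 0 < r by exact: lt_le_trans r1.
by rewrite ler_pdivrMr // mul1r (le_trans (W0 tb)) // (le_trans _ r1).
Qed.

Let dstep_out r t : 1 <= r -> t <= b -> dstep (W t / r) = 0.
Proof. by move=> r1 tb; rewrite dstep0 // W_le1. Qed.

(** The flux pairing of the test function [step (W(f) / r)]: the flux averaged over the levels with
    [W] between [r] and [2 r]. *)
Let B r x := dstep (W (f x) / r) / r * e x.

Let B_cont r : 1 <= r -> continuous (B r).
Proof.
move=> r1; apply: (@cutoff_cont (fun t => dstep (W t / r) / r) e) => [t ct|t tb|x cx]; last exact: e_cont.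
  have cr : {for t, continuous (fun _ : R => r^-1)} by exact: cst_continuous.
  exact: (cont_mulr (@dstep_cont r t ct) cr).
by rewrite dstep_out // mul0r.
Qed.

Let B_ge0 r x : 1 <= r -> 0 <= B r x.
Proof.
move=> r1; have r0 : 0 <= r by exact: le_trans r1.
have [cx|xc] := ltP c (f x); last by rewrite /B dstep_out ?mul0r // (le_trans xc) // ltW.
by rewrite mulr_ge0 ?e_ge0 // divr_ge0 ?dstep_ge0.
Qed.

Let is_derive_cutoff (r t : R) : c < t -> is_derive t (1 : R) (fun t => step (W t / r)) (dstep (W t / r) / r * La t).
Proof.
move=> ct; have d := is_derive_mulr (dW ct) (is_derive_cst r^-1 t 1).
have h := is_derive_comp1 d (is_derive_step (W t / r)).
by apply: is_derive_eq h _; rewrite /cst mulr0 addr0; ring.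
Qed.

Let Ck_cutoff (r : R) j : Ck j [set t | c < t] (fun t => step (W t / r)).
Proof.
have Cq : Ck j [set t | c < t] (fun t => W t / r).
  by apply: (eq_Ck oc _ (CkZ r^-1 oc (CW j))) => t _; rewrite mulrC.
exact: (Ck_comp1 oc (fun _ _ => I) Cq (@Ck_step R j)).
Qed.

(* Testing the flux inequality with step (W f) (1 - step (W f / L)). *)
Let flux_estimate L : 2 <= L -> (volume_int (B L) <= volume_int (B 1))%E.
Proof.
move=> L2; have L1 : 1 <= L by rewrite (le_trans _ L2) // ler1n.
have Lp : 0 < L by exact: lt_le_trans L1.
apply: volume_nonneg_le (B_cont (lexx 1)) (B_cont L1) (fun x => B_ge0 x (lexx 1)) (fun x => B_ge0 x L1) _.
pose F t := step (W t / 1) * (1 - step (W t / L)).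
have F0 t : t <= b -> F t = 0 by move=> tb; rewrite /F step0 ?mul0r // W_le1.
have CF j : Ck j [set t | c < t] F.
  exact: (CkM oc (Ck_cutoff 1 j) (CkB oc (Ck_cst j _ (1 : R)) (Ck_cutoff L j))).
(* Beyond [t1] one has [W >= 2 L], so the factor [1 - step (W / L)] vanishes and the test function
   is supported in the compact set [b <= f <= t1]. *)
have [t1 Wt1] := unb (2 * L).
pose K := [set x | f x <= t1] `&` [set x | b <= f x].
have cK : compact K.
  apply: compact_closedI; first exact: cpt.
  by apply: (@preimage_closed _ _ f [set t : R | b <= t]) => [x _|]; [exact: cf|exact: closed_ge].
have KO : K `<=` O by move=> x [_ /= bx]; exact: lt_le_trans bx.
have FK x : ~ K x -> (F \o f) x = 0.
  move=> nK /=; have [xb|bx] := leP (f x) b; first exact: F0.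
  have t1x : t1 < f x by rewrite ltNge; apply/negP => xt; apply: nK; split => //=; exact: ltW.
  rewrite /F [step (_ / L)]step1 ?subrr ?mulr0 // ler_pdivlMr //.
  by apply: le_trans (mW (ltW t1x)); exact: ltW.
have Fge0 x : 0 <= (F \o f) x by rewrite /= /F mulr_ge0 ?step_ge0 // subr_ge0 step_le1.
have sF : smooth2 [set: M] (F \o f) by move=> k; rewrite preimT; exact: (cutoff_smooth CF F0 k 2).
have V := flux_global oO sO (fun x Ox => dA Ox) CA T0 super sF cK KO Fge0 FK.
suff <- : flux_pair f O A p (F \o f) = fun x => B 1 x - B L x by [].
apply/funext => x; have [cx|xc] := ltP c (f x); last first.
  have xb : f x <= b by rewrite (le_trans xc) // ltW.
  have -> : flux_pair f O A p (F \o f) x = 0 by apply: extend0_out; rewrite /O /= ltNge xc.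
  by rewrite /B !dstep_out // !mul0r subrr.
have -> : flux_pair f O A p (F \o f) x = A (f x) * inner_grad f f x `^ a * inner_grad (F \o f) f x by exact: extend0_in.
have dF := is_derive_mulr (is_derive_cutoff 1 cx) (is_derive_subf (is_derive_cst (1 : R) (f x) 1) (is_derive_cutoff L cx)).
rewrite (inner_grad_comp f oO cx sO dF) /B /e.
(* Where the first step is still rising, [W < 2 <= L] and the second step has not begun. *)
have e1 : dstep (W (f x) / 1) * (1 - step (W (f x) / L)) = dstep (W (f x) / 1).
  have [W2|W2] := leP 2 (W (f x) / 1); first by rewrite dstep1 // mul0r.
  rewrite [step _]step0 ?subr0 ?mulr1 // ler_pdivrMr // mul1r (le_trans _ L2) //.
  by move: W2; rewrite divr1 => /ltW.
(* Where the second step is rising, [W > L >= 2] and the first step is complete. *)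
have e2 : step (W (f x) / 1) * dstep (W (f x) / L) = dstep (W (f x) / L).
  have [W1|W1] := leP (W (f x) / L) 1; first by rewrite dstep0 // mulr0.
  rewrite step1 ?mul1r // divr1 (le_trans L2) //.
  by move: W1; rewrite ltr_pdivlMr // mul1r => /ltW.
rewrite -{2}e1 -{2}e2.
move: (dstep (W (f x) / 1)) (dstep (W (f x) / L)) (step (W (f x) / 1)) (step (W (f x) / L)) => d1 dL s1 sL.
move: (La (f x)) (A (f x)) (inner_grad f f x `^ a) (inner_grad f f x) => l aa g1 g2.
by rewrite /cst invr1; ring.
Qed.

Let u L x := 1 - step (W (f x) / L).

Let Ck_u L k j : 1 <= L -> Ck j (C k) (u L \o ci k).
Proof.
move=> L1; have oC : open (C k) by exact: cimg_open.
have F0 t : t <= b -> step (W t / L) = 0 by move=> tb; rewrite step0 // W_le1.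
exact: (CkB oC (Ck_cst j _ (1 : R)) (cutoff_smooth (fun j => Ck_cutoff L j) F0 k j)).
Qed.

(** The slope of the cutoff with respect to [W] is at most [C0 / L <= 1], so the energy density is
    bounded by [C0 / L] times the flux density. *)
Let energy_le L C0 : 1 <= L -> C0 <= L -> (forall t, dstep t <= C0) -> 0 < C0 ->
  (volume_int (fun x => (tnorm x (grad (u L) x) `^ p)%R) <= (C0 / L)%:E * volume_int (B L))%E.
Proof.
move=> L1 CL1 dC C00; have Lp : 0 < L by exact: lt_le_trans L1.
have k0 : 0 <= C0 / L by rewrite divr_ge0 // ltW.
rewrite -(volume_scale (B_cont L1) (fun x => B_ge0 x L1) k0).
have su : smooth2 [set: M] (u L) by move=> k; rewrite preimT; exact: Ck_u.
have tE x : tnorm x (grad (u L) x) = Num.sqrt (inner_grad (u L) (u L) x) by [].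
have ck : continuous (fun _ : M => C0 / L) by exact: cst_continuous.
apply: volume_le => [x|x|x].
- have c1 : {for x, continuous (inner_grad (u L) (u L))} := cont_inner_grad openT su I.
  have c2 : {for x, continuous (Num.sqrt \o inner_grad (u L) (u L))}.
    by apply: continuous_comp; [exact: c1|exact: sqrt_continuous].
  have p1 : 1 <= p by rewrite (le_trans _ p2) // ler1n.
  have H : {for x, continuous ((fun s : R => `|s| `^ p) \o (Num.sqrt \o inner_grad (u L) (u L)))}.
    by apply: continuous_comp; [exact: c2|exact: (cont_powR_norm p1)].
  by apply: near_eq_cont H; apply: filterE => z /=; rewrite tE ger0_norm // sqrtr_ge0.
- exact: (cont_mulr (ck x) (B_cont L1 (x := x))).
rewrite powR_ge0 /= tE; have pn : p != 0 by rewrite gt_eqF // (lt_le_trans _ p2).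
have [cx|xc] := ltP c (f x); last first.
  have xb : f x < b by exact: le_lt_trans cb.
  have g0 : grad (u L) x = 0.
    apply: (grad_near_cst oB xb) (_ : forall z, f z < b -> u L z = 1) => z /ltW zb.
    by rewrite /u step0 ?subr0 // W_le1.
  by rewrite /inner_grad g0 dot0l sqrtr0 powR0 // mulr_ge0 // B_ge0.
have du : is_derive (f x) (1 : R) (fun t => 1 - step (W t / L)) (- (dstep (W (f x) / L) / L * La (f x))).
  by apply: is_derive_eq (is_derive_subf (is_derive_cst (1 : R) (f x) 1) (is_derive_cutoff L cx)) _; rewrite sub0r.
have E1 h : inner_grad (u L) h x = - (dstep (W (f x) / L) / L * La (f x)) * inner_grad f h x := inner_grad_comp h oO cx sO du.
rewrite E1 inner_gradC E1 mulrA -expr2 sqrrN /B /e.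
apply: powR_energy_le => //; first by rewrite divr_ge0 ?dstep_ge0 // ltW.
- by rewrite ler_pM2r ?invr_gt0.
- by rewrite ler_pdivrMr // mul1r.
- exact: L0.
- exact: T0.
Qed.

(** The energy of the cutoff [u L] is at most [C0 / L] times the flux at level [L], hence at most
    [C0 / L] times the fixed finite flux at level 1, which tends to 0. *)
Lemma parabolic_of_exhaustion : [set: M] !=set0 -> p_parabolic M p.
Proof.
move=> [x0 _]; pose t0 := f x0 + 1; pose D := [set x | f x <= t0].
exists D; split; first exact: cpt.
  exists x0; apply: (@filterS _ _ _ [set x : M | f x < t0]) => [z /= /ltW //|].
  apply: open_nbhs_nbhs; split; last by rewrite /= ltrDl.
  by apply: (@open_comp _ _ f [set t : R | t < t0]) => [x _|]; [exact: cf|exact: open_lt].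
have [C0 C00 dC] := @dstep_bounded R.
have fB : (volume_int (B 1) < +oo)%E.
  have [t2 Wt2] := unb 2.
  apply: (volume_finite (B_cont (lexx 1)) (fun x => B_ge0 x (lexx 1)) (@cpt t2)) => x /= nx.
  have tx : t2 < f x by rewrite ltNge; apply/negP.
  by rewrite /B dstep1 ?mul0r // divr1; apply: le_trans (mW (ltW tx)); exact: ltW.
have vB : volume_int (B 1) = (fine (volume_int (B 1)))%:E.
  by rewrite fineK // ge0_fin_numE // volume_ge0 // => x; exact: B_ge0.
set v := fine _ in vB; have v0 : 0 <= v by rewrite -lee_fin -vB volume_ge0 // => x; exact: B_ge0.
apply/eqP; rewrite eq_le; apply/andP; split; last first.
  apply: le_ereal_inf_tmp => _ [w _ <-]; apply: volume_ge0 => x; exact: powR_ge0.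
apply/lee_addgt0Pr => eps eps0; rewrite add0e.
(* The entries ensure in turn that the two steps do not overlap, that the slope is at most 1, that
   [u L] is 1 on [D], and that the energy is at most [eps]. *)
pose L := Num.max (Num.max 2 C0) (Num.max (W t0) (C0 * v / eps)).
have L2 : 2 <= L by rewrite /L !le_max lexx.
have LC : C0 <= L by rewrite /L !le_max lexx orbT.
have LW : W t0 <= L by rewrite /L !le_max lexx !orbT.
have Lv : C0 * v / eps <= L by rewrite /L !le_max lexx !orbT.
have L1 : 1 <= L by rewrite (le_trans _ L2) // ler1n.
have Lp : 0 < L by exact: lt_le_trans L1.
have E : (volume_int (fun x => (tnorm x (grad (u L) x) `^ p)%R) <= eps%:E)%E.
  apply: le_trans (energy_le L1 LC dC C00) _.
  have k0 : (0 <= (C0 / L)%:E)%E by rewrite lee_fin divr_ge0 // ltW.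
  apply: le_trans (lee_wpmul2l k0 (flux_estimate L2)) _.
  by rewrite vB -EFinM lee_fin mulrAC ler_pdivrMr // [eps * L]mulrC -ler_pdivrMr.
apply: le_trans E; apply: ereal_inf_lbound; exists (u L) => //; split; last first.
  move=> x Dx; rewrite /u step0 ?subr0 // ler_pdivrMr // mul1r.
  by apply: le_trans LW; exact: mW.
split; first by move=> k j; exact: Ck_u.
(* The same unboundedness of [W] confines the support of the cutoff to the compact sublevel set of
   [t1]. *)
have [t1 Wt1] := unb (2 * L).
have cl : closed [set x | f x <= t1] by exact: compact_closed (@carrier_hausdorff _ _ M) (@cpt t1).
apply: (subclosed_compact (@closed_closure _ _) (@cpt t1)).
rewrite [X in _ `<=` X](closure_id _).1 //; apply: closure_subset => x /= ux.
rewrite leNgt; apply/negP => t1x; move: ux; rewrite /u step1 ?subrr ?eqxx // ler_pdivlMr //.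
by apply: le_trans (mW (ltW t1x)); exact: ltW.
Qed.

End Parabolicity.

Section PoleDistance.
Variables (R : realType) (n : nat) (N : riemannian R n) (o : N) (expo : 'rV[R]_n -> N) (loga : N -> 'rV[R]_n).
Hypotheses (eE : is_exp o expo) (sE : smooth_into setT expo) (sL : smooth_from loga).
Hypotheses (EK : cancel expo loga) (LK : cancel loga expo).

Lemma continuous_dist : continuous (dist o).
Proof.
apply: Ck_chart_continuous => k; split; last by [].
move=> y ky.
have cr : continuous (rho0 (emetric expo)) by exact: continuous_rho0.
have H : {for y, continuous (rho0 (emetric expo) \o (loga \o cinv (atlas N k)))}.
  by apply: continuous_comp; [exact: (Ck_cont (sL k 0) ky)|exact: cr].
by apply: near_eq_cont H; apply: filterE => z; rewrite /= (distE eE sE sL EK LK).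
Qed.

Lemma dist_pole : dist o o = 0.
Proof.
have lo : loga o = 0 by rewrite -(expo0 eE) EK.
by rewrite (distE eE sE sL EK LK) lo /rho0 dot0l sqrtr0.
Qed.

End PoleDistance.

(** The exhaustion criterion is applied to the distance from the pole restricted to S, with
    [c = rho + 1] and [b = rho + 2]. Its sublevel sets are compact because the immersion is proper
    and closed balls around the pole are compact. *)
Theorem theorem4p1 (R : realType) (m n : nat)
    (N : riemannian R n) (o : N)
    (hNcomplete : complete_manifold N) (hpole : pole o)
    (S : riemannian R m)
    (hSnoncompact : ~ compact [set: S])
    (hSconnected : connected [set: S])
    (hScomplete : complete_manifold S)
    (X : S -> N) (hXimm : isometric_immersion X) (hXproper : proper_map X)
    (w : R -> R) (hw : warping w)
    (g lam h : R -> R) (hconst : constellation X o w g lam h)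
    (p : R) (hp : 2 <= p)
    (hbalanced : forall r, 0 < r -> 0 <= balance m p w lam h r)
    (rho : R) (hrho : 0 < rho)
    (* the integrand defining Lambda makes sense on [rho, +oo[ *)
    (hgpos : forall t, rho <= t -> 0 < g t)
    (hdiv : (\int[lebesgue_measure]_(t in `[rho, +oo[)
               (Lambda m p rho w g lam h t)%:E)%E = +oo%E) :
  p_parabolic S p.
Proof.
have [expo [eE sE [loga sL [EK LK]]]] := hpole.
have [_ [Cg Cl Ch] bounds] := hconst.
(* An empty S would be compact; a point is needed to choose a sublevel set with nonempty
   interior. *)
have S0 : [set: S] !=set0.
  apply: contrapT => nS; apply: hSnoncompact.
  rewrite (_ : [set: S] = set0); first exact: compact0.
  by apply/seteqP; split => // x _; apply: nS; exists x.
have unb c (rc : rho < c) := Lambda_unbounded hw Cg Cl Ch hp hbalanced hrho hgpos rc hdiv.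
have CL k : Ck k [set t | rho < t] (Lambda m p rho w g lam h) by exact: Ck_Lambda.
have L0 t : rho < t -> 0 < Lambda m p rho w g lam h t by move=> rt; exact: Lambda_gt0.
have dL t : rho < t -> is_derive t (1 : R) (Lambda m p rho w g lam h) (Lambda m p rho w g lam h t * (eta w t - rate m p w g lam h t)).
  by move=> rt; exact: is_derive_Lambda.
have [W [dW CW W0 mW unbW]] := weight_profile CL L0 unb.
pose f := rdist X o.
have cX x : {for x, continuous X} by exact: imm_cont.
have cd := continuous_dist eE sE sL EK LK.
have cf : continuous f by move=> x; exact: (@continuous_comp _ _ _ X (dist o) x (cX x) (@cd (X x))).
have rc t : rho + 1 < t -> rho < t by apply: lt_trans; rewrite ltrDl.
have xo x : rho + 1 < f x -> X x <> o.
  move=> fx Xo; move: (lt_trans hrho (rc _ fx)).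
  by rewrite /f /rdist Xo (dist_pole eE sE sL EK LK) ltxx.
have TE x : tangency X o x = Num.sqrt (inner_grad f f x) by exact: tangencyE.
have T2 x : rho + 1 < f x -> 0 < inner_grad f f x /\ g (f x) ^+ 2 <= inner_grad f f x.
  move=> fx; have g0 : 0 < g (f x) by apply: hgpos; exact: ltW (rc _ fx).
  have [gT _ _] := bounds x (xo x fx); move: gT; rewrite TE => gT.
  have i0 : 0 < inner_grad f f x by rewrite -sqrtr_gt0; exact: lt_le_trans gT.
  split => //; rewrite -[leRHS](sqr_sqrtr (ltW i0)) ler_sqr ?nnegrE ?sqrtr_ge0 ?(ltW g0) //.
have p1 : 0 < p - 1 by rewrite subr_gt0 (lt_le_trans _ hp) // ltr1n.
pose La := Lambda m p rho w g lam h; pose q := rate m p w g lam h.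
(* The logarithmic derivative of [Lambda] is [eta - q], so that of its power is [p - 1] times as
   large. *)
pose A' t := (p - 1) * La t `^ (p - 1) * (eta w t - q t).
have dA t : rho + 1 < t -> is_derive t (1 : R) (fun t => La t `^ (p - 1)) (A' t).
  move=> /rc rt; have d := is_derive_comp1 (dL t rt) (is_derive1_powR (p - 1) (L0 t rt)).
  apply: is_derive_eq d _; rewrite /A' (powR_pred (p - 1) (L0 t rt)) -/(La t) -/(q t).
  by move: (La t `^ _) => r; ring.
apply: (@parabolic_of_exhaustion _ _ _ f p (rho + 1) (rho + 2) La W A') => //.
- by rewrite ltrD2l ltr1n.
- by move=> t; exact: (hXproper _ (@compact_closed_ball _ _ _ _ _ _ eE sE sL EK LK t)).
- move=> k j; apply: sub_Ck (Ck_rchart eE sE sL EK LK hXimm k j) => y [ky fy]; split => //; exact: xo.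
- by move=> k; apply: sub_Ck (CL k) => t; exact: rc.
- by move=> t /rc; exact: L0.
- by move=> x /T2 [].
move=> x fx; have [i0 gi] := T2 x fx; have rf := rc _ fx.
have e0 : rchart X o (chart_at x) (coord x) = f x by rewrite /rchart /= cmapK //; exact: chart_at_dom.
have i0' : 0 < gn2 (metric S (chart_at x)) (rchart X o (chart_at x)) (coord x) by exact: i0.
have := radial_op_le eE sE sL EK LK hXimm hw hconst hp (xo x fx) i0'.
rewrite e0 -[gn2 _ _ _]/(inner_grad f f x) -[radial_op _ _ _ _]/(radial_op (coord x) p (metric S (chart_at x)) (f \o cinv (atlas S (chart_at x)))).
set ro := radial_op _ _ _ _ => rle.
have b0 : 0 <= balance m p w lam h (f x) by apply: hbalanced; exact: lt_trans rf.
have g0 : 0 < g (f x) by apply: hgpos; exact: ltW.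
have l0 : 0 <= La (f x) `^ (p - 1) by exact: powR_ge0.
(* By definition of the rate, the right-hand side is the balance times [T^2 / g^2]. The balance is
   nonnegative and this ratio is at least 1, by [T >= g > 0]. *)
have key : balance m p w lam h (f x) <= (p - 1) * q (f x) * inner_grad f f x.
  have -> : (p - 1) * q (f x) * inner_grad f f x = balance m p w lam h (f x) * (inner_grad f f x / g (f x) ^+ 2).
    rewrite /q /rate; move: (inner_grad f f x) (balance m p w lam h (f x)) => I B; field.
    by rewrite !gt_eqF.
  by apply: ler_peMr => //; rewrite ler_pdivlMr ?mul1r // exprn_gt0.
apply: (@le_trans _ _ (La (f x) `^ (p - 1) * (balance m p w lam h (f x) - (p - 1) * q (f x) * inner_grad f f x))); last first.
  by apply: mulr_ge0_le0 => //; rewrite subr_le0.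
have -> : A' (f x) * inner_grad f f x + La (f x) `^ (p - 1) * ro =
    La (f x) `^ (p - 1) * ((p - 1) * (eta w (f x) - q (f x)) * inner_grad f f x + ro) by rewrite /A'; ring.
apply: ler_wpM2l => //; rewrite -lerBrDl; apply: le_trans rle _.
by rewrite le_eqVlt; apply/orP; left; apply/eqP; ring.
Qed.
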